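(* Let $u\in W$ be a solution of $Lu=0$ in $\Omega$. Then $$\sup_\Omega u\le\sup_\Gamma Tu\qquad\text{and}\qquad\inf_\Omega u\ge\inf_\Gamma Tu .$$ In particular, if $Tu$ is essentially bounded, then $\sup_\Omega|u|\le\sup_\Gamma|Tu|$.
   Context: Let $n\ge2$ and let $0<d<n-1$ be a real number. $\Gamma\subset\mathbb R^n$ is a nonempty closed set which is Ahlfors regular of dimension $d$: there is $C_0\ge1$ with $C_0^{-1}r^d\le\mathcal H^d(\Gamma\cap B(x,r))\le C_0r^d$ for all $x\in\Gamma$, $r>0$. Set $\Omega=\mathbb R^n\setminus\Gamma$, $\sigma=\mathcal H^d|_\Gamma$, $\delta(z)=\operatorname{dist}(z,\Gamma)$ and $w(z)=\delta(z)^{d+1-n}$. $\sup$ and $\inf$ are essential suprema and infima (with respect to Lebesgue measure on $\Omega$ and $\sigma$ on $\Gamma$). $W=\{u\in L^1_{loc}(\Omega):\nabla u\in L^2(\Omega,w)\}$ (distributional gradient in $\Omega$; $L^2(\Omega,w)=L^2(\Omega,w\,dz)$); every $u\in W$ lies in $L^1_{loc}(\mathbb R^n)$. The trace of $u\in W$ is $Tu(x)=\lim_{r\to0}\frac1{|B(x,r)|}\int_{B(x,r)}u\,dz$, which exists for $\sigma$-a.e. $x\in\Gamma$. $A:\Omega\to M_n(\mathbb R)$ is measurable and satisfies, for some $C_1\ge1$, $|A(x)\xi\cdot\zeta|\le C_1w(x)|\xi||\zeta|$ and $A(x)\xi\cdot\xi\ge C_1^{-1}w(x)|\xi|^2$ for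 all $x\in\Omega$, $\xi,\zeta\in\mathbb R^n$; $L=-\operatorname{div}A\nabla$. $u\in W$ is a solution of $Lu=0$ in $\Omega$ if $\int_\Omega A\nabla u\cdot\nabla\varphi\,dz=0$ for all $\varphi\in C_0^\infty(\Omega)$. *)

(* Defs.v *)
From HB Require Import structures.
From mathcomp Require Import all_boot all_order all_algebra.
From mathcomp Require Import all_classical all_reals all_analysis.
From mathcomp Require Import ess_sup_inf.

Set Implicit Arguments.
Unset Strict Implicit.
Unset Printing Implicit Defensive.

Import Order.TTheory GRing.Theory Num.Theory.
Import numFieldNormedType.Exports.

Local Open Scope classical_set_scope.
Local Open Scope ring_scope.

(* Points of R^n are row vectors.  The library norm on 'rV[R]_n is the sup norm:
   it is used only through the topology (which is the Euclidean one); balls,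
   distances, diameters and lengths below are all Euclidean. *)

Section euclidean.
Context {R : realType} {n : nat}.
Implicit Types (x y : 'rV[R]_n) (S : set 'rV[R]_n).

Definition dotv x y : R := \sum_(i < n) x 0 i * y 0 i.

Definition enorm x : R := Num.sqrt (dotv x x).

Definition eball x (r : R) : set 'rV[R]_n := [set y | enorm (y - x) < r].

Definition ediam S : \bar R :=
  ereal_sup [set (enorm (p.1 - p.2))%:E | p in S `*` S].

Definition edist_to S x : R := inf [set enorm (x - y) | y in S].

End euclidean.

Section cover_outer.
Context {R : realType} {T : Type}.
Local Open Scope ereal_scope.

(* inf of \sum_k c (F k) over all countable coverings F of A (finite coverings
   are included when c set0 = 0; sets are discarded by giving them c = +oo) *)
Definition cover_outer (c : set T -> \bar R) (A : set T) : \bar R :=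
  ereal_inf [set \sum_(k <oo) c (F k) |
    F in [set F : (set T)^nat | A `<=` \bigcup_k F k]].

End cover_outer.

Section cover_outer_theory.
Context {R : realType} {T : pointedType}.
Local Open Scope ereal_scope.
Variable c : set T -> \bar R.
Hypotheses (c0 : c set0 = 0) (c_ge0 : forall S, 0 <= c S).

Let D := g_sigma_algebraType [set: set T].

Let cover_outerE : cover_outer c = mu_ext (c : set D -> \bar R).
Proof.
apply/funext => A; congr ereal_inf; apply/seteqP; split => y [F].
- by move=> AF <-; exists F => //; split=> // k; exact: sub_sigma_algebra.
- by move=> [_ AF] <-; exists F.
Qed.

Lemma cover_outer0 : cover_outer c set0 = 0.
Proof. by rewrite cover_outerE; exact: mu_ext0. Qed.

Lemma cover_outer_ge0 A : 0 <= cover_outer c A.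
Proof. by rewrite cover_outerE; exact: mu_ext_ge0. Qed.

Lemma le_cover_outer : {homo cover_outer c : A B / A `<=` B >-> A <= B}.
Proof. by move=> A B AB; rewrite cover_outerE; exact: le_mu_ext. Qed.

Lemma cover_outer_sigma_subadditive : sigma_subadditive (cover_outer c).
Proof. by rewrite cover_outerE; exact: (@mu_ext_sigma_subadditive _ D). Qed.

End cover_outer_theory.

Section lebesgue.
Context {R : realType} {n : nat}.
Local Open Scope ereal_scope.

Definition box (a b : 'rV[R]_n) : set 'rV[R]_n :=
  [set x | forall i, (a 0 i <= x 0 i <= b 0 i)%R].

(* the volume of S if S is a closed box or is empty, +oo otherwise *)
Definition box_volume (S : set 'rV[R]_n) : \bar R :=
  if S == set0 then 0 else
  ereal_inf [set (\prod_(i < n) (p.2 0 i - p.1 0 i))%:E |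
    p in [set p : 'rV[R]_n * 'rV[R]_n | S = box p.1 p.2]].

Lemma box_volume0 : box_volume set0 = 0.
Proof. by rewrite /box_volume eqxx. Qed.

Lemma box_volume_ge0 S : 0 <= box_volume S.
Proof.
rewrite /box_volume; case: ifPn => // /set0P[x Sx].
apply: le_ereal_inf_tmp => _ [[a b] /= Sab <-]; rewrite lee_fin.
apply: prodr_ge0 => i _; rewrite subr_ge0.
by move: Sx; rewrite Sab => /(_ i) /andP[]; exact: le_trans.
Qed.

Definition lebesgue_outer : set 'rV[R]_n -> \bar R := cover_outer box_volume.

HB.instance Definition _ := isOuterMeasure.Build R 'rV[R]_n lebesgue_outer
  (cover_outer0 box_volume0 box_volume_ge0) (cover_outer_ge0 box_volume_ge0)
  (@le_cover_outer _ _ box_volume)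
  (cover_outer_sigma_subadditive box_volume_ge0).

(* its sigma-algebra is that of all Lebesgue (= Caratheodory) measurable sets *)
Definition lebesgue_vec : set (caratheodory_type lebesgue_outer) -> \bar R :=
  lebesgue_outer.

HB.instance Definition _ :=
  isMeasure.Build _ _ _ lebesgue_vec
  (@caratheodory_measure0 _ _ (lebesgue_outer : {outer_measure set _ -> \bar R}))
  (@caratheodory_measure_ge0 _ _ (lebesgue_outer : {outer_measure set _ -> \bar R}))
  (@caratheodory_measure_sigma_additive _ _
    (lebesgue_outer : {outer_measure set _ -> \bar R})).

End lebesgue.
Arguments lebesgue_outer : clear implicits.
Arguments lebesgue_vec : clear implicits.

Section hausdorff.
Context {R : realType} {n : nat}.
Local Open Scope ereal_scope.
Implicit Types (d delta : R) (S : set 'rV[R]_n).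

(* (diam S)^d if diam S <= delta, +oo otherwise; the case S = set0 is apart
   because ediam set0 = -oo *)
Definition hausdorff_gauge d delta S : \bar R :=
  if S == set0 then 0
  else if ediam S <= delta%:E then (fine (ediam S) `^ d)%:E else +oo.

Lemma hausdorff_gauge0 d delta : hausdorff_gauge d delta set0 = 0.
Proof. by rewrite /hausdorff_gauge eqxx. Qed.

Lemma hausdorff_gauge_ge0 d delta S : 0 <= hausdorff_gauge d delta S.
Proof.
rewrite /hausdorff_gauge; case: ifP => // _; case: ifP => // _.
by rewrite lee_fin powR_ge0.
Qed.

(* H^d without a normalizing constant: sup (= limit as delta --> 0+) of the
   delta-contents *)
Definition hausdorff_outer d : set 'rV[R]_n -> \bar R := fun A =>
  ereal_sup [set cover_outer (hausdorff_gauge d delta) A |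
    delta in [set delta | (0 < delta)%R]].

Lemma hausdorff_outer0 d : hausdorff_outer d set0 = 0.
Proof.
rewrite /hausdorff_outer (_ : [set _ | _ in _] = [set 0]) ?ereal_sup1//.
apply/seteqP; split => [_ [e _ <-]|_ ->] /=; last exists 1%R => //=.
all: rewrite cover_outer0//; [exact: hausdorff_gauge0|].
all: exact: hausdorff_gauge_ge0.
Qed.

Lemma hausdorff_outer_ge0 d A : 0 <= hausdorff_outer d A.
Proof.
apply: (@le_trans _ _ (cover_outer (hausdorff_gauge d 1) A)).
  exact/cover_outer_ge0/hausdorff_gauge_ge0.
by apply: ereal_sup_ubound; exists 1%R => /=.
Qed.

Lemma le_hausdorff_outer d :
  {homo hausdorff_outer d : A B / A `<=` B >-> A <= B}.
Proof.
move=> A B AB; apply: ge_ereal_sup => _ [e e0 <-].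
apply: (le_trans (le_cover_outer (hausdorff_gauge d e) AB)).
by apply: ereal_sup_ubound; exists e.
Qed.

Lemma hausdorff_outer_sigma_subadditive d :
  sigma_subadditive (hausdorff_outer d).
Proof.
move=> F; apply: ge_ereal_sup => _ [e e0 <-].
apply: (le_trans (cover_outer_sigma_subadditive (hausdorff_gauge_ge0 d e) F)).
apply: lee_nneseries => k _; first by move=> _; exact/cover_outer_ge0/hausdorff_gauge_ge0.
by apply: ereal_sup_ubound; exists e.
Qed.

HB.instance Definition _ d := isOuterMeasure.Build R 'rV[R]_n
  (hausdorff_outer d) (hausdorff_outer0 d) (hausdorff_outer_ge0 d)
  (@le_hausdorff_outer d) (@hausdorff_outer_sigma_subadditive d).

Definition hausdorff_measure d :
  set (caratheodory_type (hausdorff_outer d)) -> \bar R := hausdorff_outer d.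

Arguments hausdorff_measure : clear implicits.

HB.instance Definition _ d :=
  isMeasure.Build _ _ _ (hausdorff_measure d)
  (@caratheodory_measure0 _ _ (hausdorff_outer d : {outer_measure set _ -> \bar R}))
  (@caratheodory_measure_ge0 _ _ (hausdorff_outer d : {outer_measure set _ -> \bar R}))
  (@caratheodory_measure_sigma_additive _ _
    (hausdorff_outer d : {outer_measure set _ -> \bar R})).

Definition ahlfors_regular d (C0 : R) (Gamma : set 'rV[R]_n) : Prop :=
  forall x r, Gamma x -> (0 < r)%R ->
    (C0^-1 * r `^ d)%:E <= hausdorff_measure d (Gamma `&` eball x r)
      <= (C0 * r `^ d)%:E.

End hausdorff.
Arguments hausdorff_measure {R n} d A.

(* Essential bounds over D: the values of f outside D are made irrelevant; when
   D is measurable these are the essential bounds for the restriction of mu to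
   D. *)
Section essential_bounds_on.
Context {disp : measure_display} {T : measurableType disp} {R : realType}.
Local Open Scope ereal_scope.

Definition ess_sup_on (mu : {measure set T -> \bar R}) (D : set T)
  (f : T -> \bar R) : \bar R := ess_sup mu (patch (cst -oo) D f).

Definition ess_inf_on (mu : {measure set T -> \bar R}) (D : set T)
  (f : T -> \bar R) : \bar R := ess_inf mu (patch (cst +oo) D f).

End essential_bounds_on.

Section weak_derivatives.
Context {R : realType} {n : nat}.
Implicit Types (Omega : set 'rV[R]_n) (u phi : 'rV[R]_n -> R)
  (g : 'rV[R]_n -> 'rV[R]_n).

Definition loc_integrable Omega u : Prop :=
  forall K : set 'rV[R]_n, compact K -> K `<=` Omega ->
    (lebesgue_vec R n).-integrable K (EFin \o u).

Definition partial (i : 'I_n) phi : 'rV[R]_n -> R :=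
  fun x => 'D_(delta_mx 0 i) phi x.

Definition grad phi : 'rV[R]_n -> 'rV[R]_n := fun x => \row_i partial i phi x.

Definition iter_partial (s : seq 'I_n) phi : 'rV[R]_n -> R := foldr partial phi s.

Definition smooth phi : Prop := forall s : seq 'I_n,
  continuous (iter_partial s phi) /\
  forall i x, derivable (iter_partial s phi) x (delta_mx 0 i).

(* elements of C_0^oo(Omega), extended by 0 to R^n *)
Definition test_function Omega phi : Prop :=
  [/\ smooth phi, compact (closure [set x | phi x != 0]) &
      closure [set x | phi x != 0] `<=` Omega].

(* g is (a representative of) the distributional gradient of u in Omega *)
Definition weak_gradient Omega u g : Prop :=
  (forall i, loc_integrable Omega (fun x => g x 0 i)) /\
  forall phi, test_function Omega phi -> forall i,
    \int[lebesgue_vec R n]_(x in Omega) (u x * partial i phi x) =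
    - \int[lebesgue_vec R n]_(x in Omega) (g x 0 i * phi x).

End weak_derivatives.

Section degenerate_elliptic.
Context {R : realType} {n : nat}.
Implicit Types (Gamma : set 'rV[R]_n) (d : R) (u : 'rV[R]_n -> R)
  (A : 'rV[R]_n -> 'M[R]_n).

Definition weight Gamma d : 'rV[R]_n -> R :=
  fun z => edist_to Gamma z `^ (d + 1 - n%:R).

(* the space W, with Omega = ~` Gamma *)
Definition in_W Gamma d u : Prop :=
  loc_integrable (~` Gamma) u /\
  exists2 g, weak_gradient (~` Gamma) u g &
    (\int[lebesgue_vec R n]_(z in ~` Gamma)
       (enorm (g z) ^+ 2 * weight Gamma d z)%:E < +oo)%E.

(* average of u on eball x r *)
Definition ball_average u (x : 'rV[R]_n) (r : R) : R :=
  (fine (lebesgue_vec R n (eball x r)))^-1 *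
  \int[lebesgue_vec R n]_(z in eball x r) u z.

(* Tu x; a default value at the points x where the limit does not exist *)
Definition trace u (x : 'rV[R]_n) : R :=
  lim (ball_average u x r @[r --> 0^'+]).

(* A x xi, on row vectors *)
Definition mx_apply (M : 'M[R]_n) (xi : 'rV[R]_n) : 'rV[R]_n := xi *m M^T.

Definition elliptic Gamma d (C1 : R) A : Prop :=
  [/\ forall i j, measurable_fun
        (~` Gamma : set (caratheodory_type (lebesgue_outer R n)))
        (fun x => A x i j),
      forall x xi zeta, ~ Gamma x ->
        `|dotv (mx_apply (A x) xi) zeta| <=
          C1 * weight Gamma d x * enorm xi * enorm zeta &
      forall x xi, ~ Gamma x ->
        C1^-1 * weight Gamma d x * enorm xi ^+ 2 <= dotv (mx_apply (A x) xi) xi].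

(* - div A grad u = 0 in ~` Gamma *)
Definition weak_solution Gamma A u : Prop :=
  exists2 g, weak_gradient (~` Gamma) u g &
    forall phi, test_function (~` Gamma) phi ->
      \int[lebesgue_vec R n]_(z in ~` Gamma)
         dotv (mx_apply (A z) (g z)) (grad phi z) = 0.

End degenerate_elliptic.

(* Main.v *)
(* Suppose Tu <= M almost everywhere on Gamma, and take for G a bounded nondecreasing smooth function
   which vanishes exactly on ]-oo, M].  Testing the equation with phi * G(u), phi a cutoff in Omega,
   gives by ellipticity
     int phi G'(u) |grad u|^2 w  <=  C int |grad u| G(u) |grad phi| w.
   The cutoff is 1 outside an eta-neighbourhood of Gamma and inside a ball of radius r, so by Young's
   inequality the right-hand side tends to 0 once
     int_{eta < delta < 2 eta} G(u)^2 w  <=  C eta^2 int |grad G(u)|^2 w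
   is known uniformly in eta.  This Hardy inequality comes from the Poincare inequality on balls
   centred on Gamma, whose codimension is larger than 1: if the average of G(u) on such a ball of
   radius r is at least lam, then, as the averages tend to 0 at almost every point x of Gamma,
   telescoping gives a scale t <= 2 r at which the energy of ball x t dominates t^d lam^2 / r, and by
   the Vitali covering lemma and the lower regularity of Gamma lam^2 is at most C r^(1-d) times the
   energy near the ball.  Letting eta -> 0 and r -> oo, |grad G(u)|^2 w integrates to 0, hence so does
   G(u)^2 w, that is u <= M.  The lower bound is the upper bound for -u. *)

Require Import Defs.
From HB Require Import structures.
From mathcomp Require Import all_boot all_order all_algebra.
From mathcomp Require Import all_classical all_reals all_analysis.
From mathcomp Require Import measurable_realfun ess_sup_inf.
From mathcomp Require Import ring lra.

Set Implicit Arguments.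
Unset Strict Implicit.
Unset Printing Implicit Defensive.

Import Order.TTheory GRing.Theory Num.Theory.
Import numFieldNormedType.Exports.

Local Open Scope classical_set_scope.
Local Open Scope ring_scope.

(** * Lebesgue measure, Borel functions and integrals *)

(** The obstacle is that the gradient of [u] is only known off Gamma, while the Poincare inequality
    on balls centred on Gamma needs one across it. As p = n - 1 - d is positive, the
    (n-1)-dimensional content of Gamma is locally zero and Gamma is removable for bounded functions;
    [u] itself is reached through the truncations [N * sin (u / N)]. The weight is [delta ^ -p].
    Within [r] of Gamma it is at least of order [r ^ -p], so unweighted energies cost a factor
    [r ^ p]; off the [r]-neighbourhood this factor cancels against the weight, whence the [eta ^ 2]
    of the Hardy inequality. That inequality only bounds one half of the cutoff error: Young's
    inequality with parameter [lam] leaves [lam] times the energy near Gamma and near infinity, plus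
    a bounded quantity divided by [lam], so [lam] is fixed before [eta] and [r]. Balls are those of
    the sup norm: being products of intervals they contain the staircase paths between their points.
    Since Tonelli's theorem is used on Borel functions, the Lebesgue measurable data are first
    replaced by Borel ones that vanish on a null set containing Gamma. *)

Section ball.
Context {R : realType} {n : nat}.
Implicit Types (x y : 'rV[R]_n) (r : R).

Lemma rV_ballP x r y : 0 < r -> ball x r y <-> forall i, `|x 0 i - y 0 i| < r.
Proof.
move=> r0; split; first by move=> xy i; have [_ /(_ 0 i)] := xy.
by move=> xy; split => // i j; rewrite (ord1 i); exact: xy.
Qed.

Lemma rV_ball_norm x r y : ball x r y <-> `|x - y| < r.
Proof. by rewrite -ball_normE. Qed.

Lemma ball_gt0 x r y : ball x r y -> 0 < r.
Proof. by move=> /rV_ball_norm; apply: le_lt_trans. Qed.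

Lemma rV_norm_coord x i : `|x 0 i| <= `|x|.
Proof.
rewrite {2}/Num.Def.normr/= mx_normrE.
by apply: (le_trans _ (le_bigmax _ _ (0, i))).
Qed.

End ball.

Section measure.
Context {R : realType} {n : nat}.
Local Notation V := 'rV[R]_n.
Local Notation leb := (lebesgue_vec R n).
Local Open Scope ereal_scope.

Lemma in_box_lr (a b : V) : box a b !=set0 -> box a b a /\ box a b b.
Proof.
move=> [x xab]; have ab i : (a 0 i <= b 0 i)%R.
  by have /andP[+ +] := xab i; exact: le_trans.
by split=> i; rewrite lexx ab.
Qed.

Lemma box_inj (a b c e : V) : box a b !=set0 -> box a b = box c e -> a = c /\ b = e.
Proof.
move=> ab0 E; have [ha hb] := in_box_lr ab0.
rewrite E in ab0; have [hc he] := in_box_lr ab0.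
rewrite E in ha hb; rewrite -E in hc he.
split; apply/rowP => i; apply/le_anti.
- by have /andP[-> _] := hc i; have /andP[-> _] := ha i.
- by have /andP[_ ->] := hb i; have /andP[_ ->] := he i.
Qed.

Lemma box_volumeE (a b : V) : box a b !=set0 ->
  box_volume (box a b) = (\prod_(i < n) (b 0 i - a 0 i))%:E.
Proof.
move=> ab0; rewrite /box_volume; case: ifPn => [/eqP E|_].
  by rewrite E in ab0; case: ab0.
rewrite (_ : [set _ | _ in _] = [set (\prod_(i < n) (b 0 i - a 0 i))%:E]) ?ereal_inf1//.
apply/seteqP; split => [_ [[c e] /= E <-]|_ ->] /=; last by exists (a, b).
by have [-> ->] := box_inj ab0 E.
Qed.

Lemma box_volume_pinfty (S : set V) :
  (forall a b, S <> box a b) -> S !=set0 -> box_volume S = +oo.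
Proof.
move=> nS S0; rewrite /box_volume; case: ifPn => [/eqP E|_].
  by rewrite E in S0; case: S0.
rewrite (_ : [set _ | _ in _] = set0) ?ereal_inf0//.
by apply/seteqP; split => // _ [[c e] /= /nS E _].
Qed.

(** Shaped for [elim/], which replaces [S] and [box_volume S] together and leaves the three cases of
    the definition. *)
Lemma box_volume_ind (P : set V -> \bar R -> Prop) : P set0 0 ->
  (forall S, S !=set0 -> P S +oo) ->
  (forall a b, box a b !=set0 -> P (box a b) (\prod_(i < n) (b 0 i - a 0 i))%:E) ->
  forall S, P S (box_volume S).
Proof.
move=> P0 Poo Pbox S; have [->|/set0P S0] := eqVneq S set0.
  by rewrite box_volume0.
have [[[a b] /= Sab]|nS] := pselect (exists p, S = box p.1 p.2).
  by move: S0; rewrite Sab => ab0; rewrite box_volumeE//; exact: Pbox.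
by rewrite box_volume_pinfty//; [exact: Poo|move=> a b Sab; apply: nS; exists (a, b)].
Qed.

Lemma cover_outer_preimage (T : pointedType) (c : set T -> \bar R) (f : T -> T) (k : R)
    (A : set T) : (0 < k)%R -> (forall S, 0 <= c S) ->
  (forall S, c (f @^-1` S) <= k%:E * c S) ->
  cover_outer c (f @^-1` A) <= k%:E * cover_outer c A.
Proof.
move=> k0 c0 cf; rewrite -lee_pdivrMl//.
apply: le_ereal_inf_tmp => _ [F AF <-].
rewrite lee_pdivrMl// -nneseriesZl//.
apply: (@le_trans _ _ (\sum_(j <oo) c (f @^-1` F j))).
  apply: ereal_inf_lbound; exists (fun j => f @^-1` F j) => //.
  by move=> x /AF [j _ Fj]; exists j.
by apply: lee_nneseries => // j _; exact: c0.
Qed.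

Lemma box_volume_preimage (r : R) (h : V) (S : set V) : (0 < r)%R ->
  box_volume ((fun x => r *: x + h)%R @^-1` S) <= ((r^-1) ^+ n)%:E * box_volume S.
Proof.
move=> r0; elim/box_volume_ind : S / (box_volume S) => [|S _|a b ab0].
- by rewrite preimage_set0 box_volume0 mule0.
- by rewrite gt0_muley ?leey// lte_fin exprn_gt0// invr_gt0.
have E : (fun x => r *: x + h)%R @^-1` box a b = box (r^-1 *: (a - h))%R (r^-1 *: (b - h))%R.
  apply/seteqP; split => x /= xab i; have /andP[] := xab i; rewrite !mxE.
    move=> h1 h2; rewrite ler_pdivrMl// ler_pdivlMl// lerBlDr h1/=.
    by rewrite lerBrDr.
  by rewrite ler_pdivrMl// ler_pdivlMl// lerBlDr lerBrDr => -> ->.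
rewrite E box_volumeE.
  rewrite -EFinM lee_fin -[X in (r^-1 ^+ X)%R]card_ord -prodr_const -big_split/=.
  rewrite le_eqVlt; apply/orP; left; apply/eqP/eq_bigr => i _; rewrite !mxE -mulrBr.
  by congr *%R; ring.
rewrite -E; case: ab0 => x xab; exists (r^-1 *: (x - h))%R => /=.
by rewrite scalerA divff ?gt_eqF// scale1r subrK.
Qed.

(** The preimage of a box under a dilation is a box of rescaled volume, which gives one inequality;
    the same inequality for the inverse map gives the other. *)
Lemma lebesgue_outer_affine (r : R) (h : V) (A : set V) : (0 < r)%R ->
  lebesgue_outer R n ((fun x => r *: x + h)%R @^-1` A) =
  ((r^-1) ^+ n)%:E * lebesgue_outer R n A.
Proof.
have le r' h' B : (0 < r')%R ->
    lebesgue_outer R n ((fun x => r' *: x + h')%R @^-1` B) <=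
    ((r'^-1) ^+ n)%:E * lebesgue_outer R n B.
  move=> r0; apply: cover_outer_preimage => //.
  - by rewrite exprn_gt0// invr_gt0.
  - exact: box_volume_ge0.
  - by move=> S; exact: box_volume_preimage.
move=> r0; apply/le_anti/andP; split; first exact: le.
rewrite -lee_pdivlMl ?exprn_gt0 ?invr_gt0//.
have := @le r^-1%R (- (r^-1 *: h))%R ((fun x => r *: x + h)%R @^-1` A).
rewrite invr_gt0 r0 => /(_ isT); rewrite -exprVn; apply: le_trans.
rewrite le_eqVlt; apply/orP; left; apply/eqP; congr (lebesgue_outer R n).
apply/seteqP; split => x /=; rewrite scalerBr !scalerA divff ?gt_eqF// !scale1r subrK//.
Qed.

(** Both half-spaces are closed so that the two pieces remain closed boxes; sharing a face costs
    nothing, since the two edges in direction [i] add up to the original one. This is what makes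
    half-spaces Caratheodory measurable. *)
Lemma box_volume_split (i : 'I_n) (t : R) (S : set V) :
  box_volume (S `&` [set x : V | (x 0 i <= t)%R]) +
  box_volume (S `&` [set x : V | (t <= x 0 i)%R]) <= box_volume S.
Proof.
elim/box_volume_ind : S / (box_volume S) => [|S _|a b ab0].
- by rewrite !set0I box_volume0 adde0.
- exact: leey.
have [ha hb] := in_box_lr ab0; have /andP[abi _] := hb i.
have [tai|ait] := ltP t (a 0%R i).
  rewrite (_ : _ `&` [set x : V | (x 0 i <= t)%R] = set0) ?box_volume0 ?add0e.
    rewrite (_ : _ `&` _ = box a b) ?box_volumeE//; apply/setIidl => x xab /=.
    by have /andP[+ _] := xab i; exact/le_trans/ltW.
  apply/seteqP; split => // x [xab /= xt]; have /andP[+ _] := xab i.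
  by rewrite leNgt (le_lt_trans xt tai).
have [bit|tbi] := ltP (b 0%R i) t.
  rewrite (_ : _ `&` [set x : V | (t <= x 0 i)%R] = set0) ?box_volume0 ?adde0.
    rewrite (_ : _ `&` _ = box a b) ?box_volumeE//; apply/setIidl => x xab /=.
    by have /andP[_] := xab i => /le_trans; apply; exact/ltW.
  apply/seteqP; split => // x [xab /= xt]; have /andP[_] := xab i.
  by rewrite leNgt (lt_le_trans bit xt).
pose c : V := \row_j (if j == i then t else b 0%R j).
pose e : V := \row_j (if j == i then t else a 0%R j).
have E1 : box a b `&` [set x : V | (x 0 i <= t)%R] = box a c.
  apply/seteqP; split => x.
    move=> [xab xt] j; rewrite !mxE; have /andP[-> +] := xab j.
    by case: eqP => [->|].
  move=> xac; split => /=; last first.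
    by have /andP[_] := xac i; rewrite mxE eqxx.
  move=> j; have /andP[->] := xac j; rewrite mxE.
  by case: eqP => [-> /le_trans|_ ->//]; exact.
have E2 : box a b `&` [set x : V | (t <= x 0 i)%R] = box e b.
  apply/seteqP; split => x.
    move=> [xab xt] j; rewrite !mxE; have /andP[+ ->] := xab j.
    by case: eqP => [->|_ ->]; rewrite ?andbT.
  move=> xac; split => /=; last first.
    by have /andP[+ _] := xac i; rewrite mxE eqxx.
  move=> j; have /andP[+ ->] := xac j; rewrite mxE andbT.
  by case: eqP => [-> |//]; exact: le_trans.
rewrite E1 E2 !box_volumeE//; last 2 first.
- exists e => j; rewrite !mxE; case: eqP => [->|_]; first by rewrite tbi lexx.
  by rewrite lexx; have /andP[->] := hb j.
- exists c => j; rewrite !mxE lexx; case: eqP => [->|_]; first by rewrite ait.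
  by have /andP[->] := hb j.
rewrite -EFinD lee_fin (bigD1 i)//= [X in (_ + X)%R](bigD1 i)//= [leRHS](bigD1 i)//=.
rewrite !mxE !eqxx.
under eq_bigr => j ji do rewrite mxE (negbTE ji).
under [X in (_ + _ * X)%R]eq_bigr => j ji do rewrite mxE (negbTE ji).
by rewrite -mulrDl; rewrite le_eqVlt; apply/orP; left; apply/eqP; congr *%R; ring.
Qed.

Lemma measurable_halfspace (i : 'I_n) (t : R) :
  (lebesgue_outer R n).-cara.-measurable [set x : V | (x 0 i < t)%R].
Proof.
apply: (@le_caratheodory_measurable R V (lebesgue_outer R n)) => X.
apply: le_ereal_inf_tmp => _ [F XF <-].
apply: (@le_trans _ _ (\sum_(k <oo) box_volume (F k `&` [set x : V | (x 0 i <= t)%R]) +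
                       \sum_(k <oo) box_volume (F k `&` [set x : V | (t <= x 0 i)%R]))).
  apply: leeD; apply: ereal_inf_lbound => /=.
    eexists; last reflexivity.
    by move=> x [/XF[k _ Fk] /= xt]; exists k => //; split => //=; exact: ltW.
  eexists; last reflexivity.
  by move=> x [/XF[k _ Fk] /= /negP]; rewrite -leNgt; exists k.
rewrite -nneseriesD; try by move=> k _ _; exact: box_volume_ge0.
apply: lee_nneseries => k _; first by rewrite adde_ge0// box_volume_ge0.
exact: box_volume_split.
Qed.

Definition halfspaces : set (set V) :=
  [set S | exists (i : 'I_n) (t : R), S = [set x : V | (x 0 i < t)%R]].

(* Two sigma-algebras on the same vectors: Tonelli's theorem needs [borelV], whereas the measure [leb]
   lives on the Lebesgue sets [lebV]. *)
Definition borelV := g_sigma_algebraType halfspaces.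
Definition lebV := caratheodory_type (lebesgue_outer R n).

Lemma borel_cara (A : set V) : <<s halfspaces >> A ->
  (lebesgue_outer R n).-cara.-measurable A.
Proof.
suff : <<s halfspaces >> `<=` (lebesgue_outer R n).-cara.-measurable by exact.
apply: smallest_sub; first exact: sigma_algebra_measurable.
by move=> _ [i [t ->]]; exact: measurable_halfspace.
Qed.

Lemma measurable_coord (i : 'I_n) :
  measurable_fun setT (fun x : borelV => (x : V) 0%R i).
Proof.
apply: (measurability _ (RGenInftyO.measurableE R)).
move=> _ [_ [t ->] <-]; rewrite setTI; apply: sub_sigma_algebra.
by exists i, t; apply/seteqP; split=> x /=; rewrite in_itv.
Qed.

Lemma measurable_to_borel d (X : measurableType d) (f : X -> V) :
  (forall i, measurable_fun setT (fun x => f x 0%R i)) ->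
  measurable_fun setT (f : X -> borelV).
Proof.
move=> mf; apply: (@measurability _ _ X borelV setT _ halfspaces) => //.
move=> _ [_ [i [t ->]] <-].
have := mf i measurableT _ (measurable_itv `]-oo, t[).
by congr measurable; apply/seteqP; split => x; rewrite /= in_itv.
Qed.

Lemma measurable_open_borel (U : set V) : open U -> <<s halfspaces >> U.
Proof.
move=> oU.
pose bx (q : 'rV[rat]_n * 'rV[rat]_n) : set V :=
  [set x | forall i, (ratr (q.1 0%R i) < x 0%R i < ratr (q.2 0%R i))%R].
have mbx q : measurable (bx q : set borelV).
  have -> : bx q = \bigcap_(i in [set: 'I_n])
      ((fun x : borelV => (x : V) 0%R i) @^-1` `]ratr (q.1 0%R i), ratr (q.2 0%R i)[%classic).
    apply/seteqP; split => x /=; first by move=> h i _ /=; rewrite in_itv/= h.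
    by move=> h i; have := h i I; rewrite /= in_itv.
  apply: fin_bigcap_measurable => // i _.
  rewrite -[X in measurable X]setTI; apply: measurable_coord; first exact: measurableT.
  exact: measurable_itv.
have -> : U = \bigcup_(q in [set q | bx q `<=` U]) bx q.
  apply/seteqP; split => [x Ux|x [q qU]]; last exact: qU.
  have /nbhs_ballP[e /= e0 eU] : nbhs x U by exact: open_nbhs_nbhs.
  have H1 i : exists q : rat, (x 0%R i - e < ratr q < x 0%R i)%R.
    have [|q] := @rat_in_itvoo R (x 0%R i - e) (x 0%R i); first by rewrite ltrBlDr ltrDl.
    by rewrite in_itv/=; exists q.
  have H2 i : exists q : rat, (x 0%R i < ratr q < x 0%R i + e)%R.
    have [|q] := @rat_in_itvoo R (x 0%R i) (x 0%R i + e); first by rewrite ltrDl.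
    by rewrite in_itv/=; exists q.
  have [q1 q1P] := choice H1; have [q2 q2P] := choice H2.
  exists (\row_i q1 i, \row_i q2 i) => /=; last first.
    by move=> i; rewrite !mxE; have /andP[_ ->] := q1P i; have /andP[-> _] := q2P i.
  move=> y /= hy; apply: eU; apply/rV_ballP => // i.
  have := hy i; rewrite !mxE => /andP[h1 h2].
  have /andP[h3 h4] := q1P i; have /andP[h5 h6] := q2P i.
  rewrite ltr_norml; apply/andP; split; lra.
have -> : \bigcup_(q in [set q | bx q `<=` U]) bx q =
   \bigcup_q (if pselect (bx q `<=` U) then bx q else set0).
  apply/seteqP; split => x [q]; first by move=> qU xq; exists q => //; case: pselect.
  by case: pselect => // qU _ xq; exists q.
apply: (@countable_bigcupT_measurable _ borelV) => [|q].
  exact: countableP.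
by case: (pselect _) => [qU|qU] /=; [exact: mbx|exact: measurable0].
Qed.

Lemma measurable_open (U : set V) : open U -> measurable (U : set lebV).
Proof. by move=> oU; apply: borel_cara; apply: measurable_open_borel. Qed.

Lemma measurable_closed_borel (U : set V) : closed U -> measurable (U : set borelV).
Proof.
by rewrite -openC -[X in measurable X]setCK => oU; apply: measurableC; exact: measurable_open_borel.
Qed.

Definition borel_fun (f : V -> R) := measurable_fun setT (f : borelV -> R).

Lemma borel_fun_leb f : borel_fun f -> measurable_fun setT (f : lebV -> R).
Proof.
by move=> bf _ A mA; apply: borel_cara; apply: bf => //; exact: measurableT.
Qed.

Lemma borel_cst c : borel_fun (fun=> c).
Proof. exact: measurable_cst. Qed.

Lemma borelD f g : borel_fun f -> borel_fun g -> borel_fun (fun x => f x + g x)%R.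
Proof. exact: measurable_funD. Qed.

Lemma borelB f g : borel_fun f -> borel_fun g -> borel_fun (fun x => f x - g x)%R.
Proof. exact: measurable_funB. Qed.

Lemma borelM f g : borel_fun f -> borel_fun g -> borel_fun (fun x => f x * g x)%R.
Proof. exact: measurable_funM. Qed.

Lemma borelX f k : borel_fun f -> borel_fun (fun x => f x ^+ k)%R.
Proof. exact: measurable_funX. Qed.

Lemma borel_norm f : borel_fun f -> borel_fun (fun x => `|f x|)%R.
Proof. by move=> bf; apply: measurableT_comp. Qed.

Lemma borel_indic (A : set V) : measurable (A : set borelV) -> borel_fun (\1_A).
Proof. exact: measurable_indic. Qed.

Lemma borel_continuous (f : V -> R) : continuous f -> borel_fun f.
Proof.
move=> cf; apply: (measurability _ (RGenOpens.measurableE R)).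
move=> _ [_ [a [b ->]] <-]; rewrite setTI; apply: measurable_open_borel.
by apply: open_comp => // x _; exact: cf.
Qed.

Lemma leb_affine (r : R) (h : V) (A : set V) : (0 < r)%R ->
  leb ((fun x => r *: x + h)%R @^-1` A) = ((r^-1) ^+ n)%:E * leb A.
Proof. exact: lebesgue_outer_affine. Qed.

Lemma leb_translate (h : V) (A : set V) : leb ((fun x => x + h)%R @^-1` A) = leb A.
Proof.
rewrite -[RHS]mul1e -(expr1n _ n) -[X in (X ^+ n)%:E]invr1 -(leb_affine h)//.
by congr leb; apply/seteqP; split => x /=; rewrite scale1r.
Qed.

(* The measure of a ball of radius [r] of the sup norm is [kappa * r ^ n].  That [kappa] is positive is
   never proved: if it vanishes then so does [leb], by [leb0_unit_ball]. *)
Definition leb_unit_ball : R := fine (leb (ball (0%R : V) 1)).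
Local Notation kappa := leb_unit_ball.

Lemma leb_box_le (a b : V) : leb (box a b) <= box_volume (box a b).
Proof.
apply: ereal_inf_lbound.
exists (fun k => if (k == 0)%N then box a b else set0) => /=; first by move=> x xab; exists 0%N.
rewrite (nneseries_split 0 1)// => [|k _]; last by case: ifP => // _; exact: box_volume_ge0.
rewrite add0n big_nat1 /= eseries0 ?adde0// => k; by case: k => // k _ _ /=; rewrite box_volume0.
Qed.

Lemma leb_ball_lty (x : V) (r : R) : leb (ball x r) < +oo.
Proof.
have sub : ball x r `<=` box (x - const_mx r)%R (x + const_mx r)%R.
  move=> y xy i; rewrite !mxE.
  have /(rV_ballP _ _ (ball_gt0 xy))/(_ i) := xy; rewrite ltr_norml => /andP[? ?].
  by apply/andP; split; lra.
have [|/set0P/[dup] b0 [y yb]] := eqVneq (ball x r) set0; first by move=> ->; rewrite measure0.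
apply: (@le_lt_trans _ _ (leb (box (x - const_mx r)%R (x + const_mx r)%R))).
  exact: (@le_outer_measure _ _ (lebesgue_outer R n)).
apply: (le_lt_trans (leb_box_le _ _)); rewrite box_volumeE ?ltry//.
by exists y; apply: sub.
Qed.

Lemma leb_ball (x : V) (r : R) : (0 < r)%R -> leb (ball x r) = (kappa * r ^+ n)%:E.
Proof.
move=> r0; have := @leb_affine r^-1%R (- (r^-1 *: x))%R (ball (0%R : V) 1).
rewrite invr_gt0 r0 invrK => /(_ isT); rewrite /kappa EFinM fineK; last first.
  by rewrite ge0_fin_numE// leb_ball_lty.
rewrite [RHS]muleC => <-; congr leb.
apply/seteqP; split => y /=.
  move=> /rV_ballP-/(_ r0) xy; apply/rV_ballP => // i; rewrite !mxE.
  rewrite sub0r normrN -mulrBr normrM gtr0_norm ?invr_gt0// ltr_pdivrMl// mulr1 distrC.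
  exact: xy.
move=> /rV_ballP-/(_ ltr01) xy; apply/rV_ballP => // i; have := xy i; rewrite !mxE.
by rewrite sub0r normrN -mulrBr normrM gtr0_norm ?invr_gt0// ltr_pdivrMl// mulr1 distrC.
Qed.

Lemma leb_unit_ball_ge0 : (0 <= kappa)%R.
Proof. by rewrite fine_ge0. Qed.

Lemma bigcup_ball : \bigcup_k ball (0%R : V) k.+1%:R = setT.
Proof.
apply/seteqP; split => // x _; have := truncnS_gt `|x|%R.
by exists (Num.trunc `|x|%R) => //=; apply/rV_ball_norm; rewrite sub0r normrN.
Qed.

Lemma leb_sigma_finite : sigma_finite setT leb.
Proof.
exists (fun k => ball (0%R : V) k.+1%:R); first by rewrite bigcup_ball.
move=> k; split; first by apply: measurable_open; exact: ball_open.
exact: leb_ball_lty.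
Qed.

HB.instance Definition _ := Measure_isSigmaFinite.Build _ _ _ leb leb_sigma_finite.

Lemma leb0_unit_ball (A : set V) : kappa = 0%R -> leb A = 0.
Proof.
move=> k0; apply/eqP; rewrite eq_le measure_ge0 andbT.
apply: (@le_trans _ _ (leb (\bigcup_k ball (0%R : V) k.+1%:R))).
  by apply: (@le_outer_measure _ _ (lebesgue_outer R n)); rewrite bigcup_ball.
apply: (le_trans (@outer_measure_sigma_subadditive _ _ (lebesgue_outer R n) _)).
rewrite eseries0// => k _ _; by rewrite -[LHS]/(leb _) leb_ball// k0 mul0r.
Qed.

End measure.

(** * Integration over the whole space *)

Section integral.
Context {R : realType} {n : nat}.
Local Notation V := 'rV[R]_n.
Local Notation leb := (lebesgue_vec R n).
Local Notation borelV := (@borelV R n).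
Local Notation lebV := (@lebV R n).
Local Open Scope ereal_scope.
Implicit Types (f g : V -> R) (F : V -> V -> R).

(** Integrals run over the whole space and domains are encoded by indicator factors, so that
    translations and Tonelli's theorem apply without tracking sets. *)
Definition nnint f : \bar R := \int[leb]_x (f x)%:E.

Lemma borel_EFin f : borel_fun f -> measurable_fun setT (fun x : lebV => (f x)%:E).
Proof. by move=> /borel_fun_leb bf; apply/measurable_EFinP. Qed.

Lemma nnint_ge0 f : (forall x, 0 <= f x)%R -> 0 <= nnint f.
Proof. by move=> f0; apply: integral_ge0 => x _; rewrite lee_fin. Qed.

Lemma le_nnint f g : borel_fun f -> borel_fun g -> (forall x, 0 <= f x)%R ->
  (forall x, f x <= g x)%R -> nnint f <= nnint g.
Proof.
move=> bf bg f0 fg; apply: ge0_le_integral.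
- exact: measurableT.
- by move=> x _; rewrite lee_fin.
- exact: borel_EFin.
- exact: borel_EFin.
- by move=> x _; rewrite lee_fin.
Qed.

Lemma nnintD f g : borel_fun f -> borel_fun g -> (forall x, 0 <= f x)%R ->
  (forall x, 0 <= g x)%R -> nnint (fun x => f x + g x)%R = nnint f + nnint g.
Proof.
move=> bf bg f0 g0; rewrite /nnint -ge0_integralD.
- by [].
- exact: measurableT.
- by move=> x _; rewrite lee_fin.
- exact: borel_EFin.
- by move=> x _; rewrite lee_fin.
- exact: borel_EFin.
Qed.

Lemma nnintZ (k : R) f : (0 <= k)%R -> borel_fun f -> (forall x, 0 <= f x)%R ->
  nnint (fun x => k * f x)%R = k%:E * nnint f.
Proof.
move=> k0 bf f0; rewrite /nnint -ge0_integralZl_EFin.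
- by [].
- exact: measurableT.
- by move=> x _; rewrite lee_fin.
- exact: borel_EFin.
- exact: k0.
Qed.

Lemma nnint_sum (I : Type) (s : seq I) (f : I -> V -> R) :
  (forall i, borel_fun (f i)) -> (forall i x, 0 <= f i x)%R ->
  nnint (fun x => \sum_(i <- s) f i x)%R = \sum_(i <- s) nnint (f i).
Proof.
move=> bf f0; rewrite /nnint.
under eq_integral => x _ do rewrite -sumEFin.
rewrite ge0_integral_sum// => i; first exact: borel_EFin.
by move=> x _; rewrite lee_fin.
Qed.

Lemma nnint_indic (A : set V) : measurable (A : set borelV) -> nnint (\1_A) = leb A.
Proof. by move=> mA; rewrite /nnint integral_indic ?setIT//; exact: borel_cara. Qed.

Lemma measurable_id_borel : measurable_fun setT (id : lebV -> borelV).
Proof. by move=> _ A mA; rewrite setTI; exact: borel_cara. Qed.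

Lemma measurable_shift (h : V) : measurable_fun setT ((fun x => x + h)%R : borelV -> borelV).
Proof.
apply: measurable_to_borel => i; under eq_fun do rewrite mxE.
by apply: measurable_funD; [exact: measurable_coord|exact: measurable_cst].
Qed.

Lemma borel_shift f (h : V) : borel_fun f -> borel_fun (fun x => f (x + h)%R).
Proof.
by move=> bf; apply: (@measurableT_comp _ _ _ _ _ _ (f : borelV -> R)) => //; exact: measurable_shift.
Qed.

(** Both sides are integrals against push-forwards of [leb] to the Borel sets, one by the
    translation and one by the identity; these two measures agree by [leb_translate]. *)
Lemma nnint_shift f (h : V) : borel_fun f -> (forall x, 0 <= f x)%R ->
  nnint (fun x => f (x + h)%R) = nnint f.
Proof.
move=> bf f0; pose phi : lebV -> borelV := (fun x => x + h)%R.
have mphi : measurable_fun setT phi.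
  by move=> _ A mA; rewrite setTI; apply: borel_cara; rewrite -[X in <<s _ >> X]setTI; apply: measurable_shift.
have bf' : measurable_fun setT (fun x : borelV => (f x)%:E) by apply/measurable_EFinP.
have f0' : {in setT, forall y, 0 <= (f y)%:E} by move=> y _; rewrite lee_fin.
have := ge0_integral_pushforward mphi leb measurableT bf' f0'.
rewrite preimage_setT /nnint => <-.
have := ge0_integral_pushforward measurable_id_borel leb measurableT bf' f0'.
rewrite preimage_setT /= => <-.
apply: eq_measure_integral => [|mid B mB _]; first exact: measurable_id_borel.
by change (leb ((fun x : V => x + h)%R @^-1` B) = leb B); exact: leb_translate.
Qed.

Definition borel_fun2 F := measurable_fun setT (fun p : borelV * borelV => F p.1 p.2).

Lemma borel2_cst c : borel_fun2 (fun _ _ => c).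
Proof. exact: measurable_cst. Qed.

Lemma borel2D F G : borel_fun2 F -> borel_fun2 G -> borel_fun2 (fun x y => F x y + G x y)%R.
Proof. exact: measurable_funD. Qed.

Lemma borel2B F G : borel_fun2 F -> borel_fun2 G -> borel_fun2 (fun x y => F x y - G x y)%R.
Proof. exact: measurable_funB. Qed.

Lemma borel2M F G : borel_fun2 F -> borel_fun2 G -> borel_fun2 (fun x y => F x y * G x y)%R.
Proof. exact: measurable_funM. Qed.

Lemma borel2X F k : borel_fun2 F -> borel_fun2 (fun x y => F x y ^+ k)%R.
Proof. exact: measurable_funX. Qed.

Lemma borel2_norm F : borel_fun2 F -> borel_fun2 (fun x y => `|F x y|)%R.
Proof. by move=> bf; apply: measurableT_comp. Qed.

Lemma borel2_comp f (h : V -> V -> V) : borel_fun f ->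
  (forall i, borel_fun2 (fun x y => h x y 0%R i)) -> borel_fun2 (fun x y => f (h x y)).
Proof.
move=> bf bh; apply: (@measurableT_comp _ _ _ _ _ _ (f : borelV -> R)) => //.
exact: measurable_to_borel.
Qed.

Lemma borel2_fst f : borel_fun f -> borel_fun2 (fun x _ => f x).
Proof. by move=> bf; apply: (measurableT_comp bf); exact: measurable_fst. Qed.

Lemma borel2_snd f : borel_fun f -> borel_fun2 (fun _ y => f y).
Proof. by move=> bf; apply: (measurableT_comp bf); exact: measurable_snd. Qed.

Lemma borel2_add f : borel_fun f -> borel_fun2 (fun x y => f (x + y)%R).
Proof.
move=> bf; apply: borel2_comp => // i.
rewrite (_ : (fun x y : V => _) = (fun x y : V => x 0%R i + y 0%R i)%R); last first.
  by apply/funext => x; apply/funext => y; rewrite mxE.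
by apply: borel2D; [apply: borel2_fst|apply: borel2_snd]; exact: measurable_coord.
Qed.

Lemma borel2_sub f : borel_fun f -> borel_fun2 (fun x y => f (x - y)%R).
Proof.
move=> bf; apply: borel2_comp => // i.
rewrite (_ : (fun x y : V => _) = (fun x y : V => x 0%R i - y 0%R i)%R); last first.
  by apply/funext => x; apply/funext => y; rewrite !mxE.
by apply: borel2B; [apply: borel2_fst|apply: borel2_snd]; exact: measurable_coord.
Qed.

Lemma borel2_swap F : borel_fun2 F -> borel_fun2 (fun x y => F y x).
Proof.
move=> bF; apply: (@measurableT_comp _ _ _ _ _ _ (fun p : borelV * borelV => F p.1 p.2) _ (fun p => (p.2, p.1))) => //.
by apply: measurable_fun_pair; [exact: measurable_snd|exact: measurable_fst].
Qed.

Lemma borel2_leb F : borel_fun2 F ->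
  measurable_fun setT (fun p : lebV * lebV => (F p.1 p.2)%:E).
Proof.
move=> bF; apply/measurable_EFinP.
have mp : measurable_fun setT (fun p : lebV * lebV => (p.1, p.2) : borelV * borelV).
  apply: measurable_fun_pair.
    exact: (measurableT_comp measurable_id_borel measurable_fst).
  exact: (measurableT_comp measurable_id_borel measurable_snd).
exact: (measurableT_comp bF mp).
Qed.

Lemma nnint_tonelli F : borel_fun2 F -> (forall x y, 0 <= F x y)%R ->
  \int[leb]_x \int[leb]_y (F x y)%:E = \int[leb]_y \int[leb]_x (F x y)%:E.
Proof.
move=> bF F0; apply: (@fubini_tonelli _ _ _ _ _ leb leb (fun p => (F p.1 p.2)%:E)).
  exact: borel2_leb.
by move=> [x y]; rewrite lee_fin.
Qed.

Lemma measurable_nnint F : borel_fun2 F -> (forall x y, 0 <= F x y)%R ->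
  measurable_fun setT (fun x : borelV => nnint (F x)).
Proof.
move=> bF F0.
apply: (@measurable_fun_fubini_tonelli_F _ _ borelV lebV R leb (fun p => (F p.1 p.2)%:E)).
  apply/measurable_EFinP.
  have mp : measurable_fun setT (fun p : borelV * lebV => (p.1, p.2) : borelV * borelV).
    apply: measurable_fun_pair; first exact: measurable_fst.
    exact: (measurableT_comp measurable_id_borel measurable_snd).
  exact: (measurableT_comp bF mp).
by move=> [x y]; rewrite lee_fin.
Qed.

Lemma borel_fine_nnint F : borel_fun2 F -> (forall x y, 0 <= F x y)%R ->
  borel_fun (fun x => fine (nnint (F x))).
Proof. by move=> bF F0; apply: measurableT_comp => //; exact: measurable_nnint. Qed.

Definition L1 f := borel_fun f /\ nnint (fun x => `|f x|)%R < +oo.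

Lemma L1_integrable f : L1 f -> leb.-integrable setT (EFin \o f).
Proof. by move=> [bf fi]; apply/integrableP; split; [exact: borel_EFin|]. Qed.

Lemma L1_le f g : borel_fun f -> L1 g -> (forall x, `|f x| <= `|g x|)%R -> L1 f.
Proof.
move=> bf [bg gi] fg; split => //; apply: le_lt_trans gi.
by apply: le_nnint => //; exact: borel_norm.
Qed.

Lemma L1D f g : L1 f -> L1 g -> L1 (fun x => f x + g x)%R.
Proof.
move=> [bf fi] [bg gi]; split; first exact: borelD.
apply: (@le_lt_trans _ _ (nnint (fun x => `|f x| + `|g x|)%R)).
  apply: le_nnint => //; [apply: borel_norm; exact: borelD|apply: borelD; exact: borel_norm|].
  by move=> x; exact: ler_normD.
by rewrite nnintD//; [exact: lte_add_pinfty|exact: borel_norm|exact: borel_norm].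
Qed.

Lemma L1Z (k : R) f : L1 f -> L1 (fun x => k * f x)%R.
Proof.
move=> [bf fi]; split; first by apply: borelM => //; exact: borel_cst.
under eq_fun do rewrite normrM.
by rewrite nnintZ//; [rewrite lte_mul_pinfty|exact: borel_norm].
Qed.

Lemma L1B f g : L1 f -> L1 g -> L1 (fun x => f x - g x)%R.
Proof.
move=> fi gi; rewrite (_ : (fun _ => _) = (fun x => f x + (-1) * g x)%R).
  by apply: L1D => //; exact: L1Z.
by apply/funext => x; rewrite mulN1r.
Qed.

Lemma L1_shift f h : L1 f -> L1 (fun x => f (x + h)%R).
Proof.
move=> [bf fi]; split; first exact: borel_shift.
by rewrite (@nnint_shift (fun x => `|f x|)%R h)//; exact: borel_norm.
Qed.

Definition rint f : R := (\int[leb]_x f x)%R.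

Lemma rintD f g : L1 f -> L1 g -> rint (fun x => f x + g x)%R = (rint f + rint g)%R.
Proof. by move=> fi gi; rewrite /rint RintegralD//; exact: L1_integrable. Qed.

Lemma rintB f g : L1 f -> L1 g -> rint (fun x => f x - g x)%R = (rint f - rint g)%R.
Proof. by move=> fi gi; rewrite /rint RintegralB//; exact: L1_integrable. Qed.

Lemma rintZ (k : R) f : L1 f -> rint (fun x => k * f x)%R = (k * rint f)%R.
Proof. by move=> fi; rewrite /rint RintegralZl//; exact: L1_integrable. Qed.

Lemma rint_nnint f : (forall x, 0 <= f x)%R -> L1 f -> (rint f)%:E = nnint f.
Proof.
move=> f0 fi; rewrite /rint /Rintegral fineK//.
rewrite ge0_fin_numE; last exact: nnint_ge0.
have [_] := fi; apply: le_lt_trans.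
rewrite le_eqVlt; apply/orP; left; apply/eqP; congr nnint.
by apply/funext => x; rewrite ger0_norm.
Qed.

Lemma rint_norm_le f : L1 f -> `|rint f|%:E <= nnint (fun x => `|f x|)%R.
Proof.
move=> fi; rewrite -rint_nnint//; last first.
  by split; [apply: borel_norm; exact: (proj1 fi)|under eq_fun do rewrite normr_id; exact: (proj2 fi)].
by rewrite lee_fin; apply: le_normr_Rintegral => //; exact: L1_integrable.
Qed.

Lemma le_rint f g : L1 f -> L1 g -> (forall x, f x <= g x)%R -> (rint f <= rint g)%R.
Proof. by move=> fi gi fg; apply: le_Rintegral => //; exact: L1_integrable. Qed.

Lemma rint_ge0 f : (forall x, 0 <= f x)%R -> (0 <= rint f)%R.
Proof. by move=> f0; apply: Rintegral_ge0. Qed.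

Lemma rint_shift f h : L1 f -> rint (fun x => f (x + h)%R) = rint f.
Proof.
move=> fi.
pose fp x := Num.max (f x) 0%R; pose fm x := Num.max (- f x)%R 0%R.
have E x : f x = (fp x - fm x)%R.
  rewrite /fp /fm; case: (leP (f x) 0%R) => fx.
    by rewrite max_l ?oppr_ge0// sub0r opprK.
  by rewrite max_r ?subr0// oppr_le0 ltW.
have Lp : L1 fp.
  apply: (L1_le _ fi); last first.
    move=> x; rewrite /fp; case: (leP (f x) 0%R) => fx //; by rewrite normr0.
  exact: measurable_maxr (proj1 fi) (borel_cst _).
have Lm : L1 fm.
  apply: (L1_le _ fi); last first.
    move=> x; rewrite /fm; case: (leP (- f x)%R 0%R) => fx; by rewrite ?normr0// normrN.
  apply: measurable_maxr; last exact: borel_cst.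
  by apply: measurableT_comp => //; exact: (proj1 fi).
have p0 x : (0 <= fp x)%R by rewrite /fp le_max lexx orbT.
have m0 x : (0 <= fm x)%R by rewrite /fm le_max lexx orbT.
have S g : (forall x, 0 <= g x)%R -> L1 g -> rint (fun x => g (x + h)%R) = rint g.
  move=> g0 gi; apply: EFin_inj; rewrite !rint_nnint//; last exact: L1_shift.
  by rewrite nnint_shift//; exact: (proj1 gi).
rewrite (_ : (fun _ => _) = (fun x => fp (x + h)%R - fm (x + h)%R)%R); last first.
  by apply/funext => x; rewrite E.
rewrite rintB ?S//; try exact: L1_shift.
by rewrite -rintB//; congr rint; apply/funext => x; rewrite E.
Qed.

End integral.

(** * Null sets and convergence theorems *)

Section dominated.
Context {R : realType} {n : nat}.
Local Notation V := 'rV[R]_n.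
Local Notation leb := (lebesgue_vec R n).
Local Notation borelV := (@borelV R n).
Local Notation lebV := (@lebV R n).
Local Open Scope ereal_scope.
Implicit Types (f g : V -> R).

Lemma cvg_to_EFin (u : nat -> R) (l : R) : u @ \oo --> l -> (fun k => (u k)%:E) @ \oo --> l%:E.
Proof. by move=> ul; apply/cvg_EFin => //; near=> k. Unshelve. all: end_near. Qed.

(** [leb] is the outer measure on every set, so no measurable witness is asked for; [aeP] recovers
    the library notion because sets of outer measure 0 are Caratheodory measurable. *)
Definition ae (P : V -> Prop) := leb (~` [set x | P x]) = 0.

Lemma aeP (P : V -> Prop) : ae P <-> almost_everywhere (leb : {measure set lebV -> \bar R}) P.
Proof.
split=> [P0|[A [_ A0 PA]]]; last first.
  apply/eqP; rewrite eq_le measure_ge0 andbT -A0.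
  exact: (@le_outer_measure _ _ (lebesgue_outer R n)).
exists (~` [set x | P x]); split => //.
apply: (@le_caratheodory_measurable R V (lebesgue_outer R n)) => X.
rewrite [X in X + _](_ : _ = 0) ?add0e.
  exact: (@le_outer_measure _ _ (lebesgue_outer R n)).
apply/eqP; rewrite eq_le outer_measure_ge0 andbT -P0.
by apply: (@le_outer_measure _ _ (lebesgue_outer R n)) => x [].
Qed.

Lemma aeS (P Q : V -> Prop) : (forall x, P x -> Q x) -> ae P -> ae Q.
Proof.
move=> PQ P0; apply/eqP; rewrite eq_le measure_ge0 andbT -P0.
by apply: (@le_outer_measure _ _ (lebesgue_outer R n)) => x /= nQ /PQ.
Qed.

Lemma aeT (P : V -> Prop) : (forall x, P x) -> ae P.
Proof.
move=> PT; rewrite /ae (_ : ~` _ = set0) ?measure0//.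
by apply/seteqP; split => // x; apply.
Qed.

Lemma ae_forall (P : nat -> V -> Prop) : (forall k, ae (P k)) -> ae (fun x => forall k, P k x).
Proof.
move=> aP; apply/eqP; rewrite eq_le measure_ge0 andbT.
apply: (@le_trans _ _ (leb (\bigcup_k ~` [set x | P k x]))).
  apply: (@le_outer_measure _ _ (lebesgue_outer R n)) => x /= /existsNP[k nP].
  by exists k.
apply: (le_trans (@outer_measure_sigma_subadditive _ _ (lebesgue_outer R n) _)).
by rewrite eseries0// => k _ _; exact: aP.
Qed.

Lemma nnint_dominated (f : nat -> V -> R) g : (forall k, borel_fun (f k)) ->
  (forall k x, 0 <= f k x <= g x)%R -> L1 g ->
  ae (fun x => f ^~ x @ \oo --> (0%R : R)) ->
  forall e, (0 < e)%R -> exists N, forall k, (N <= k)%N -> nnint (f k) <= e%:E.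
Proof.
move=> bf fg gi f0 e e0.
have bf' k : measurable_fun setT (fun x : lebV => (f k x)%:E) by exact: borel_EFin.
have [] := @dominated_convergence _ _ _ leb setT measurableT
   (fun k x => (f k x)%:E) (cst 0) (EFin \o g) bf'.
- exact: measurable_cst.
- by apply/aeP; apply: aeS f0 => x fx _; exact: cvg_to_EFin.
- exact: L1_integrable.
- apply: aeW => x k _; rewrite gee0_abs ?lee_fin; by have /andP[] := fg k x.
move=> _ _; rewrite integral0 => /fine_cvgP[_].
move=> /cvgrPdist_le/(_ _ e0)[N _ NP].
have fin k : nnint (f k) \is a fin_num.
  rewrite ge0_fin_numE; last by apply: nnint_ge0 => x; have /andP[] := fg k x.
  apply: le_lt_trans (proj2 gi); apply: le_nnint => //.
  - exact: borel_norm (proj1 gi).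
  - by move=> x; have /andP[] := fg k x.
  - by move=> x; have /andP[_] := fg k x => /le_trans; apply; exact: ler_norm.
exists N => k Nk; have := NP k Nk; rewrite sub0r normrN /= => H.
by rewrite -(fineK (fin k)) lee_fin; apply: le_trans H; exact: ler_norm.
Qed.

Lemma nnint_fatou (f : nat -> V -> R) g (M : \bar R) : (forall k, borel_fun (f k)) ->
  borel_fun g -> (forall x, 0 <= g x)%R ->
  (forall k x, 0 <= f k x)%R -> (forall x, f ^~ x @ \oo --> g x) ->
  (forall k, nnint (f k) <= M) -> nnint g <= M.
Proof.
move=> bf bg g0 f0 fg fM.
have := @fatou _ _ _ leb setT measurableT (fun k x => (f k x)%:E) (fun k => borel_EFin (bf k)).
have f0' k (x : V) : setT x -> 0%R <= (f k x)%:E by rewrite lee_fin.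
move=> /(_ f0').
rewrite (_ : (fun x => _) = (fun x => (g x)%:E)); last first.
  apply/funext => x; rewrite is_cvg_limn_einfE; first by apply: cvg_lim => //; exact: cvg_to_EFin.
  by apply/cvg_ex; exists (g x)%:E; exact: cvg_to_EFin.
move=> /le_trans; apply.
rewrite limn_einf_lim; apply: lime_le; first exact: is_cvg_einfs.
near=> k; apply: (le_trans _ (fM k)); apply: ereal_inf_lbound.
by exists k => //=.
Unshelve. all: end_near. Qed.

Lemma nnint_eq0 f : borel_fun f -> (forall x, 0 <= f x)%R -> nnint f = 0 ->
  ae (fun x => f x = 0%R).
Proof.
move=> bf f0 fi.
have := ae_eq_integral_abs leb measurableT (borel_EFin bf).
have -> : \int[leb]_x `|(f x)%:E| = nnint f.
  by apply: eq_integral => x _; rewrite gee0_abs ?lee_fin.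
move=> [/(_ fi) + _] => /aeP; apply: aeS => x /(_ I) /=; exact: EFin_inj.
Qed.

Lemma nnint_eq_ae f g : borel_fun f -> borel_fun g -> (forall x, 0 <= f x)%R ->
  (forall x, 0 <= g x)%R -> ae (fun x => f x = g x) -> nnint f = nnint g.
Proof.
move=> bf bg f0 g0 fg; apply: ge0_ae_eq_integral.
- exact: measurableT.
- exact: borel_EFin.
- exact: borel_EFin.
- by move=> x _; rewrite lee_fin.
- by move=> x _; rewrite lee_fin.
- by apply/aeP; apply: aeS fg => x -> _.
Qed.

Definition indb (x : V) (r : R) : V -> R := \1_(ball x r).

Lemma indb_ge0 x r y : (0 <= indb x r y)%R.
Proof. by rewrite /indb indicE. Qed.

Lemma indb_le1 x r y : (indb x r y <= 1)%R.
Proof. by rewrite /indb indicE lern1 leq_b1. Qed.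

Lemma borel_indb x r : borel_fun (indb x r).
Proof. by apply: borel_indic; apply: measurable_open_borel; exact: ball_open. Qed.

Lemma indb_in x r y : ball x r y -> indb x r y = 1%R.
Proof. by move=> xy; rewrite /indb indicE mem_set. Qed.

Lemma indb_out x r y : ~ ball x r y -> indb x r y = 0%R.
Proof. by move=> xy; rewrite /indb indicE memNset. Qed.

Lemma indbP x r y : (indb x r y = 1%R /\ ball x r y) \/ (indb x r y = 0%R /\ ~ ball x r y).
Proof.
by have [xy|xy] := pselect (ball x r y); [left; rewrite indb_in|right; rewrite indb_out].
Qed.

Lemma nnint_indb x r : (0 < r)%R -> nnint (indb x r) = (leb_unit_ball (R:=R) (n:=n) * r ^+ n)%:E.
Proof.
move=> r0; rewrite nnint_indic ?leb_ball//.
by apply: measurable_open_borel; exact: ball_open.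
Qed.

Lemma L1_indb x r : L1 (indb x r).
Proof.
split; first exact: borel_indb.
rewrite (_ : (fun _ => _) = indb x r); last first.
  by apply/funext => y; rewrite ger0_norm// indb_ge0.
rewrite nnint_indic ?leb_ball_lty//.
by apply: measurable_open_borel; exact: ball_open.
Qed.

End dominated.

(** * Continuity of translations in the mean *)

Section borel_more.
Context {R : realType} {n : nat}.
Implicit Types (f : 'rV[R]_n -> R).

Lemma borelN f : borel_fun f -> borel_fun (fun x => - f x).
Proof. by move=> bf; apply: measurableT_comp. Qed.

Lemma borel_sum (I : Type) (s : seq I) (f : I -> 'rV[R]_n -> R) :
  (forall i, borel_fun (f i)) -> borel_fun (fun x => \sum_(i <- s) f i x).
Proof.
move=> bf; elim: s => [|i s IH].
  by under eq_fun do rewrite big_nil; exact: borel_cst.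
by under eq_fun do rewrite big_cons; exact: borelD.
Qed.

End borel_more.

Ltac borel := repeat (first [assumption | apply: borel_indb | apply: borel_cst |
  apply: borelM | apply: borel_norm | apply: borelB | apply: borelN | apply: borelD |
  apply: borelX | apply: borel_sum | apply: borel_shift]).

Section translation_continuity.
Context {R : realType} {n : nat}.
Local Notation V := 'rV[R]_n.
Local Notation leb := (lebesgue_vec R n).
Local Notation borelV := (@borelV R n).
Local Open Scope ereal_scope.
Implicit Types (f g : V -> R).

(* The integrals are over bounded balls, so that indicators of half-spaces qualify. *)
Definition tcont f := forall r e : R, (0 < r)%R -> (0 < e)%R -> exists2 eta : R, (0 < eta)%R &
  forall h, (`|h| < eta)%R -> nnint (fun x => indb 0 r x * `|f (x + h)%R - f x|)%R <= e%:E.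

(** Compare [f (x + h)] with [g (x + h)], then [g (x + h)] with [g x], then [g x] with [f x]. The
    approximation is asked on the ball of radius [r + 1] because it contains the translates by [h]
    of the ball of radius [r] once [h] has norm less than 1. *)
Lemma tcont_limit f : borel_fun f -> (forall r e : R, (0 < r)%R -> (0 < e)%R ->
  exists g, [/\ borel_fun g, tcont g & nnint (fun x => indb 0 r x * `|f x - g x|)%R <= e%:E]) ->
  tcont f.
Proof.
move=> bf H r e r0 e0; have e30 : (0 < e / 3)%R by rewrite divr_gt0.
have r10 : (0 < r + 1)%R by rewrite addr_gt0.
have [g [bg tg fg]] := H _ _ r10 e30.
have [eta eta0 etaP] := tg _ _ r0 e30.
exists (Num.min eta 1%R) => [|h]; first by rewrite lt_min eta0/=.
rewrite lt_min => /andP[heta h1].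
pose F1 x := (indb 0 (r + 1) x * `|f x - g x|)%R.
pose F2 x := (indb 0 r x * `|g (x + h) - g x|)%R.
have b1 : borel_fun F1 by rewrite /F1; borel.
have b2 : borel_fun F2 by rewrite /F2; borel.
have b3 := borel_shift h b1.
have F10 x : (0 <= F1 x)%R by rewrite mulr_ge0// indb_ge0.
have F20 x : (0 <= F2 x)%R by rewrite mulr_ge0// indb_ge0.
apply: (@le_trans _ _ (nnint (fun x => F1 (x + h) + (F2 x + F1 x)))%R).
  apply: le_nnint; [by borel|exact: borelD b3 (borelD b2 b1)| |].
    by move=> x; rewrite mulr_ge0// indb_ge0.
  move=> x; have [[-> /rV_ball_norm xr]|[-> _]] := indbP 0 r x; last first.
    by rewrite mul0r !addr_ge0.
  rewrite sub0r normrN in xr.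
  rewrite /F1 /F2 !indb_in ?mul1r; last 3 first.
  - by apply/rV_ball_norm; rewrite sub0r normrN (lt_trans xr)// ltrDl.
  - by apply/rV_ball_norm; rewrite sub0r normrN.
  - apply/rV_ball_norm; rewrite sub0r normrN (le_lt_trans (ler_normD _ _))//.
    exact: ltrD.
  rewrite (_ : _ - _ = (f (x + h) - g (x + h)) + ((g (x + h) - g x) - (f x - g x)))%R; last by ring.
  apply: (le_trans (ler_normD _ _)); rewrite lerD2l.
  exact: ler_normB.
rewrite nnintD; [|exact: b3|exact: borelD b2 b1|by []|by move=> x; exact: addr_ge0].
rewrite nnintD; [|exact: b2|exact: b1|exact: F20|exact: F10].
rewrite nnint_shift// (_ : e = e / 3 + (e / 3 + e / 3))%R; last by field.
rewrite !EFinD; apply: leeD => //; apply: leeD => //; exact: etaP.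
Qed.

Lemma tcont_ext f g : f =1 g -> tcont f -> tcont g.
Proof. by move=> /funext ->. Qed.

Lemma tcontD f g : borel_fun f -> borel_fun g -> tcont f -> tcont g ->
  tcont (fun x => f x + g x)%R.
Proof.
move=> bf bg tf tg r e r0 e0; have e20 : (0 < e / 2)%R by rewrite divr_gt0.
have [a a0 aP] := tf _ _ r0 e20; have [b b0 bP] := tg _ _ r0 e20.
exists (Num.min a b) => [|h]; first by rewrite lt_min a0.
rewrite lt_min => /andP[ha hb].
apply: (@le_trans _ _ (nnint (fun x => indb 0 r x * `|f (x + h) - f x| +
    indb 0 r x * `|g (x + h) - g x|)%R)).
  apply: le_nnint; [by borel|by borel| |].
    by move=> x; rewrite mulr_ge0// indb_ge0.
  move=> x; rewrite -mulrDr; apply: ler_wpM2l; first exact: indb_ge0.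
  rewrite (_ : _ - _ = (f (x + h) - f x) + (g (x + h) - g x))%R; last by ring.
  exact: ler_normD.
rewrite nnintD; [|by borel|by borel|by move=> x; rewrite mulr_ge0// indb_ge0
  |by move=> x; rewrite mulr_ge0// indb_ge0].
by rewrite (splitr e) EFinD; apply: leeD; [exact: aP|exact: bP].
Qed.

Lemma tcont_cst c : tcont (fun=> c).
Proof.
move=> r e r0 e0; exists 1%R => // h _; rewrite subrr normr0.
rewrite (_ : nnint _ = 0) ?lee_fin ?ltW//.
by rewrite /nnint; under eq_integral do rewrite mulr0; rewrite integral0.
Qed.

Lemma tcontZ c f : borel_fun f -> tcont f -> tcont (fun x => c * f x)%R.
Proof.
move=> bf tf r e r0 e0.
have c1 : (0 < `|c| + 1)%R by rewrite ltr_wpDl.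
have [a a0 aP] := tf _ _ r0 (divr_gt0 e0 c1).
exists a => // h ha.
apply: (@le_trans _ _ (nnint (fun x => (`|c| + 1) * (indb 0 r x * `|f (x + h) - f x|))%R)).
  apply: le_nnint; [by borel|by borel| |].
    by move=> x; rewrite mulr_ge0// indb_ge0.
  move=> x; rewrite -mulrBr normrM mulrCA; apply: ler_wpM2r.
    by rewrite mulr_ge0// indb_ge0.
  by rewrite lerDl.
rewrite nnintZ; [|exact: ltW|by borel|by move=> x; rewrite mulr_ge0// indb_ge0].
by rewrite -lee_pdivlMl// -EFinM mulrC; exact: aP.
Qed.

Lemma tcont_sum (N : nat) (f : nat -> V -> R) : (forall k, borel_fun (f k)) ->
  (forall k, tcont (f k)) -> tcont (fun x => \sum_(k < N) f k x)%R.
Proof.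
move=> bf tf; elim: N => [|N IH].
  by apply: tcont_ext (tcont_cst 0) => x; rewrite big_ord0.
apply: (@tcont_ext (fun x => \sum_(k < N) f k x + f N x)%R).
  by move=> x; rewrite big_ord_recr.
by apply: tcontD => //; exact: borel_sum.
Qed.

(** The indicator changes only on the slab where [x 0 i] is within [eta] of [t]; inside the ball
    this slab lies in a box of volume [2 * eta * K], and [eta] is chosen accordingly. *)
Lemma tcont_halfspace (i : 'I_n) (t : R) : tcont (\1_[set x : V | (x 0 i < t)%R]).
Proof.
move=> r e r0 e0.
pose K := (\prod_(j < n | j != i) (r + r))%R.
have K0 : (0 <= K)%R by apply: prodr_ge0 => j _; rewrite addr_ge0 ?ltW.
pose eta := (e / (2 * (K + 1)))%R.
have eta0 : (0 < eta)%R by rewrite divr_gt0// mulr_gt0// ltr_wpDl.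
exists eta => // h heta.
pose a : V := \row_j (if j == i then t - eta else - r)%R.
pose b : V := \row_j (if j == i then t + eta else r)%R.
have mbox : measurable (box a b : set borelV).
  have -> : box a b = \bigcap_(j in [set: 'I_n])
      ((fun x : borelV => (x : V) 0%R j) @^-1` `[a 0%R j, b 0%R j]%classic).
    apply/seteqP; split => x /=; first by move=> H j _ /=; rewrite in_itv/= H.
    by move=> H j; have := H j I; rewrite /= in_itv.
  apply: fin_bigcap_measurable => // j _.
  rewrite -[X in measurable X]setTI; apply: measurable_coord; first exact: measurableT.
  exact: measurable_itv.
have bE : borel_fun (\1_[set x : V | (x 0 i < t)%R]).
  by apply: borel_indic; apply: sub_sigma_algebra; exists i, t.
apply: (@le_trans _ _ (nnint (\1_(box a b)))).
  apply: le_nnint; [by borel|exact: borel_indic| |].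
    by move=> x; rewrite mulr_ge0// indb_ge0.
  move=> x; have [[-> /rV_ball_norm]|[-> _]] := indbP 0 r x; last first.
    by rewrite mul0r indicE.
  rewrite sub0r normrN mul1r => xr.
  have [xab|xab] := pselect (box a b x).
    rewrite [leRHS]indicE mem_set//= !indicE.
    by case: (_ \in _); case: (_ \in _); rewrite ?subrr ?subr0 ?sub0r ?normrN ?normr1 ?normr0.
  rewrite [leRHS]indicE memNset//= le_eqVlt; apply/orP; left.
  rewrite normr_eq0 subr_eq0 !indicE; apply/eqP; congr (_%:R); congr nat_of_bool.
  have xh : (`|h 0%R i| < eta)%R by exact: le_lt_trans (rV_norm_coord _ _) heta.
  have [xt|xt] := ltP (x 0%R i) (t - eta)%R.
    by rewrite !mem_set//= ?mxE; move: xh eta0; rewrite ltr_norml => /andP[? ?] ?; lra.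
  have [tx|tx] := ltP (t + eta)%R (x 0%R i).
    by rewrite !memNset//= ?mxE; apply/negP; rewrite -leNgt; move: xh eta0;
      rewrite ltr_norml => /andP[? ?] ?; lra.
  exfalso; apply: xab => j; rewrite !mxE; case: eqP => [->|_]; first by rewrite xt.
  by have := le_lt_trans (rV_norm_coord x j) xr; rewrite ltr_norml => /andP[/ltW-> /ltW->].
rewrite nnint_indic//; apply: (le_trans (leb_box_le _ _)).
rewrite box_volumeE; last first.
  by exists a => j; rewrite lexx !mxE /=; case: ifP => _; lra.
rewrite lee_fin (bigD1 i)//= !mxE eqxx.
under eq_bigr => j ji do rewrite !mxE (negbTE ji) opprK.
rewrite -/K (_ : t + eta - (t - eta) = 2 * eta)%R; last by ring.
rewrite /eta -mulrA mulrCA mulrA mulrAC.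
have K1 : (0 < K + 1)%R by rewrite ltr_wpDl.
rewrite (_ : e / (2 * (K + 1)) * K * 2 = e * (K / (K + 1)))%R; last first.
  by field; rewrite gt_eqF.
by rewrite ler_piMr ?(ltW e0)// ler_pdivrMr// mul1r lerDl.
Qed.

(** The Borel sets with this property form a sigma-algebra containing the half-spaces: the increment
    of the indicator of a union of two sets is at most the sum of their increments, and countable
    unions follow from finite ones by dominated convergence and [tcont_limit]. *)
Lemma tcont_indic (E : set V) : measurable (E : set borelV) -> tcont (\1_E).
Proof.
move=> mE; suff [] : measurable (E : set borelV) /\ tcont (\1_E) by [].
pose C : set (set V) := [set A | measurable (A : set borelV) /\ tcont (\1_A)].
suff : <<s halfspaces >> `<=` C by move=> /(_ E mE).
apply: smallest_sub; last first.
  move=> _ [i [t ->]]; split; last exact: tcont_halfspace.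
  by apply: sub_sigma_algebra; exists i, t.
split.
- split; first exact: measurable0.
  by apply: tcont_ext (tcont_cst 0) => x; rewrite indic0.
- move=> A [mA tA]; rewrite setTD; split; first exact: measurableC.
  move=> r e r0 e0; have [a a0 aP] := tA _ _ r0 e0; exists a => // h /aP.
  rewrite (_ : (fun x => indb 0 r x * `|\1_(~` A) (x + h) - \1_(~` A) x|)%R =
    (fun x => indb 0 r x * `|\1_A (x + h) - \1_A x|)%R)//.
  apply/funext => x; congr (_ * _)%R; rewrite !indicE !in_setC.
  by case: (_ \in _); case: (_ \in _); rewrite ?subrr ?subr0 ?sub0r ?normrN.
- move=> A mtA.
  have mA k : measurable (A k : set borelV) by have [] := mtA k.
  split; first exact: bigcupT_measurable.
  pose B N := \big[setU/set0]_(k < N) A k.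
  have mB N : measurable (B N : set borelV) by apply: bigsetU_measurable.
  have tB N : tcont (\1_(B N)).
    elim: N => [|N IH].
      by apply: tcont_ext (tcont_cst 0) => x; rewrite /B big_ord0 indic0.
    move=> r e r0 e0; have e20 : (0 < e / 2)%R by rewrite divr_gt0.
    have [a a0 aP] := IH _ _ r0 e20; have [b b0 bP] := (mtA N).2 _ _ r0 e20.
    exists (Num.min a b) => [|h]; first by rewrite lt_min a0.
    rewrite lt_min => /andP[/aP{}ha /bP{}hb].
    have bI (D : set V) : measurable (D : set borelV) -> borel_fun (\1_D) by exact: borel_indic.
    have bA := bI _ (mA N); have bB := bI _ (mB N); have bB1 := bI _ (mB N.+1).
    apply: (@le_trans _ _ (nnint (fun x => indb 0 r x * `|\1_(B N) (x + h) - \1_(B N) x| +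
       indb 0 r x * `|\1_(A N) (x + h) - \1_(A N) x|)%R)).
      apply: le_nnint; [by borel|by borel| |].
        by move=> x; rewrite mulr_ge0// indb_ge0.
      move=> x; rewrite -mulrDr; apply: ler_wpM2l; first exact: indb_ge0.
      rewrite /B big_ord_recr/= -/(B N) !indicE !in_setU.
      by do 4 (case: (_ \in _)); rewrite /= ?subrr ?subr0 ?sub0r ?normrN ?normr1 ?normr0; lra.
    rewrite nnintD; [|by borel|by borel|by move=> x; rewrite mulr_ge0// indb_ge0
      |by move=> x; rewrite mulr_ge0// indb_ge0].
    by rewrite (splitr e) EFinD; exact: leeD.
  apply: tcont_limit; first by apply: borel_indic; exact: bigcupT_measurable.
  move=> r e r0 e0.
  pose D : V -> R := \1_(\bigcup_k A k).
  have bD : borel_fun D by apply: borel_indic; exact: bigcupT_measurable.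
  have bB N : borel_fun (\1_(B N)) by exact: borel_indic.
  have [|||N NP] := @nnint_dominated _ _ (fun N x => indb 0 r x * `|D x - \1_(B N) x|)%R
    (indb 0 r) _ _ (L1_indb _ _) _ _ e0.
  + move=> N; by borel.
  + move=> N x; rewrite mulr_ge0 ?indb_ge0//= ler_piMr ?indb_ge0//.
    by rewrite /D !indicE; case: (_ \in _); case: (_ \in _); rewrite /= ?subrr ?subr0 ?sub0r ?normrN ?normr1 ?normr0 ?lexx ?ler01.
  + apply: aeT => x.
    suff [N0 N0P] : exists N0, forall N, (N0 <= N)%N -> D x = \1_(B N) x.
      apply/cvgrPdist_le => d d0; exists N0 => // N /= N0N.
      by rewrite -N0P// subrr normr0 mulr0 subrr normr0 ltW.
    have [[k _ Akx]|nA] := pselect ((\bigcup_k A k) x).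
      exists k.+1 => N kN; rewrite /D !indicE !mem_set//; last by exists k.
      by rewrite /B -bigcup_mkord; exists k.
    exists 0%N => N _; rewrite /D !indicE !memNset// /B -bigcup_mkord.
    by move=> [k _ Akx]; apply: nA; exists k.
  by exists (\1_(B N)); split => //; exact: NP.
Qed.

Lemma measurable_ge_borel f c : borel_fun f -> measurable ([set x | (c <= f x)%R] : set borelV).
Proof.
move=> bf; have := bf measurableT _ (measurable_itv `[c, +oo[).
by rewrite setTI; congr measurable; apply/seteqP; split => x /=; rewrite in_itv/= andbT.
Qed.

Lemma measurable_lt_borel f c : borel_fun f -> measurable ([set x | (f x < c)%R] : set borelV).
Proof.
move=> bf; have := bf measurableT _ (measurable_itv `]-oo, c[).
by rewrite setTI; congr measurable; apply/seteqP; split => x /=; rewrite in_itv/=.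
Qed.

(** The sum counts the positive integers up to [y], hence is the integer part of [y]. *)
Lemma layer_sum_approx (y : R) (K : nat) : (0 <= y <= K%:R)%R ->
  (`|y - \sum_(j < K) (j.+1%:R <= y)%R%:R| <= 1)%R.
Proof.
move=> /andP[y0 yK].
suff [H1 H2] : (\sum_(j < K) (j.+1%:R <= y)%R%:R <= y)%R /\
    ((y <= K%:R)%R -> (y <= \sum_(j < K) (j.+1%:R <= y)%R%:R + 1)%R).
  by have := H2 yK; rewrite ler_norml => H3; apply/andP; split; lra.
suff [H1 [H2 _]] : (\sum_(j < K) (j.+1%:R <= y)%R%:R <= y)%R /\
    ((y <= K%:R)%R -> (y <= \sum_(j < K) (j.+1%:R <= y)%R%:R + 1)%R) /\
    ((K%:R <= y)%R -> (\sum_(j < K) (j.+1%:R <= y)%R%:R = K%:R :> R)%R) by [].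
elim: K {yK} => [|K [IH1 [IH2 IH3]]].
  by rewrite big_ord0; split => //; split => // ?; lra.
rewrite big_ord_recr/=; case: (leP K.+1%:R y) => Ky.
  have Ky' : (K%:R <= y)%R by rewrite (le_trans _ Ky)// ler_nat.
  by rewrite (IH3 Ky') natr1; split => //; split => // ?; lra.
rewrite addr0; split => //; split => // _.
have [/IH2//|/ltW/IH3->] := leP y K%:R.
by rewrite natr1 ltW.
Qed.

(** After adding [M] the function is nonnegative and is uniformly within [m.+1%:R^-1] of a finite
    combination of indicators of its superlevel sets, by [layer_sum_approx] applied to
    [m.+1%:R * g x]. *)
Lemma tcont_bounded f (M : R) : borel_fun f -> (forall x, `|f x| <= M)%R -> tcont f.
Proof.
move=> bf fM; apply: (@tcont_ext (fun x => (f x + M) + (- M))%R).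
  by move=> x; rewrite addrK.
have M0 : (0 <= M)%R := le_trans (normr_ge0 _) (fM 0%R).
have bg : borel_fun (fun x => f x + M)%R by borel.
apply: tcontD => //; [by borel| |exact: tcont_cst].
apply: tcont_limit => // r e r0 e0.
set g := (fun x => f x + M)%R.
have g0 x : (0 <= g x <= 2 * M)%R.
  by have := fM x; rewrite ler_norml /g => /andP[? ?]; apply/andP; split; lra.
have [m mP] : exists m : nat, (fine (leb (ball (0%R : V) r)) / e < m.+1%:R)%R.
  by eexists; exact: truncnS_gt.
pose K := (Num.trunc (m.+1%:R * (2 * M))).+1.
pose h (x : V) : R := (m.+1%:R^-1 * \sum_(j < K) \1_[set x | (j.+1%:R <= m.+1%:R * g x)] x)%R.
have bj j : borel_fun (\1_[set x | (j.+1%:R <= m.+1%:R * g x)%R]).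
  by apply: borel_indic; apply: measurable_ge_borel; rewrite /g; borel.
have bh : borel_fun h by rewrite /h; borel => j; exact: bj.
exists h; split => //.
  apply: tcontZ; first by borel => j; exact: bj.
  apply: (@tcont_sum _ (fun j => \1_[set x | (j.+1%:R <= m.+1%:R * g x)%R])) => // j.
  by apply: tcont_indic; apply: measurable_ge_borel; rewrite /g; borel.
apply: (@le_trans _ _ (nnint (fun x => m.+1%:R^-1 * indb 0 r x)%R)).
  apply: le_nnint; [by borel|by borel| |].
    by move=> x; rewrite mulr_ge0// indb_ge0.
  move=> x; rewrite mulrC; apply: ler_wpM2r; first exact: indb_ge0.
  rewrite -(ler_pM2l (ltr0Sn R m)) divff// -[X in (X * _)%R]ger0_norm// -normrM.
  rewrite mulrBr /h mulrA divff// mul1r.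
  under eq_bigr do rewrite indicE.
  rewrite (_ : (\sum_(j < K) _) = \sum_(j < K) (j.+1%:R <= m.+1%:R * g x)%R%:R :> R)%R.
    apply: layer_sum_approx; have /andP[? ?] := g0 x; rewrite mulr_ge0//=.
    by apply: (@le_trans _ _ (m.+1%:R * (2 * M))%R); [rewrite ler_pM2l|exact/ltW/truncnS_gt].
  apply: eq_bigr => j _; congr (_%:R); congr nat_of_bool.
  by apply/idP/idP; rewrite inE.
rewrite nnintZ; [|by rewrite invr_ge0|exact: borel_indb|by move=> x; exact: indb_ge0].
rewrite nnint_indic; last by apply: measurable_open_borel; exact: ball_open.
rewrite -(@fineK _ (leb (ball (0%R : V) r))); last first.
  by rewrite ge0_fin_numE// leb_ball_lty.
rewrite -EFinM lee_fin ler_pdivrMl//.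
by move: mP; rewrite ltr_pdivrMr// => /ltW.
Qed.

Definition L1loc f := borel_fun f /\ forall r, L1 (fun x => indb 0 r x * f x)%R.

(** Setting [f] to 0 where its modulus is at least [N] gives bounded functions converging to [f] in
    L1 on every ball. *)
Lemma tcont_L1loc f : L1loc f -> tcont f.
Proof.
move=> [bf fi]; apply: tcont_limit => // r e r0 e0.
pose f_ (N : nat) x := (f x * \1_[set x | `|f x| < N%:R] x)%R.
have bN N : borel_fun (f_ N).
  by rewrite /f_; borel; apply: borel_indic; apply: measurable_lt_borel; borel.
have [||||N NP] := @nnint_dominated _ _ (fun N x => indb 0 r x * `|f x - f_ N x|)%R
    (fun x => `|indb 0 r x * f x|)%R _ _ _ _ _ e0.
- by move=> N; have bfN := bN N; borel.
- move=> N x; rewrite mulr_ge0 ?indb_ge0//= normrM (ger0_norm (indb_ge0 _ _ _)).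
  rewrite ler_wpM2l ?indb_ge0// /f_ indicE; case: (_ \in _); rewrite ?mulr1 ?mulr0 ?subr0//.
  by rewrite subrr normr0.
- split; first by borel.
  by under eq_fun do rewrite normr_id; exact: (proj2 (fi r)).
- apply: aeT => x; apply/cvgrPdist_le => d d0.
  exists (Num.trunc `|f x|).+1 => // N /= xN.
  rewrite /f_ indicE mem_set/= ?mulr1 ?subrr ?normr0 ?mulr0 ?subrr ?normr0 ?ltW//.
  by rewrite (lt_le_trans (truncnS_gt _))// ler_nat.
exists (f_ N); split => //; last exact: NP.
apply: (@tcont_bounded _ N%:R) => // x.
rewrite /f_ indicE; have [xN|xN] := ltP `|f x|%R N%:R.
  by rewrite mem_set//= mulr1 ltW.
by rewrite memNset/= ?mulr0 ?normr0//; apply/negP; rewrite -leNgt.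
Qed.

End translation_continuity.

(** * Smooth functions and convolutions *)

Section calculus.
Context {R : realType} {n : nat}.
Local Notation V := 'rV[R]_n.
Implicit Types (f u phi psi : V -> R) (x v h : V).
Local Notation e_ i := (delta_mx 0 i : V).

Lemma is_derive_line f x v (t d : R) :
  is_derive t (1 : R) (fun s : R => f (x + s *: v)) d <-> is_derive (x + t *: v) v f d.
Proof.
have E : (fun h : R => h^-1 *: (((fun s : R => f (x + s *: v)) \o shift t) (h *: (1 : R)) -
    f (x + t *: v))) =
  (fun h : R => h^-1 *: ((f \o shift (x + t *: v)) (h *: v) - f (x + t *: v))).
  apply/funext => h /=; congr (_ *: (f _ - _)).
  by rewrite scalerDl addrCA [_ *: 1]mulr1.
by split=> -[H1 H2]; split; move: H1 H2; rewrite /derivable /derive E.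
Qed.

Lemma is_derive_comp1 (g : R -> R) u x v (dg du : R) :
  is_derive (u x) (1 : R) g dg -> is_derive x v u du ->
  is_derive x v (fun y => g (u y)) (dg * du).
Proof.
move=> Hg Hu; have E : x + 0 *: v = x by rewrite scale0r addr0.
rewrite -E; apply/is_derive_line; apply: (@is_derive1_comp R g (fun s : R => u (x + s *: v))).
  by rewrite E.
by apply/is_derive_line; rewrite E.
Qed.

Lemma is_derive_continuous (g : R -> R) (t d : R) : is_derive t (1 : R) g d -> {for t, continuous g}.
Proof. by move=> [H _]; apply: differentiable_continuous; exact/derivable1_diffP. Qed.

Lemma is_derive_scale (W : normedModType R) (c : R) (f : W -> R) (x v : W) (d : R) :
  is_derive x v f d -> is_derive x v (fun y => c * f y) (c * d).
Proof.
move=> H; have := is_deriveM (is_derive_cst c x v) H.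
by rewrite scaler0 addr0.
Qed.

(** A coinduction principle: a class of continuous functions that is closed under partial
    derivatives contains all iterated derivatives of its members. *)
Lemma smooth_class (P : (V -> R) -> Prop) :
  (forall phi, P phi -> continuous phi) ->
  (forall phi, P phi -> forall i, exists2 psi, P psi & forall x, is_derive x (e_ i) phi (psi x)) ->
  forall phi, P phi -> smooth phi.
Proof.
move=> Pc Pd phi Pphi s.
have Ps : P (iter_partial s phi).
  elim: s => //= i s /Pd/(_ i)[psi Ppsi H].
  rewrite (_ : partial i _ = psi)//; apply/funext => x; rewrite /partial.
  by have [_ ->] := H x.
split; first exact: Pc.
by move=> i x; have [psi _ H] := Pd _ Ps i; have [] := H x.
Qed.

Lemma smooth_continuous phi : smooth phi -> continuous phi.
Proof. by move=> /(_ [::])[]. Qed.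

Lemma smooth_is_derive phi i x : smooth phi -> is_derive x (e_ i) phi (partial i phi x).
Proof. by move=> /(_ [::])[_ H]; split => //; exact: (H i x). Qed.

Lemma smooth_partial phi i : smooth phi -> smooth (partial i phi).
Proof. by move=> sphi s; have := sphi (rcons s i); rewrite /iter_partial foldr_rcons. Qed.

Lemma partial_eq phi i x d : is_derive x (e_ i) phi d -> partial i phi x = d.
Proof. by move=> [_ <-]. Qed.

(* Infinitely differentiable: [g] belongs to some class of functions stable under derivation. *)
Definition smooth1 (g : R -> R) := exists2 P : (R -> R) -> Prop, P g &
  forall k, P k -> exists2 k', P k' & forall t, is_derive t (1 : R) k (k' t).

Lemma smooth1_derive g : smooth1 g ->
  exists2 g', smooth1 g' & forall t, is_derive t (1 : R) g (g' t).
Proof. by move=> [P Pg H]; have [g' Pg' dg] := H _ Pg; exists g' => //; exists P. Qed.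

Lemma smooth1_continuous g : smooth1 g -> continuous g.
Proof. by move=> /smooth1_derive[g' _ dg] t; exact: is_derive_continuous (dg t). Qed.

(** The chain and product rules do not leave this class, so [smooth_class] applies to it and yields
    at once the stability of smooth functions under sums, products and composition with [smooth1]
    functions. *)
Inductive smooth_alg : (V -> R) -> Prop :=
| SmoothAlg_smooth phi of smooth phi : smooth_alg phi
| SmoothAlg_comp g u of smooth1 g & smooth u : smooth_alg (fun x => g (u x))
| SmoothAlg_add phi psi of smooth_alg phi & smooth_alg psi : smooth_alg (fun x => phi x + psi x)
| SmoothAlg_mul phi psi of smooth_alg phi & smooth_alg psi : smooth_alg (fun x => phi x * psi x).

Lemma smooth_alg_smooth phi : smooth_alg phi -> smooth phi.
Proof.
apply: smooth_class => {phi} phi.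
  elim=> [{}phi /smooth_continuous//|g u sg su x|{}phi psi _ c1 _ c2 x|{}phi psi _ c1 _ c2 x].
  - by apply: continuous_comp; [exact: smooth_continuous|exact: smooth1_continuous].
  - exact: (continuousD (c1 x) (c2 x)).
  - exact: (continuousM (c1 x) (c2 x)).
elim=> [{}phi sphi i|g u sg su i|{}phi psi a1 c1 a2 c2 i|{}phi psi a1 c1 a2 c2 i].
- exists (partial i phi); last by move=> x; exact: smooth_is_derive.
  by apply: SmoothAlg_smooth; exact: smooth_partial.
- have [g' sg' dg] := smooth1_derive sg.
  exists (fun x => g' (u x) * partial i u x).
    apply: SmoothAlg_mul; first exact: SmoothAlg_comp.
    by apply: SmoothAlg_smooth; exact: smooth_partial.
  by move=> x; apply: is_derive_comp1 => //; exact: smooth_is_derive.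
- have [p1 s1 d1] := c1 i; have [p2 s2 d2] := c2 i.
  exists (fun x => p1 x + p2 x); first exact: SmoothAlg_add.
  by move=> x; exact: is_deriveD.
- have [p1 s1 d1] := c1 i; have [p2 s2 d2] := c2 i.
  exists (fun x => phi x * p2 x + psi x * p1 x); last by move=> x; exact: is_deriveM.
  by apply: SmoothAlg_add; exact: SmoothAlg_mul.
Qed.

Lemma smoothD phi psi : smooth phi -> smooth psi -> smooth (fun x => phi x + psi x).
Proof. by move=> s1 s2; apply/smooth_alg_smooth/SmoothAlg_add; exact: SmoothAlg_smooth. Qed.

Lemma smoothM phi psi : smooth phi -> smooth psi -> smooth (fun x => phi x * psi x).
Proof. by move=> s1 s2; apply/smooth_alg_smooth/SmoothAlg_mul; exact: SmoothAlg_smooth. Qed.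

Lemma smooth_comp g u : smooth1 g -> smooth u -> smooth (fun x => g (u x)).
Proof. by move=> s1 s2; apply/smooth_alg_smooth/SmoothAlg_comp. Qed.

Lemma smooth_cst (c : R) : smooth (fun _ : V => c).
Proof.
apply: (@smooth_class (fun phi => exists c : R, phi = fun=> c)); last by exists c.
- by move=> phi [d ->] x; exact: cst_continuous.
- move=> phi [d ->] i; exists (fun=> 0); first by exists 0.
  by move=> x; exact: is_derive_cst.
Qed.

Lemma smoothZ c phi : smooth phi -> smooth (fun x => c * phi x).
Proof. by move=> sphi; exact: smoothM (smooth_cst c) sphi. Qed.

Lemma smoothN phi : smooth phi -> smooth (fun x => - phi x).
Proof.
by move=> /(smoothZ (-1)); congr smooth; apply/funext => x; rewrite mulN1r.
Qed.

Lemma smoothB phi psi : smooth phi -> smooth psi -> smooth (fun x => phi x - psi x).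
Proof. by move=> s1 s2; exact: smoothD s1 (smoothN s2). Qed.

Lemma smooth_prod (I : Type) (s : seq I) (F : I -> V -> R) :
  (forall i, smooth (F i)) -> smooth (fun x => \prod_(i <- s) F i x).
Proof.
move=> sF; elim: s => [|i s IH].
  by under eq_fun do rewrite big_nil; exact: smooth_cst.
by under eq_fun do rewrite big_cons; exact: smoothM.
Qed.

Lemma continuous_coord i : continuous (fun x : V => x 0 i).
Proof. exact: coord_continuous. Qed.

Lemma smooth_coord i : smooth (fun x => x 0 i).
Proof.
apply: (@smooth_class (fun phi => (exists c : R, phi = fun=> c) \/ phi = fun x => x 0 i)).
- by move=> phi [[c ->] x|-> x]; [exact: cst_continuous|exact: continuous_coord].
- move=> phi [[c ->]|->] j.
    exists (fun=> 0); first by left; exists 0.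
    by move=> x; exact: is_derive_cst.
  exists (fun=> (j == i)%:R); first by left; eexists.
  move=> x; have := @is_derive_line (fun x => x 0 i) x (e_ j) 0 (j == i)%:R.
  rewrite scale0r addr0 => -[+ _]; apply.
  rewrite (_ : (fun s : R => _) = (fun s : R => x 0 i + (j == i)%:R * s)); last first.
    by apply/funext => s; rewrite !mxE eqxx/= eq_sym mulrC.
  have H := @is_derive_scale R^o (j == i)%:R id 0 1 1 (is_derive_id _ _).
  have := is_deriveD (is_derive_cst (x 0 i : R) (0 : R^o) 1) H.
  by rewrite add0r mulr1.
- by right.
Qed.

Lemma is_derive_affine phi (s : R) (a : V) v x d : is_derive (s *: x + a) v phi d ->
  is_derive x v (fun y => phi (s *: y + a)) (s * d).
Proof.
move=> H; have := @is_derive_line (fun y => phi (s *: y + a)) x v 0 (s * d).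
rewrite scale0r addr0 => -[+ _]; apply.
have H' : is_derive (s * 0) (1 : R) (fun t : R => phi (s *: x + a + t *: v)) d.
  by apply/is_derive_line; rewrite mulr0 scale0r addr0.
rewrite (_ : (fun t : R => _) = (fun t : R => phi (s *: x + a + t *: v)) \o (fun t => s * t)).
  rewrite mulrC; apply: is_derive1_comp => //.
  have := @is_derive_scale R^o s id 0 1 1 (is_derive_id _ _).
  by rewrite mulr1.
by apply/funext => t /=; rewrite scalerDr scalerA addrAC.
Qed.

Lemma smooth_affine phi (s : R) (a : V) : smooth phi -> smooth (fun x => phi (s *: x + a)).
Proof.
move=> sphi.
apply: (@smooth_class (fun f => exists c psi, smooth psi /\ f = fun x => c * psi (s *: x + a))).
- move=> _ [c [psi [spsi ->]]] x; apply: continuousM; first exact: cst_continuous.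
  apply: (@continuous_comp _ _ _ (fun x => s *: x + a) psi); last exact: smooth_continuous.
  by apply: continuousD; [exact: scaler_continuous|exact: cst_continuous].
- move=> _ [c [psi [spsi ->]]] i.
  exists (fun x => c * s * partial i psi (s *: x + a)).
    by exists (c * s), (partial i psi); split; [exact: smooth_partial|by []].
  move=> x; have H := is_derive_affine (smooth_is_derive i (s *: x + a) spsi).
  by rewrite -mulrA; exact: is_derive_scale.
- by exists 1, phi; split => //; apply/funext => x; rewrite mul1r.
Qed.

Lemma partial_affine phi (s : R) (a : V) i x : smooth phi ->
  partial i (fun y => phi (s *: y + a)) x = s * partial i phi (s *: x + a).
Proof.
by move=> sphi; apply: partial_eq; apply: is_derive_affine; exact: smooth_is_derive.
Qed.

Lemma partialM phi psi i x : smooth phi -> smooth psi ->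
  partial i (fun y => phi y * psi y) x = phi x * partial i psi x + psi x * partial i phi x.
Proof.
move=> s1 s2; apply: partial_eq.
by apply: is_deriveM; exact: smooth_is_derive.
Qed.

Lemma partial_comp g (dg : R -> R) u i x : (forall t, is_derive t (1 : R) g (dg t)) -> smooth u ->
  partial i (fun y => g (u y)) x = dg (u x) * partial i u x.
Proof.
by move=> Hg su; apply: partial_eq; apply: is_derive_comp1 => //; exact: smooth_is_derive.
Qed.

Lemma mean_value (L L' : R -> R) (a b : R) : (forall s, is_derive s (1 : R) L (L' s)) ->
  exists c, `|c - a| <= `|b - a| /\ L b - L a = L' c * (b - a).
Proof.
move=> dL.
have cL : forall A : set R, {within A, continuous L}.
  by move=> A; apply: continuous_subspaceT => s; exact: is_derive_continuous (dL s).
have [ab|ba] := leP a b.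
  have [c + Ec] := MVT_segment ab (fun s _ => dL s) (cL _).
  rewrite in_itv/= => /andP[ac cb]; exists c; split => //.
  by rewrite !ger0_norm ?subr_ge0// lerD2r.
have [c + Ec] := MVT_segment (ltW ba) (fun s _ => dL s) (cL _).
rewrite in_itv/= => /andP[bc ca]; exists c; split.
  by rewrite !ler0_norm ?subr_le0 ?(ltW ba)// lerN2 lerD2r.
by apply: oppr_inj; rewrite opprB Ec -mulrN opprB.
Qed.

(** The vertices of the staircase path from 0 to [h], one coordinate direction at a time. Increments
    of [f] are split along it so that only partial derivatives are ever used. *)
Definition axis_prefix h (k : nat) : V := \row_j (if (j < k)%N then h 0 j else 0).

Lemma axis_prefix0 h : axis_prefix h 0 = 0.
Proof. by apply/rowP => j; rewrite !mxE. Qed.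

Lemma axis_prefix_full h : axis_prefix h n = h.
Proof. by apply/rowP => j; rewrite !mxE ltn_ord. Qed.

Lemma axis_prefixS h (k : 'I_n) : axis_prefix h k.+1 = axis_prefix h k + h 0 k *: e_ k.
Proof.
apply/rowP => j; rewrite !mxE eqxx/= ltnS leq_eqVlt val_eqE eq_sym.
have [->|jk] := eqVneq k j; first by rewrite ltnn add0r mulr1.
by rewrite mulr0 addr0.
Qed.

Lemma axis_telescope f x h :
  f (x + h) - f x = \sum_(k < n) (f (x + axis_prefix h k + h 0 k *: e_ k) - f (x + axis_prefix h k)).
Proof.
rewrite (eq_bigr (fun k : 'I_n => f (x + axis_prefix h k.+1) - f (x + axis_prefix h k))).
  rewrite -(big_mkord xpredT (fun k => f (x + axis_prefix h k.+1) - f (x + axis_prefix h k))).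
  by rewrite (telescope_sumr (fun k => f (x + axis_prefix h k)))// axis_prefix0 axis_prefix_full addr0.
by move=> k _; rewrite axis_prefixS addrA.
Qed.

Lemma axis_lipschitz f i (M : R) x (t : R) :
  (forall y, is_derive y (e_ i) f (partial i f y)) -> (forall y, `|partial i f y| <= M) ->
  `|f (x + t *: e_ i) - f x| <= M * `|t|.
Proof.
move=> df fM.
have [|c [_]] := @mean_value (fun s => f (x + s *: e_ i)) (fun s => partial i f (x + s *: e_ i)) 0 t.
  by move=> s; apply/is_derive_line.
rewrite scale0r addr0 subr0 => ->; rewrite normrM ler_wpM2r//.
Qed.

Lemma smooth_lipschitz f (M : R) x h : smooth f -> (forall i y, `|partial i f y| <= M) ->
  `|f (x + h) - f x| <= n%:R * M * `|h|.
Proof.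
move=> sf fM; rewrite axis_telescope.
apply: (le_trans (ler_norm_sum _ _ _)).
apply: (@le_trans _ _ (\sum_(k < n) M * `|h|)); last first.
  by rewrite sumr_const card_ord -mulrA mulr_natl.
apply: ler_sum => k _; apply: (le_trans (axis_lipschitz (M := M) _ _ _ _)) => //.
  by move=> y; exact: smooth_is_derive.
apply: ler_wpM2l; last exact: rV_norm_coord.
exact: le_trans (normr_ge0 _) (fM k 0).
Qed.

(** The mean value theorem, applied to [f] and then to its partial derivative; the constant is not
    halved. *)
Lemma axis_taylor f i (M : R) x (t : R) : smooth f ->
  (forall y, `|partial i (partial i f) y| <= M) ->
  `|f (x + t *: e_ i) - f x - t * partial i f x| <= M * t ^+ 2.
Proof.
move=> sf fM.
have [|c [ct]] := @mean_value (fun s => f (x + s *: e_ i)) (fun s => partial i f (x + s *: e_ i)) 0 t.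
  by move=> s; apply/is_derive_line; exact: smooth_is_derive.
rewrite scale0r addr0 subr0 => ->; rewrite subr0 in ct.
rewrite mulrC -mulrBr normrM -(real_normK (num_real t)) expr2 mulrCA.
apply: ler_wpM2l => //.
apply: (le_trans (axis_lipschitz (M := M) _ _ _ _)) => //.
  by move=> y; apply: smooth_is_derive; exact: smooth_partial.
apply: ler_wpM2l; last by rewrite subr0 in ct.
exact: le_trans (normr_ge0 _) (fM 0).
Qed.

End calculus.

(** * Flat functions and smooth truncations *)

Section special_functions.
Context {R : realType}.
Implicit Types (p : {poly R}) (t s : R).

Definition exp_inv p t : R := if 0 < t then p.[t^-1] * expR (- t^-1) else 0.

(** Termwise, since [s ^ i] is at most [i!] times [expR s] for nonnegative [s]. *)
Lemma poly_exp_bounded p : exists2 C : R, 0 <= C & forall s, 0 <= s -> `|p.[s]| * expR (- s) <= C.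
Proof.
exists (\sum_(i < size p) `|p`_i| * (i`!)%:R).
  by apply: sumr_ge0 => i _; rewrite mulr_ge0.
move=> s s0; rewrite expRN ler_pdivrMr ?expR_gt0// horner_coef mulr_suml.
apply: (le_trans (ler_norm_sum _ _ _)); apply: ler_sum => i _.
rewrite normrM normrX (ger0_norm s0) -mulrA ler_wpM2l//.
case: (nat_of_ord i) => [|k].
  by rewrite expr0 fact0 mul1r; have := expR_ge1Dx s; lra.
rewrite mulrC -ler_pdivrMr ?ltr0n ?fact_gt0//.
by have := expR_ge1Dxn k s0; lra.
Qed.

Lemma exp_inv_bounded p : exists2 C : R, 0 <= C & forall t, `|exp_inv p t| <= C.
Proof.
have [C C0 CP] := poly_exp_bounded p; exists C => // t; rewrite /exp_inv.
case: ifPn => [t0|_]; last by rewrite normr0.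
by rewrite normrM (ger0_norm (expR_ge0 _)) CP// invr_ge0 ltW.
Qed.

Lemma is_derive_exp_inv p t :
  is_derive t (1 : R) (exp_inv p) (exp_inv ((p - deriv p) * 'X^2) t).
Proof.
have [t0|] := ltP 0 t.
  apply: (@near_eq_is_derive _ R^o R^o (fun t => p.[t^-1] * expR (- t^-1))).
    near=> u; rewrite /exp_inv; have -> // : 0 < u.
    by near: u; exact: lt_nbhsr.
  have dV : is_derive t (1 : R) (fun u : R => u^-1) (- t^-2).
    have tn0 : id t != 0 by rewrite gt_eqF.
    have := is_deriveV tn0 (is_derive_id t (1 : R)).
    by move=> /is_derive_eq; apply; rewrite [LHS]mulr1.
  have d1 : is_derive t (1 : R) (fun u : R => p.[u^-1]) (p^`().[t^-1] * - t^-2).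
    by apply: is_derive1_comp; apply: is_derive_poly.
  have d2 : is_derive t (1 : R) (fun u : R => expR (- u^-1)) (expR (- t^-1) * t^-2).
    apply: (@is_derive1_comp R expR (fun u => - u^-1)).
    by move: (is_deriveN dV) => /is_derive_eq; apply; rewrite opprK.
  move: (is_deriveM d1 d2) => /is_derive_eq; apply.
  rewrite /exp_inv t0 hornerM hornerXn hornerD hornerN /GRing.scale/= -exprVn.
  ring.
rewrite le_eqVlt => /orP[/eqP->|t0]; last first.
  apply: (@near_eq_is_derive _ R^o R^o (fun t => 0)).
    near=> u; rewrite /exp_inv; case: ifPn => // u0; exfalso.
    have : u < 0 by near: u; exact: lt_nbhsl.
    by rewrite ltNge ltW.
  by rewrite /exp_inv ltNge (ltW t0)/=; exact: is_derive_cst.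
(* At 0 the difference quotient is [h] times the value at [h^-1] of [(p * 'X^2) * exp (-s)], hence
   at most [C * h]. *)
have [C C0 CP] := poly_exp_bounded (p * 'X^2).
have H : (fun h : R => h^-1 *: ((exp_inv p \o shift 0) (h *: (1 : R)) - exp_inv p 0))
    @ 0^' --> (0 : R).
  apply/cvgrPdist_le => e e0.
  have d0 : 0 < e / (C + 1) by rewrite divr_gt0// ltr_wpDl.
  near=> h; rewrite sub0r normrN /= addr0 [h *: 1]mulr1 /exp_inv ltxx subr0.
  case: ifPn => [h0|_]; last by rewrite scaler0 normr0 ltW.
  have hd : h < e / (C + 1).
    have : `|h| < e / (C + 1) by near: h; apply: dnbhs0_lt.
    by rewrite gtr0_norm.
  have := CP h^-1; rewrite invr_ge0 (ltW h0) => /(_ isT).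
  rewrite hornerM hornerXn normrM (ger0_norm (exprn_ge0 _ _)) ?invr_ge0 ?(ltW h0)// => Hh.
  rewrite [X in `|X|](_ : _ = h^-1 * (p.[h^-1] * expR (- h^-1)))// !normrM.
  rewrite (ger0_norm (expR_ge0 _)) (gtr0_norm (_ : 0 < h^-1)) ?invr_gt0//.
  rewrite (_ : _ * _ = h * (`|p.[h^-1]| * h^-1 ^+ 2 * expR (- h^-1))); last first.
    by field; rewrite gt_eqF.
  apply: (@le_trans _ _ (h * C)); first by rewrite ler_wpM2l ?(ltW h0).
  apply: (@le_trans _ _ (h * (C + 1))); first by rewrite ler_wpM2l ?(ltW h0)// lerDl.
  by rewrite -ler_pdivlMr ?ltr_wpDl// ltW.
have -> : exp_inv ((p - p^`()) * 'X^2) 0 = 0 by rewrite /exp_inv ltxx.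
by split; [apply/cvg_ex; exists 0|exact/cvg_lim].
Unshelve. all: end_near. Qed.

Lemma smooth1_exp_inv p : smooth1 (exp_inv p).
Proof.
exists (fun f => exists p, f = exp_inv p); first by exists p.
move=> _ [q ->]; exists (exp_inv ((q - q^`()) * 'X^2)); first by eexists.
by move=> t; exact: is_derive_exp_inv.
Qed.

Definition pexp t : R := exp_inv 1 t.

Lemma pexp_le0 t : t <= 0 -> pexp t = 0.
Proof. by rewrite /pexp /exp_inv leNgt => /negbTE->. Qed.

Lemma pexp_gt0 t : 0 < t -> 0 < pexp t.
Proof. by rewrite /pexp /exp_inv => ->; rewrite hornerC mul1r expR_gt0. Qed.

Lemma pexp_ge0 t : 0 <= pexp t.
Proof. by have [/pexp_gt0/ltW//|/pexp_le0->] := ltP 0 t. Qed.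

Lemma pexp_le s t : s <= t -> pexp s <= pexp t.
Proof.
move=> st; have [s0|s0] := ltP 0 s; last by rewrite (pexp_le0 s0) pexp_ge0.
have t0 := lt_le_trans s0 st.
by rewrite /pexp /exp_inv s0 t0 !hornerC !mul1r ler_expR lerN2 lef_pV2.
Qed.

(** The Lipschitz bound on [dg] is there to compare [dg] of a mollification of [u] with [dg (u x)];
    a single constant [M] serves the three bounds. *)
Definition bounded_derivatives (g dg : R -> R) := [/\ smooth1 g, smooth1 dg,
  forall t, is_derive t (1 : R) g (dg t) &
  exists M : R, forall s t, [/\ `|g t| <= M, `|dg t| <= M & `|dg s - dg t| <= M * `|s - t|]].

Lemma bounded_derivatives_lipschitz (g dg : R -> R) (M : R) : (forall t, is_derive t (1 : R) g (dg t)) ->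
  (forall t, `|dg t| <= M) -> forall s t, `|g s - g t| <= M * `|s - t|.
Proof.
move=> dgP dgM s t; have [c [_ ->]] := mean_value t s dgP.
by rewrite normrM ler_wpM2r.
Qed.

Lemma pexp_bounded_derivatives (m : R) : exists dg,
  bounded_derivatives (fun t => pexp (t - m)) dg /\ forall t, 0 <= dg t.
Proof.
have sm p : smooth1 (fun t => exp_inv p (t - m)) /\ forall t, is_derive t (1 : R)
    (fun t => exp_inv p (t - m)) (exp_inv ((p - deriv p) * 'X^2) (t - m)).
  have D q t : is_derive t (1 : R) (fun t => exp_inv q (t - m)) (exp_inv ((q - deriv q) * 'X^2) (t - m)).
    rewrite -[X in is_derive _ _ _ X]mulr1; apply: (@is_derive1_comp R (exp_inv q) (fun t => t - m)).
      exact: is_derive_exp_inv.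
    by have := is_deriveD (is_derive_id t 1) (is_derive_cst (- m) t (1 : R^o)); rewrite addr0.
  split => //; exists (fun f => exists q, f = fun t => exp_inv q (t - m)); first by exists p.
  move=> _ [q ->]; exists (fun t => exp_inv ((q - q^`()) * 'X^2) (t - m)); first by eexists.
  exact: D.
pose p1 : {poly R} := (1 - 1^`()) * 'X^2.
have [C0 C00 C0P] := exp_inv_bounded 1.
have [C1 C10 C1P] := exp_inv_bounded p1.
have [C2 C20 C2P] := exp_inv_bounded ((p1 - p1^`()) * 'X^2).
exists (fun t => exp_inv p1 (t - m)); split.
  split; [exact: (sm 1).1|exact: (sm p1).1|exact: (sm 1).2|].
  exists (C0 + C1 + C2) => s t; split.
  - by rewrite (le_trans (C0P _))// -addrA lerDl addr_ge0.
  - by rewrite (le_trans (C1P _))// addrAC lerDr addr_ge0.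
  - apply: (le_trans (bounded_derivatives_lipschitz (sm p1).2 (M := C2) _ s t)) => //.
    by rewrite ler_wpM2r// lerDr addr_ge0.
move=> t; rewrite /exp_inv; case: ifPn => // t0; rewrite /p1 derivC subr0 mul1r hornerXn.
by rewrite mulr_ge0 ?expR_ge0// exprn_ge0// invr_ge0 ltW.
Qed.

(** [N * sin (t / N)] is a smooth bounded truncation of the identity. Its derivative has modulus at
    most 1, so truncating does not increase the energy, and it tends to [t] as [N] grows. *)
Lemma sin_bounded_derivatives (N : R) : 0 < N ->
  bounded_derivatives (fun t => N * sin (t / N)) (fun t => cos (t / N)).
Proof.
move=> N0.
have dl t : is_derive t (1 : R) (fun t : R => t / N) N^-1.
  have := @is_derive_scale R R^o N^-1 id t 1 1 (is_derive_id _ _).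
  by rewrite mulr1; congr is_derive; apply/funext => s; rewrite mulrC.
have ds t : is_derive t (1 : R) (fun t : R => sin (t / N)) (cos (t / N) * N^-1).
  by apply: (@is_derive1_comp R sin (fun t : R => t / N)); exact: is_derive_sin.
have dc t : is_derive t (1 : R) (fun t : R => cos (t / N)) (- sin (t / N) * N^-1).
  by apply: (@is_derive1_comp R cos (fun t : R => t / N)); exact: is_derive_cos.
have sm : forall a b : R, smooth1 (fun t => a * sin (t / N) + b * cos (t / N)).
  move=> a b; exists (fun f => exists a b : R, f = fun t => a * sin (t / N) + b * cos (t / N)).
    by exists a, b.
  move=> _ [c [d ->]]; exists (fun t => - (d / N) * sin (t / N) + c / N * cos (t / N)).
    by exists (- (d / N)), (c / N).
  move=> t; have := is_deriveD (is_derive_scale c (ds t)) (is_derive_scale d (dc t)).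
  by move=> /is_derive_eq; apply; ring.
have D t : is_derive t (1 : R) (fun t => N * sin (t / N)) (cos (t / N)).
  by move: (is_derive_scale N (ds t)) => /is_derive_eq; apply; field; rewrite gt_eqF.
split => //.
- by have := sm N 0; congr smooth1; apply/funext => t; rewrite mul0r addr0.
- by have := sm 0 1; congr smooth1; apply/funext => t; rewrite mul0r add0r mul1r.
exists (N + 1 + N^-1) => s t.
have N1 : 0 <= N^-1 by rewrite invr_ge0 ltW.
have sin1 u : `|@sin R u| <= 1 by rewrite ler_norml sin_geN1 sin_le1.
have cos1 u : `|@cos R u| <= 1 by rewrite ler_norml cos_geN1 cos_le1.
split.
- rewrite normrM (gtr0_norm N0) (@le_trans _ _ N)//; first by rewrite ler_piMr// ltW.
  by rewrite -addrA lerDl addr_ge0.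
- by rewrite (le_trans (cos1 _))// addrAC lerDr addr_ge0// ltW.
- apply: (@le_trans _ _ (N^-1 * `|s - t|)).
    apply: (@bounded_derivatives_lipschitz (fun t => cos (t / N)) (fun t => - sin (t / N) * N^-1)) => // u.
    by rewrite normrM normrN (ger0_norm N1) ler_piMl.
  by rewrite ler_wpM2r// lerDr addr_ge0// ltW.
Qed.

End special_functions.

(** * Test functions and convolution *)

Section test_functions.
Context {R : realType} {n : nat}.
Local Notation V := 'rV[R]_n.
Local Notation kappa := (@leb_unit_ball R n).
Implicit Types (f u phi psi rho : V -> R) (Omega K : set V).
Local Notation e_ i := (delta_mx 0 i : V).

Lemma norm_delta_le1 i : `|e_ i| <= 1.
Proof.
rewrite {1}/Num.Def.normr/= mx_normrE; apply/bigmax_leP; split => // -[j k] _.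
by rewrite !mxE /=; case: (_ && _); rewrite ?normr1 ?normr0.
Qed.

Lemma test_functionP Omega K phi : smooth phi -> compact K -> K `<=` Omega ->
  (forall x, ~ K x -> phi x = 0) -> test_function Omega phi.
Proof.
move=> sphi cK KO phi0.
have clK : closed K by apply: compact_closed => //; exact: norm_hausdorff.
have sub : closure [set x | phi x != 0] `<=` K.
  have E : closure K = K by rewrite -(closure_id K).1.
  rewrite -[X in _ `<=` X]E; apply: closure_subset => x /= /eqP phix.
  by apply: contrapT => /phi0.
split => //; last exact: subset_trans sub KO.
by apply: (subclosed_compact _ cK sub); exact: closed_closure.
Qed.

Lemma test_support Omega phi : test_function Omega phi ->
  exists K, [/\ compact K, K `<=` Omega & forall x, ~ K x -> phi x = 0].
Proof.
move=> [sphi cphi sub]; eexists; split; [exact: cphi|exact: sub|].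
move=> x nx; apply: contrapT => /eqP px; apply: nx.
exact: subset_closure.
Qed.

Lemma test_smooth Omega phi : test_function Omega phi -> smooth phi.
Proof. by case. Qed.

Lemma test_functionM Omega phi psi : test_function Omega phi -> smooth psi ->
  test_function Omega (fun x => phi x * psi x).
Proof.
move=> tphi spsi; have [K [cK KO phi0]] := test_support tphi.
apply: (test_functionP _ cK KO) => [|x /phi0->]; last by rewrite mul0r.
by exact: smoothM (test_smooth tphi) spsi.
Qed.

Lemma test_partial_eq0 Omega phi i K : smooth phi -> closed K ->
  (forall x, ~ K x -> phi x = 0) -> forall x, ~ K x -> partial i phi x = 0.
Proof.
move=> sphi clK phi0 x nKx; apply: partial_eq.
have d0 : is_derive x (e_ i) (fun _ : V => 0 : R) 0 by exact: is_derive_cst.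
apply: near_eq_is_derive d0.
have oK : open (~` K) by rewrite openC.
have : nbhs x (~` K) by exact: open_nbhs_nbhs.
by apply: filterS => y /phi0.
Qed.

Lemma test_partial Omega phi i : test_function Omega phi -> test_function Omega (partial i phi).
Proof.
move=> tphi; have [K [cK KO phi0]] := test_support tphi.
have sphi := test_smooth tphi.
apply: (test_functionP _ cK KO); first exact: smooth_partial.
by apply: (test_partial_eq0 Omega) => //; apply: compact_closed => //; exact: norm_hausdorff.
Qed.

Lemma compact_ball K : compact K -> exists2 r : R, 0 < r & K `<=` ball (0 : V) r.
Proof.
move=> /compact_bounded[M [_ MP]].
exists (`|M| + 2) => [|x Kx]; first by rewrite ltr_wpDl.
apply/rV_ball_norm; rewrite sub0r normrN.
apply: (@le_lt_trans _ _ (`|M| + 1)); last by rewrite ltrD2l ltr1n.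
by apply: MP => //; rewrite (le_lt_trans (ler_norm _))// ltrDl.
Qed.

Lemma test_ball Omega phi : test_function Omega phi ->
  exists2 r : R, 0 < r & forall x, ~ ball (0 : V) r x -> phi x = 0.
Proof.
move=> /test_support[K [/compact_ball[r r0 Kr] _ phi0]]; exists r => // x nx.
by apply: phi0 => /Kr.
Qed.

Lemma test_bounded Omega phi : test_function Omega phi ->
  exists2 M : R, 0 <= M & forall x, `|phi x| <= M.
Proof.
move=> tphi; have [K [cK _ phi0]] := test_support tphi.
have [K0|/set0P[x0 Kx0]] := eqVneq K set0.
  by exists 0 => // x; rewrite phi0 ?normr0// K0.
have cn : {within K, continuous (fun x => `|phi x|)}.
  apply: continuous_subspaceT => x; apply: continuous_comp; last exact: norm_continuous.
  exact: smooth_continuous (test_smooth tphi) x.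
have [|c _ cP] := EVT_max_rV _ cK cn; first by exists x0.
exists `|phi c| => // x; have [Kx|/phi0->] := pselect (K x); last by rewrite normr0.
by apply: cP; rewrite inE.
Qed.

Lemma smooth_borel phi : smooth phi -> borel_fun phi.
Proof. by move=> sphi; apply: borel_continuous; exact: smooth_continuous. Qed.

Lemma L1_bounded_support f (M r : R) : borel_fun f -> (forall x, `|f x| <= M) ->
  (forall x, ~ ball (0 : V) r x -> f x = 0) -> L1 f.
Proof.
move=> bf fM f0; apply: (L1_le bf (L1Z M (L1_indb 0 r))) => x.
have M0 : 0 <= M := le_trans (normr_ge0 _) (fM 0).
have [[-> _]|[-> /f0->]] := indbP 0 r x; last by rewrite mulr0.
by rewrite mulr1 (ger0_norm M0).
Qed.

Lemma test_L1 Omega phi : test_function Omega phi -> L1 phi.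
Proof.
move=> tphi; have [M M0 MP] := test_bounded tphi; have [r r0 rP] := test_ball tphi.
exact: L1_bounded_support (smooth_borel (test_smooth tphi)) MP rP.
Qed.

Lemma L1M_bounded f g (M : R) : L1 f -> borel_fun g -> (forall x, `|g x| <= M) ->
  L1 (fun x => f x * g x).
Proof.
move=> fi bg gM; apply: (L1_le _ (L1Z M fi)); first by apply: borelM => //; exact: (proj1 fi).
move=> x; rewrite !normrM mulrC ler_wpM2r//.
exact: le_trans (gM x) (ler_norm _).
Qed.

Lemma rint_le_bound f (M r : R) : borel_fun f -> (forall x, `|f x| <= M) -> 0 < r ->
  (forall x, ~ ball (0 : V) r x -> f x = 0) -> `|rint f| <= M * (kappa * r ^+ n).
Proof.
move=> bf fM r0 f0; have fi := L1_bounded_support bf fM f0.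
have M0 : 0 <= M := le_trans (normr_ge0 _) (fM 0).
rewrite -lee_fin; apply: (le_trans (rint_norm_le fi)).
apply: (@le_trans _ _ (nnint (fun x => M * indb 0 r x))).
  apply: le_nnint; [by borel|by borel|by []|].
  move=> x; have [[-> _]|[-> /f0->]] := indbP 0 r x; last by rewrite mulr0 normr0.
  by rewrite mulr1.
rewrite nnintZ; [|by []|exact: borel_indb|by move=> x; exact: indb_ge0].
by rewrite nnint_indb// -EFinM.
Qed.

Lemma le0_small (x C : R) : (forall t, 0 < t -> t <= 1 -> x <= C * t) -> x <= 0.
Proof.
move=> H; rewrite leNgt; apply/negP => x0.
pose t := Num.min 1 (x / (2 * (`|C| + 1))).
have C1 : 0 < `|C| + 1 by rewrite ltr_wpDl.
have t0 : 0 < t by rewrite lt_min ltr01 divr_gt0// mulr_gt0.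
have := H t t0; rewrite ge_min lexx => /(_ isT) H1.
have : C * t <= (`|C| + 1) * t by rewrite ler_wpM2r ?(ltW t0)// (le_trans (ler_norm _))// lerDl.
have : (`|C| + 1) * t <= (`|C| + 1) * (x / (2 * (`|C| + 1))).
  by rewrite ler_pM2l// ge_min lexx orbT.
rewrite (_ : (`|C| + 1) * (x / (2 * (`|C| + 1))) = x / 2); last by field; rewrite gt_eqF.
by lra.
Qed.

Lemma eq0_small (x C : R) : (forall t, 0 < t -> t <= 1 -> `|x| <= C * t) -> x = 0.
Proof. by move=> /le0_small; rewrite normr_le0 => /eqP. Qed.

(** By translation invariance the integral of [psi (x + t *: e_ i) - psi x] is 0, so [t] times the
    integral of the partial derivative is that of a second order Taylor remainder, which is of order
    [t ^ 2] on a bounded set. *)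
Lemma rint_partial Omega psi i : test_function Omega psi -> rint (partial i psi) = 0.
Proof.
move=> tpsi; have sp := test_smooth tpsi; have tp := test_partial i tpsi.
have [M M0 MP] := test_bounded (test_partial i tp).
have [r r0 rP] := test_ball tpsi; have [r' r'0 rP'] := test_ball tp.
have L0 := test_L1 tpsi; have Lp := test_L1 tp.
apply: (@eq0_small _ (M * (kappa * (r + r' + 1) ^+ n))) => t t0 t1.
rewrite -(ler_pM2l t0) -[X in X * `|_|]gtr0_norm// -normrM -rintZ//.
have -> : rint (fun x => t * partial i psi x) =
    - rint (fun x => psi (x + t *: e_ i) - psi x - t * partial i psi x).
  rewrite rintB; [|by apply: L1B => //; exact: L1_shift|exact: L1Z].
  by rewrite rintB ?rint_shift ?subrr ?sub0r ?opprK//; exact: L1_shift.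
rewrite normrN; apply: (le_trans (@rint_le_bound _ (M * t ^+ 2) (r + r' + 1) _ _ _ _)).
- by apply: borelB; [apply: borelB; [apply: borel_shift|]; exact: (proj1 L0)|exact: (proj1 (L1Z t Lp))].
- by move=> x; exact: axis_taylor.
- by rewrite !addr_gt0.
- move=> x nx; rewrite !(rP, rP') ?mulr0 ?subrr//.
  + by move=> /rV_ball_norm H; apply: nx; apply/rV_ball_norm; lra.
  + by move=> /rV_ball_norm H; apply: nx; apply/rV_ball_norm; lra.
  + move=> /rV_ball_norm H; apply: nx; apply/rV_ball_norm; move: H; rewrite !sub0r !normrN => H.
    have : `|x| <= `|x + t *: e_ i| + `|t *: e_ i|.
      by rewrite -{1}(addrK (t *: e_ i) x) ler_normB.
    have : `|t *: e_ i| <= t by rewrite normrZ gtr0_norm// ler_piMr ?norm_delta_le1// ltW.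
    by lra.
- by rewrite le_eqVlt; apply/orP; left; apply/eqP; ring.
Qed.

Lemma partial_min phi i x : test_function setT phi -> (forall y, 0 <= phi y) -> phi x = 0 ->
  partial i phi x = 0.
Proof.
move=> tphi phi0 phix.
have [M M0 MP] := test_bounded (test_partial i (test_partial i tphi)).
apply: (@eq0_small _ M) => t t0 _.
have T s : `|phi (x + s *: e_ i) - s * partial i phi x| <= M * s ^+ 2.
  by have := axis_taylor (M := M) x s (test_smooth tphi) MP; rewrite phix subr0.
have := T t; have := T (- t).
rewrite !ler_norml => /andP[_ H1] /andP[_ H2].
have p1 := phi0 (x + t *: e_ i); have p2 := phi0 (x + - t *: e_ i).
rewrite sqrrN in H1.
have H3 : t * partial i phi x <= t * (M * t) by move: H1; rewrite mulNr expr2; lra.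
have H4 : t * - (M * t) <= t * partial i phi x by move: H2; rewrite mulrN expr2; lra.
by apply/andP; split; [move: H4|move: H3]; rewrite ler_pM2l.
Qed.

Lemma is_derive_taylor f x v (d C : R) :
  (forall t, `|f (x + t *: v) - f x - t * d| <= C * t ^+ 2) -> is_derive x v f d.
Proof.
move=> H.
have cv : (fun h : R => h^-1 *: ((f \o shift x) (h *: v) - f x)) @ 0^' --> d.
  apply/cvgrPdist_le => e e0.
  have C1 : 0 < `|C| + 1 by rewrite ltr_wpDl.
  near=> h.
  have h0 : h != 0 by near: h; exact: nbhs_dnbhs_neq.
  have hd : `|h| < e / (`|C| + 1) by near: h; apply: dnbhs0_lt; exact: divr_gt0.
  rewrite /= [h *: v + x]addrC.
  rewrite (_ : d - _ = - (h^-1 * (f (x + h *: v) - f x - h * d))); last first.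
    by rewrite mulrBr mulKf// opprB.
  rewrite normrN normrM normfV.
  have nh : 0 < `|h| by rewrite normr_gt0.
  rewrite ler_pdivrMl//; apply: (le_trans (H h)).
  rewrite -(real_normK (num_real h)) expr2 mulrCA ler_wpM2l//.
  apply: (@le_trans _ _ ((`|C| + 1) * `|h|)).
    by rewrite ler_wpM2r// (le_trans (ler_norm _))// lerDl.
  by rewrite mulrC -ler_pdivlMr// ltW.
by split; [apply/cvg_ex; exists d|exact/cvg_lim].
Unshelve. all: end_near. Qed.

Definition conv f rho : V -> R := fun x => rint (fun y => f y * rho (x - y)).

Lemma smooth_reflect rho x : smooth rho -> smooth (fun y => rho (x - y)).
Proof.
move=> /(smooth_affine (-1) x); congr smooth; apply/funext => y.
by rewrite scaleN1r addrC.
Qed.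

Lemma partial_reflect rho i x y : smooth rho ->
  partial i (fun y => rho (x - y)) y = - partial i rho (x - y).
Proof.
move=> srho; have := partial_affine (-1) x i y srho.
rewrite mulN1r scaleN1r [- y + x]addrC => <-; congr (partial i _ y).
by apply/funext => z; rewrite scaleN1r addrC.
Qed.

Lemma conv_L1 f rho x : L1 f -> test_function setT rho -> L1 (fun y => f y * rho (x - y)).
Proof.
move=> fi trho; have [M M0 MP] := test_bounded trho.
apply: (L1M_bounded fi _ (fun y => MP (x - y))).
by apply: smooth_borel; apply: smooth_reflect; exact: test_smooth trho.
Qed.

Lemma rint_mul_le f g (M : R) : L1 f -> borel_fun g -> (forall x, `|g x| <= M) ->
  `|rint (fun x => f x * g x)| <= M * rint (fun x => `|f x|).
Proof.
move=> fi bg gM; have M0 : 0 <= M := le_trans (normr_ge0 _) (gM 0).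
have fni : L1 (fun x => `|f x|).
  by apply: (L1_le _ fi) => [|x]; [exact: borel_norm (proj1 fi)|rewrite normr_id].
rewrite -rintZ// -lee_fin; apply: (le_trans (rint_norm_le (L1M_bounded fi bg gM))).
rewrite rint_nnint; [|by move=> x; rewrite mulr_ge0|exact: L1Z].
have bf := proj1 fi.
apply: le_nnint => //; [by borel|by borel|].
by move=> x; rewrite normrM mulrC ler_wpM2r.
Qed.

Lemma conv_continuous f rho : L1 f -> test_function setT rho -> continuous (conv f rho).
Proof.
move=> fi trho; suff : forall x : V, conv f rho y @[y --> x] --> conv f rho x by [].
move=> x; have srho := test_smooth trho.
have [M M0 MP] : exists2 M : R, 0 <= M & forall i y, `|partial i rho y| <= M.
  have H i : exists M : R, 0 <= M /\ forall y, `|partial i rho y| <= M.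
    by have [M M0 MP] := test_bounded (test_partial i trho); exists M.
  have [M MP] := choice H; exists (\sum_i M i); first by apply: sumr_ge0 => i _; exact: (MP i).1.
  move=> i y; apply: (le_trans ((MP i).2 y)); rewrite (bigD1 i)//= lerDl.
  by apply: sumr_ge0 => j _; exact: (MP j).1.
pose I := rint (fun x => `|f x|).
have I0 : 0 <= I by apply: rint_ge0.
have L h : `|conv f rho (x + h) - conv f rho x| <= n%:R * M * `|h| * I.
  rewrite /conv -rintB; [|exact: conv_L1|exact: conv_L1].
  under eq_fun do rewrite -mulrBr.
  apply: rint_mul_le => //.
    by apply: borelB; apply: smooth_borel; exact: smooth_reflect.
  move=> z; rewrite addrAC; exact: smooth_lipschitz.
have FF : Filter (nbhs x) by exact: nbhs_filter.
apply/(@cvgrPdist_le _ _ _ (nbhs x)) => e e0; pose K := n%:R * M * I + 1.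
have K0 : 0 < K by rewrite ltr_wpDl// mulr_ge0// mulr_ge0.
have eK : 0 < e / K by exact: divr_gt0.
have : nbhs x (ball x (e / K)) by exact: nbhsx_ballx.
apply: (@filterS _ (nbhs x)) => y /rV_ball_norm xy.
have Ey : y = x + (y - x) by rewrite addrC subrK.
rewrite distrC {1}Ey.
apply: (le_trans (L _)); rewrite mulrAC.
apply: (@le_trans _ _ (K * `|y - x|)); first by rewrite ler_wpM2r// lerDl.
by rewrite mulrC -ler_pdivlMr// distrC ltW.
Qed.

(** The second order Taylor bound on [rho] is uniform in the base point, so it survives integration
    against [f] and [is_derive_taylor] applies. *)
Lemma conv_is_derive f rho i x : L1 f -> test_function setT rho ->
  is_derive x (e_ i) (conv f rho) (conv f (partial i rho) x).
Proof.
move=> fi trho; have srho := test_smooth trho; have tp := test_partial i trho.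
have [M M0 MP] := test_bounded (test_partial i tp).
apply: (@is_derive_taylor _ _ _ _ (M * rint (fun x => `|f x|))) => t.
rewrite /conv -rintB; [|exact: conv_L1|exact: conv_L1].
have L := conv_L1.
rewrite -rintZ; last exact: conv_L1.
rewrite -rintB; [|by apply: L1B; exact: conv_L1|by apply: L1Z; exact: conv_L1].
rewrite (_ : (fun y => _) = (fun y => f y * (rho (x + t *: e_ i - y) - rho (x - y) - t * partial i rho (x - y)))).
  rewrite mulrAC; apply: rint_mul_le => //.
    apply: borelB; first by apply: borelB; apply: smooth_borel; exact: smooth_reflect.
    apply: borelM; first exact: borel_cst.
    by apply: smooth_borel; apply: smooth_reflect; exact: smooth_partial.
  by move=> y; rewrite [x + _ - y]addrAC; exact: axis_taylor.
by apply/funext => y; ring.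
Qed.

Lemma conv_smooth f rho : L1 f -> test_function setT rho -> smooth (conv f rho).
Proof.
move=> fi trho.
apply: (@smooth_class _ _ (fun g => exists2 psi, test_function setT psi & g = conv f psi)).
- by move=> _ [psi tpsi ->]; exact: conv_continuous.
- move=> _ [psi tpsi ->] i; exists (conv f (partial i psi)).
    by exists (partial i psi) => //; exact: test_partial.
  by move=> x; exact: conv_is_derive.
- by exists rho.
Qed.

Lemma partial_conv f rho i x : L1 f -> test_function setT rho ->
  partial i (conv f rho) x = conv f (partial i rho) x.
Proof. by move=> fi trho; apply: partial_eq; exact: conv_is_derive. Qed.

End test_functions.

(** * Mollifiers and cutoffs *)

Section nnint_more.
Context {R : realType} {n : nat}.
Local Notation V := 'rV[R]_n.
Implicit Types (f g : V -> R) (F : V -> V -> R).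

Lemma nnint_norm_ge0 f : (forall x, 0 <= f x) -> nnint (fun x => `|f x|) = nnint f.
Proof. by move=> f0; congr nnint; apply/funext => x; rewrite ger0_norm. Qed.

Lemma L1_ge0 f : borel_fun f -> (forall x, 0 <= f x) -> (nnint f < +oo)%E -> L1 f.
Proof. by move=> bf f0 fi; split => //; rewrite nnint_norm_ge0. Qed.

Lemma nnint_tonelli_le F f g : borel_fun2 F -> (forall x y, 0 <= F x y) ->
  borel_fun f -> borel_fun g -> (forall x, 0 <= f x) ->
  (forall x, ((f x)%:E <= nnint (F x))%E) ->
  (forall y, (nnint (fun x => F x y) <= (g y)%:E)%E) ->
  (nnint f <= nnint g)%E.
Proof.
move=> bF F0 bf bg f0 fF Fg.
apply: (@le_trans _ _ (\int[lebesgue_vec R n]_x nnint (F x))%E).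
  apply: ge0_le_integral.
  - exact: measurableT.
  - by move=> x _; rewrite lee_fin.
  - exact: borel_EFin.
  - exact: (measurableT_comp (measurable_nnint bF F0) measurable_id_borel).
  - by move=> x _; exact: fF.
rewrite [leLHS](nnint_tonelli bF F0); apply: ge0_le_integral.
- exact: measurableT.
- by move=> y _; apply: (@nnint_ge0 _ _ (fun x => F x y)).
- have bF' := borel2_swap bF.
  exact: (measurableT_comp (measurable_nnint bF' (fun y x => F0 x y)) measurable_id_borel).
- exact: borel_EFin.
- by move=> y _; exact: Fg.
Qed.

End nnint_more.

Section mollifiers.
Context {R : realType} {n : nat}.
Local Notation V := 'rV[R]_n.
Local Notation kappa := (@leb_unit_ball R n).
Implicit Types (f g u phi psi rho : V -> R) (Omega K : set V).
Local Notation e_ i := (delta_mx 0 i : V).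

(** Evenness turns [y |-> rho (x - y)] into a translate of [rho]. The constant [C] is a parameter
    separate from [eps] so that one value can serve all scales, as in [mollifier_exists]. *)
Record mollifier (C eps : R) (rho : V -> R) : Prop := Mollifier {
  mol_smooth : smooth rho ;
  mol_ge0 : forall x, 0 <= rho x ;
  mol_even : forall x, rho (- x) = rho x ;
  mol_supp : forall x, rho x != 0 -> ball (0 : V) eps x ;
  mol_int : rint rho = 1 ;
  mol_grad : forall i x, `|partial i rho x| <= C / eps ^+ n.+1 }.

Lemma compact_closed_ball (x : V) (r : R) : compact [set y : V | `|x - y| <= r].
Proof.
apply: bounded_closed_compact.
  exists (`|x| + `|r|); split; first by rewrite num_real.
  move=> M rM y /= xy; rewrite -[y](subKr x) (le_trans (ler_normB _ _))//.
  by rewrite (le_trans _ (ltW rM))// lerD2l (le_trans xy)// ler_norm.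
rewrite (_ : mkset _ = (fun y : V => `|x - y|) @^-1` [set s : R | s <= r])//.
apply: preimage_closed; last exact: closed_le.
move=> y _; apply: continuous_comp; last exact: norm_continuous.
by apply: continuousB; [exact: cst_continuous|exact: cvg_id].
Qed.

Lemma test_functionT_ball phi (x : V) (r : R) : smooth phi ->
  (forall y, r < `|x - y| -> phi y = 0) -> test_function setT phi.
Proof.
move=> sphi phi0; apply: (test_functionP sphi (@compact_closed_ball x r)) => // y /=.
by move=> /negP; rewrite -ltNge; exact: phi0.
Qed.

Lemma mol_out C eps rho x : mollifier C eps rho -> eps <= `|x| -> rho x = 0.
Proof.
move=> m ex; apply: contrapT => /eqP /(mol_supp m)/rV_ball_norm.
by rewrite sub0r normrN ltNge ex.
Qed.

Lemma mol_test C eps rho : mollifier C eps rho -> test_function setT rho.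
Proof.
move=> m; apply: (@test_functionT_ball _ 0 eps); first exact: mol_smooth m.
by move=> y; rewrite sub0r normrN => /ltW; exact: (mol_out m).
Qed.

Lemma mol_test_reflect C eps rho Omega x : mollifier C eps rho ->
  (forall y, `|x - y| <= eps -> Omega y) -> test_function Omega (fun y => rho (x - y)).
Proof.
move=> m sub; apply: (test_functionP _ (@compact_closed_ball x eps)) => //.
  by apply: smooth_reflect; exact: mol_smooth m.
by move=> y /= /negP; rewrite -ltNge => /ltW; exact: (mol_out m).
Qed.

(** A product of one-variable flat functions, one per coordinate, is supported in a ball of the sup
    norm; each factor is bounded below on the concentric ball of half the radius. *)
Lemma smooth_exists_bump : exists2 B : V -> R,
  [/\ smooth B, forall x, 0 <= B x, forall x, B (- x) = B x &
      forall x, B x != 0 -> ball (0 : V) 1 x] &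
  exists2 c : R, 0 < c & forall x, ball (0 : V) 2^-1 x -> c <= B x.
Proof.
pose B (x : V) : R := \prod_(i < n) pexp (1 - x 0 i * x 0 i).
exists B; first split.
- apply: smooth_prod => i; apply: smooth_comp; first exact: smooth1_exp_inv.
  apply: smoothB; first exact: smooth_cst.
  by apply: smoothM; exact: smooth_coord.
- by move=> x; apply: prodr_ge0 => i _; exact: pexp_ge0.
- by move=> x; apply: eq_bigr => i _; rewrite !mxE mulrNN.
- move=> x /prodf_neq0 H; apply/rV_ballP => // i; rewrite mxE sub0r normrN.
  have := H i isT; apply: contraNT; rewrite -leNgt => x1; apply/eqP/pexp_le0.
  by rewrite subr_le0 -expr2 -(real_normK (num_real _)) expr_ge1.
exists (pexp (1 - 2^-1 ^+ 2) ^+ n).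
  by apply/exprn_gt0/pexp_gt0; lra.
move=> x /rV_ballP xr; rewrite /B -[X in _ ^+ X]card_ord -prodr_const.
apply: ler_prod => i _; rewrite pexp_ge0/=; apply: pexp_le.
have h20 : (0 : R) < 2^-1 by [].
have := xr h20 i; rewrite mxE sub0r normrN => /ltW H.
rewrite lerD2l lerN2 -expr2 -(real_normK (num_real _)).
by apply: lerXn2r; rewrite ?nnegrE// ltW.
Qed.

(** The lower bound [c] on the half ball gives the rescaled bump a mass of at least [c' * eps ^+ n].
    Dividing by this mass turns a gradient of order [1 / eps] into one of order
    [1 / eps ^+ n.+1]. *)
Lemma mollifier_exists : 0 < kappa ->
  exists2 C : R, 0 < C & forall eps, 0 < eps -> exists rho, mollifier C eps rho.
Proof.
move=> k0; have [B [sB B0 Beven Bsupp] [c c0 cP]] := smooth_exists_bump.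
have tB : test_function setT B.
  apply: (@test_functionT_ball _ 0 1) => // y; rewrite sub0r normrN => y1.
  apply: contrapT => /eqP/Bsupp/rV_ball_norm; rewrite sub0r normrN.
  by rewrite ltNge (ltW y1).
have [M M0 MP] : exists2 M : R, 0 <= M & forall i y, `|partial i B y| <= M.
  have H i : exists M : R, 0 <= M /\ forall y, `|partial i B y| <= M.
    by have [M M0 MP] := test_bounded (test_partial i tB); exists M.
  have [M MP] := choice H; exists (\sum_i M i); first by apply: sumr_ge0 => i _; exact: (MP i).1.
  move=> i y; apply: (le_trans ((MP i).2 y)); rewrite (bigD1 i)//= lerDl.
  by apply: sumr_ge0 => j _; exact: (MP j).1.
pose c' := c * (kappa * 2^-1 ^+ n).
have c'0 : 0 < c' by rewrite mulr_gt0// mulr_gt0// exprn_gt0.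
exists ((M + 1) / c'); first by rewrite divr_gt0// ltr_wpDl.
move=> eps eps0.
pose Be x := B (eps^-1 *: x).
have E0 : 0 < eps^-1 by rewrite invr_gt0.
have BeE : Be = fun x => B (eps^-1 *: x + 0) by apply/funext => x; rewrite addr0.
have sBe : smooth Be by rewrite BeE; exact: smooth_affine.
have Besupp x : Be x != 0 -> ball (0 : V) eps x.
  move=> /Bsupp/rV_ball_norm; rewrite sub0r normrN normrZ gtr0_norm// ltr_pdivrMl// mulr1 => H.
  by apply/rV_ball_norm; rewrite sub0r normrN.
have tBe : test_function setT Be.
  apply: (@test_functionT_ball _ 0 eps) => // y; rewrite sub0r normrN => y1.
  apply: contrapT => /eqP/Besupp/rV_ball_norm; rewrite sub0r normrN.
  by rewrite ltNge (ltW y1).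
pose Z := rint Be.
have ZP : c' * eps ^+ n <= Z.
  rewrite -lee_fin (rint_nnint _ (test_L1 tBe)); last by move=> x; exact: B0.
  have -> : (c' * eps ^+ n)%:E = nnint (fun x : V => c * indb 0 (eps / 2) x).
    rewrite nnintZ; [|exact: ltW|exact: borel_indb|by move=> x; exact: indb_ge0].
    rewrite nnint_indb ?divr_gt0//.
    by rewrite -EFinM exprMn /c'; congr (_%:E); ring.
  apply: le_nnint; [by borel|exact: smooth_borel| |].
    by move=> x; rewrite mulr_ge0 ?(ltW c0)// indb_ge0.
  move=> x; have [[-> /rV_ball_norm]|[-> _]] := indbP 0 (eps / 2) x; last by rewrite mulr0; exact: B0.
  rewrite sub0r normrN mulr1 => xe; apply: cP; apply/rV_ball_norm.
  by rewrite sub0r normrN normrZ gtr0_norm// ltr_pdivrMl.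
have Z0 : 0 < Z by apply: lt_le_trans ZP; rewrite mulr_gt0// exprn_gt0.
exists (fun x => Z^-1 * Be x); split.
- exact: smoothZ.
- by move=> x; rewrite mulr_ge0 ?invr_ge0 ?(ltW Z0)//; exact: B0.
- by move=> x; rewrite /Be scalerN Beven.
- by move=> x; rewrite mulf_eq0 negb_or => /andP[_]; exact: Besupp.
- by rewrite rintZ ?mulVf ?gt_eqF//; exact: test_L1 tBe.
- move=> i x; rewrite (partial_eq (is_derive_scale Z^-1 (smooth_is_derive i x sBe))).
  rewrite BeE partial_affine// !normrM (gtr0_norm E0) gtr0_norm ?invr_gt0//.
  apply: (@le_trans _ _ ((c' * eps ^+ n)^-1 * (eps^-1 * (M + 1)))).
    apply: ler_pM; rewrite ?invr_ge0 ?(ltW Z0) ?mulr_ge0 ?(ltW E0)//.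
      by rewrite lef_pV2// posrE mulr_gt0// exprn_gt0.
    by rewrite ler_pM2l// (le_trans (MP _ _))// lerDl.
  rewrite le_eqVlt exprS; apply/orP; left; apply/eqP; field.
  by rewrite !gt_eqF//= ?exprn_gt0.
Qed.

Section one_mollifier.
Variables (C eps : R) (rho : V -> R) (m : mollifier C eps rho) (eps0 : 0 < eps).

Lemma mol_borel : borel_fun rho.
Proof. by apply: smooth_borel; exact: mol_smooth m. Qed.

Lemma mol_borel_reflect x : borel_fun (fun y => rho (x - y)).
Proof. by apply: smooth_borel; apply: smooth_reflect; exact: mol_smooth m. Qed.

Lemma mol_L1 : L1 rho.
Proof. exact: test_L1 (mol_test m). Qed.

Lemma mol_reflectE x y : rho (x - y) = rho (y + - x).
Proof. by rewrite -(mol_even m) opprB. Qed.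

Lemma mol_int_reflect x : rint (fun y => rho (x - y)) = 1.
Proof.
under eq_fun do rewrite mol_reflectE.
by rewrite rint_shift ?(mol_int m)//; exact: mol_L1.
Qed.

Lemma mol_L1_reflect x : L1 (fun y => rho (x - y)).
Proof. by under eq_fun do rewrite mol_reflectE; apply: L1_shift; exact: mol_L1. Qed.

Lemma mol_nnint : nnint rho = 1%E.
Proof. by rewrite -(rint_nnint (mol_ge0 m) mol_L1) (mol_int m). Qed.

Lemma mol_nnint_reflect x : nnint (fun y => rho (x - y)) = 1%E.
Proof.
rewrite -(rint_nnint _ (mol_L1_reflect x)) ?mol_int_reflect// => y.
exact: mol_ge0 m _.
Qed.

Lemma mol_nnint_reflect' y : nnint (fun x => rho (x - y)) = 1%E.
Proof. by rewrite nnint_shift ?mol_nnint//; [exact: mol_borel|exact: mol_ge0 m]. Qed.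

Lemma conv_shiftE f x : L1 f -> conv f rho x = rint (fun h => f (h + x) * rho h).
Proof.
move=> fi; rewrite /conv -(@rint_shift _ _ _ x); last exact: conv_L1 (mol_test m).
congr rint; apply/funext => h; congr (_ * _).
by rewrite opprD addrCA subrr addr0 (mol_even m).
Qed.

Lemma conv_bound f (M : R) x : L1 f -> (forall y, `|f y| <= M) -> `|conv f rho x| <= M.
Proof.
move=> fi fM.
rewrite -lee_fin; apply: (le_trans (rint_norm_le (conv_L1 x fi (mol_test m)))).
have M0 : 0 <= M := le_trans (normr_ge0 _) (fM 0).
have bf := proj1 fi; have br := mol_borel_reflect x.
apply: (@le_trans _ _ (nnint (fun y => M * rho (x - y)))).
  apply: le_nnint => //; [by borel|by borel|] => y.
  by rewrite normrM (ger0_norm (mol_ge0 m _)) ler_wpM2r// (mol_ge0 m).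
rewrite nnintZ//; last by move=> y; exact: mol_ge0 m _.
by rewrite mol_nnint_reflect mule1.
Qed.

(** Jensen's inequality: integrate [2 c f - c ^ 2 <= f ^ 2] against the probability density
    [rho (x - y)], where [c] is the convolution at [x]. *)
Lemma conv_sqr_le f x : L1 f ->
  ((conv f rho x ^+ 2)%:E <= nnint (fun y => f y ^+ 2 * rho (x - y))%R)%E.
Proof.
move=> fi; set c := conv f rho x.
have bf := proj1 fi; have br := mol_borel_reflect x.
have p0 y : 0 <= f y ^+ 2 * rho (x - y) by rewrite mulr_ge0 ?sqr_ge0// (mol_ge0 m).
have [fin|] := ltP (nnint (fun y => f y ^+ 2 * rho (x - y))) +oo%E; last first.
  by rewrite leye_eq => /eqP->; rewrite leey.
have L2 : L1 (fun y => f y ^+ 2 * rho (x - y)) by apply: L1_ge0 => //; borel.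
rewrite -(rint_nnint p0 L2) lee_fin.
have L3 := conv_L1 x fi (mol_test m); have L4 := mol_L1_reflect x.
have : rint (fun y => (2 * c) * (f y * rho (x - y)) - c ^+ 2 * rho (x - y)) <=
    rint (fun y => f y ^+ 2 * rho (x - y)).
  apply: le_rint => //; first by apply: L1B; exact: L1Z.
  move=> y; rewrite mulrA -mulrBl ler_wpM2r ?(mol_ge0 m)//.
  by have := sqr_ge0 (f y - c); rewrite sqrrB; lra.
rewrite rintB; [|exact: L1Z|exact: L1Z].
rewrite !rintZ// mol_int_reflect -/(conv f rho x) -/c mulr1; apply: le_trans.
by rewrite le_eqVlt; apply/orP; left; apply/eqP; ring.
Qed.

Lemma borel_conv f : L1 f -> borel_fun (conv f rho).
Proof. by move=> fi; apply: smooth_borel; apply: conv_smooth => //; exact: mol_test m. Qed.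

Lemma borel2_mol : borel_fun2 (fun x y => rho (x - y)).
Proof. exact: borel2_sub mol_borel. Qed.

(** [conv_sqr_le] followed by Tonelli's theorem, as [rho (x - y)] has mass 1 in either variable; the
    radius grows by [eps] because of the support of [rho]. *)
Lemma conv_sqr_ball f x0 r : L1 f ->
  (nnint (fun x => indb x0 r x * conv f rho x ^+ 2)%R <=
   nnint (fun y => indb x0 (r + eps) y * f y ^+ 2)%R)%E.
Proof.
move=> fi; have bf := proj1 fi; have bc := borel_conv fi.
have r0 := mol_ge0 m.
have b2 : borel_fun2 (fun x y => indb x0 r x * (f y ^+ 2 * rho (x - y))).
  apply: borel2M; first exact: borel2_fst (borel_indb _ _).
  by apply: borel2M; [apply: borel2X; exact: borel2_snd|exact: borel2_mol].
have p2 x y : 0 <= indb x0 r x * (f y ^+ 2 * rho (x - y)).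
  by rewrite mulr_ge0 ?indb_ge0// mulr_ge0 ?sqr_ge0.
apply: (nnint_tonelli_le b2 p2); [by borel|by borel| | |].
- by move=> x; rewrite mulr_ge0 ?indb_ge0 ?sqr_ge0.
- move=> x; rewrite nnintZ ?indb_ge0//.
  + by rewrite EFinM; apply: lee_wpmul2l; [rewrite lee_fin indb_ge0|exact: conv_sqr_le].
  + by apply: borelM; [borel|exact: mol_borel_reflect].
  + by move=> y; rewrite mulr_ge0 ?sqr_ge0.
move=> y; have bs : borel_fun (fun x => rho (x - y)) by apply: borel_shift; exact: mol_borel.
have [[-> _]|[-> ny]] := indbP x0 (r + eps) y.
  rewrite mul1r; apply: (@le_trans _ _ (nnint (fun x => f y ^+ 2 * rho (x - y)))).
    apply: le_nnint; [by borel|by borel|by move=> x; exact: p2|].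
    by move=> x; rewrite ler_piMl ?indb_le1// mulr_ge0 ?sqr_ge0.
  by rewrite nnintZ ?sqr_ge0// mol_nnint_reflect' mule1.
rewrite mul0r [X in (X <= _)%E](_ : _ = 0)%E//; apply: integral0_eq => x _.
have [[-> xr]|[-> _]] := indbP x0 r x; last by rewrite mul0r.
rewrite (mol_out m) ?mulr0//; rewrite leNgt; apply/negP => xy; apply: ny.
move: xr => /rV_ball_norm xr; apply/rV_ball_norm.
by rewrite -(subrKA x) (le_lt_trans (ler_normD _ _))// ltrD.
Qed.

(** [conv f rho x - f x] is the mean of [f (x + h) - f x] for the density [rho h]; Tonelli's theorem
    bounds its norm by the mean of the translation errors. *)
Lemma conv_L1_dist f r (eta e : R) : L1 f -> (eps <= eta) -> 0 <= e ->
  (forall h, `|h| < eta -> (nnint (fun x => indb 0 r x * `|f (x + h)%R - f x|)%R <= e%:E)%E) ->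
  (nnint (fun x => indb 0 r x * `|conv f rho x - f x|)%R <= e%:E)%E.
Proof.
move=> fi ee e0 H; have bf := proj1 fi; have bc := borel_conv fi; have r0 := mol_ge0 m.
have b2 : borel_fun2 (fun x h => indb 0 r x * `|f (x + h) - f x| * rho h).
  apply: borel2M; last exact: borel2_snd mol_borel.
  apply: borel2M; first exact: borel2_fst (borel_indb _ _).
  by apply: borel2_norm; apply: borel2B; [exact: borel2_add|exact: borel2_fst].
have p2 x h : 0 <= indb 0 r x * `|f (x + h) - f x| * rho h.
  by rewrite mulr_ge0// mulr_ge0 ?indb_ge0.
have bm := mol_borel.
rewrite -[e%:E]mule1 -mol_nnint -(nnintZ e0 bm r0).
apply: (nnint_tonelli_le b2 p2); [by borel|by borel| | |].
- by move=> x; rewrite mulr_ge0 ?indb_ge0.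
- move=> x.
  have bx : borel_fun (fun h => f (x + h)).
    by under eq_fun do rewrite addrC; exact: borel_shift.
  rewrite (_ : (fun h => _) = (fun h => indb 0 r x * (`|f (x + h) - f x| * rho h))); last first.
    by apply/funext => h; rewrite mulrA.
  rewrite nnintZ ?indb_ge0//; [|by borel|by move=> h; rewrite mulr_ge0].
  rewrite EFinM; apply: lee_wpmul2l; first by rewrite lee_fin indb_ge0.
  have Lx : L1 (fun h => f (x + h)) by under eq_fun do rewrite addrC; exact: L1_shift.
  have L : L1 (fun h => f (x + h) * rho h).
    by have [M M0 MP] := test_bounded (mol_test m); exact: (L1M_bounded Lx bm MP).
  have L' : L1 (fun h => f x * rho h) by apply: L1Z; exact: mol_L1.
  have E : conv f rho x - f x = rint (fun h => f (x + h) * rho h - f x * rho h).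
    rewrite rintB// rintZ ?(mol_int m) ?mulr1; last exact: mol_L1.
    by rewrite conv_shiftE//; congr (rint _ - _); apply/funext => h; rewrite addrC.
  rewrite E; apply: le_trans (rint_norm_le (L1B L L')) _.
  apply: le_nnint => [|||h]; [by borel|by borel|by []|].
  by rewrite -mulrBl normrM (ger0_norm (r0 _)).
move=> h; have [he|eh] := ltP `|h| eps; last first.
  rewrite (mol_out m eh) mulr0 [X in (X <= _)%E](_ : _ = 0)%E//.
  by apply: integral0_eq => x _; rewrite mulr0.
rewrite (_ : (fun x => _) = (fun x => rho h * (indb 0 r x * `|f (x + h) - f x|))); last first.
  by apply/funext => x; rewrite mulrC.
rewrite nnintZ//; [|by borel|by move=> x; rewrite mulr_ge0 ?indb_ge0].
rewrite mulrC EFinM; apply: lee_wpmul2l; first by rewrite lee_fin.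
by apply: H; exact: lt_le_trans ee.
Qed.

End one_mollifier.

(** The Taylor bounds at [x + s *: e_ i] and [x - s *: e_ i] force the derivative to be at most of
    order [s] in modulus, for every small [s]. *)
Lemma partial_extremum phi i x (M : R) : smooth phi -> (forall y, `|partial i (partial i phi) y| <= M) ->
  (forall y, phi x <= phi y) \/ (forall y, phi y <= phi x) -> partial i phi x = 0.
Proof.
move=> sphi MP.
have T s : `|phi (x + s *: e_ i) - phi x - s * partial i phi x| <= M * s ^+ 2 by exact: axis_taylor.
have T' s : `|phi (x + s *: e_ i) - phi x - s * partial i phi x| <= M * s ^+ 2 /\
  `|phi (x + - s *: e_ i) - phi x + s * partial i phi x| <= M * s ^+ 2.
  by split => //; have := T (- s); rewrite sqrrN mulNr opprK.
move=> H; apply: (@eq0_small _ _ M) => t t0 _.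
have [] := T' t; rewrite !ler_norml => /andP[a1 a2] /andP[a3 a4].
suff /andP[H3 H4] : t * - (M * t) <= t * partial i phi x <= t * (M * t).
  by apply/andP; split; [move: H3|move: H4]; rewrite ler_pM2l.
rewrite mulrN -[t * (M * t)]mulrCA -expr2; case: H => H.
  by have p1 := H (x + t *: e_ i); have p2 := H (x + - t *: e_ i); apply/andP; split; lra.
by have p1 := H (x + t *: e_ i); have p2 := H (x + - t *: e_ i); apply/andP; split; lra.
Qed.

Lemma mol_partial_out C eps rho i x : mollifier C eps rho -> eps <= `|x| -> partial i rho x = 0.
Proof.
move=> m ex; have [M M0 MP] := test_bounded (test_partial i (test_partial i (mol_test m))).
apply: (partial_extremum (mol_smooth m) MP); left => y.
by rewrite (mol_out m ex) (mol_ge0 m).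
Qed.

(** [phi] is the mollified indicator of [S]. Its gradient is an integral over a ball of volume
    [kappa * eps ^+ n] of a quantity at most [C / eps ^+ n.+1], whence the constant [C * kappa]. *)
Lemma cutoff_exists : 0 < kappa -> exists2 C : R, 0 < C & forall (S : set V) (b eps : R),
  measurable (S : set (@borelV R n)) -> S `<=` ball (0 : V) b -> 0 < eps ->
  exists phi : V -> R, [/\ test_function setT phi, (forall x, 0 <= phi x <= 1),
    (forall x, (forall y, `|x - y| < eps -> S y) -> phi x = 1),
    (forall x, phi x != 0 -> exists2 y, S y & `|x - y| < eps) &
    forall i x, `|partial i phi x| <= C / eps].
Proof.
move=> k0; have [C C0 CP] := mollifier_exists k0.
exists (C * kappa); first by rewrite mulr_gt0.
move=> S b eps mS Sb eps0; have [rho m] := CP _ eps0.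
pose I : V -> R := \1_S.
have bI : borel_fun I by exact: borel_indic.
have I01 x : 0 <= I x <= 1 by rewrite /I indicE; case: (_ \in _); rewrite /= ?ler01 ?lexx.
have nI x : `|I x| <= 1 by have /andP[? ?] := I01 x; rewrite ger0_norm.
have IL : L1 I.
  apply: (L1_bounded_support bI nI) => x nx; rewrite /I indicE memNset// => /Sb.
  exact: nx.
have tm := mol_test m.
have supp x : conv I rho x != 0 -> exists2 y, S y & `|x - y| < eps.
  apply: contraPP => H; rewrite /conv (_ : (fun y => _) = fun=> 0).
    by rewrite /rint /Rintegral integral0 /= eqxx.
  apply/funext => y; have [Sy|nSy] := pselect (S y); last first.
    by rewrite /I indicE memNset// mul0r.
  rewrite (mol_out m) ?mulr0// leNgt; apply/negP => xy.
  by apply: H; exists y.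
exists (conv I rho); split.
- apply: (@test_functionT_ball _ 0 (`|b| + eps)); first exact: conv_smooth.
  move=> y; rewrite sub0r normrN => yb; apply: contrapT => /eqP/supp[z Sz yz].
  have /rV_ball_norm := Sb _ Sz; rewrite sub0r normrN => zb.
  have := ler_normB y (y - z); rewrite subKr => H.
  have : `|y| <= `|z| + `|y - z| by rewrite -{1}(subrK z y) addrC ler_normD.
  have := ler_norm b; lra.
- move=> x; rewrite rint_ge0/=; last first.
    by move=> y; rewrite mulr_ge0 ?(mol_ge0 m)//; have /andP[] := I01 y.
  exact: le_trans (ler_norm _) (conv_bound m x IL nI).
- move=> x xS; rewrite -(mol_int_reflect m x); congr rint; apply/funext => y.
  have [xy|xy] := ltP `|x - y| eps; last by rewrite (mol_out m xy) mulr0.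
  by rewrite /I indicE mem_set ?mul1r//; exact: xS.
- exact: supp.
- move=> i x; rewrite partial_conv// -lee_fin.
  apply: (le_trans (rint_norm_le (conv_L1 x IL (test_partial i tm)))).
  have bp : borel_fun (fun y => partial i rho (x - y)).
    by apply: smooth_borel; apply: smooth_reflect; apply: smooth_partial; exact: mol_smooth m.
  have Ce : 0 <= C / eps ^+ n.+1 by rewrite divr_ge0 ?(ltW C0)// exprn_ge0 ?(ltW eps0).
  apply: (@le_trans _ _ (nnint (fun y => C / eps ^+ n.+1 * indb x eps y))).
    apply: le_nnint => // [||y]; [by borel|by borel|].
    have [xy|xy] := ltP `|x - y| eps; last first.
      by rewrite (mol_partial_out i m xy) mulr0 normr0 mulr_ge0// indb_ge0.
    rewrite indb_in ?mulr1; last exact/rV_ball_norm.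
    by rewrite normrM -[leRHS]mul1r ler_pM// (mol_grad m).
  rewrite nnintZ; [|by []|exact: borel_indb|by move=> y; exact: indb_ge0].
  rewrite nnint_indb//.
  rewrite -EFinM lee_fin exprS le_eqVlt; apply/orP; left; apply/eqP; field.
  by rewrite !gt_eqF//= exprn_gt0.
Qed.

Lemma L1_tail f (e : R) : L1 f -> 0 < e -> exists N : nat,
  (nnint (fun x => `|f x| * \1_[set x | N%:R <= `|f x|] x)%R <= e%:E)%E.
Proof.
move=> [bf fi] e0.
have bN (N : nat) : borel_fun (\1_[set x | N%:R <= `|f x|]).
  by apply: borel_indic; apply: measurable_ge_borel; borel.
have [||||N NP] := @nnint_dominated _ _ (fun N x => `|f x| * \1_[set x | N%:R <= `|f x|] x)%R
    (fun x => `|f x|)%R _ _ _ _ _ e0.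
- by move=> N; have := bN N; borel.
- move=> N x; rewrite mulr_ge0 ?indicE//= ler_piMr//.
  by case: (_ \in _).
- split; first by borel.
  by under eq_fun do rewrite normr_id.
- apply: aeT => x; apply/cvgrPdist_le => d d0.
  exists (Num.trunc `|f x|).+1 => // N /= xN.
  have xN' : `|f x| < N%:R by rewrite (lt_le_trans (truncnS_gt _))// ler_nat.
  rewrite indicE memNset/=; last by apply/negP; rewrite -ltNge.
  by rewrite mulr0 subrr normr0 ltW.
by exists N; exact: NP.
Qed.

Lemma L1_L1loc f : L1 f -> L1loc f.
Proof.
move=> fi; split; first exact: (proj1 fi).
move=> r; under eq_fun do rewrite mulrC.
apply: (L1M_bounded fi (borel_indb _ _) (M := 1)) => x.
by rewrite ger0_norm ?indb_le1// indb_ge0.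
Qed.

Lemma mollify_L1 C f (r e : R) : L1 f -> 0 < r -> 0 < e -> exists2 eta : R, 0 < eta &
  forall eps rho, 0 < eps -> eps <= eta -> mollifier C eps rho ->
  (nnint (fun x => indb 0 r x * `|conv f rho x - f x|)%R <= e%:E)%E.
Proof.
move=> fi r0 e0; have [eta eta0 H] := tcont_L1loc (L1_L1loc fi) r0 e0.
by exists eta => // eps rho eps0 ee m; apply: (conv_L1_dist m fi ee (ltW e0)).
Qed.

(** [D] is bounded but small only in L1, while [f] is merely integrable: where [f] exceeds [N] the
    tail of [f] is small, and elsewhere the L1 smallness of [D] is multiplied by [N]. This replaces
    the extraction of an almost everywhere convergent subsequence. The scale [eta] is chosen before
    [D]. *)
Lemma mollify_weighted C f u (M r e : R) : L1 f -> (forall x, ~ ball (0 : V) r x -> f x = 0) ->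
  L1 u -> 0 <= M -> 0 < r -> 0 < e -> exists2 eta : R, 0 < eta &
  forall eps rho, 0 < eps -> eps <= eta -> mollifier C eps rho ->
  forall D : V -> R, borel_fun D -> (forall x, `|D x| <= M) ->
    (forall x, `|D x| <= M * `|conv u rho x - u x|) ->
    (nnint (fun x => `|f x| * `|D x|)%R <= e%:E)%E.
Proof.
move=> fi f0 ui M0 r0 e0; have M1 : 0 < M + 1 by rewrite ltr_wpDl.
have [N NP] := L1_tail fi (divr_gt0 e0 (mulr_gt0 (ltr0n _ 2) M1)).
have N1 : 0 < N%:R + 1 :> R by rewrite ltr_wpDl.
have [eta eta0 H] := mollify_L1 C ui r0 (divr_gt0 e0 (mulr_gt0 (ltr0n _ 2) (mulr_gt0 N1 M1))).
exists eta => // eps rho eps0 ee m D bD D1 D2.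
have bf := proj1 fi; have bu := proj1 ui; have bc := borel_conv m ui.
have bN : borel_fun (\1_[set x | N%:R <= `|f x|]).
  by apply: borel_indic; apply: measurable_ge_borel; borel.
apply: (@le_trans _ _ (nnint (fun x => (M + 1) * (`|f x| * \1_[set x | N%:R <= `|f x|] x) +
   (N%:R + 1) * (M + 1) * (indb 0 r x * `|conv u rho x - u x|)))).
  apply: le_nnint => [|||x]; [by borel|by borel|by move=> x; rewrite mulr_ge0|].
  have i0 : 0 <= indb 0 r x by exact: indb_ge0.
  rewrite indicE; have [fN|fN] := leP N%:R `|f x|.
    rewrite mem_set//= mulr1; apply: ler_wpDr.
      by rewrite !mulr_ge0// ?(ltW N1) ?(ltW M1).
    by rewrite mulrC ler_wpM2r// (le_trans (D1 x))// lerDl.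
  rewrite memNset ?mulr0 ?add0r; last by apply/negP; rewrite -ltNge.
  have [[-> _]|[_ nx]] := indbP 0 r x; last by rewrite f0// normr0 mul0r !mulr_ge0// ?(ltW N1) ?(ltW M1).
  rewrite mul1r -mulrA; apply: ler_pM => //.
    by rewrite (le_trans (ltW fN))// lerDl.
  by rewrite (le_trans (D2 x))// ler_wpM2r// lerDl.
rewrite nnintD; last 4 first.
- by borel.
- by borel.
- by move=> x; rewrite mulr_ge0 ?(ltW M1)// mulr_ge0// indicE.
- by move=> x; rewrite !mulr_ge0 ?(ltW M1) ?(ltW N1)// indb_ge0.
rewrite nnintZ; [|exact: ltW|by borel|by move=> x; rewrite mulr_ge0// indicE].
rewrite nnintZ; [|by rewrite mulr_ge0// ?(ltW M1) ?(ltW N1)|by borel|by move=> x; rewrite mulr_ge0// indb_ge0].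
apply: (@le_trans _ _ ((M + 1)%:E * (e / (2 * (M + 1)))%:E +
   ((N%:R + 1) * (M + 1))%:E * (e / (2 * ((N%:R + 1) * (M + 1))))%:E)%E); last first.
  rewrite -!EFinM -EFinD lee_fin le_eqVlt; apply/orP; left; apply/eqP; field.
  by rewrite !gt_eqF.
apply: leeD.
  by apply: lee_wpmul2l => //; rewrite lee_fin ltW.
by apply: lee_wpmul2l; [rewrite lee_fin mulr_ge0// ?(ltW M1) ?(ltW N1)|exact: H m].
Qed.

(** Where [F ^+ 2] is at most [N], L1 convergence of the mollifications suffices; on the rest,
    Young's inequality combines the small tail of [F ^+ 2] with the boundedness of the
    mollifications in L2, which is [conv_sqr_ball]. *)
Lemma mollify_L2 C f F (r e : R) : borel_fun F -> (nnint (fun x => F x ^+ 2)%R < +oo)%E ->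
  (forall x, ~ ball (0 : V) r x -> F x = 0) ->
  L1 f -> (nnint (fun x => f x ^+ 2)%R < +oo)%E -> 0 < r -> 0 < e -> exists2 eta : R, 0 < eta &
  forall eps rho, 0 < eps -> eps <= eta -> mollifier C eps rho ->
    (nnint (fun x => `|F x| * `|conv f rho x - f x|)%R <= e%:E)%E.
Proof.
move=> bF F2 F0 fi f2 r0 e0; have bf := proj1 fi.
have FL : L1 (fun x => F x ^+ 2) by apply: L1_ge0 => //; [borel|move=> x; exact: sqr_ge0].
have f2L : L1 (fun x => f x ^+ 2) by apply: L1_ge0 => //; [borel|move=> x; exact: sqr_ge0].
pose I := rint (fun x => f x ^+ 2).
have I0 : 0 <= I by apply: rint_ge0 => x; exact: sqr_ge0.
(* The parameter of Young's inequality, for which [2 * t * (2 * (I + 1))] is [e / 3]. *)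
pose t := e / (12 * (I + 1)).
have I1 : 0 < I + 1 by rewrite ltr_wpDl.
have t0 : 0 < t by rewrite divr_gt0// mulr_gt0.
have [N NP] := L1_tail FL (mulr_gt0 t0 (divr_gt0 e0 (ltr0n _ 3))).
have N1 : 0 < N%:R + 1 :> R by rewrite ltr_wpDl.
have [eta eta0 H] := mollify_L1 C fi r0 (divr_gt0 e0 (mulr_gt0 (ltr0n _ 3) N1)).
exists eta => // eps rho eps0 ee m; have bc := borel_conv m fi.
set T := fun x => `|F x ^+ 2| * \1_[set x | N%:R <= `|F x ^+ 2|] x.
have bT : borel_fun T.
  by apply: borelM; [borel|apply: borel_indic; apply: measurable_ge_borel; borel].
have T0 x : 0 <= T x by rewrite /T mulr_ge0// indicE.
set d := fun x => conv f rho x - f x.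
have bd : borel_fun d by rewrite /d; borel.
apply: (@le_trans _ _ (nnint (fun x => (N%:R + 1) * (indb 0 r x * `|d x|) + (t^-1 * T x +
   (2 * t) * (indb 0 r x * conv f rho x ^+ 2 + f x ^+ 2))))).
  apply: le_nnint => [|||x]; [by borel|by borel|by move=> x; rewrite mulr_ge0|].
  have i0 : 0 <= indb 0 r x by exact: indb_ge0.
  have s0 : 0 <= 2 * t * (indb 0 r x * conv f rho x ^+ 2 + f x ^+ 2).
    apply: mulr_ge0; first by rewrite mulr_ge0// ltW.
    by rewrite addr_ge0 ?sqr_ge0// mulr_ge0 ?sqr_ge0.
  have s1 : 0 <= t^-1 * T x by rewrite mulr_ge0 ?invr_ge0 ?(ltW t0).
  have s2 : 0 <= (N%:R + 1) * (indb 0 r x * `|d x|) by rewrite !mulr_ge0 ?(ltW N1).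
  have [[ix _]|[_ nx]] := indbP 0 r x; last first.
    by rewrite F0// normr0 mul0r addr_ge0// addr_ge0.
  have [fN|fN] := leP N%:R `|F x ^+ 2|; last first.
    apply: (@le_trans _ _ ((N%:R + 1) * (indb 0 r x * `|d x|))); last by rewrite lerDl addr_ge0.
    rewrite ix mul1r ler_wpM2r//; move: fN; rewrite normrX => fN.
    have := sqr_ge0 (`|F x| - 1); rewrite sqrrB expr1n mulr1.
    by have := normr_ge0 (F x); lra.
  apply: (@le_trans _ _ (t^-1 * T x + 2 * t * (indb 0 r x * conv f rho x ^+ 2 + f x ^+ 2))); last by rewrite lerDr.
  rewrite ix mul1r /T indicE mem_set//= mulr1.
  have dd : d x ^+ 2 <= 2 * (conv f rho x ^+ 2 + f x ^+ 2).
    by have := sqr_ge0 (conv f rho x + f x); rewrite /d sqrrB sqrrD; lra.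
  apply: (@le_trans _ _ (t^-1 * `|F x ^+ 2| + t * d x ^+ 2)); last first.
    rewrite (_ : 2 * t * (conv f rho x ^+ 2 + f x ^+ 2) = t * (2 * (conv f rho x ^+ 2 + f x ^+ 2))).
      by apply: lerD => //; apply: ler_wpM2l => //; exact: ltW.
    by ring.
  rewrite -/(d x) normrX -(real_normK (num_real (d x))).
  have := sqr_ge0 (t^-1 * `|F x| - `|d x|); rewrite sqrrB => Hs.
  have p0 : 0 <= `|F x| * `|d x| by rewrite mulr_ge0.
  rewrite -subr_ge0.
  have -> : t^-1 * `|F x| ^+ 2 + t * `|d x| ^+ 2 - `|F x| * `|d x| =
     t * ((t^-1 * `|F x|) ^+ 2 - t^-1 * `|F x| * `|d x| *+ 2 + `|d x| ^+ 2) + `|F x| * `|d x|.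
    by field; rewrite gt_eqF.
  by rewrite addr_ge0// mulr_ge0 ?(ltW t0).
have p1 x : 0 <= indb 0 r x * `|d x| by rewrite mulr_ge0// indb_ge0.
have p2 x : 0 <= indb 0 r x * conv f rho x ^+ 2 by rewrite mulr_ge0 ?sqr_ge0// indb_ge0.
have p3 x : 0 <= indb 0 r x * conv f rho x ^+ 2 + f x ^+ 2 by rewrite addr_ge0 ?sqr_ge0.
have q1 x : 0 <= (N%:R + 1) * (indb 0 r x * `|d x|) by rewrite mulr_ge0 ?(ltW N1).
have q2 x : 0 <= t^-1 * T x by rewrite mulr_ge0 ?invr_ge0 ?(ltW t0).
have q3 x : 0 <= 2 * t * (indb 0 r x * conv f rho x ^+ 2 + f x ^+ 2).
  by rewrite mulr_ge0// mulr_ge0 ?(ltW t0).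
rewrite nnintD; [|by borel|by borel|by []|by move=> x; rewrite addr_ge0].
rewrite nnintD; [|by borel|by borel|by []|by []].
rewrite nnintZ; [|exact: ltW|by borel|by []].
have t1 : 0 <= t^-1 by rewrite invr_ge0 ltW.
have t2 : 0 <= 2 * t by rewrite mulr_ge0 ?(ltW t0).
rewrite (@nnintZ _ _ t^-1 T)//.
rewrite (@nnintZ _ _ (2 * t) (fun x => indb 0 r x * conv f rho x ^+ 2 + f x ^+ 2))//; last by borel.
rewrite nnintD; [|by borel|by borel|by []|by move=> x; exact: sqr_ge0].
have cI : (nnint (fun x => indb 0 r x * conv f rho x ^+ 2)%R <= I%:E)%E.
  apply: le_trans (conv_sqr_ball m 0 r fi) _.
  rewrite rint_nnint//; last by move=> x; exact: sqr_ge0.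
  apply: le_nnint => [|||x]; [by borel|by borel|by move=> x; rewrite mulr_ge0 ?sqr_ge0// indb_ge0|].
  by rewrite ler_piMl ?sqr_ge0// indb_le1.
have fI : (nnint (fun x => f x ^+ 2)%R <= I%:E)%E.
  by rewrite rint_nnint// => x; exact: sqr_ge0.
apply: (@le_trans _ _ ((e / 3)%:E + ((e / 3)%:E + (e / 3)%:E))%E); last first.
  by rewrite -!EFinD lee_fin; lra.
apply: leeD; last apply: leeD.
- rewrite (_ : e / 3 = (N%:R + 1) * (e / (3 * (N%:R + 1)))); last by field; rewrite gt_eqF.
  by rewrite EFinM; apply: lee_wpmul2l; [rewrite lee_fin ltW|exact: H m].
- rewrite (_ : e / 3 = t^-1 * (t * (e / 3))); last by rewrite mulKf// gt_eqF.
  by rewrite EFinM; apply: lee_wpmul2l; [rewrite lee_fin invr_ge0 ltW|exact: NP].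
- apply: (@le_trans _ _ ((2 * t)%:E * (I%:E + I%:E))%E).
    by apply: lee_wpmul2l; [rewrite lee_fin mulr_ge0 ?(ltW t0)|exact: leeD].
  rewrite -EFinD -EFinM lee_fin.
  apply: (@le_trans _ _ (2 * t * (2 * (I + 1)))); first by apply: ler_wpM2l => //; lra.
  by rewrite /t le_eqVlt; apply/orP; left; apply/eqP; field; rewrite gt_eqF.
Qed.

End mollifiers.

(** * Weak gradients *)

Section weak_gradients.
Context {R : realType} {n : nat}.
Local Notation V := 'rV[R]_n.
Local Notation kappa := (@leb_unit_ball R n).
Implicit Types (f u phi psi rho : V -> R) (g h : 'I_n -> V -> R) (Omega K : set V).
Local Notation e_ i := (delta_mx 0 i : V).

Definition locL1 Omega u := borel_fun u /\
  forall K, compact K -> K `<=` Omega -> L1 (fun x => \1_K x * u x).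

Definition wgrad Omega u g := forall phi, test_function Omega phi -> forall i,
  rint (fun x => u x * partial i phi x) = - rint (fun x => g i x * phi x).

Lemma compact_borel K : compact K -> measurable (K : set (@borelV R n)).
Proof.
move=> cK; apply: measurable_closed_borel; apply: compact_closed => //; exact: norm_hausdorff.
Qed.

Lemma rint_small f (e : R) : L1 f -> (nnint (fun x => `|f x|)%R <= e%:E)%E -> `|rint f| <= e.
Proof. by move=> fi H; rewrite -lee_fin; apply: le_trans H; exact: rint_norm_le. Qed.

(** [K'] is the sum of [K] and a closed ball of radius [s]: mollifications at scales below [s],
    evaluated on [K], only see values on [K']. *)
Lemma compact_thicken Omega K : open Omega -> compact K -> K `<=` Omega ->
  exists s K', [/\ 0 < s, compact K', K' `<=` Omega &
    forall x y, K x -> `|x - y| <= s -> K' y].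
Proof.
move=> oO cK KO.
have [s s0 sP] : exists2 s : R, 0 < s & forall x, K x -> forall y, `|x - y| <= s -> Omega y.
  have H : \forall s \near (0 : R)^'+, forall x, K x -> forall y, `|x - y| <= s -> Omega y.
    apply: ((compact_near_coveringP K).1 cK _ (0 : R)^'+ (fun s x => forall y, `|x - y| <= s -> Omega y) _).
    move=> x /KO Ox; have /nbhs_ballP[e /= e0 eO] : nbhs x Omega by exact: open_nbhs_nbhs.
    exists (ball x (e / 2), [set s | 0 < s < e / 2]).
      split; first by apply: nbhsx_ballx; exact: divr_gt0.
      near=> s; apply/andP; split; first by near: s; exact: nbhs_right_gt.
      by near: s; apply: nbhs_right_lt; exact: divr_gt0.
    move=> [z s] /= [/rV_ball_norm xz /andP[s0 se]] y zy; apply: eO; apply/rV_ball_norm.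
    by rewrite -(subrKA z) (le_lt_trans (ler_normD _ _))// [ltRHS]splitr ltr_leD// (le_trans zy)// ltW.
  have [s [s0 sP]] := filter_ex (filterI (nbhs_right_gt (0 : R)) H).
  by exists s.
exists s, ((fun p : V * V => p.1 + p.2) @` (K `*` [set h : V | `|0 - h| <= s])); split => //.
- apply: (@continuous_compact _ _ (fun p : V * V => p.1 + p.2)).
    by apply: continuous_subspaceT => p; exact: (@add_continuous V p).
  exact: (@compact_setX _ _ K _ cK (@compact_closed_ball R n 0 s)).
- move=> _ [[x h] /= [Kx hs] <-]; apply: (sP x Kx).
  by rewrite opprD addrA subrr.
- move=> x y Kx xy; exists (x, y - x) => /=; last by rewrite addrC subrK.
  by split=> //=; rewrite sub0r normrN distrC.
Unshelve. all: end_near. Qed.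

(** The reflected mollifier [y |-> rho (x - y)] is itself an admissible test function as soon as its
    support lies in [Omega]. *)
Lemma wgrad_conv Omega K C eps rho u g x i : mollifier C eps rho -> wgrad Omega u g ->
  K `<=` Omega -> (forall y, `|x - y| <= eps -> K y) -> L1 (fun y => \1_K y * u y) ->
  partial i (conv (fun y => \1_K y * u y) rho) x = conv (fun y => \1_K y * g i y) rho x.
Proof.
move=> m wg KO sub ui; rewrite partial_conv//; last exact: mol_test m.
have loc (v psi : V -> R) : (forall z, eps <= `|z| -> psi z = 0) ->
    conv (fun y => \1_K y * v y) psi x = rint (fun y => v y * psi (x - y)).
  move=> psi0; congr rint; apply/funext => y; rewrite indicE.
  have [xy|xy] := leP `|x - y| eps; first by rewrite mem_set ?mul1r//; exact: sub.
  by rewrite psi0 ?mulr0// ltW.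
rewrite loc; last by move=> z; exact: mol_partial_out m.
rewrite loc; last by move=> z; exact: mol_out m.
apply: oppr_inj; rewrite -(wg (fun y => rho (x - y))); last first.
  by apply: (mol_test_reflect m) => y /sub /KO.
rewrite (_ : (fun y => u y * partial i (fun y => rho (x - y)) y) =
    (fun y => (-1) * (u y * partial i rho (x - y)))); last first.
  by apply/funext => y; rewrite partial_reflect ?mulN1r ?mulrN//; exact: mol_smooth m.
have L : L1 (fun y => u y * partial i rho (x - y)).
  have := conv_L1 x ui (test_partial i (mol_test m)); congr L1; apply/funext => y.
  have [xy|xy] := leP `|x - y| eps; first by rewrite indicE mem_set ?mul1r//; exact: sub.
  by rewrite (mol_partial_out _ m) ?mulr0// ltW.
by rewrite rintZ// mulN1r.
Qed.

Lemma borel_smooth1 (G : R -> R) f : smooth1 G -> borel_fun f -> borel_fun (fun x => G (f x)).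
Proof.
move=> sG bf; have mG : measurable_fun setT G.
  by apply: continuous_measurable_fun; exact: smooth1_continuous.
exact: measurableT_comp mG bf.
Qed.

(** For the mollification [Ue] the identity is [rint_partial] applied to [phi * G(Ue)]. The limit is
    taken in three terms: [mollify_weighted] handles [G(Ue)] and [dG(Ue)], which are bounded and
    converge in L1, and [mollify_L1] handles the gradient. *)
Lemma wgrad_comp Omega u g (G dG : R -> R) : 0 < kappa -> open Omega -> bounded_derivatives G dG ->
  locL1 Omega u -> (forall i, locL1 Omega (g i)) -> wgrad Omega u g ->
  wgrad Omega (fun x => G (u x)) (fun i x => dG (u x) * g i x).
Proof.
move=> kappa_gt0 oO [sG sdG Gd [M MP]] [bu uloc] gloc wg phi tphi i.
have [K [cK KO phi0]] := test_support tphi.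
have [s [K' [s0 cK' K'O KK']]] := compact_thicken oO cK KO.
have [r r0 Kr] := compact_ball cK.
pose U x := \1_K' x * u x; pose H x := \1_K' x * g i x.
have Ui : L1 U by exact: uloc.
have Hi : L1 H by apply: (proj2 (gloc i)).
have [C C0 mol] := mollifier_exists kappa_gt0.
have M0 : 0 <= M by have [+ _ _] := MP 0 0; exact: le_trans.
have [B B0 BP] := test_bounded tphi.
have [B' B'0 BP'] := test_bounded (test_partial i tphi).
have bphi := smooth_borel (test_smooth tphi).
have bdphi := smooth_borel (test_smooth (test_partial i tphi)).
have bG (v : V -> R) : borel_fun v -> borel_fun (fun x => G (v x)) := borel_smooth1 sG.
have bdG (v : V -> R) : borel_fun v -> borel_fun (fun x => dG (v x)) := borel_smooth1 sdG.
have dphi0 x : ~ K x -> partial i phi x = 0.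
  by apply: test_partial_eq0 => //; [exact: test_smooth tphi|apply: compact_closed => //; exact: norm_hausdorff].
have KU x : K x -> U x = u x /\ H x = g i x.
  move=> Kx; have K'x : K' x by apply: (KK' x x) => //; rewrite subrr normr0 ltW.
  by rewrite /U /H indicE mem_set// !mul1r.
have eU : (fun x => G (u x) * partial i phi x) = (fun x => partial i phi x * G (U x)).
  apply/funext => x; rewrite mulrC; have [Kx|nKx] := pselect (K x); last by rewrite dphi0// !mul0r.
  by rewrite (KU x Kx).1.
have eH : (fun x => dG (u x) * g i x * phi x) = (fun x => H x * phi x * dG (U x)).
  apply/funext => x; have [Kx|nKx] := pselect (K x); last by rewrite phi0// !mulr0 mul0r.
  by rewrite (KU x Kx).1 (KU x Kx).2; ring.
have bU := proj1 Ui; have bH := proj1 Hi.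
have L_1 : L1 (fun x => partial i phi x * G (U x)).
  apply: (L1M_bounded (M := M)) => //; [exact: test_L1 (test_partial i tphi)|exact: bG|].
  by move=> x; have [] := MP 0 (U x).
have L_2 : L1 (fun x => H x * phi x * dG (U x)).
  apply: (L1M_bounded (M := M)) => //; [exact: L1M_bounded BP|exact: bdG|].
  by move=> x; have [] := MP 0 (U x).
rewrite eU eH; apply/eqP; rewrite -subr_eq0 opprK -rintD//; apply/eqP.
apply: (@eq0_small _ _ 3) => t t0 _.
have Gl := bounded_derivatives_lipschitz Gd (fun y => let: And3 _ a _ := MP 0 y in a).
have M20 : 0 <= M + M by rewrite addr_ge0.
have Hphi0 x : ~ ball (0 : V) r x -> H x * phi x = 0.
  by move=> nx; rewrite phi0 ?mulr0// => /Kr.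
have dphir x : ~ ball (0 : V) r x -> partial i phi x = 0.
  by move=> nx; apply: dphi0 => /Kr.
have [e1 e10 E1] := mollify_weighted C (test_L1 (test_partial i tphi)) dphir Ui M20 r0 t0.
have [e2 e20 E2] := mollify_weighted C (L1M_bounded Hi bphi BP) Hphi0 Ui M20 r0 t0.
have BM1 : 0 < B * M + 1 by rewrite ltr_wpDl// mulr_ge0.
have [e3 e30 E3] := mollify_L1 C Hi r0 (divr_gt0 t0 BM1).
pose eps := Num.min s (Num.min e1 (Num.min e2 e3)).
have eps0 : 0 < eps by rewrite !lt_min s0 e10 e20.
have [rho m] := mol eps eps0.
have es : eps <= s by rewrite ge_min lexx.
have ee1 : eps <= e1 by rewrite /eps !ge_min lexx ?orbT.
have ee2 : eps <= e2 by rewrite /eps !ge_min lexx ?orbT.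
have ee3 : eps <= e3 by rewrite /eps !ge_min lexx ?orbT.
pose Ue := conv U rho; pose He := conv H rho.
have sUe : smooth Ue by apply: conv_smooth => //; exact: mol_test m.
have bUe := smooth_borel sUe.
have bHe : borel_fun He by exact: (borel_conv m Hi).
have parU x : K x -> partial i Ue x = He x.
  move=> Kx; apply: (wgrad_conv i m wg K'O) => // y xy; apply: (KK' x) => //; exact: le_trans es.
have tpsi : test_function Omega (fun x => phi x * G (Ue x)).
  by apply: test_functionM; [assumption|exact: smooth_comp].
have := rint_partial i tpsi.
rewrite (_ : partial i _ = (fun x => partial i phi x * G (Ue x) + phi x * (dG (Ue x) * He x))); last first.
  apply/funext => x; rewrite partialM; [|exact: test_smooth tphi|exact: smooth_comp].
  rewrite (partial_comp i x Gd sUe) addrC; congr (_ + _); first by rewrite mulrC.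
  by have [Kx|nKx] := pselect (K x); [rewrite parU|rewrite phi0// !mul0r].
move=> int0.
have bA := bG _ bU; have bB := bG _ bUe; have bC := bdG _ bU; have bD := bdG _ bUe.
have L_3 : L1 (fun x => partial i phi x * G (Ue x) + phi x * (dG (Ue x) * He x)).
  have := test_L1 (test_partial i tpsi); congr L1.
  apply/funext => x; rewrite partialM; [|exact: test_smooth tphi|exact: smooth_comp].
  rewrite (partial_comp i x Gd sUe) addrC; congr (_ + _); first by rewrite mulrC.
  by have [Kx|nKx] := pselect (K x); [rewrite parU|rewrite phi0// !mul0r].
rewrite -[X in `|X|]subr0 -int0 -rintB//; last exact: L1D.
apply: rint_small; first by apply: L1B => //; exact: L1D.
have bZ : borel_fun (fun x => H x * phi x) by borel.
have D1 x : `|G (U x) - G (Ue x)| <= M + M.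
  by apply: (le_trans (ler_normB _ _)); apply: lerD; have [] := MP 0 (U x); have [] := MP 0 (Ue x).
have D2 x : `|G (U x) - G (Ue x)| <= (M + M) * `|Ue x - U x|.
  by apply: (le_trans (Gl _ _)); rewrite distrC ler_wpM2r// lerDl.
have D3 x : `|dG (U x) - dG (Ue x)| <= M + M.
  by apply: (le_trans (ler_normB _ _)); apply: lerD; have [] := MP 0 (U x); have [] := MP 0 (Ue x).
have D4 x : `|dG (U x) - dG (Ue x)| <= (M + M) * `|Ue x - U x|.
  have [_ _] := MP (U x) (Ue x); move=> /le_trans; apply.
  by rewrite distrC ler_wpM2r// lerDl.
apply: (@le_trans _ _ (nnint (fun x => `|partial i phi x| * `|G (U x) - G (Ue x)| +
   (`|H x * phi x| * `|dG (U x) - dG (Ue x)| + (B * M + 1) * (indb 0 r x * `|He x - H x|)))%R)).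
  apply: le_nnint => [|||x]; [by borel|by borel|by []|].
  rewrite (_ : _ - _ = partial i phi x * (G (U x) - G (Ue x)) + (H x * phi x * (dG (U x) - dG (Ue x)) +
     phi x * dG (Ue x) * (H x - He x))); last by ring.
  apply: (le_trans (ler_normD _ _)); rewrite normrM lerD2l.
  apply: (le_trans (ler_normD _ _)); rewrite normrM lerD2l.
  have [[-> _]|[-> nx]] := indbP 0 r x; last first.
    by rewrite phi0 ?mul0r ?normr0 ?mulr0// => /Kr.
  rewrite mul1r !normrM [X in _ * X <= _]distrC ler_wpM2r//.
  have [_ dGM _] := MP 0 (Ue x).
  by apply: (@le_trans _ _ (B * M)); [exact: ler_pM|rewrite lerDl].
have p1 x : 0 <= (B * M + 1) * (indb 0 r x * `|He x - H x|).
  by rewrite mulr_ge0 ?(ltW BM1)// mulr_ge0// indb_ge0.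
rewrite nnintD; [|by borel|by borel|by move=> x; rewrite mulr_ge0|by move=> x; rewrite addr_ge0// mulr_ge0].
rewrite nnintD; [|by borel|by borel|by move=> x; rewrite mulr_ge0|by []].
rewrite (@nnintZ _ _ (B * M + 1)); [|exact: ltW|by borel|by move=> x; rewrite mulr_ge0// indb_ge0].
apply: (@le_trans _ _ (t%:E + (t%:E + (B * M + 1)%:E * (t / (B * M + 1))%:E))%E); last first.
  rewrite -EFinM -!EFinD lee_fin le_eqVlt; apply/orP; left; apply/eqP; field.
  by rewrite gt_eqF.
apply: leeD; first by apply: (E1 eps rho) => //; borel.
apply: leeD; first by apply: (E2 eps rho) => //; borel.
by apply: lee_wpmul2l; [rewrite lee_fin ltW|exact: E3 m].
Qed.

(** On [K] the mollifications of both gradients are the derivative of the same smooth function,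
    hence equal; each tends in L1 to the gradient it comes from. *)
Lemma wgrad_unique Omega u g h K i : 0 < kappa -> open Omega -> (forall K, compact K -> K `<=` Omega ->
    L1 (fun x => \1_K x * u x)) -> (forall i, locL1 Omega (g i)) -> (forall i, locL1 Omega (h i)) ->
  wgrad Omega u g -> wgrad Omega u h -> compact K -> K `<=` Omega ->
  ae (fun x => K x -> g i x = h i x).
Proof.
move=> kappa_gt0 oO uloc gloc hloc wg wh cK KO.
have [s [K' [s0 cK' K'O KK']]] := compact_thicken oO cK KO.
have [r r0 Kr] := compact_ball cK.
have [C C0 mol] := mollifier_exists kappa_gt0.
pose F x := \1_K' x * g i x; pose H x := \1_K' x * h i x.
have Fi : L1 F by exact: (proj2 (gloc i)).
have Hi : L1 H by exact: (proj2 (hloc i)).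
have bF := proj1 Fi; have bH := proj1 Hi.
have bK : borel_fun (\1_K : V -> R) by apply: borel_indic; exact: compact_borel.
have K0 x : 0 <= (\1_K x : R) by rewrite indicE.
have : nnint (fun x => \1_K x * `|F x - H x|) = 0%E.
  apply/eqP; rewrite eq_le nnint_ge0 ?andbT; last by move=> x; rewrite mulr_ge0.
  apply/lee_addgt0Pr => e e0; rewrite add0e.
  have e20 : 0 < e / 2 by exact: divr_gt0.
  have [e1 e10 E1] := mollify_L1 C Fi r0 e20.
  have [e2 e20' E2] := mollify_L1 C Hi r0 e20.
  pose eps := Num.min s (Num.min e1 e2).
  have eps0 : 0 < eps by rewrite !lt_min s0 e10 e20'.
  have [rho m] := mol eps eps0.
  have es : eps <= s by rewrite ge_min lexx.
  have ee1 : eps <= e1 by rewrite /eps !ge_min lexx ?orbT.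
  have ee2 : eps <= e2 by rewrite /eps !ge_min lexx ?orbT.
  have b1 := borel_conv m Fi; have b2 := borel_conv m Hi.
  have i0 x : 0 <= indb (0 : V) r x by exact: indb_ge0.
  apply: (@le_trans _ _ (nnint (fun x => indb 0 r x * `|conv F rho x - F x| +
     indb 0 r x * `|conv H rho x - H x|)%R)).
    apply: le_nnint => [|||x]; [by borel|by borel|by move=> x; rewrite mulr_ge0|].
    rewrite indicE; have [Kx|nKx] := pselect (K x); last first.
      by rewrite memNset// mul0r addr_ge0// mulr_ge0.
    rewrite mem_set// mul1r indb_in ?mul1r; last exact: Kr.
    suff -> : conv F rho x = conv H rho x.
      apply: le_trans (ler_normB _ _); rewrite le_eqVlt; apply/orP; left; apply/eqP.
      by rewrite -normrN; congr (`|_|); ring.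
    have sub y : `|x - y| <= eps -> K' y.
      by move=> xy; apply: (KK' x) => //; exact: le_trans es.
    by rewrite -(wgrad_conv i m wg K'O sub (uloc _ cK' K'O)) (wgrad_conv i m wh K'O sub (uloc _ cK' K'O)).
  rewrite nnintD; [|by borel|by borel|by move=> x; rewrite mulr_ge0|by move=> x; rewrite mulr_ge0].
  by rewrite [e]splitr EFinD; apply: leeD; [exact: E1 m|exact: E2 m].
move=> H0; have {H0} : ae (fun x => \1_K x * `|F x - H x| = 0).
  apply: nnint_eq0 => //; first by borel.
apply: aeS => x; rewrite /F /H => + Kx.
have K'x : K' x by apply: (KK' x x) => //; rewrite subrr normr0 ltW.
rewrite !indicE (mem_set Kx) (mem_set K'x) !mul1r => /eqP.
by rewrite normr_eq0 subr_eq0 => /eqP.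
Qed.

End weak_gradients.

(** * The Poincare inequality *)

Ltac nonneg := repeat first [done | exact: ltW | exact: sqr_ge0 | exact: exprn_even_ge0 |
  apply: exprn_ge0 | exact: powR_ge0 | exact: indb_ge0 | rewrite invr_ge0 | apply: mulr_ge0 |
  apply: addr_ge0 | apply: sumr_ge0 => ? _].

Section poincare.
Context {R : realType} {n : nat}.
Local Notation V := 'rV[R]_n.
Local Notation kappa := (@leb_unit_ball R n).
Implicit Types (f u v phi psi rho : V -> R) (g h : 'I_n -> V -> R) (x y z : V).
Local Notation e_ i := (delta_mx 0 i : V).

Lemma sqr_sum_le m (a : 'I_m -> R) : (\sum_i a i) ^+ 2 <= m%:R * \sum_i a i ^+ 2.
Proof.
elim: m a => [|m IH] a; first by rewrite !big_ord0 expr2 mulr0.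
rewrite !big_ord_recr/=; set S := \sum_(i < m) a _; set T := \sum_(i < m) a _ ^+ 2; set b := a ord_max.
have := IH (fun i => a (widen_ord (leqnSn m) i)); rewrite -/S -/T => H.
have : 2 * S * b <= T + m%:R * b ^+ 2.
  have -> : m%:R * b ^+ 2 = \sum_(i < m) b ^+ 2 by rewrite sumr_const card_ord mulr_natl.
  rewrite /S mulr_sumr mulr_suml /T -big_split/=.
  by apply: ler_sum => i _; have := sqr_ge0 (a (widen_ord (leqnSn m) i) - b); rewrite sqrrB; lra.
by rewrite sqrrD -natr1; lra.
Qed.

Lemma sqrD_le (a b : R) : (a + b) ^+ 2 <= 2 * a ^+ 2 + 2 * b ^+ 2.
Proof. by have := sqr_ge0 (a - b); rewrite sqrrB sqrrD; lra. Qed.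

(** Balls of the sup norm are products of intervals, so they contain every point lying
    coordinatewise between two of theirs; midpoints along an axis and staircase vertices are the
    cases used. *)
Lemma indb_coord x0 (r : R) x y z : ball x0 r x -> ball x0 r y ->
  (forall i, Num.min (x 0 i) (y 0 i) <= z 0 i <= Num.max (x 0 i) (y 0 i)) -> ball x0 r z.
Proof.
move=> xr yr H; have r0 := ball_gt0 xr.
move: xr yr => /(rV_ballP _ _ r0) xr /(rV_ballP _ _ r0) yr; apply/(rV_ballP _ _ r0) => i.
have := xr i; have := yr i; rewrite !ltr_norml => /andP[a1 a2] /andP[a3 a4].
have /andP[] := H i; rewrite ge_min le_max => /orP[]b1 /orP[]b2; apply/andP; split; lra.
Qed.

(** The mean over a ball of the sup norm, of volume [kappa * r ^+ n]; [trace_avg] relates it to the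
    Euclidean [ball_average]. *)
Definition avg v x (r : R) : R := rint (fun y => indb x r y * v y) / (kappa * r ^+ n).

Section smooth_case.
Variables (f : V -> R) (M : R) (x0 : V) (r : R).
Hypotheses (sf : smooth f) (r0 : 0 < r) (kappa_gt0 : 0 < kappa).
Hypotheses (fM : forall y, `|f y| <= M) (dfM : forall i y, `|partial i f y| <= M)
  (ddfM : forall i y, `|partial i (partial i f) y| <= M).

Let Phi a := nnint (fun x => indb x0 r x * indb x0 r (x + a) * (f (x + a) - f x) ^+ 2).
Let D i := rint (fun x => indb x0 r x * partial i f x ^+ 2).

Let bf := smooth_borel sf.
Let bdf i := smooth_borel (smooth_partial i sf).
Let M0 : 0 <= M := le_trans (normr_ge0 _) (fM 0).

#[local] Hint Resolve indb_ge0 : core.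

Local Lemma bPhi a : borel_fun (fun x => indb x0 r x * indb x0 r (x + a) * (f (x + a) - f x) ^+ 2).
Proof.
have bi : borel_fun (fun x => indb x0 r (x + a)) := borel_shift a (borel_indb x0 r).
by have bs : borel_fun (fun x => f (x + a)) := borel_shift a bf; borel.
Qed.

Local Lemma pPhi a x : 0 <= indb x0 r x * indb x0 r (x + a) * (f (x + a) - f x) ^+ 2.
Proof. by rewrite mulr_ge0 ?sqr_ge0// mulr_ge0. Qed.

Local Lemma LD i : L1 (fun x => indb x0 r x * partial i f x ^+ 2).
Proof.
apply: (L1M_bounded (M := M ^+ 2) (L1_indb _ _)); first by have b := bdf i; borel.
move=> y; rewrite normrX; have := dfM i y; rewrite -ler_sqr ?nnegrE//.
Qed.

(** Insert the midpoint, which stays in the ball. The point of the constant 4 is that it is exactly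
    the scaling of [s ^+ 2], so nothing is lost under iteration. *)
Local Lemma Phi_double i (s : R) : (Phi ((2 * s) *: e_ i) <= 4%:E * Phi (s *: e_ i))%E.
Proof.
pose psi x := indb x0 r x * indb x0 r (x + s *: e_ i) * (f (x + s *: e_ i) - f x) ^+ 2.
have bpsi : borel_fun psi by exact: bPhi.
have bpsi' : borel_fun (fun x => psi (x + s *: e_ i)) by exact: borel_shift.
have psi0 x : 0 <= psi x by exact: pPhi.
apply: (@le_trans _ _ (nnint (fun x => 2 * psi x + 2 * psi (x + s *: e_ i))%R)).
  apply: le_nnint => [|||x]; [exact: bPhi|by borel|exact: pPhi|].
  have H0 : 0 <= 2 * psi x + 2 * psi (x + s *: e_ i) by rewrite addr_ge0// mulr_ge0.
  have [[-> xr]|[-> _]] := indbP x0 r x; last by rewrite !mul0r.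
  have [[-> x2r]|[-> _]] := indbP x0 r (x + (2 * s) *: e_ i); last by rewrite mulr0 mul0r.
  have E : x + (2 * s) *: e_ i = x + s *: e_ i + s *: e_ i.
    by rewrite -addrA -scalerDl; congr (_ + _ *: _); ring.
  rewrite /psi -E !indb_in//; last first.
    apply: (indb_coord xr x2r) => j; rewrite !mxE eqxx/=.
    case: (j == i); rewrite /= ?mulr0 ?mulr1 ?addr0 ?minxx ?maxxx ?lexx//.
    rewrite ge_min le_max; have [s0|s0] := leP 0 s; apply/andP; split; apply/orP.
    - by left; lra.
    - by right; lra.
    - by right; lra.
    - by left; lra.
  rewrite !mul1r; apply: le_trans (sqrD_le _ _).
  by rewrite le_eqVlt; apply/orP; left; apply/eqP; congr (_ ^+ 2); ring.
rewrite nnintD; [|by borel|by borel|by move=> x; rewrite mulr_ge0|by move=> x; rewrite mulr_ge0].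
rewrite (@nnintZ _ _ 2 psi)// (@nnintZ _ _ 2 (fun x => psi (x + s *: e_ i)))//.
rewrite nnint_shift// -ge0_muleDl; [|by rewrite lee_fin|by rewrite lee_fin].
by rewrite -EFinD (_ : 2 + 2 = 4 :> R)//; ring.
Qed.

(** Halve the step [k] times by [Phi_double], then use Taylor's formula: the main term is
    independent of [k] and the remainder, [4 ^+ k] times the fourth power of [t / 2 ^+ k], tends to
    0. This stands in for integrating the derivative along lines. *)
Local Lemma Phi_axis i (t : R) : (Phi (t *: e_ i) <= (2 * t ^+ 2 * D i)%:E)%E.
Proof.
have D0 : 0 <= D i by apply: rint_ge0 => x; rewrite mulr_ge0 ?sqr_ge0.
have iter k : (Phi (t *: e_ i) <= (4 ^+ k)%:E * Phi ((t / 2 ^+ k) *: e_ i))%E.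
  elim: k => [|k IH]; first by rewrite !expr0 divr1 mul1e.
  apply: (le_trans IH); rewrite (_ : t / 2 ^+ k = 2 * (t / 2 ^+ k.+1)); last first.
    by rewrite exprS; field; rewrite expf_neq0.
  rewrite [4 ^+ k.+1]exprSr EFinM -muleA; apply: lee_wpmul2l; first by rewrite lee_fin exprn_ge0.
  exact: Phi_double.
pose K := 2 * M ^+ 2 * t ^+ 4 * (kappa * r ^+ n).
have K0 : 0 <= K.
  by rewrite /K; nonneg.
have step k : (Phi (t *: e_ i) <= (2 * t ^+ 2 * D i + K / 4 ^+ k)%:E)%E.
  apply: (le_trans (iter k)); set s := t / 2 ^+ k.
  have : (Phi (s *: e_ i) <= (2 * s ^+ 2 * D i + 2 * M ^+ 2 * s ^+ 4 * (kappa * r ^+ n))%:E)%E.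
    have b := bdf i.
    apply: (@le_trans _ _ (nnint (fun x => (2 * s ^+ 2) * (indb x0 r x * partial i f x ^+ 2) +
       (2 * M ^+ 2 * s ^+ 4) * indb x0 r x)%R)).
      apply: le_nnint => [|||x]; [exact: bPhi|by borel|exact: pPhi|].
      have c1 : 0 <= 2 * s ^+ 2 by rewrite mulr_ge0// sqr_ge0.
      have c2 : 0 <= 2 * M ^+ 2 * s ^+ 4 by nonneg.
      have [[-> _]|[-> _]] := indbP x0 r x; last by rewrite !(mul0r,mulr0) addr0.
      rewrite !mul1r mulr1; apply: (@le_trans _ _ ((f (x + s *: e_ i) - f x) ^+ 2)).
        by rewrite ler_piMl ?sqr_ge0// indb_le1.
      have T := axis_taylor (M := M) x s sf (ddfM i).
      rewrite -[f _ - f x](subrK (s * partial i f x)) addrC.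
      apply: (le_trans (sqrD_le _ _)); apply: lerD; first by rewrite exprMn mulrA.
      rewrite -mulrA ler_wpM2l//.
      rewrite -real_normK ?num_real// (_ : M ^+ 2 * s ^+ 4 = (M * s ^+ 2) ^+ 2); last by ring.
      by rewrite ler_sqr ?nnegrE// mulr_ge0// sqr_ge0.
    have c1 : 0 <= 2 * s ^+ 2 by rewrite mulr_ge0// sqr_ge0.
    have c2 : 0 <= 2 * M ^+ 2 * s ^+ 4 by nonneg.
    rewrite nnintD; [|by borel|by borel|by move=> x; rewrite mulr_ge0// mulr_ge0// sqr_ge0|by move=> x; rewrite mulr_ge0].
    rewrite (@nnintZ _ _ (2 * s ^+ 2)); [|by []|by borel|by move=> x; rewrite mulr_ge0 ?sqr_ge0].
    rewrite (@nnintZ _ _ (2 * M ^+ 2 * s ^+ 4)); [|by []|by borel|by []].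
    rewrite nnint_indb// -rint_nnint//; last exact: LD.
    by move=> x; nonneg.
  move=> H; apply: (@le_trans _ _ ((4 ^+ k)%:E * (2 * s ^+ 2 * D i + 2 * M ^+ 2 * s ^+ 4 * (kappa * r ^+ n))%:E)%E).
    by apply: lee_wpmul2l => //; rewrite lee_fin exprn_ge0.
  rewrite -EFinM lee_fin le_eqVlt; apply/orP; left; apply/eqP; rewrite /s /K.
  rewrite (_ : 4 = 2 ^+ 2 :> R); last by ring.
  by rewrite -exprM mulnC exprM; field; rewrite expf_neq0.
apply/lee_addgt0Pr => e e0.
have [k kP] : exists k, K / 4 ^+ k <= e.
  have /cvgrPdist_le /(_ e e0) [k _ kP] : (fun k => K * (4^-1) ^+ k) @ \oo --> (K * 0 : R).
    apply: cvgM; first exact: cvg_cst.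
    by apply: cvg_expr; rewrite ger0_norm// invf_lt1// ltr1n.
  exists k; have := kP k (leqnn k); rewrite mulr0 sub0r normrN ger0_norm ?exprVn//.
  by rewrite mulr_ge0// invr_ge0 exprn_ge0.
apply: (le_trans (step k)); rewrite -EFinD lee_fin lerD2l//.
Qed.

(** Split the increment along the staircase from [x] to [x + a], whose vertices stay in the ball,
    and apply Cauchy-Schwarz; translation brings each edge back to [Phi_axis]. *)
Local Lemma Phi_le a : `|a| <= 2 * r -> (Phi a <= (n%:R * (2 * (2 * r) ^+ 2 * \sum_i D i))%:E)%E.
Proof.
move=> ar; have D0 i : 0 <= D i by apply: rint_ge0 => x; rewrite mulr_ge0 ?sqr_ge0.
pose psi i x := indb x0 r x * indb x0 r (x + a 0 i *: e_ i) * (f (x + a 0 i *: e_ i) - f x) ^+ 2.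
have bpsi i : borel_fun (psi i) by exact: bPhi.
have psi0 i x : 0 <= psi i x by exact: pPhi.
have bpsi' i : borel_fun (fun x => psi i (x + axis_prefix a i)) by exact: borel_shift.
apply: (@le_trans _ _ (nnint (fun x => n%:R * \sum_(i < n) psi i (x + axis_prefix a i))%R)).
  have S0 x : 0 <= n%:R * \sum_(i < n) psi i (x + axis_prefix a i) by rewrite mulr_ge0// sumr_ge0.
  apply: le_nnint => [|||x]; [exact: bPhi|by apply: borelM; [borel|apply: borel_sum]|exact: pPhi|].
  have [[-> xr]|[-> _]] := indbP x0 r x; last by rewrite !mul0r.
  have [[-> xar]|[-> _]] := indbP x0 r (x + a); last by rewrite mulr0 mul0r.
  rewrite !mul1r axis_telescope; apply: (le_trans (sqr_sum_le _)).
  apply: ler_wpM2l => //; apply: ler_sum => i _.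
  have mid k : ball x0 r (x + axis_prefix a k).
    apply: (indb_coord xr xar) => j; rewrite !mxE.
    rewrite ge_min le_max; case: ifP => _; rewrite ?addr0 lexx ?orbT//.
  rewrite /psi -addrA -axis_prefixS !indb_in// !mul1r.
  by rewrite axis_prefixS addrA.
rewrite nnintZ//; [|by apply: borel_sum|by move=> x; rewrite sumr_ge0].
rewrite EFinM; apply: lee_wpmul2l; first by rewrite lee_fin.
rewrite nnint_sum// mulr_sumr -sumEFin; apply: lee_sum => i _.
rewrite nnint_shift//; apply: (le_trans (Phi_axis i (a 0 i))); rewrite lee_fin.
apply: ler_wpM2r => //; apply: ler_wpM2l => //.
rewrite -(real_normK (num_real (a 0 i))) ler_sqr ?nnegrE//; last by rewrite mulr_ge0// ltW.
exact: le_trans (rV_norm_coord _ _) ar.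
Qed.

(** By Jensen's inequality [(f x - c) ^+ 2] is at most the mean over [y] of [(f y - f x) ^+ 2].
    Writing [y = x + a] and exchanging integrals leaves the integral of [Phi] over the ball of
    radius [2 * r], divided by the volume of the ball of radius [r]; hence the factor [2 ^+ n]. *)
Lemma poincare_smooth : (nnint (fun x => indb x0 r x * (f x - avg f x0 r) ^+ 2)%R <=
  (2 ^+ n * (n%:R * (2 * (2 * r) ^+ 2 * \sum_i D i)))%:E)%E.
Proof.
set c := avg f x0 r; set K := n%:R * _.
pose m := kappa * r ^+ n; have m0 : 0 < m by rewrite mulr_gt0// exprn_gt0.
have Lf : L1 (fun y => indb x0 r y * f y) by apply: (L1M_bounded (M := M) (L1_indb _ _)).
have key x : (((f x - c) ^+ 2)%:E <= nnint (fun y => m^-1 * (indb x0 r y * (f y - f x) ^+ 2))%R)%E.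
  have Lq : L1 (fun y => indb x0 r y * (f y - f x) ^+ 2).
    apply: (L1M_bounded (M := (M + M) ^+ 2) (L1_indb _ _)); first by borel.
    move=> y; rewrite normrX ler_sqr ?nnegrE ?addr_ge0//.
    by rewrite (le_trans (ler_normB _ _))// lerD.
  rewrite -rint_nnint//; [|by move=> y; nonneg|exact: L1Z].
  rewrite lee_fin rintZ// -ler_pdivrMl ?invr_gt0// invrK.
  have : rint (fun y => (2 * (c - f x)) * (indb x0 r y * f y) -
       ((c - f x) * (c + f x)) * indb x0 r y) <= rint (fun y => indb x0 r y * (f y - f x) ^+ 2).
    apply: le_rint => //; first by apply: L1B; apply: L1Z => //; exact: L1_indb.
    move=> y; rewrite -subr_ge0.
    rewrite (_ : _ - _ = indb x0 r y * (f y - c) ^+ 2); first by rewrite mulr_ge0 ?sqr_ge0.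
    by ring.
  have i1 : rint (indb x0 r) = m.
    apply: EFin_inj; rewrite rint_nnint//; [exact: nnint_indb|exact: L1_indb].
  rewrite rintB; [|exact: L1Z|by apply: L1Z; exact: L1_indb].
  rewrite !rintZ//; last exact: L1_indb.
  have -> : rint (fun y => indb x0 r y * f y) = c * m by rewrite /c /avg divfK// gt_eqF.
  by rewrite i1; apply: le_trans; rewrite le_eqVlt; apply/orP; left; apply/eqP; ring.
have m1 : 0 <= m^-1 by rewrite invr_ge0 ltW.
have b2 : borel_fun2 (fun x (a : V) => m^-1 * (indb x0 r x * indb x0 r (x + a) * (f (x + a) - f x) ^+ 2)).
  apply: borel2M; first exact: borel2_cst.
  apply: borel2M; [apply: borel2M|apply: borel2X; apply: borel2B].
  - exact: borel2_fst (borel_indb _ _).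
  - exact: borel2_add (borel_indb _ _).
  - exact: borel2_add.
  - exact: borel2_fst.
have D0 i : 0 <= D i by apply: rint_ge0 => x; rewrite mulr_ge0 ?sqr_ge0.
have K0 : 0 <= K by rewrite /K; nonneg.
have -> : (2 ^+ n * K)%:E = nnint (fun a : V => (m^-1 * K) * indb 0 (2 * r) a).
  rewrite nnintZ; [|by rewrite mulr_ge0|by borel|by []].
  rewrite nnint_indb ?mulr_gt0// -EFinM exprMn /m; congr EFin.
  by field; rewrite !gt_eqF ?exprn_gt0.
apply: (nnint_tonelli_le b2).
- by move=> x h; apply: mulr_ge0 => //; exact: pPhi.
- by borel.
- by borel.
- by move=> x; nonneg.
- move=> x; have [[-> _]|[-> _]] := indbP x0 r x; last first.
    by rewrite mul0r nnint_ge0// => y; rewrite !mul0r mulr0.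
  rewrite mul1r; apply: (le_trans (key x)).
  rewrite -(@nnint_shift _ _ (fun y => m^-1 * (indb x0 r y * (f y - f x) ^+ 2)) x); [|by borel|].
    rewrite le_eqVlt; apply/orP; left; apply/eqP; congr nnint; apply/funext => y.
    by rewrite mul1r [y + x]addrC.
  by move=> y; nonneg.
- move=> h; have bh := bPhi h; have ph := pPhi h.
  rewrite (@nnintZ _ _ m^-1)//.
  have [[-> hr]|[-> hr]] := indbP 0 (2 * r) h.
    rewrite mulr1 EFinM; apply: lee_wpmul2l; first by rewrite lee_fin.
    by apply: Phi_le; move: hr => /rV_ball_norm; rewrite sub0r normrN => /ltW.
  rewrite mulr0 [X in (_ * X)%E](_ : _ = 0)%E ?mule0//; apply: integral0_eq => x _.
  have [[-> xr]|[-> _]] := indbP x0 r x; last by rewrite !mul0r.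
  have [[_ xhr]|[-> _]] := indbP x0 r (x + h); last by rewrite mulr0 mul0r.
  exfalso; apply: hr; move: xr xhr => /rV_ball_norm xr /rV_ball_norm xhr.
  apply/rV_ball_norm; rewrite sub0r (_ : - h = (x0 - (x + h)) - (x0 - x)).
    by rewrite (le_lt_trans (ler_normB _ _))// mulr_natl mulr2n ltrD.
  by apply/rowP => i; rewrite !mxE; ring.
Qed.

End smooth_case.

Lemma test_partial2_bounded rho : test_function setT rho ->
  exists2 M : R, 0 <= M & [/\ forall y, `|rho y| <= M,
    forall i y, `|partial i rho y| <= M & forall i y, `|partial i (partial i rho) y| <= M].
Proof.
move=> trho; have [M0 M00 M0P] := test_bounded trho.
have /choice[M1 M1P] i : exists M, 0 <= M /\ forall y, `|partial i rho y| <= M.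
  by have [M ? ?] := test_bounded (test_partial i trho); exists M.
have /choice[M2 M2P] i : exists M, 0 <= M /\ forall y, `|partial i (partial i rho) y| <= M.
  by have [M ? ?] := test_bounded (test_partial i (test_partial i trho)); exists M.
have s1 : 0 <= \sum_i M1 i by apply: sumr_ge0 => i _; exact: (M1P i).1.
have s2 : 0 <= \sum_i M2 i by apply: sumr_ge0 => i _; exact: (M2P i).1.
exists (M0 + \sum_i M1 i + \sum_i M2 i); first by rewrite !addr_ge0.
split=> [y|i y|i y]; first by apply: (le_trans (M0P y)); lra.
  have := (M1P i).2 y.
  have : M1 i <= \sum_i M1 i by rewrite (bigD1 i)//= lerDl sumr_ge0// => j _; exact: (M1P j).1.
  by lra.
have := (M2P i).2 y.
have : M2 i <= \sum_i M2 i by rewrite (bigD1 i)//= lerDl sumr_ge0// => j _; exact: (M2P j).1.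
by lra.
Qed.

Lemma conv_partial2_bounded f rho : L1 f -> test_function setT rho ->
  exists M : R, [/\ forall y, `|conv f rho y| <= M,
    forall i y, `|partial i (conv f rho) y| <= M &
    forall i y, `|partial i (partial i (conv f rho)) y| <= M].
Proof.
move=> fi trho; have [M M0 [MP0 MP1 MP2]] := test_partial2_bounded trho.
have B psi y : test_function setT psi -> (forall z, `|psi z| <= M) ->
    `|conv f psi y| <= M * rint (fun z => `|f z|).
  move=> tpsi psiM; apply: rint_mul_le => //.
  by apply: smooth_borel; apply: smooth_reflect; exact: test_smooth tpsi.
have E1 i : partial i (conv f rho) = conv f (partial i rho).
  by apply/funext => z; exact: partial_conv.
have t1 i := test_partial i trho.
exists (M * rint (fun z => `|f z|)); split=> [y|i y|i y]; first exact: B.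
  by rewrite E1; apply: B.
by rewrite E1 partial_conv//; apply: B => //; exact: test_partial.
Qed.

Lemma rint_indb x0 (r : R) : 0 < r -> rint (indb x0 r) = kappa * r ^+ n.
Proof.
move=> r0; apply: EFin_inj; rewrite rint_nnint; [exact: nnint_indb| |exact: L1_indb].
by move=> x; exact: indb_ge0.
Qed.

Lemma L1_indbM v (M : R) x0 (r : R) : borel_fun v -> (forall x, `|v x| <= M) ->
  L1 (fun x => indb x0 r x * v x).
Proof. by move=> bv vM; apply: (L1M_bounded (M := M) (L1_indb _ _)). Qed.

Lemma avg_dist u v x0 (r e : R) : 0 < kappa -> 0 < r ->
  L1 (fun x => indb x0 r x * u x) -> L1 (fun x => indb x0 r x * v x) ->
  (nnint (fun x => indb x0 r x * `|u x - v x|)%R <= e%:E)%E ->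
  `|avg u x0 r - avg v x0 r| <= e / (kappa * r ^+ n).
Proof.
move=> kappa_gt0 r0 Lu Lv H; have m0 : 0 < kappa * r ^+ n by rewrite mulr_gt0// exprn_gt0.
rewrite /avg -mulrBl normrM [X in _ * X]gtr0_norm ?invr_gt0// ler_pM2r ?invr_gt0//.
rewrite -rintB//; apply: rint_small; first exact: L1B.
apply: le_trans H; rewrite le_eqVlt; apply/orP; left; apply/eqP; congr nnint; apply/funext => x.
by rewrite -mulrBr normrM [X in X * _]ger0_norm// indb_ge0.
Qed.

Lemma avg0 x0 (r : R) : avg (fun=> 0) x0 r = 0.
Proof.
rewrite /avg (_ : rint _ = 0) ?mul0r//.
rewrite (_ : (fun y => _) = (fun y => 0 * indb x0 r y)); last by apply/funext => y; rewrite mulr0 mul0r.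
by rewrite rintZ ?mul0r//; exact: L1_indb.
Qed.

Lemma avg_bound v (M : R) x0 (r : R) : 0 < kappa -> 0 < r -> borel_fun v -> (forall x, `|v x| <= M) ->
  `|avg v x0 r| <= M.
Proof.
move=> kappa_gt0 r0 bv vM; have m0 : 0 < kappa * r ^+ n by rewrite mulr_gt0// exprn_gt0.
have M0 : 0 <= M := le_trans (normr_ge0 _) (vM 0).
have := @avg_dist v (fun=> 0) x0 r (M * (kappa * r ^+ n)) kappa_gt0 r0 (L1_indbM _ _ bv vM).
rewrite avg0 subr0 mulfK ?gt_eqF//; apply.
  by apply: (L1_indbM (M := 0)) => [|x]; [exact: borel_cst|rewrite normr0].
apply: (@le_trans _ _ (nnint (fun x => M * indb x0 r x)%R)).
  have bi := @borel_indb R n x0 r.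
  apply: le_nnint => [|||x]; [by borel|by borel|by move=> x; nonneg|].
  by rewrite subr0 mulrC ler_wpM2r ?indb_ge0.
rewrite nnintZ; [by rewrite nnint_indb|exact: M0|exact: borel_indb|].
by move=> x; exact: indb_ge0.
Qed.

(** Mollify [v], cut to the ball of radius [3 * r], at a scale at most [r]: the doubled radius on
    the right is the room this takes. As [v] is bounded by [M], the squares on the left differ by at
    most [4 * M] times first order differences, so L1 convergence suffices. *)
Lemma poincare v h (M : R) x0 (r : R) : 0 < kappa -> 0 < r -> borel_fun v -> (forall x, `|v x| <= M) ->
  (forall i, borel_fun (h i)) -> (forall i, L1 (fun x => indb x0 (3 * r) x * h i x)) ->
  wgrad setT v h ->
  (nnint (fun x => indb x0 r x * (v x - avg v x0 r) ^+ 2)%R <=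
   (2 ^+ n * n%:R * 8 * r ^+ 2)%:E * \sum_i nnint (fun x => indb x0 (2 * r) x * h i x ^+ 2)%R)%E.
Proof.
move=> kappa_gt0 r0 bv vM bh Lh wg.
have M0 : 0 <= M := le_trans (normr_ge0 _) (vM 0).
pose m := kappa * r ^+ n; have m0 : 0 < m by rewrite mulr_gt0// exprn_gt0.
pose r' := `|x0| + r; have r'0 : 0 < r' by rewrite ltr_wpDl.
pose U x := indb x0 (3 * r) x * v x; pose H i x := indb x0 (3 * r) x * h i x.
have Ui : L1 U by exact: L1_indbM vM.
have UM x : `|U x| <= M.
  by rewrite normrM ger0_norm ?indb_ge0// (le_trans _ (vM x))// ler_piMl// indb_le1.
have bU := proj1 Ui.
have [C C0 mol] := mollifier_exists kappa_gt0.
apply/lee_addgt0Pr => e e0.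
have M8 : 0 < 8 * M + 1 by rewrite ltr_wpDl// mulr_ge0.
(* Of the [8 * M], one half pays for replacing [v] by [f] and the other for replacing the mean of
   [v] by that of [f]. *)
have [eta eta0 E] := mollify_L1 C Ui r'0 (divr_gt0 e0 M8).
pose eps := Num.min r eta.
have eps0 : 0 < eps by rewrite lt_min r0 eta0.
have er : eps <= r by rewrite ge_min lexx.
have ee : eps <= eta by rewrite ge_min lexx orbT.
have [rho mr] := mol eps eps0.
have {}E := E eps rho eps0 ee mr.
pose f := conv U rho.
have trho := mol_test mr.
have sf : smooth f by exact: conv_smooth.
have bf := smooth_borel sf.
have [M' [f0 f1 f2]] := conv_partial2_bounded Ui trho.
have fM y : `|f y| <= M by exact: (conv_bound mr y Ui UM).
have P := poincare_smooth x0 sf r0 kappa_gt0 f0 f1 f2.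
pose c := avg v x0 r; pose cf := avg f x0 r.
have cM : `|c| <= M by exact: avg_bound.
have cfM : `|cf| <= M by exact: avg_bound.
have bi := @borel_indb R n x0 r.
have i0 x s : 0 <= indb x0 s x by exact: indb_ge0.
have {}E : (nnint (fun x => indb x0 r x * `|v x - f x|)%R <= (e / (8 * M + 1))%:E)%E.
  apply: le_trans E; apply: le_nnint => [|||x]; [by borel|by borel|by move=> x; nonneg|].
  have [[-> xr]|[-> _]] := indbP x0 r x; last by rewrite mul0r; nonneg.
  rewrite mul1r /U !indb_in ?mul1r 1?distrC//.
    by apply/rV_ball_norm; move: xr => /rV_ball_norm xr; apply: lt_le_trans xr _; rewrite ler_peMl ?(ltW r0)// ler1n.
  move: xr => /rV_ball_norm; rewrite distrC => xr; apply/rV_ball_norm.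
  by rewrite sub0r normrN -(subrK x0 x) (le_lt_trans (ler_normD _ _))// addrC ltrD2l.
have cc : `|c - cf| <= e / (8 * M + 1) / m.
  by apply: avg_dist => //; exact: L1_indbM.
have Pi i : ((rint (fun x => indb x0 r x * partial i f x ^+ 2))%:E <=
    nnint (fun x => indb x0 (2 * r) x * h i x ^+ 2)%R)%E.
  have bp := smooth_borel (smooth_partial i sf); have bhi := bh i.
  have bH : borel_fun (H i) by have [] := Lh i.
  have bC : borel_fun (conv (H i) rho) := borel_conv mr (Lh i).
  rewrite rint_nnint; last 2 first.
  - by move=> x; nonneg.
  - apply: (L1M_bounded (M := M' ^+ 2) (L1_indb _ _)); first by borel.
    by move=> y; rewrite normrX ler_sqr ?nnegrE//; exact: le_trans (normr_ge0 _) (f0 0).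
  apply: (@le_trans _ _ (nnint (fun x => indb x0 r x * conv (H i) rho x ^+ 2)%R)).
    apply: le_nnint => [|||x]; [by borel|by borel|by move=> x; nonneg|].
    have [[-> xr]|[-> _]] := indbP x0 r x; last by rewrite !mul0r.
    rewrite !mul1r (@wgrad_conv _ _ setT (ball x0 (3 * r)) C eps rho v h x i mr wg)//.
    move=> y xy; move: xr => /rV_ball_norm xr; apply/rV_ball_norm.
    by rewrite -(subrKA x) (le_lt_trans (ler_normD _ _))//; have := le_trans xy er; lra.
  apply: (le_trans (conv_sqr_ball mr x0 r (Lh i))).
  apply: le_nnint => [|||x]; [by borel|by borel|by move=> x; nonneg|].
  have [[-> xr]|[-> _]] := indbP x0 (r + eps) x; last by rewrite mul0r; nonneg.
  have x2r : ball x0 (2 * r) x.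
    by apply/rV_ball_norm; move: xr => /rV_ball_norm /lt_le_trans; apply; lra.
  have x3r : ball x0 (3 * r) x.
    by apply/rV_ball_norm; move: x2r => /rV_ball_norm /lt_le_trans; apply; lra.
  by rewrite !indb_in// !mul1r.
apply: (@le_trans _ _ (nnint (fun x => indb x0 r x * (f x - cf) ^+ 2 + (4 * M * (indb x0 r x * `|v x - f x|) +
   4 * M * `|c - cf| * indb x0 r x))%R)).
  apply: le_nnint => [|||x]; [by borel|by borel|by move=> x; nonneg|].
  have [[-> xr]|[-> _]] := indbP x0 r x; last by rewrite !mul0r !mulr0 !addr0.
  rewrite !mul1r mulr1 -lerBlDl -mulrDr.
  have -> : (v x - c) ^+ 2 - (f x - cf) ^+ 2 = (v x - c + (f x - cf)) * ((v x - f x) - (c - cf)) by ring.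
  apply: (le_trans (ler_norm _)); rewrite normrM; apply: ler_pM => //; last exact: ler_normB.
  apply: (le_trans (ler_normD _ _)); apply: (@le_trans _ _ ((M + M) + (M + M))); last by lra.
  by apply: lerD; apply: (le_trans (ler_normB _ _)); apply: lerD => //; exact: vM.
have M4 : 0 <= 4 * M by rewrite mulr_ge0.
rewrite nnintD; [|by borel|by borel|by move=> x; nonneg|by move=> x; nonneg].
apply: leeD.
  apply: (le_trans P); rewrite (_ : 2 ^+ n * _ = (2 ^+ n * n%:R * 8 * r ^+ 2) *
     \sum_i rint (fun x => indb x0 r x * partial i f x ^+ 2)); last by ring.
  rewrite EFinM -sumEFin; apply: lee_wpmul2l; first by rewrite lee_fin; nonneg.
  exact: lee_sum.
rewrite nnintD; [|by borel|by borel|by move=> x; nonneg|by move=> x; nonneg].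
rewrite (@nnintZ _ _ (4 * M)); [|by []|by borel|by move=> x; nonneg].
rewrite (@nnintZ _ _ (4 * M * `|c - cf|)); [|by nonneg|by borel|by []].
rewrite nnint_indb// -/m.
apply: (@le_trans _ _ ((4 * M)%:E * (e / (8 * M + 1))%:E + (4 * M * (e / (8 * M + 1) / m))%:E * m%:E)%E).
  apply: leeD; first exact: lee_wpmul2l.
  by rewrite -!EFinM lee_fin ler_pM2r// ler_wpM2l.
rewrite -!EFinM -EFinD lee_fin.
rewrite [leLHS](_ : _ = (8 * M) * (e / (8 * M + 1))); last by field; rewrite !gt_eqF.
by rewrite mulrCA ler_piMr ?(ltW e0)// ler_pdivrMr// mul1r lerDl.
Qed.

End poincare.

(** * Coverings and removable sets *)

Section geometry.
Context {R : realType} {n : nat}.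
Local Notation V := 'rV[R]_n.
Local Notation kappa := (@leb_unit_ball R n).
Implicit Types (x y z : V).

Lemma enorm_ge0 x : 0 <= enorm x. Proof. exact: sqrtr_ge0. Qed.

Lemma enorm_sqr x : enorm x ^+ 2 = \sum_i x 0 i ^+ 2.
Proof.
rewrite sqr_sqrtr; last by apply: sumr_ge0 => i _; rewrite -expr2 sqr_ge0.
by apply: eq_bigr => i _; rewrite expr2.
Qed.

Lemma rV_norm_le x (r : R) : 0 <= r -> (forall i, `|x 0 i| <= r) -> `|x| <= r.
Proof.
move=> r0 H; have : forall e, 0 < e -> `|x| <= r + e.
  move=> e e0; have /rV_ball_norm : ball (0 : V) (r + e) x.
    apply/rV_ballP => [|i]; first by rewrite ltr_wpDl.
    by rewrite mxE sub0r normrN (le_lt_trans (H i))// ltrDl.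
  by rewrite sub0r normrN => /ltW.
by move=> H'; apply/ler_addgt0Pr => e e0; exact: H'.
Qed.

Lemma norm_enorm x : `|x| <= enorm x.
Proof.
apply: rV_norm_le (enorm_ge0 x) _ => i.
rewrite -ler_sqr ?nnegrE ?enorm_ge0// enorm_sqr real_normK ?num_real//.
by rewrite (bigD1 i)//= lerDl sumr_ge0// => j _; exact: sqr_ge0.
Qed.

Lemma enorm_norm x : enorm x <= n%:R * `|x|.
Proof.
have nn : 0 <= n%:R * `|x| by rewrite mulr_ge0.
rewrite -ler_sqr ?nnegrE ?enorm_ge0// enorm_sqr exprMn.
apply: (@le_trans _ _ (\sum_(i < n) `|x| ^+ 2)).
  apply: ler_sum => i _; rewrite -(real_normK (num_real (x 0 i))).
  by rewrite ler_sqr ?nnegrE//; exact: rV_norm_coord.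
rewrite sumr_const card_ord -[_ *+ n]mulr_natl; apply: ler_wpM2r; first exact: sqr_ge0.
rewrite expr2 -natrM ler_nat; case: (n) => // m; exact: leq_pmulr.
Qed.

Lemma eball_ball x (r : R) : eball x r `<=` ball x r.
Proof.
move=> y xy; apply/rV_ball_norm; rewrite distrC; exact: le_lt_trans (norm_enorm _) xy.
Qed.

Lemma ball_eball x (r : R) : (0 < n)%N -> ball x r `<=` eball x (n%:R * r).
Proof.
move=> n0 y /rV_ball_norm xy; apply: (le_lt_trans (enorm_norm _)).
by rewrite distrC ltr_pM2l// ltr0n.
Qed.

(** Zorn's lemma on disjoint subfamilies such that any ball of the family meeting one of theirs also
    meets one of theirs with at least half its radius. If a maximal subfamily missed some ball,
    adding a ball of almost maximal radius among the missed ones would preserve the property. *)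
Lemma vitali (S : set V) (t : V -> R) (T : R) :
  (forall x, S x -> 0 < t x <= T) -> exists D : set V, [/\ D `<=` S,
    (forall x y, D x -> D y -> ball x (t x) `&` ball y (t y) !=set0 -> x = y) &
    forall x, S x -> exists2 y, D y & ball x (t x) `&` ball y (t y) !=set0 /\ t x <= 2 * t y].
Proof.
move=> tT.
pose P (D : set V) := [/\ D `<=` S,
  (forall x y, D x -> D y -> ball x (t x) `&` ball y (t y) !=set0 -> x = y) &
  forall x z, S x -> D z -> ball x (t x) `&` ball z (t z) !=set0 ->
    exists2 y, D y & ball x (t x) `&` ball y (t y) !=set0 /\ t x <= 2 * t y].
have [|D [[DS Dd Dc] Dmax]] := @Zorn_bigcup _ P.
  move=> F FP Ft; split.
  - by move=> x [D FD Dx]; have [+ _ _] := FP D FD; exact.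
  - move=> x y [D FD Dx] [E FE Ey].
    have [DE|ED] := Ft D E FD FE.
      by have [_ + _] := FP E FE; apply => //; exact: DE.
    by have [_ + _] := FP D FD; apply => //; exact: ED.
  - move=> x z Sx [D FD Dz] xz; have [_ _ H] := FP D FD.
    by have [y Dy yP] := H x z Sx Dz xz; exists y => //; exists D.
exists D; split=> // x Sx; apply: contrapT => nx.
pose S' := [set z | S z /\ forall y, D y -> ~ (ball z (t z) `&` ball y (t y) !=set0)].
have S'x : S' x.
  by split => // y Dy xy; apply: nx; exact: Dc Sx Dy xy.
have supS : has_sup (t @` S').
  split; first by exists (t x), x.
  by exists T => _ [z [Sz _] <-]; have /andP[] := tT z Sz.
have [z S'z tz] : exists2 z, S' z & sup (t @` S') < 2 * t z.
  have sup0 : 0 < sup (t @` S').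
    have /andP[tx0 _] := tT x Sx; apply: (lt_le_trans tx0); apply: ub_le_sup; last by exists x.
    by have [] := supS.
  have [_ [z S'z <-]] := sup_adherent (divr_gt0 sup0 (ltr0n _ 2)) supS.
  by rewrite {1}[sup _]splitr addrK => H; exists z => //; lra.
have tle y : S' y -> t y <= 2 * t z.
  by move=> S'y; apply: (le_trans _ (ltW tz)); apply: ub_le_sup; [have [] := supS|exists y].
have z0 : 0 < t z by have /andP[] := tT z S'z.1.
have nDz : ~ D z.
  move=> Dz; apply: (S'z.2 z Dz); exists z; split; exact: ballxx.
apply: (Dmax (D `|` [set z])).
  by split; [by move=> y; left|move=> /(_ z) H; apply: nDz; apply: H; right].
split.
- by move=> y [/DS//|->]; exact: S'z.1.
- move=> a b [Da|->] [Db|->] //; first exact: Dd.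
    by rewrite setIC => /(S'z.2 a Da).
  by move=> /(S'z.2 b Db).
- move=> y w Sy Dw yw; have [[v [Dv yv]]|H] := pselect (exists v, D v /\ ball y (t y) `&` ball v (t v) !=set0).
    by have [u Du uP] := Dc y v Sy Dv yv; exists u => //; left.
  have S'y : S' y by split => // v Dv yv; apply: H; exists v.
  case: Dw yw => [Dw yw|-> yw]; first by exfalso; apply: H; exists w.
  by exists z; [right|split => //; exact: tle].
Qed.

Lemma rat_point x (r : R) : 0 < r -> exists q : 'rV[rat]_n, ball x r (\row_i ratr (q 0 i)).
Proof.
move=> r0; have /choice[q qP] i : exists q : rat, `|x 0 i - ratr q| < r.
  have [|q] := @rat_in_itvoo R (x 0 i - r) (x 0 i + r); first by lra.
  by rewrite in_itv/= => /andP[q1 q2]; exists q; rewrite ltr_norml; apply/andP; split; lra.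
by exists (\row_i q i); apply/rV_ballP => // i; rewrite !mxE.
Qed.

(** The dilates by 5 of a disjoint Vitali subfamily cover [S]. Upper regularity bounds the content
    of each by the integral of [f] over the original ball, and disjointness adds these integrals up
    to at most [nnint f]. *)
Lemma hausdorff_vitali (d C : R) (S : set V) (t : V -> R) (T A : R) (f : V -> R) :
  (forall x, S x -> 0 < t x <= T) -> 0 <= A -> 0 <= C -> 0 < d ->
  (forall x r, S x -> 0 < r -> (hausdorff_outer d (S `&` ball x r) <= (C * r `^ d)%:E)%E) ->
  borel_fun f -> (forall x, 0 <= f x) ->
  (forall x, S x -> ((t x `^ d)%:E <= A%:E * nnint (fun y => indb x (t x) y * f y)%R)%E) ->
  (hausdorff_outer d S <= (C * 5 `^ d * A)%:E * nnint f)%E.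
Proof.
move=> tT A0 C0 d0 Sreg bf f0 St.
have [D [DS Dd Dc]] := vitali tT.
have t0 x : D x -> 0 < t x by move=> /DS /tT /andP[].
have /choice[q qP] x : exists q : 'rV[rat]_n, D x -> ball x (t x) (\row_i ratr (q 0 i)).
  have [Dx|nDx] := pselect (D x); last by exists 0 => /nDx.
  by have [q qx] := rat_point x (t0 x Dx); exists q.
have qinj x y : D x -> D y -> q x = q y -> x = y.
  move=> Dx Dy qxy; apply: Dd => //; exists (\row_i ratr (q x 0 i)); split; first exact: qP.
  by rewrite qxy; exact: qP.
(* The disjoint balls are enumerated by the codes of rational points chosen in them; a code that is
   not attained gives the empty set. *)
pose E k : set V := [set y | exists2 x, D x & pickle (q x) = k /\ ball x (t x) y].
pose F k : set V := [set y | S y /\ exists2 x, D x & pickle (q x) = k /\ ball x (5 * t x) y].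
have cE k : (exists2 x, D x & pickle (q x) = k /\ E k = ball x (t x) /\ F k = S `&` ball x (5 * t x)) \/
    (E k = set0 /\ F k = set0).
  have [[x [Dx xk]]|H] := pselect (exists x, D x /\ pickle (q x) = k); last first.
    right; split; apply/seteqP; split => // y.
      by move=> [x Dx [xk _]]; apply: H; exists x.
    by move=> [_ [x Dx [xk _]]]; apply: H; exists x.
  left; exists x => //; split => //; split; apply/seteqP; split => y.
  - move=> [x' Dx' [x'k x'y]]; suff <- : x' = x by [].
    by apply: qinj => //; apply: (pcan_inj pickleK); rewrite x'k.
  - by move=> xy; exists x.
  - move=> [Sy [x' Dx' [x'k x'y]]]; split => //; suff <- : x' = x by [].
    by apply: qinj => //; apply: (pcan_inj pickleK); rewrite x'k.
  - by move=> [Sy xy]; split => //; exists x.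
have mE k : measurable (E k : set (@borelV R n)).
  have [[x _ [_ [-> _]]]|[-> _]] := cE k; last exact: measurable0.
  by apply: measurable_open_borel; exact: ball_open.
have bE k : borel_fun (fun y => \1_(E k) y * f y) by apply: borelM => //; exact: borel_indic.
have E0 k y : 0 <= \1_(E k) y * f y by rewrite mulr_ge0// indicE.
have FE k : (hausdorff_outer d (F k) <= (C * 5 `^ d * A)%:E * nnint (fun y => \1_(E k) y * f y)%R)%E.
  have [[x Dx [_ [-> ->]]]|[_ ->]] := cE k; last first.
    by rewrite outer_measure0 mule_ge0 ?nnint_ge0// lee_fin; nonneg; exact: powR_ge0.
  have tx0 := t0 x Dx.
  apply: (le_trans (Sreg x _ (DS x Dx) _)); first by rewrite mulr_gt0.
  rewrite powRM// ?(ltW tx0)// mulrA EFinM [X in (_ <= X * _)%E]EFinM -muleA.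
  by apply: lee_wpmul2l; [rewrite lee_fin; nonneg; exact: powR_ge0|exact: St x (DS x Dx)].
have SF : S `<=` \bigcup_k F k.
  move=> x Sx; have [y Dy [[z [xz yz]] txy]] := Dc x Sx.
  exists (pickle (q y)) => //; split => //; exists y => //; split => //.
  have /andP[tx0 _] := tT x Sx; have ty0 := t0 y Dy.
  move: xz yz => /rV_ball_norm xz /rV_ball_norm yz; apply/rV_ball_norm.
  rewrite -(subrKA z) (le_lt_trans (ler_normD _ _))// [X in _ + X]distrC; lra.
apply: (le_trans (le_outer_measure (hausdorff_outer d) _ _ SF)).
apply: (le_trans (outer_measure_sigma_subadditive (hausdorff_outer d) F)).
apply: lime_le; first by apply: is_cvg_nneseries => k _ _; exact: outer_measure_ge0.
apply: nearW => N.
apply: (@le_trans _ _ (\sum_(0 <= k < N) (C * 5 `^ d * A)%:E * nnint (fun y => \1_(E k) y * f y)%R)%E).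
  by apply: lee_sum => k _; exact: FE.
rewrite -ge0_sume_distrr; last by move=> k _; exact: nnint_ge0.
apply: lee_wpmul2l; first by rewrite lee_fin; nonneg; exact: powR_ge0.
rewrite -(@nnint_sum _ _ _ (index_iota 0 N) (fun k y => \1_(E k) y * f y))//.
apply: le_nnint => //; first by apply: borel_sum.
  by move=> y; exact: sumr_ge0.
move=> y; rewrite -mulr_suml ler_piMl//.
have [[k [kN Eky]]|H] := pselect (exists k, (k < N)%N /\ E k y); last first.
  rewrite big_nat big1// => k /andP[_ kN]; rewrite indicE memNset// => Eky.
  by apply: H; exists k.
rewrite big_mkord (bigD1 (Ordinal kN))//= big1 ?addr0.
  by rewrite indicE lern1 leq_b1.
move=> j jk; rewrite indicE memNset// => Ejy; move/eqP: jk; apply; apply/val_inj => /=.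
move: Eky Ejy => [x Dx [<- xy]] [x' Dx' [<- x'y]].
by rewrite (Dd x x' Dx Dx')//; exists y.
Qed.

(** A set of diameter D at most [del] contributes [D ^+ n.-1], which is at most [del]^ p * D [^ d],
    to the (n-1)-dimensional sum: the positive power of [del] beats the finite measure. Each set of
    the cover is put in a ball centred at one of its points in [S], and compactness makes the cover
    finite. *)
Lemma hausdorff_cover (d : R) (S : set V) (e : R) : (2 <= n)%N -> 0 < d -> d < n%:R - 1 -> compact S ->
  (hausdorff_outer d S < +oo)%E -> 0 < e ->
  exists s : seq (V * R), [/\ forall q, q \in s -> S q.1 /\ 0 < q.2 <= e,
    S `<=` [set x | exists2 q, q \in s & ball q.1 q.2 x] &
    \sum_(q <- s) q.2 ^+ n.-1 <= e].
Proof.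
move=> n2 d0 dn cS Sfin e0.
pose p : R := n%:R - 1 - d; have p0 : 0 < p by rewrite subr_gt0.
have S0 := outer_measure_ge0 (hausdorff_outer d) S.
pose H := fine (hausdorff_outer d S).
have HE : hausdorff_outer d S = H%:E by rewrite fineK// ge0_fin_numE.
have H0 : 0 <= H by rewrite -lee_fin -HE.
have n1E : n.-1%:R = n%:R - 1 :> R by case: (n) n2 => // m _; rewrite -natr1 addrK.
have n1 : (0 < n.-1)%N by case: (n) n2 => // -[].
pose K : R := 2 ^+ n.-1 * (H + 3).
have K0 : 0 < K by rewrite mulr_gt0 ?exprn_gt0// ltr_wpDl.
pose del := Num.min (Num.min 1 (e / 2)) (Num.min (e / K) ((e / K) `^ p^-1)).
have eK : 0 < e / K by exact: divr_gt0.
have del0 : 0 < del by rewrite !lt_min ltr01 divr_gt0//= eK powR_gt0.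
have del1 : del <= 1 by rewrite /del !ge_min lexx.
have del2 : del <= e / 2 by rewrite /del !ge_min lexx !orbT.
have del3 : del <= e / K by rewrite /del !ge_min lexx !orbT.
have del4 : del `^ p <= e / K.
  have : del <= (e / K) `^ p^-1 by rewrite /del !ge_min lexx !orbT.
  move=> /(ge0_ler_powR (ltW p0)); rewrite !nnegrE ?powR_ge0 (ltW del0) => /(_ isT isT).
  by rewrite -powRrM mulVf ?gt_eqF// powRr1// ltW.
have [F [SF Fsum]] : exists F : nat -> set V, S `<=` \bigcup_k F k /\
    (\sum_(k <oo) hausdorff_gauge d del (F k) < (H + 1)%:E)%E.
  have : (cover_outer (hausdorff_gauge d del) S < (H + 1)%:E)%E.
    apply: (@le_lt_trans _ _ H%:E); last by rewrite lte_fin ltrDl.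
    by rewrite -HE; apply: ereal_sup_ubound; exists del.
  by move=> /ereal_inf_lt[_ [F SF <-] Flt]; exists F.
have g0 k := hausdorff_gauge_ge0 d del (F k).
have part N : (\sum_(k < N) hausdorff_gauge d del (F k) <= (H + 1)%:E)%E.
  apply: le_trans (ltW Fsum); rewrite -(big_mkord xpredT (fun k => hausdorff_gauge d del (F k))).
  exact: nneseries_lim_ge.
have gk k : (hausdorff_gauge d del (F k) <= (H + 1)%:E)%E.
  apply: (le_trans _ (part k.+1)); rewrite big_ord_recr/=; apply: leeDr; apply: sume_ge0 => i _; exact: g0.
pose D k := fine (ediam (F k)).
have Dk k x : F k x -> [/\ 0 <= D k, D k <= del, ediam (F k) = (D k)%:E &
    hausdorff_gauge d del (F k) = (D k `^ d)%:E].
  move=> Fx; have F0 : F k != set0 by apply/set0P; exists x.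
  have D0 : (0%:E <= ediam (F k))%E.
    apply: (@le_trans _ _ (enorm (x - x))%:E); first by rewrite lee_fin enorm_ge0.
    by apply: ereal_sup_ubound; exists (x, x).
  have := gk k; rewrite /hausdorff_gauge (negbTE F0); case: ifPn => [dd _|]; last by rewrite leye_eq.
  have Dfin : ediam (F k) \is a fin_num by rewrite ge0_fin_numE// (le_lt_trans dd)// ltry.
  split => //; rewrite -?lee_fin /D ?fineK//.
(* A summable positive lower bound for the radii, since a set of the cover may have diameter 0 while
   the balls must be open and nonempty. *)
pose tau k : R := del / 2 ^+ k.+1.
have tau0 k : 0 < tau k by rewrite divr_gt0// exprn_gt0.
have tau_sum N : \sum_(k < N) tau k <= del.
  suff -> : \sum_(k < N) tau k = del - del / 2 ^+ N.
    by rewrite lerBlDr lerDl divr_ge0 ?exprn_ge0// ltW.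
  elim: N => [|N IH]; first by rewrite big_ord0 expr0 divr1 subrr.
  by rewrite big_ord_recr/= IH /tau exprS; field; rewrite expf_neq0.
have tau_del k : tau k <= del.
  apply: le_trans (tau_sum k.+1); rewrite big_ord_recr/= lerDr sumr_ge0// => i _; exact: ltW.
have /choice[c cP] k : exists c, (exists2 x, F k x & S x) -> F k c /\ S c.
  have [[x Fx Sx]|nx] := pselect (exists2 x, F k x & S x); first by exists x.
  by exists 0 => /nx.
pose r k := 2 * Num.max (D k) (tau k).
have r0 k : 0 < r k by rewrite mulr_gt0// lt_max tau0 orbT.
pose good k := exists2 x, F k x & S x.
have re k : good k -> r k <= e.
  move=> [x Fx _]; have [_ Dd _ _] := Dk k x Fx; rewrite /r.
  have : Num.max (D k) (tau k) <= del by rewrite ge_max Dd tau_del.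
  by lra.
have rpow k : good k -> r k ^+ n.-1 <= 2 ^+ n.-1 * (del `^ p * D k `^ d + tau k).
  move=> [x Fx _]; have [D0 Dd _ _] := Dk k x Fx; rewrite /r exprMn; apply: ler_wpM2l.
    exact: exprn_ge0.
  have A1 : D k ^+ n.-1 <= del `^ p * D k `^ d.
    have [->|Dn0] := eqVneq (D k) 0.
      by rewrite expr0n gtn_eqF// mulr_ge0// powR_ge0.
    rewrite -powR_mulrn// n1E (_ : n%:R - 1 = p + d); last by rewrite /p subrK.
    rewrite powRD; last by rewrite Dn0 implybT.
    by apply: ler_wpM2r; [exact: powR_ge0|apply: ge0_ler_powR; rewrite ?nnegrE// ltW].
  have A2 : tau k ^+ n.-1 <= tau k.
    rewrite -[leRHS]expr1; apply: ler_wiXn2l => //; first exact: ltW.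
    exact: le_trans (tau_del k) del1.
  have B1 : 0 <= del `^ p * D k `^ d by rewrite mulr_ge0// powR_ge0.
  have B2 := ltW (tau0 k).
  by have [_|_] := leP (D k) (tau k); lra.
have cover : S `<=` cover (good : set nat) (fun k => ball (c k) (r k)).
  move=> x Sx; have [k _ Fx] := SF x Sx; have gk' : good k by exists x.
  exists k => //; have [Fc Sc] := cP k gk'.
  have [D0 Dd DE _] := Dk k x Fx.
  apply/rV_ball_norm; apply: (le_lt_trans (norm_enorm _)).
  have : enorm (c k - x) <= D k.
    by rewrite -lee_fin -DE; apply: ereal_sup_ubound; exists (c k, x).
  move=> H1; apply: (@le_lt_trans _ _ (Num.max (D k) (tau k))); first by rewrite le_max H1.
  have : 0 < Num.max (D k) (tau k) by rewrite lt_max tau0 orbT.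
  by rewrite /r; lra.
have := cS; rewrite compact_cover => /(_ _ _ _ _ cover)[|I Igood Icov].
  by move=> k _; exact: ball_open.
pose N := (\max_(k <- finmap.enum_fset I) k).+1.
pose s := [seq k <- iota 0 N | `[< good k >]].
exists [seq (c k, r k) | k <- s]; split.
- move=> q /mapP[k]; rewrite mem_filter => /andP[/asboolP gk' _] -> /=.
  by split; [exact: (cP k gk').2|rewrite r0 re].
- move=> x /Icov[k /= Ik xk]; exists (c k, r k) => //.
  apply: map_f; rewrite mem_filter mem_iota/= add0n; apply/andP; split.
    by apply/asboolP; have := Igood k Ik; rewrite inE.
  by rewrite ltnS; apply: leq_bigmax_seq.
rewrite big_map.
apply: (@le_trans _ _ (\sum_(k <- iota 0 N | `[< good k >]) 2 ^+ n.-1 * (del `^ p * D k `^ d + tau k))).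
  by rewrite big_filter; apply: ler_sum => k /asboolP; exact: rpow.
apply: (@le_trans _ _ (2 ^+ n.-1 * (del `^ p * (H + 1) + del))); last first.
  have : del `^ p * (H + 1) <= e / K * (H + 1) by rewrite ler_wpM2r// addr_ge0.
  move=> Q; apply: (@le_trans _ _ (2 ^+ n.-1 * (e / K * (H + 1) + e / K))).
    by rewrite ler_wpM2l ?exprn_ge0// lerD.
  rewrite (_ : _ * _ = e * ((2 ^+ n.-1 * (H + 2)) / K)); last by ring.
  rewrite ler_piMr ?(ltW e0)// ler_pdivrMr// mul1r /K ler_wpM2l ?exprn_ge0// lerD2l.
  by lra.
rewrite -mulr_sumr ler_wpM2l ?exprn_ge0// big_split/=; apply: lerD; last first.
  apply: le_trans (tau_sum N); rewrite -(big_mkord xpredT tau) /index_iota subn0.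
  rewrite [leRHS](bigID (fun k => `[< good k >]))/= lerDl sumr_ge0// => k _; exact: ltW.
rewrite -mulr_sumr ler_wpM2l ?powR_ge0//.
rewrite -lee_fin -sumEFin; apply: le_trans (part N).
rewrite -(big_mkord xpredT (fun k => hausdorff_gauge d del (F k))) /index_iota subn0.
rewrite [X in (_ <= X)%E](bigID (fun k => `[< good k >]))/=.
apply: (@le_trans _ _ (\sum_(k <- iota 0 N | `[< good k >]) hausdorff_gauge d del (F k))%E).
  apply: lee_sum => k /asboolP[x Fx _]; have [_ _ _ ->] := Dk k x Fx.
  by [].
by rewrite leeDl// sume_ge0.
Qed.

End geometry.

(** * Removability of sets of zero (n-1)-dimensional content *)

Section removability.
Context {R : realType} {n : nat}.
Local Notation V := 'rV[R]_n.
Local Notation kappa := (@leb_unit_ball R n).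
Implicit Types (x y z : V) (u v phi psi : V -> R) (h : 'I_n -> V -> R) (Gamma : set V).

(* The (n-1)-dimensional content of [Gamma] is locally zero. *)
Definition thin Gamma := forall r e : R, 0 < e ->
  exists s : seq (V * R), [/\ forall q, q \in s -> Gamma q.1 /\ 0 < q.2 <= e,
    Gamma `&` [set x | `|x| <= r] `<=` [set x | exists2 q, q \in s & ball q.1 q.2 x] &
    \sum_(q <- s) q.2 ^+ n.-1 <= e].

(** [eta] is the product of the [1 - theta q]. It vanishes wherever one [theta q] is 1, and both
    [1 - eta] and the gradient are controlled by plain sums because all factors lie between 0 and
    1. *)
Lemma cutoff_product (s : seq (V * R)) (theta : V * R -> V -> R) :
  (forall q, q \in s -> smooth (theta q) /\ forall x, 0 <= theta q x <= 1) ->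
  exists eta : V -> R, [/\ smooth eta, forall x, 0 <= eta x <= 1,
    forall x, 1 - eta x <= \sum_(q <- s) theta q x,
    forall i x, `|partial i eta x| <= \sum_(q <- s) `|partial i (theta q) x| &
    forall q x, q \in s -> theta q x = 1 -> eta x = 0].
Proof.
elim: s => [_|q s IH H].
  exists (fun=> 1); split => //.
  - exact: smooth_cst.
  - by move=> x; rewrite ler01 lexx.
  - by move=> x; rewrite big_nil subrr.
  - move=> i x; rewrite big_nil (_ : partial _ _ _ = 0) ?normr0//.
    apply: partial_eq; exact: is_derive_cst.
have [|eta [seta eta01 eta1 deta eta0]] := IH.
  by move=> q' q's; apply: H; rewrite inE q's orbT.
have [stheta theta01] := H q (mem_head q s).
have s1 : smooth (fun x => 1 - theta q x) by exact: smoothB (smooth_cst 1) stheta.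
exists (fun x => eta x * (1 - theta q x)); split.
- exact: smoothM.
- move=> x; have /andP[a b] := eta01 x; have /andP[c d] := theta01 x.
  have d' : 0 <= 1 - theta q x by lra.
  rewrite mulr_ge0//=; apply: (@le_trans _ _ (1 * (1 - theta q x))); last lra.
  exact: ler_wpM2r.
- move=> x; rewrite big_cons; have /andP[a b] := eta01 x; have /andP[c d] := theta01 x.
  have := eta1 x; have : eta x * theta q x <= theta q x by rewrite ler_piMl.
  by lra.
- move=> i x; rewrite partialM// big_cons.
  have -> : partial i (fun y => 1 - theta q y) x = - partial i (theta q) x.
    rewrite -[RHS]add0r; apply: partial_eq.
    by apply: is_deriveB; exact: smooth_is_derive.
  have /andP[a b] := eta01 x; have /andP[c d] := theta01 x.
  apply: (le_trans (ler_normD _ _)); rewrite !normrM normrN; apply: lerD.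
    by rewrite ler_piMl// ger0_norm.
  apply: le_trans (deta i x); rewrite ler_piMl// ger0_norm; lra.
- move=> q' x; rewrite inE => /orP[/eqP->|q's] t1; first by rewrite t1 subrr mulr0.
  by rewrite (eta0 q' x q's t1) mul0r.
Qed.

(** The gradient of a cutoff adapted to a ball of radius s has integral of order [s ^+ n.-1], and
    these are the quantities whose sum [thin] makes small. Only the part of Gamma in the ball of
    radius [r] is covered, hence the condition on the support of [phi]. *)
Lemma thin_cutoff Gamma : 0 < kappa -> (0 < n)%N -> thin Gamma -> closed Gamma ->
  exists2 C : R, 0 < C & forall r e : R, 0 < e -> e <= 1 ->
  exists eta : V -> R, [/\ smooth eta, forall x, 0 <= eta x <= 1,
    (forall phi, test_function setT phi -> (forall x, ~ ball (0 : V) r x -> phi x = 0) ->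
       test_function (~` Gamma) (fun x => eta x * phi x)),
    (nnint (fun x => 1 - eta x)%R <= (C * e)%:E)%E &
    forall i, (nnint (fun x => `|partial i eta x|)%R <= (C * e)%:E)%E].
Proof.
move=> kappa_gt0 n0 thinG clG.
have [C C0 cut] := @cutoff_exists R n kappa_gt0.
exists ((C + 1) * (kappa * 3 ^+ n)).
  by rewrite !mulr_gt0 ?exprn_gt0// ltr_wpDl// ltW.
move=> r e e0 e1; have [s [sP scov ssum]] := thinG r e e0.
have /choice[theta thetaP] (q : V * R) : exists theta : V -> R, q \in s ->
    [/\ smooth theta, forall x, 0 <= theta x <= 1, forall x, ball q.1 q.2 x -> theta x = 1,
     forall x, ~ ball q.1 (3 * q.2) x -> theta x = 0 &
     forall i x, `|partial i theta x| <= C / q.2 * indb q.1 (3 * q.2) x].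
  have [qs|] := boolP (q \in s); last by exists (fun=> 0).
  have [_ /andP[q0 _]] := sP q qs.
  have [|||theta [t1 t2 t3 t4 t5]] := cut (ball q.1 (2 * q.2)) (`|q.1| + 2 * q.2) q.2.
  - by apply: measurable_open_borel; exact: ball_open.
  - move=> x /rV_ball_norm xq; apply/rV_ball_norm; rewrite sub0r normrN.
    by rewrite -(subrK q.1 x) (le_lt_trans (ler_normD _ _))// addrC ltrD2l distrC.
  - exact: q0.
  have out x : ~ ball q.1 (3 * q.2) x -> theta x = 0.
    move=> nx; apply: contrapT => /eqP /t4[y /rV_ball_norm yq xy]; apply: nx; apply/rV_ball_norm.
    by rewrite -(subrKA y) (le_lt_trans (ler_normD _ _))// distrC [X in _ < X](_ : _ = 2 * q.2 + q.2); [rewrite [X in X + _]distrC ltrD// distrC|ring].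
  exists theta => _; split => //.
  - exact: test_smooth t1.
  - move=> x /rV_ball_norm xq; apply: t3 => y xy; apply/rV_ball_norm.
    by rewrite -(subrKA x) (le_lt_trans (ler_normD _ _))//; lra.
  - move=> i x; have [[-> _]|[-> nx]] := indbP q.1 (3 * q.2) x; first by rewrite mulr1.
    rewrite mulr0 normr_le0; apply/eqP.
    have p0 : forall y, 0 <= theta y by move=> y; have /andP[] := t2 y.
    by apply: partial_min t1 p0 _; exact: out.
have [|eta [seta eta01 eta1 deta eta0]] := @cutoff_product s theta.
  by move=> q qs; have [? ? _ _ _] := thetaP q qs.
have beta := smooth_borel seta.
have sum_n : \sum_(q <- s) q.2 ^+ n <= e.
  apply: le_trans ssum; rewrite !big_seq; apply: ler_sum => q /sP[_ /andP[q0 qe]].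
  have q1 : q.2 <= 1 by exact: le_trans e1.
  by apply: ler_wiXn2l => //; [exact: ltW|exact: leq_pred].
have bi (q : V * R) : borel_fun (indb q.1 (3 * q.2)) by exact: borel_indb.
have i0 (q : V * R) x : 0 <= indb q.1 (3 * q.2) x by exact: indb_ge0.
have k3 : 0 <= kappa * 3 ^+ n by rewrite mulr_ge0 ?exprn_ge0// ltW.
exists eta; split => //.
- move=> phi tphi phi0; have [K [cK _ K0]] := test_support tphi.
  pose O := [set x | exists2 q, q \in s & ball q.1 q.2 x].
  have oO : open O.
    rewrite (_ : O = \bigcup_(q in [set q | q \in s]) ball q.1 q.2).
      by apply: bigcup_open => q _; exact: ball_open.
    by apply/seteqP; split => x [q qs xq]; exists q.
  have etaO x : O x -> eta x = 0.
    move=> [q qs xq]; apply: (eta0 q) => //.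
    by have [_ _ + _ _] := thetaP q qs; exact.
  have clO : closed (~` O) by exact: open_closedC.
  have cl1 : closed [set y : V | `|0 - y| <= r].
    by apply: compact_closed; [exact: norm_hausdorff|exact: (@compact_closed_ball R n 0 r)].
  apply: (@test_functionP _ _ _ ([set y : V | `|0 - y| <= r] `&` ~` O)).
  + by exact: smoothM seta (test_smooth tphi).
  + apply: (@subclosed_compact _ _ [set y : V | `|0 - y| <= r]).
    * exact: closedI.
    * exact: (@compact_closed_ball R n 0 r).
    * by move=> x [].
  + move=> x [/= xr nO] Gx; apply: nO; apply: scov; split => //.
    by move: xr; rewrite sub0r normrN.
  + move=> x nx; have [Ox|nOx] := pselect (O x); first by rewrite etaO// mul0r.
    rewrite phi0 ?mulr0// => /rV_ball_norm xr; apply: nx; split => //=; exact: ltW.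
- apply: (@le_trans _ _ (nnint (fun x => \sum_(q <- s) indb q.1 (3 * q.2) x)%R)).
    apply: le_nnint; [by borel|by apply: borel_sum| |].
      by move=> x; have /andP[_] := eta01 x; rewrite subr_ge0.
    move=> x; apply: (le_trans (eta1 x)); rewrite !big_seq; apply: ler_sum => q qs.
    have [_ t01 _ tout _] := thetaP q qs; have [[-> _]|[-> nx]] := indbP q.1 (3 * q.2) x.
      by have /andP[] := t01 x.
    by rewrite tout.
  rewrite nnint_sum//; apply: (@le_trans _ _ (\sum_(q <- s) (kappa * 3 ^+ n * q.2 ^+ n)%:E)%E).
    rewrite !big_seq; apply: lee_sum => q /sP[_ /andP[q0 _]].
    by rewrite nnint_indb ?mulr_gt0// exprMn mulrA.
  rewrite sumEFin lee_fin -mulr_sumr.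
  apply: (@le_trans _ _ (kappa * 3 ^+ n * e)); first exact: ler_wpM2l.
  by rewrite ler_wpM2r ?(ltW e0)// ler_peMl// lerDr ltW.
- move=> i; apply: (@le_trans _ _ (nnint (fun x => \sum_(q <- s) `|C / q.2| * indb q.1 (3 * q.2) x)%R)).
    have bd := smooth_borel (smooth_partial i seta).
    apply: le_nnint; [by borel|by apply: borel_sum => q; borel|by []|].
    move=> x; apply: (le_trans (deta i x)); rewrite !big_seq; apply: ler_sum => q qs.
    have [_ _ _ _ t5] := thetaP q qs; apply: (le_trans (t5 i x)).
    by rewrite ler_wpM2r// ler_norm.
  rewrite nnint_sum; [|by move=> q; borel|by move=> q x; rewrite mulr_ge0].
  apply: (@le_trans _ _ (\sum_(q <- s) (C * (kappa * 3 ^+ n) * q.2 ^+ n.-1)%:E)%E).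
    rewrite !big_seq; apply: lee_sum => q /sP[_ /andP[q0 _]].
    rewrite nnintZ; [|by []|exact: bi|exact: i0].
    rewrite nnint_indb ?mulr_gt0// -EFinM lee_fin ger0_norm ?divr_ge0 ?(ltW C0) ?(ltW q0)//.
    have qn : q.2 ^+ n = q.2 * q.2 ^+ n.-1 by rewrite -exprS prednK.
    rewrite exprMn qn le_eqVlt; apply/orP; left; apply/eqP.
    by field; rewrite gt_eqF.
  rewrite sumEFin lee_fin -mulr_sumr.
  apply: (@le_trans _ _ (C * (kappa * 3 ^+ n) * e)).
    by apply: ler_wpM2l => //; rewrite mulr_ge0// ltW.
  by rewrite ler_wpM2r ?(ltW e0)// ler_wpM2r// lerDl.
Qed.

(** Test with [eta * phi]. The additional term [v * phi * partial i eta] is small because [v] is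
    bounded and the gradient of [eta] is small in L1; replacing [eta] by 1 elsewhere costs an
    integral of [1 - eta], after cutting off the tail of [h i * phi]. *)
Lemma wgrad_removable Gamma v h (M : R) : 0 < kappa -> (0 < n)%N -> thin Gamma -> closed Gamma ->
  borel_fun v -> (forall x, `|v x| <= M) -> (forall i, borel_fun (h i)) ->
  (forall i r, L1 (fun x => indb 0 r x * h i x)) ->
  wgrad (~` Gamma) v h -> wgrad setT v h.
Proof.
move=> kappa_gt0 n0 thinG clG bv vM bh Lh wg phi tphi i.
have M0 : 0 <= M := le_trans (normr_ge0 _) (vM 0).
have [C C0 cut] := thin_cutoff kappa_gt0 n0 thinG clG.
have [r r0 phi0] := test_ball tphi.
have [B B0 BP] := test_bounded tphi; have [B' B'0 BP'] := test_bounded (test_partial i tphi).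
have bphi := smooth_borel (test_smooth tphi).
have bdphi := smooth_borel (test_smooth (test_partial i tphi)).
have bhi := bh i.
have Lv (f : V -> R) : L1 f -> L1 (fun x => v x * f x).
  move=> Lf; rewrite (_ : (fun x => _) = (fun x => f x * v x)); last by apply/funext => x; rewrite mulrC.
  exact: L1M_bounded vM.
have hE : (fun x => h i x * phi x) = (fun x => indb 0 r x * h i x * phi x).
  apply/funext => x; have [[-> _]|[-> nx]] := indbP 0 r x; first by rewrite mul1r.
  by rewrite phi0// !mulr0.
have Lhphi : L1 (fun x => h i x * phi x) by rewrite hE; exact: L1M_bounded BP.
have Ldphi := test_L1 (test_partial i tphi).
have Lvd := Lv _ Ldphi.
apply/eqP; rewrite -subr_eq0 opprK -rintD//; apply/eqP.
apply: (@eq0_small _ _ 3) => t t0 _.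
have [N NP] := L1_tail Lhphi t0.
pose K := C * (N%:R + M * B' + M * B + 1); have K0 : 0 < K.
  by rewrite mulr_gt0// ltr_wpDl// !addr_ge0// mulr_ge0.
pose e := Num.min 1 (t / K).
have e0 : 0 < e by rewrite lt_min ltr01 divr_gt0.
have Ke : K * e <= t by rewrite mulrC -ler_pdivlMr// ge_min lexx orbT.
have e1 : e <= 1 by rewrite ge_min lexx.
have [eta [seta eta01 etaT eta1 deta]] := cut r e e0 e1.
have beta := smooth_borel seta.
have bdeta := smooth_borel (smooth_partial i seta).
have tep := etaT phi tphi phi0.
have := wg _ tep i.
have E1 : (fun x => v x * partial i (fun y => eta y * phi y) x) =
    (fun x => v x * (eta x * partial i phi x + phi x * partial i eta x)).
  by apply/funext => x; rewrite partialM//; exact: test_smooth tphi.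
have LE : L1 (fun x => v x * (eta x * partial i phi x + phi x * partial i eta x)).
  rewrite -E1; apply: Lv; exact: test_L1 (test_partial i tep).
rewrite E1 => /eqP; rewrite -subr_eq0 opprK => /eqP.
have LE2 : L1 (fun x => h i x * (eta x * phi x)).
  rewrite (_ : (fun x => _) = (fun x => h i x * phi x * eta x)); last by apply/funext => x; ring.
  apply: (L1M_bounded (M := 1) Lhphi) => // x.
  by have /andP[a b] := eta01 x; rewrite ger0_norm.
rewrite -rintD// => int0.
rewrite -[X in `|X|]subr0 -int0 -rintB//; [|exact: L1D|exact: L1D].
apply: rint_small; first by apply: L1B; exact: L1D.
pose T x := `|h i x * phi x| * \1_[set x | N%:R <= `|h i x * phi x|] x.
have bT : borel_fun T.
  by apply: borelM; [borel|apply: borel_indic; apply: measurable_ge_borel; borel].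
have T0 x : 0 <= T x by rewrite mulr_ge0// indicE.
have d0 x : 0 <= 1 - eta x by have /andP[a b] := eta01 x; rewrite subr_ge0.
have MB0 : 0 <= N%:R + M * B' by rewrite addr_ge0// mulr_ge0.
have MB : 0 <= M * B by rewrite mulr_ge0.
apply: (@le_trans _ _ (nnint (fun x => T x + ((N%:R + M * B') * (1 - eta x) + M * B * `|partial i eta x|))%R)).
  apply: le_nnint => [|||x]; [by borel|by borel|by []|].
  rewrite (_ : _ - _ = h i x * phi x * (1 - eta x) + (v x * partial i phi x * (1 - eta x) -
     v x * phi x * partial i eta x)); last by ring.
  apply: (le_trans (ler_normD _ _)).
  rewrite [leRHS](_ : _ = (T x + N%:R * (1 - eta x)) +
    (M * B' * (1 - eta x) + M * B * `|partial i eta x|)); last by ring.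
  apply: lerD.
    rewrite normrM (ger0_norm (d0 x)) /T indicE; have [hN|hN] := leP N%:R `|h i x * phi x|.
      rewrite mem_set//= mulr1 ler_wpDr ?mulr_ge0// ler_piMr//.
      by have /andP[] := eta01 x; lra.
    rewrite memNset ?mulr0 ?add0r; last by apply/negP; rewrite -ltNge.
    by rewrite ler_wpM2r// ltW.
  apply: (le_trans (ler_normB _ _)); rewrite !normrM (ger0_norm (d0 x)).
  by apply: lerD; apply: ler_wpM2r => //; apply: ler_pM.
rewrite nnintD; [|by borel|by borel|by []|by move=> x; rewrite addr_ge0// mulr_ge0].
rewrite nnintD; [|by borel|by borel|by move=> x; rewrite mulr_ge0|by move=> x; rewrite mulr_ge0].
rewrite (@nnintZ _ _ (N%:R + M * B')); [|by []|by borel|by []].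
rewrite (@nnintZ _ _ (M * B)); [|by []|by borel|by []].
apply: (@le_trans _ _ (t%:E + ((N%:R + M * B')%:E * (C * e)%:E + (M * B)%:E * (C * e)%:E))%E).
  apply: leeD; first exact: NP.
  by apply: leeD; apply: lee_wpmul2l => //; rewrite lee_fin.
rewrite -!EFinM -!EFinD lee_fin.
have : C * e <= K * e * 1 -> True by [].
have Ce : 0 <= C * e by rewrite mulr_ge0// ltW.
by move: Ke; rewrite /K; lra.
Qed.

Lemma thin_null Gamma : (0 < n)%N -> closed Gamma -> thin Gamma -> lebesgue_vec R n Gamma = 0%E.
Proof.
move=> n0 clG thinG.
have step k : lebesgue_vec R n (Gamma `&` [set y : V | `|0 - y| <= k%:R]) = 0%E.
  apply/eqP; rewrite eq_le measure_ge0 andbT; apply/lee_addgt0Pr => e e0; rewrite add0e.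
  have k0 : 0 <= kappa by exact: leb_unit_ball_ge0.
  have K0 : 0 < kappa + 1 by rewrite ltr_wpDl.
  pose e' := Num.min 1 (e / (kappa + 1)).
  have e'0 : 0 < e' by rewrite lt_min ltr01 divr_gt0.
  have e'1 : e' <= 1 by rewrite ge_min lexx.
  have e'e : e' <= e / (kappa + 1) by rewrite ge_min lexx orbT.
  have [s [sP scov ssum]] := thinG k%:R e' e'0.
  have cl1 : closed [set y : V | `|0 - y| <= k%:R].
    by apply: compact_closed; [exact: norm_hausdorff|exact: (@compact_closed_ball R n 0 k%:R)].
  have mE : measurable (Gamma `&` [set y : V | `|0 - y| <= k%:R] : set (@borelV R n)).
    by apply: measurable_closed_borel; exact: closedI.
  have bE := borel_indic mE.
  have bi (q : V * R) : borel_fun (indb q.1 q.2) by exact: borel_indb.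
  have i0 (q : V * R) x : 0 <= indb q.1 q.2 x by exact: indb_ge0.
  rewrite -nnint_indic//; apply: (@le_trans _ _ (nnint (fun x => \sum_(q <- s) indb q.1 q.2 x)%R)).
    apply: le_nnint; [by []|by apply: borel_sum|by move=> x; rewrite indicE|].
    move=> x; rewrite indicE; have [[Gx xk]|nx] := pselect ((Gamma `&` [set y : V | `|0 - y| <= k%:R]) x); last first.
      by rewrite memNset// sumr_ge0.
    rewrite mem_set//=; have [|q qs xq] := scov x.
      by split => //=; move: xk; rewrite /= sub0r normrN.
    rewrite (perm_big _ (perm_to_rem qs)) big_cons/= indb_in// lerDl sumr_ge0//.
  rewrite nnint_sum//; apply: (@le_trans _ _ (\sum_(q <- s) (kappa * q.2 ^+ n)%:E)%E).
    by rewrite !big_seq; apply: lee_sum => q /sP[_ /andP[q0 _]]; rewrite nnint_indb.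
  rewrite sumEFin lee_fin -mulr_sumr.
  apply: (@le_trans _ _ (kappa * e')).
    apply: ler_wpM2l => //; apply: le_trans ssum; rewrite !big_seq; apply: ler_sum => q /sP[_ /andP[q0 qe]].
    by apply: ler_wiXn2l => //; [exact: ltW|exact: le_trans qe e'1|exact: leq_pred].
  apply: (@le_trans _ _ (kappa * (e / (kappa + 1)))); first exact: ler_wpM2l.
  by rewrite mulrCA ler_piMr ?(ltW e0)// ler_pdivrMr// mul1r lerDl.
apply/eqP; rewrite eq_le measure_ge0 andbT.
apply: (@le_trans _ _ (lebesgue_vec R n (\bigcup_k (Gamma `&` [set y : V | `|0 - y| <= k%:R])))).
  apply: (@le_outer_measure _ _ (lebesgue_outer R n)) => x Gx.
  exists (Num.trunc `|x|).+1 => //; split => //=; rewrite sub0r normrN ltW//; exact: truncnS_gt.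
apply: (le_trans (@outer_measure_sigma_subadditive _ _ (lebesgue_outer R n) _)).
by rewrite eseries0// => k _ _; exact: step.
Qed.

End removability.

(** * Poincare inequality near a regular set *)

Section regular_set.
Context {R : realType} {n : nat}.
Local Notation V := 'rV[R]_n.
Local Notation kappa := (@leb_unit_ball R n).
Implicit Types (x y z : V) (u v phi psi m : V -> R) (h g : 'I_n -> V -> R).
Variables (d C0 : R) (Gamma : set V).
Hypotheses (n2 : (2 <= n)%N) (d0 : 0 < d) (dn : d < n%:R - 1) (C01 : 1 <= C0)
  (Gneq0 : Gamma !=set0) (clG : closed Gamma) (reg : ahlfors_regular d C0 Gamma)
  (kappa_gt0 : 0 < kappa).

(** The codimension of Gamma minus 1, which is also minus the exponent of the weight. *)
Local Notation p := (n%:R - 1 - d : R).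

Lemma ambient_gt0 : (0 < n)%N. Proof. exact: ltnW. Qed.
Local Notation n0 := ambient_gt0.

Lemma codim_gt0 : 0 < p. Proof. by rewrite subr_gt0. Qed.
Local Notation p0 := codim_gt0.

Lemma regular_ball_le x (r : R) : Gamma x -> 0 < r ->
  (hausdorff_outer d (Gamma `&` ball x r) <= (C0 * n%:R `^ d * r `^ d)%:E)%E.
Proof.
move=> Gx r0; have nr0 : 0 < n%:R * r by rewrite mulr_gt0// ltr0n n0.
have /andP[_] := reg Gx nr0; rewrite powRM// ?(ltW r0)// mulrA.
apply: le_trans; apply: le_outer_measure; apply: setIS; apply: ball_eball; exact: n0.
Qed.

Lemma regular_ball_ge x (r : R) : Gamma x -> 0 < r ->
  ((C0^-1 * r `^ d)%:E <= hausdorff_outer d (Gamma `&` ball x r))%E.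
Proof.
move=> Gx r0; have /andP[+ _] := reg Gx r0; move=> /le_trans; apply.
by apply: (@le_outer_measure _ _ (hausdorff_outer d)); apply: setIS; exact: eball_ball.
Qed.

Lemma regular_thin : thin Gamma.
Proof.
move=> r e e0; have [z Gz] := Gneq0.
have cl1 : closed [set y : V | `|0 - y| <= r].
  by apply: compact_closed; [exact: norm_hausdorff|exact: (@compact_closed_ball R n 0 r)].
have [||s [sP scov ssum]] := @hausdorff_cover R n d (Gamma `&` [set y : V | `|0 - y| <= r]) e n2 d0 dn _ _ e0.
- apply: (@subclosed_compact _ _ [set y : V | `|0 - y| <= r]).
  + exact: closedI.
  + exact: (@compact_closed_ball R n 0 r).
  + by move=> x [].
- pose r' := `|z| + `|r| + 1; have r'0 : 0 < r' by rewrite ltr_wpDl// addr_ge0.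
  apply: (le_lt_trans _ (ltry (C0 * n%:R `^ d * r' `^ d))).
  apply: le_trans (regular_ball_le Gz r'0); apply: le_outer_measure => x [Gx /= xr]; split => //.
  apply/rV_ball_norm; apply: (le_lt_trans (ler_normB _ _)).
  rewrite /r' -addrA ltrD2l; move: xr; rewrite sub0r normrN => /le_lt_trans; apply.
  by rewrite (le_lt_trans (ler_norm r))// ltrDl.
exists s; split => //; first by move=> q /sP[[]].
by move=> x [Gx xr]; apply: scov; split => //=; rewrite sub0r normrN.
Qed.

Lemma regular_null : lebesgue_vec R n Gamma = 0%E.
Proof. exact: thin_null n0 clG regular_thin. Qed.

Local Notation delta := (edist_to Gamma).

Lemma edist_has_inf x : has_inf [set enorm (x - y) | y in Gamma].
Proof.
split; first by have [z Gz] := Gneq0; exists (enorm (x - z)), z.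
by exists 0 => _ [z _ <-]; exact: enorm_ge0.
Qed.

Lemma edist_le x z : Gamma z -> delta x <= enorm (x - z).
Proof. by move=> Gz; apply: ge_inf; [have [] := edist_has_inf x|exists z]. Qed.

Lemma edist_near x (r : R) : delta x < r -> exists2 z, Gamma z & ball z r x.
Proof.
move=> xr; have e0 : 0 < r - delta x by rewrite subr_gt0.
have [_ [z Gz <-]] := inf_adherent e0 (edist_has_inf x); rewrite subrKC => H.
by exists z => //; apply/rV_ball_norm; rewrite distrC; exact: le_lt_trans (norm_enorm _) H.
Qed.

Lemma edist_gt0 x : ~ Gamma x -> 0 < delta x.
Proof.
move=> nGx; have oG : open (~` Gamma) by exact: closed_openC.
have /nbhs_ballP[e /= e0 eP] : nbhs x (~` Gamma) by exact: open_nbhs_nbhs.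
rewrite ltNge; apply/negP => dx0; have [z Gz xz] := edist_near (le_lt_trans dx0 e0).
by apply: (eP z) => //; apply: ball_sym.
Qed.

Lemma open_eball z (r : R) : open (eball z r).
Proof.
have [r0|r0] := leP r 0.
  rewrite (_ : eball z r = set0); first exact: open0.
  by apply/seteqP; split => // x; rewrite /eball /= => /lt_le_trans /(_ r0); rewrite ltNge enorm_ge0.
have sf (s : seq 'I_n) : smooth (fun x : V => \sum_(i <- s) (x 0 i - z 0 i) ^+ 2).
  elim: s => [|i s IH]; first by under eq_fun do rewrite big_nil; exact: smooth_cst.
  under eq_fun do rewrite big_cons; apply: smoothD => //.
  by under eq_fun do rewrite expr2; apply: smoothM; apply: smoothB; [exact: smooth_coord|exact: smooth_cst|exact: smooth_coord|exact: smooth_cst].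
rewrite (_ : eball z r = (fun x => \sum_i (x 0 i - z 0 i) ^+ 2) @^-1` [set t | t < r ^+ 2]).
  apply: open_comp; last exact: open_lt.
  by move=> x _; exact: (smooth_continuous (sf _)).
apply/seteqP; split => x /=; rewrite /eball /= => H.
  rewrite (_ : \sum_i _ = enorm (x - z) ^+ 2); last by rewrite enorm_sqr; apply: eq_bigr => i _; rewrite !mxE.
  by rewrite ltr_pXn2r// ?nnegrE ?enorm_ge0// ltW.
rewrite -(@ltr_pXn2r _ 2)// ?nnegrE ?enorm_ge0 ?(ltW r0)// enorm_sqr.
by apply: le_lt_trans H; apply: ler_sum => i _; rewrite !mxE.
Qed.

Lemma borel_edist : borel_fun delta.
Proof.
apply: (measurability _ (RGenInftyO.measurableE R)) => _ [_ [r ->] <-]; rewrite setTI.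
apply: measurable_open_borel; rewrite (_ : _ @^-1` _ = \bigcup_(z in Gamma) eball z r).
  by apply: bigcup_open => z _; exact: open_eball.
apply/seteqP; split => x /=; rewrite in_itv/=.
  move=> xr; have e0 : 0 < r - delta x by rewrite subr_gt0.
  have [_ [z Gz <-]] := inf_adherent e0 (edist_has_inf x); rewrite subrKC => H.
  by exists z.
by move=> [z Gz]; rewrite /eball/=; exact: le_lt_trans (edist_le x Gz).
Qed.

Lemma edist_le_ball x z (r : R) : Gamma z -> ball z r x -> delta x <= n%:R * r.
Proof.
move=> Gz /rV_ball_norm xr; apply: (le_trans (edist_le x Gz)); apply: (le_trans (enorm_norm _)).
by rewrite ler_wpM2l// distrC ltW.
Qed.

Local Notation w := (weight Gamma d).

Lemma borel_weight : borel_fun w.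
Proof. exact: measurableT_comp (measurable_powR _) borel_edist. Qed.

Lemma weight_ge0 x : 0 <= w x. Proof. exact: powR_ge0. Qed.

Lemma weightE x : w x = (delta x `^ p)^-1.
Proof. by rewrite /weight -powRN; congr (_ `^ _); ring. Qed.

Lemma weight_ge x z (r : R) : Gamma z -> ball z r x -> ~ Gamma x -> 1 <= (n%:R * r) `^ p * w x.
Proof.
move=> Gz xr nG; have dx := edist_gt0 nG; rewrite weightE.
rewrite ler_pdivlMr ?powR_gt0// mul1r; apply: ge0_ler_powR; rewrite ?nnegrE ?(ltW p0)//.
- exact: ltW.
- by apply: le_trans (edist_le_ball Gz xr); exact: ltW.
- exact: edist_le_ball xr.
Qed.

Lemma weight_le x (r : R) : 0 < r -> (forall z, Gamma z -> ~ ball z r x) -> r `^ p * w x <= 1.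
Proof.
move=> r0 H; have rd : r <= delta x.
  by rewrite leNgt; apply/negP => /edist_near[z Gz]; exact: H.
have dx : 0 < delta x by exact: lt_le_trans rd.
rewrite weightE ler_pdivrMr ?powR_gt0// mul1r; apply: ge0_ler_powR; rewrite ?nnegrE ?(ltW p0)//; exact: ltW.
Qed.

(** The properties of the density w |h| ^ 2 that the Poincare inequality relies on. With [m] kept
    abstract, the same [m] serves when [h] is multiplied by factors of modulus at most 1, as happens
    for truncations. *)
Definition energy_bound h m := [/\ forall i, borel_fun (h i), borel_fun m, forall x, 0 <= m x,
  (nnint m < +oo)%E & forall z (r : R) x, Gamma z -> ball z r x ->
    \sum_i h i x ^+ 2 <= (n%:R * r) `^ p * m x].

Lemma energy_bound_L1 h m i z (r : R) : energy_bound h m -> Gamma z -> L1 (fun x => indb z r x * h i x).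
Proof.
move=> [bh bm m0 mfin hm] Gz; have bhi := bh i; have bi := @borel_indb R n z r.
have Lm : L1 m by exact: L1_ge0.
apply: (@L1_le _ _ _ (fun x => indb z r x + (n%:R * r) `^ p * m x)); [by borel|by apply: L1D; [exact: L1_indb|exact: L1Z]|].
move=> x; have K0 : 0 <= (n%:R * r) `^ p * m x by rewrite mulr_ge0 ?powR_ge0.
have [[-> xr]|[-> _]] := indbP z r x; last by rewrite mul0r normr0.
rewrite mul1r [leRHS]ger0_norm ?addr_ge0//.
have : h i x ^+ 2 <= (n%:R * r) `^ p * m x.
  by apply: le_trans (hm z r x Gz xr); rewrite (bigD1 i)//= lerDl sumr_ge0// => j _; exact: sqr_ge0.
by have := sqr_ge0 (`|h i x| - 1); rewrite sqrrB real_normK ?num_real//; have := normr_ge0 (h i x); lra.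
Qed.

Lemma energy_bound_locL1 h m i (r : R) : energy_bound h m -> L1 (fun x => indb 0 r x * h i x).
Proof.
move=> eb; have [z Gz] := Gneq0; have [bh _ _ _ _] := eb; have bhi := bh i; have bi := @borel_indb R n 0 r.
apply: (@L1_le _ _ _ (fun x => indb z (`|z| + r) x * h i x)); [by borel|exact: energy_bound_L1 eb Gz|].
move=> x; have [[-> xr]|[-> _]] := indbP 0 r x; last by rewrite mul0r normr0.
rewrite indb_in//; apply/rV_ball_norm; apply: (le_lt_trans (ler_normB _ _)); rewrite ltrD2l.
by move: xr => /rV_ball_norm; rewrite sub0r normrN.
Qed.

Definition poincare_cst : R := 2 ^+ n * n%:R * 8 * (2 * n%:R) `^ p.
Local Notation Cp := poincare_cst.

Lemma poincare_cst_gt0 : 0 < Cp.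
Proof. by rewrite /Cp !mulr_gt0// ?exprn_gt0 ?powR_gt0 ?mulr_gt0 ?ltr0n ?n0. Qed.

Lemma local_poincare_bounded v h m (M : R) z (r : R) : Gamma z -> 0 < r -> borel_fun v ->
  (forall x, `|v x| <= M) -> energy_bound h m -> wgrad (~` Gamma) v h ->
  (nnint (fun x => indb z r x * (v x - avg v z r) ^+ 2)%R <=
   (Cp * (r ^+ 2 * r `^ p))%:E * nnint (fun x => indb z (2 * r) x * m x)%R)%E.
Proof.
move=> Gz r0 bv vM eb wg; have [bh bm m0 mfin hm] := eb.
have wgT : wgrad setT v h.
  apply: wgrad_removable bv vM bh _ wg => //; [exact: n0|exact: regular_thin|].
  by move=> i r'; exact: energy_bound_locL1 eb.
have Lh i : L1 (fun x => indb z (3 * r) x * h i x) by exact: energy_bound_L1 eb Gz.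
apply: (le_trans (poincare kappa_gt0 r0 bv vM bh Lh wgT)).
have b2 := @borel_indb R n z (2 * r).
have i0 x : 0 <= indb z (2 * r) x by exact: indb_ge0.
rewrite -(@nnint_sum _ _ _ _ (fun i x => indb z (2 * r) x * h i x ^+ 2)); last 2 first.
- by move=> i; have bhi := bh i; borel.
- by move=> i x; nonneg.
apply: (@le_trans _ _ ((2 ^+ n * n%:R * 8 * r ^+ 2)%:E *
    nnint (fun x => (n%:R * (2 * r)) `^ p * (indb z (2 * r) x * m x))%R)%E).
  apply: lee_wpmul2l; first by rewrite lee_fin; nonneg.
  apply: le_nnint => [|||x].
  - by apply: borel_sum => i; have bhi := bh i; borel.
  - by borel.
  - by move=> x; nonneg.
  rewrite -mulr_sumr; have [[-> xr]|[-> _]] := indbP z (2 * r) x; last by rewrite !mul0r mulr0.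
  by rewrite !mul1r; exact: hm Gz xr.
rewrite nnintZ; [|exact: powR_ge0|by borel|by move=> x; rewrite mulr_ge0].
rewrite muleA -EFinM le_eqVlt; apply/orP; left; apply/eqP; congr (_%:E * _)%E.
rewrite (_ : n%:R * (2 * r) = (2 * n%:R) * r); last by ring.
by rewrite powRM ?(ltW r0)// /Cp; ring.
Qed.

Lemma sin_trunc_le (N t : R) : 0 < N -> `|N * sin (t / N)| <= `|t| /\ `|N * sin (t / N) - t| <= t ^+ 2 / N.
Proof.
move=> N0; have ds s : is_derive s (1 : R) (fun t => N * sin (t / N)) (cos (s / N)).
  by have [_ _ + _] := sin_bounded_derivatives N0; exact.
have [c [ct E]] := mean_value 0 t ds.
move: ct E; rewrite !subr0 mul0r sin0 mulr0 subr0 => ct ->.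
have [c' [c't E']] := mean_value (L := cos) 0 (c / N) (fun s => is_derive_cos s).
move: c't E'; rewrite !subr0 cos0 => c't E'.
split; first by rewrite normrM ler_piMl// ler_norml cos_geN1 cos_le1.
rewrite -[X in _ - X]mul1r -mulrBl E' !normrM normrN -real_normK ?num_real// expr2.
have s1 : `|sin c'| <= 1 by rewrite ler_norml sin_geN1 sin_le1.
have iN : 0 <= N^-1 by rewrite invr_ge0 ltW.
rewrite (ger0_norm iN) -[leRHS]mulrA [leRHS]mulrCA mulrC; apply: ler_wpM2l => //.
apply: (@le_trans _ _ (1 * (`|c| / N))); first by apply: ler_wpM2r => //; exact: mulr_ge0.
by rewrite mul1r ler_wpM2r.
Qed.

Lemma sin_trunc_cvg (t : R) : (fun k => k.+1%:R * sin (t / k.+1%:R)) @ \oo --> t.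
Proof.
apply/cvgrPdist_le => e e0.
have /cvgrPdist_le /(_ e e0) [N _ NP] : (fun k => t ^+ 2 * k.+1%:R^-1) @ \oo --> (t ^+ 2 * 0 : R).
  by apply: cvgM; [exact: cvg_cst|exact: cvg_harmonic].
exists N => // k /NP; rewrite mulr0 sub0r normrN => H.
have [|_ T] := @sin_trunc_le k.+1%:R t; first by rewrite ltr0n.
by rewrite distrC (le_trans T)// (le_trans _ H)// ler_norm.
Qed.

(** The truncations [f k] satisfy the inequality with the same [m], their gradients being multiplied
    by a cosine. Integrability of [u] near Gamma is part of the conclusion, so the means [c k] have
    to be bounded first; Fatou's lemma then gives [u] square integrable, the means converge, and a
    second use of Fatou's lemma concludes. *)
Lemma local_poincare u g m z (r : R) : Gamma z -> 0 < r -> locL1 (~` Gamma) u ->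
  (forall i, locL1 (~` Gamma) (g i)) -> energy_bound g m -> wgrad (~` Gamma) u g ->
  L1 (fun x => indb z r x * u x) /\
  (nnint (fun x => indb z r x * (u x - avg u z r) ^+ 2)%R <=
   (Cp * (r ^+ 2 * r `^ p))%:E * nnint (fun x => indb z (2 * r) x * m x)%R)%E.
Proof.
move=> Gz r0 uloc gloc eb wg; have [bg bm m0 mfin gm] := eb; have bu := proj1 uloc.
pose f k x := k.+1%:R * sin (u x / k.+1%:R).
have bF k : borel_fun (f k).
  have [sG _ _ _] := sin_bounded_derivatives (ltr0n R k.+1); exact: borel_smooth1 sG bu.
have fu k x : `|f k x| <= `|u x| by have [] := @sin_trunc_le k.+1%:R (u x) (ltr0n _ _).
pose c k := avg (f k) z r.
pose mu := nnint (fun x => indb z (2 * r) x * m x).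
have b2 := @borel_indb R n z (2 * r); have bi := @borel_indb R n z r.
have i0 x s : 0 <= indb z s x by exact: indb_ge0.
have mufin : (mu < +oo)%E.
  apply: le_lt_trans mfin; apply: le_nnint => // [|x|x]; [by borel|by nonneg|].
  by rewrite ler_piMl// indb_le1.
have mu0 : (0 <= mu)%E by apply: nnint_ge0 => x; nonneg.
pose K := Cp * (r ^+ 2 * r `^ p) * fine mu.
have muE : ((Cp * (r ^+ 2 * r `^ p))%:E * mu = K%:E)%E.
  by rewrite -[mu]fineK ?ge0_fin_numE// -EFinM.
have KP k : (nnint (fun x => indb z r x * (f k x - c k) ^+ 2)%R <= K%:E)%E.
  have bd := sin_bounded_derivatives (ltr0n R k.+1).
  have oO : open (~` Gamma) by exact: closed_openC.
  have wgk := wgrad_comp kappa_gt0 oO bd uloc gloc wg.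
  have [_ _ _ [M MP]] := bd.
  rewrite -muE; apply: (@local_poincare_bounded (f k) (fun i x => cos (u x / k.+1%:R) * g i x) m M) => //.
    by move=> x; have [] := MP 0 (u x).
  split => // [i|z' r' x Gz' xr].
    by apply: borelM => //; have [_ sG _ _] := bd; exact: borel_smooth1 sG bu.
  apply: le_trans (gm z' r' x Gz' xr); apply: ler_sum => i _.
  rewrite exprMn ler_piMl ?sqr_ge0// -real_normK ?num_real// expr_le1//.
have K0 : 0 <= K.
  by rewrite -lee_fin; apply: le_trans (KP 0%N); apply: nnint_ge0 => x; nonneg.
pose b := kappa * r ^+ n; have b0 : 0 < b by rewrite mulr_gt0// exprn_gt0.
pose Ek (k : nat) : V -> R := \1_[set x | k%:R <= `|u x|].
have bE k : borel_fun (Ek k) by apply: borel_indic; apply: measurable_ge_borel; borel.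
have E0 k x : 0 <= Ek k x by rewrite /Ek indicE.
have E1 k x : Ek k x <= 1 by rewrite /Ek indicE lern1 leq_b1.
have [N NP] : exists N, (nnint (fun x => indb z r x * Ek N x)%R <= (b / 2)%:E)%E.
  have [|||N NP] := @nnint_dominated _ _ (fun k x => indb z r x * Ek k x) (indb z r) _ _ (L1_indb z r) _ _ (divr_gt0 b0 (ltr0n _ 2)).
  - by move=> k; have bEk := bE k; borel.
  - by move=> k x; rewrite mulr_ge0//= ler_piMr.
  - apply: aeT => x; apply/cvgrPdist_le => e e0.
    exists (Num.trunc `|u x|).+1 => // k /= xk; rewrite /Ek indicE memNset/=.
      by rewrite mulr0 subrr normr0 ltW.
    apply/negP; rewrite -ltNge; apply: lt_le_trans (truncnS_gt _) _.
    by rewrite ler_nat.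
  by exists N; exact: NP.
(* On a set of at least half the volume of the ball [u] is below [N] in modulus, and there [c k] is
   at most [N] plus the deviation controlled by [KP]. *)
have cP k : c k ^+ 2 <= (2 * K + 2 * N%:R ^+ 2 * b) / (b / 2).
  rewrite ler_pdivlMr ?divr_gt0// -lee_fin.
  have bfk := bF k; have bEN := bE N.
  apply: (@le_trans _ _ (nnint (fun x => c k ^+ 2 * (indb z r x * (1 - Ek N x)))%R)).
    have D0 x : 0 <= indb z r x * (1 - Ek N x) by rewrite mulr_ge0// subr_ge0.
    rewrite nnintZ ?sqr_ge0//; last by borel.
    rewrite EFinM; apply: lee_wpmul2l; first by rewrite lee_fin sqr_ge0.
    have : (b%:E = nnint (fun x => indb z r x * (1 - Ek N x) + indb z r x * Ek N x)%R)%E.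
      by rewrite -(nnint_indb z r0); congr nnint; apply/funext => x; ring.
    rewrite nnintD; [|by borel|by borel|by []|by move=> x; rewrite mulr_ge0].
    move=> H; have := leeD2l (nnint (fun x => indb z r x * (1 - Ek N x))%R) NP.
    by rewrite -H {1}[b]splitr EFinD leeD2rE// fin_numE.
  apply: (@le_trans _ _ (nnint (fun x => 2 * (indb z r x * (f k x - c k) ^+ 2) + 2 * N%:R ^+ 2 * indb z r x)%R)).
    apply: le_nnint => [|||x]; [by borel|by borel| |].
      by move=> x; rewrite mulr_ge0 ?sqr_ge0// mulr_ge0// subr_ge0.
    have [[-> xr]|[-> _]] := indbP z r x; last by rewrite !(mul0r,mulr0) addr0.
    rewrite !mul1r mulr1 /Ek indicE; have [uN|uN] := leP N%:R `|u x|.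
      by rewrite mem_set// subrr mulr0; nonneg.
    rewrite memNset ?subr0 ?mulr1; last by apply/negP; rewrite -ltNge.
    have := sqrD_le (c k - f k x) (f k x); rewrite subrK => /le_trans; apply.
    rewrite -[(c k - f k x) ^+ 2]sqrrN opprB lerD2l; apply: ler_wpM2l => //.
    rewrite -(real_normK (num_real (f k x))) ler_sqr ?nnegrE//.
    by rewrite (le_trans (fu k x))// ltW.
  rewrite nnintD; [|by borel|by borel|by move=> x; nonneg|by move=> x; nonneg].
  rewrite (@nnintZ _ _ 2); [|by []|by borel|by move=> x; nonneg].
  rewrite (@nnintZ _ _ (2 * N%:R ^+ 2)); [|by nonneg|by borel|by []].
  rewrite nnint_indb// [X in (_ <= X)%E]EFinD; apply: leeD; last by rewrite -EFinM.
  by rewrite EFinM; apply: lee_wpmul2l => //; exact: KP.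
pose B := (2 * K + 2 * N%:R ^+ 2 * b) / (b / 2).
have u2 : (nnint (fun x => indb z r x * u x ^+ 2)%R <= (2 * K + 2 * B * b)%:E)%E.
  apply: (@nnint_fatou _ _ (fun k x => indb z r x * f k x ^+ 2)).
  - by move=> k; have bfk := bF k; borel.
  - by borel.
  - by move=> x; nonneg.
  - by move=> k x; nonneg.
  - move=> x; apply: cvgM; first exact: cvg_cst.
    by rewrite expr2; under eq_fun do rewrite expr2; apply: cvgM; exact: sin_trunc_cvg.
  - move=> k; have bfk := bF k.
    apply: (@le_trans _ _ (nnint (fun x => 2 * (indb z r x * (f k x - c k) ^+ 2) + 2 * c k ^+ 2 * indb z r x)%R)).
      apply: le_nnint => [|||x]; [by borel|by borel|by move=> x; nonneg|].
      have [[-> xr]|[-> _]] := indbP z r x; last by rewrite !(mul0r,mulr0) addr0.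
      by rewrite !mul1r mulr1; have := sqrD_le (f k x - c k) (c k); rewrite subrK.
    rewrite nnintD; [|by borel|by borel|by move=> x; nonneg|by move=> x; nonneg].
    rewrite (@nnintZ _ _ 2); [|by []|by borel|by move=> x; nonneg].
    rewrite (@nnintZ _ _ (2 * c k ^+ 2)); [|by nonneg|by borel|by []].
    rewrite nnint_indb// -EFinM [X in (_ <= X)%E]EFinD; apply: leeD.
      by rewrite EFinM; apply: lee_wpmul2l => //; exact: KP.
    by rewrite lee_fin ler_wpM2r ?(ltW b0)// ler_wpM2l.
have Lu : L1 (fun x => indb z r x * u x).
  have LQ : L1 (fun x => indb z r x * u x ^+ 2).
    apply: L1_ge0; [by borel|by move=> x; nonneg|].
    exact: le_lt_trans u2 (ltry _).
  apply: (@L1_le _ _ _ (fun x => indb z r x + indb z r x * u x ^+ 2)); [by borel|by apply: L1D => //; exact: L1_indb|].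
  move=> x; rewrite [leRHS]ger0_norm; last by nonneg.
  have [[-> xr]|[-> _]] := indbP z r x; last by rewrite !mul0r normr0 addr0.
  rewrite !mul1r; have := sqr_ge0 (`|u x| - 1); rewrite sqrrB real_normK ?num_real//.
  by have := normr_ge0 (u x); lra.
split => //; rewrite -/mu muE.
have cc : c @ \oo --> avg u z r.
  apply/cvgrPdist_le => e e0.
  have [||||N' N'P] := @nnint_dominated _ _ (fun k x => indb z r x * `|u x - f k x|)
     (fun x => 2 * `|indb z r x * u x|) _ _ _ _ _ (mulr_gt0 e0 b0).
  - by move=> k; have bfk := bF k; borel.
  - move=> k x; rewrite mulr_ge0//= normrM (ger0_norm (i0 x r)) mulrCA ler_wpM2l//.
    by apply: (le_trans (ler_normB _ _)); have := fu k x; lra.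
  - apply: L1Z; apply: (@L1_le _ _ _ (fun x => indb z r x * u x)) => //; [by borel|].
    by move=> x; rewrite normr_id.
  - apply: aeT => x; rewrite -[0 in X in _ --> X](mulr0 (indb z r x)).
    apply: cvgM; first exact: cvg_cst.
    rewrite -[0 in X in _ --> X](@normr0 R R^o) -(subrr (u x)); apply: cvg_norm.
    by apply: cvgB; [exact: cvg_cst|exact: sin_trunc_cvg].
  exists N' => // k /= N'k; apply: (le_trans (avg_dist kappa_gt0 r0 Lu _ (N'P k N'k))).
    have bfk := bF k; apply: (@L1_le _ _ _ (fun x => indb z r x * u x)) => //; [by borel|].
    by move=> x; rewrite normrM [leRHS]normrM; apply: ler_wpM2l => //; exact: fu.
  by rewrite mulfK ?gt_eqF.
apply: (@nnint_fatou _ _ (fun k x => indb z r x * (f k x - c k) ^+ 2)) => //.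
- by move=> k; have bfk := bF k; borel.
- by borel.
- by move=> x; nonneg.
- by move=> k x; nonneg.
- move=> x; apply: cvgM; first exact: cvg_cst.
  have H : (fun k => f k x - c k) @ \oo --> u x - avg u z r.
    by apply: cvgB => //; exact: sin_trunc_cvg.
  by rewrite expr2; under eq_fun do rewrite expr2; exact: cvgM.
Qed.

End regular_set.

(** * Averages and traces *)

Section averages.
Context {R : realType} {n : nat}.
Local Notation V := 'rV[R]_n.
Local Notation kappa := (@leb_unit_ball R n).
Implicit Types (x y z : V) (f u v : V -> R).
Hypothesis kappa_gt0 : 0 < kappa.

(** The intervals of centre [a k] and radius [2 * D / 2 ^+ k] are nested; [l] is the supremum of
    their left ends. *)
Lemma geometric_limit (a : nat -> R) (D : R) : 0 <= D -> (forall k, `|a k.+1 - a k| <= D / 2 ^+ k) ->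
  exists l, forall k, `|a k - l| <= 2 * D / 2 ^+ k.
Proof.
move=> D0 H; pose e k := 2 * D / 2 ^+ k.
have e0 k : 0 <= e k by rewrite divr_ge0 ?exprn_ge0// mulr_ge0.
have eS k : e k = e k.+1 + D / 2 ^+ k.
  by rewrite /e exprS; field; rewrite expf_neq0.
have step k : a k - e k <= a k.+1 - e k.+1 /\ a k.+1 + e k.+1 <= a k + e k.
  by have := H k; rewrite ler_norml => /andP[h1 h2]; have := eS k; split; lra.
have up k j : a k - e k <= a (k + j)%N - e (k + j)%N.
  elim: j => [|j IH]; first by rewrite addn0.
  by rewrite addnS; apply: (le_trans IH); exact: (step _).1.
have dn k j : a (k + j)%N + e (k + j)%N <= a k + e k.
  elim: j => [|j IH]; first by rewrite addn0.
  by rewrite addnS; apply: le_trans IH; exact: (step _).2.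
have cross k j : a k - e k <= a j + e j.
  have [kj|jk] := leqP k j.
    by have := up k (j - k)%N; rewrite subnKC// => /le_trans; apply; have := e0 j; lra.
  have := dn j (k - j)%N; rewrite subnKC ?(ltnW jk)//; apply: le_trans; by have := e0 k; lra.
pose S := [set a k - e k | k in [set: nat]].
have supS : has_sup S.
  by split; [exists (a 0%N - e 0%N), 0%N|exists (a 0%N + e 0%N) => _ [k _ <-]; exact: cross].
exists (sup S) => k; rewrite -/(e k) ler_norml; apply/andP; split.
- have : sup S <= a k + e k by apply: ge_sup; [have [] := supS|move=> _ [j _ <-]; exact: cross].
  by lra.
- have : a k - e k <= sup S by apply: ub_le_sup; [have [] := supS|exists k].
  by lra.
Qed.

#[local] Hint Resolve indb_ge0 : core.

Lemma avg_ge0 f x (r : R) : 0 <= r -> (forall y, 0 <= f y) -> 0 <= avg f x r.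
Proof.
move=> r0 f0; rewrite /avg divr_ge0//; last by rewrite mulr_ge0 ?exprn_ge0// ltW.
by apply: rint_ge0 => y; rewrite mulr_ge0.
Qed.

Lemma avg_cst (c : R) x (r : R) : 0 < r -> avg (fun=> c) x r = c.
Proof.
move=> r0; rewrite /avg (_ : (fun y => _) = (fun y => c * indb x r y)).
  rewrite rintZ; last exact: L1_indb.
  by rewrite rint_indb// mulfK// gt_eqF// mulr_gt0// exprn_gt0.
by apply/funext => y; rewrite mulrC.
Qed.

Lemma L1_indb_abs f x (r c : R) : borel_fun f -> L1 (fun y => indb x r y * f y) ->
  L1 (fun y => indb x r y * `|f y - c|).
Proof.
move=> bf Lf; have bi := @borel_indb R n x r.
apply: (@L1_le _ _ _ (fun y => indb x r y * f y - c * indb x r y)); [by borel|by apply: L1B => //; apply: L1Z; exact: L1_indb|].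
by move=> y; rewrite [c * _]mulrC -mulrBr !normrM normr_id.
Qed.

Lemma avg_sub_cst u x (r c : R) : 0 < r -> borel_fun u -> L1 (fun y => indb x r y * u y) ->
  `|avg u x r - c| <= avg (fun y => `|u y - c|) x r.
Proof.
move=> r0 bu Lu; have b0 : 0 < kappa * r ^+ n by rewrite mulr_gt0// exprn_gt0.
have Lc : L1 (fun y => indb x r y * c) by apply: (L1_indbM (M := `|c|)) => //; exact: borel_cst.
have La := L1_indb_abs c bu Lu.
rewrite -{1}(avg_cst c x r0); have := @avg_dist R n u (fun=> c) x r (rint (fun y => indb x r y * `|u y - c|)) kappa_gt0 r0 Lu Lc.
apply; rewrite rint_nnint// => y; exact: mulr_ge0.
Qed.

Lemma avg_sqr_le f x (r K : R) : 0 < r -> L1 (fun y => indb x r y * f y) -> borel_fun f ->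
  (nnint (fun y => indb x r y * f y ^+ 2)%R <= K%:E)%E -> avg f x r ^+ 2 <= K / (kappa * r ^+ n).
Proof.
move=> r0 Lf bf H; have b0 : 0 < kappa * r ^+ n by rewrite mulr_gt0// exprn_gt0.
have bi := @borel_indb R n x r.
rewrite ler_pdivlMr//; set c := avg f x r.
have L2 : L1 (fun y => indb x r y * f y ^+ 2).
  apply: L1_ge0; [by borel|by move=> y; nonneg|]; exact: le_lt_trans H (ltry _).
have : rint (fun y => (2 * c) * (indb x r y * f y) - c ^+ 2 * indb x r y) <= rint (fun y => indb x r y * f y ^+ 2).
  apply: le_rint => //; first by apply: L1B; apply: L1Z => //; exact: L1_indb.
  move=> y; rewrite -subr_ge0 (_ : _ - _ = indb x r y * (f y - c) ^+ 2); first by nonneg.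
  by ring.
rewrite rintB; [|exact: L1Z|by apply: L1Z; exact: L1_indb].
rewrite !rintZ//; last exact: L1_indb.
have -> : rint (fun y => indb x r y * f y) = c * (kappa * r ^+ n) by rewrite /c /avg divfK// gt_eqF.
rewrite rint_indb// => H2.
have : rint (fun y => indb x r y * f y ^+ 2) <= K.
  by rewrite -lee_fin rint_nnint// => y; nonneg.
apply: le_trans; apply: le_trans H2; rewrite le_eqVlt; apply/orP; left; apply/eqP; ring.
Qed.

Lemma avg_subball f x x' (r r' K : R) : 0 < r' -> 0 < r -> r <= K * r' -> ball x' r' `<=` ball x r ->
  (forall y, 0 <= f y) -> borel_fun f -> L1 (fun y => indb x r y * f y) -> avg f x' r' <= K ^+ n * avg f x r.
Proof.
move=> r'0 r0 rK sub f0 bf Lf.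
have K0 : 0 < K by rewrite -(pmulr_lgt0 _ r'0) (lt_le_trans r0).
have bi := @borel_indb R n x' r'.
have ii y : indb x' r' y <= indb x r y.
  by have [[-> /sub yr]|[-> _]] := indbP x' r' y; [rewrite indb_in|].
have Lf' : L1 (fun y => indb x' r' y * f y).
  by apply: (@L1_le _ _ _ (fun y => indb x r y * f y)) => //; [borel|move=> y; rewrite !ger0_norm ?mulr_ge0// ler_wpM2r].
have b0 : 0 < kappa * r ^+ n by rewrite mulr_gt0// exprn_gt0.
have b'0 : 0 < kappa * r' ^+ n by rewrite mulr_gt0// exprn_gt0.
rewrite /avg ler_pdivrMr//.
apply: (@le_trans _ _ (rint (fun y => indb x r y * f y))).
  by apply: le_rint => // y; exact: ler_wpM2r.
set I := rint (fun y => indb x r y * f y).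
have I0 : 0 <= I by apply: rint_ge0 => y; exact: mulr_ge0.
rewrite [leRHS](_ : _ = I * ((K ^+ n * (kappa * r' ^+ n)) / (kappa * r ^+ n))); last by ring.
apply: ler_peMr => //; rewrite ler_pdivlMr// mul1r mulrCA; apply: ler_wpM2l; first exact: ltW.
rewrite -exprMn; apply: lerXn2r => //; rewrite nnegrE; first exact: ltW.
by apply: mulr_ge0; exact: ltW.
Qed.

(** Passing from sup norm to Euclidean balls is possible because the hypothesis controls the mean of
    the modulus: a Euclidean ball lies in the sup norm ball of the same radius and contains the one
    of radius [r / n%:R]. *)
Lemma trace_avg u x (l : R) : (0 < n)%N -> borel_fun u -> (forall r, 0 < r -> L1 (fun y => indb x r y * u y)) ->
  (forall e, 0 < e -> exists2 rho : R, 0 < rho & forall r, 0 < r -> r < rho ->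
    avg (fun y => `|u y - l|) x r <= e) -> trace u x = l.
Proof.
move=> n0 bu Lu H; rewrite /trace; apply: cvg_lim => //.
apply/cvgrPdist_le => e e0.
have nn0 : 0 < (n%:R : R) by rewrite ltr0n.
have K0 : 0 < (n%:R : R) ^+ n by exact: exprn_gt0.
(* [n%:R ^+ n] bounds the ratio of the volumes of the two balls. *)
have [rho rho0 rhoP] := H (e / n%:R ^+ n) (divr_gt0 e0 K0).
near=> r.
have r0 : 0 < r by near: r; exact: nbhs_right_gt.
have rr : r < rho by near: r; exact: nbhs_right_lt.
have bi := @borel_indb R n x r.
have mE : measurable (eball x r : set (@borelV R n)).
  by apply: measurable_open_borel; exact: open_eball.
have bE := borel_indic mE; have E0 y : 0 <= (\1_(eball x r) y : R) by rewrite indicE.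
have Ei y : \1_(eball x r) y <= indb x r y.
  rewrite indicE; have [Ey|nEy] := pselect (eball x r y).
    by rewrite mem_set// indb_in//; exact: eball_ball.
  by rewrite memNset.
set vol := fine (lebesgue_vec R n (eball x r)).
have volE : lebesgue_vec R n (eball x r) = vol%:E.
  rewrite fineK// ge0_fin_numE// -nnint_indic//.
  apply: (@le_lt_trans _ _ (nnint (indb x r))); first exact: le_nnint.
  by rewrite nnint_indb// ltry.
have vol_ge : kappa * r ^+ n <= n%:R ^+ n * vol.
  have rn0 : 0 < r / n%:R by exact: divr_gt0.
  have : (nnint (indb x (r / n%:R)) <= vol%:E)%E.
    rewrite -volE -nnint_indic//; apply: le_nnint => //; first exact: borel_indb.
    move=> y; have [[-> yr]|[-> _]] := indbP x (r / n%:R) y => //.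
    rewrite indicE mem_set//; by have := ball_eball n0 yr; rewrite mulrC divfK// gt_eqF.
  rewrite nnint_indb// lee_fin => Hv.
  have := ler_wpM2l (ltW K0) Hv; apply: le_trans.
  by rewrite expr_div_n le_eqVlt; apply/orP; left; apply/eqP; field; rewrite gt_eqF.
have b0 : 0 < kappa * r ^+ n by rewrite mulr_gt0// exprn_gt0.
have vol0 : 0 < vol by rewrite -(pmulr_rgt0 _ K0) (lt_le_trans b0).
have LE : L1 (fun y => \1_(eball x r) y * u y).
  apply: (@L1_le _ _ _ (fun y => indb x r y * u y)); [by borel|exact: Lu|].
  by move=> y; rewrite !normrM; apply: ler_wpM2r => //; rewrite !ger0_norm.
have Lv : L1 (\1_(eball x r) : V -> R).
  by apply: (@L1_le _ _ _ (indb x r)) => //; [exact: L1_indb|move=> y; rewrite !ger0_norm].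
have -> : ball_average u x r = vol^-1 * rint (fun y => \1_(eball x r) y * u y).
  rewrite /ball_average -/vol; congr (_ * _); rewrite /rint /Rintegral; congr fine.
  rewrite integral_mkcond; apply: eq_integral => y _.
  rewrite patchE indicE; case: (y \in eball x r); rewrite ?mul1r ?mul0r//.
have lE : l = vol^-1 * rint (fun y => l * \1_(eball x r) y).
  rewrite rintZ//; have -> : rint (\1_(eball x r) : V -> R) = vol.
    by apply: EFin_inj; rewrite rint_nnint// nnint_indic// volE.
  by rewrite mulrCA mulVf ?mulr1// gt_eqF.
rewrite [X in X - _]lE -mulrBr -rintB//; last exact: L1Z.
rewrite normrM gtr0_norm ?invr_gt0// ler_pdivrMl//.
have La := L1_indb_abs l bu (Lu r r0).
apply: (@le_trans _ _ (rint (fun y => indb x r y * `|u y - l|))).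
  apply: rint_small; first by apply: L1B => //; exact: L1Z.
  rewrite rint_nnint//; last by move=> y; rewrite mulr_ge0.
  apply: le_nnint; [by borel|by borel|by []|].
  move=> y; rewrite [l * _]mulrC -mulrBr normrM (ger0_norm (E0 y)) distrC.
  exact: ler_wpM2r.
have := rhoP r r0 rr; rewrite /avg ler_pdivrMr// => /le_trans; apply.
rewrite [leRHS](_ : _ = e / n%:R ^+ n * (n%:R ^+ n * vol)); last by field; rewrite gt_eqF.
by apply: ler_wpM2l => //; rewrite divr_ge0// ltW.
Unshelve. all: end_near. Qed.

End averages.

(** * Existence of the trace almost everywhere on Gamma *)

Section traces.
Context {R : realType} {n : nat}.
Local Notation V := 'rV[R]_n.
Local Notation kappa := (@leb_unit_ball R n).
Implicit Types (x y z : V).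
Variables (d C0 : R) (Gamma : set V).
Hypotheses (n2 : (2 <= n)%N) (d0 : 0 < d) (dn : d < n%:R - 1) (C01 : 1 <= C0)
  (Gneq0 : Gamma !=set0) (clG : closed Gamma) (reg : ahlfors_regular d C0 Gamma)
  (kappa_gt0 : 0 < kappa).

Local Notation p := (n%:R - 1 - d : R).
Local Notation Cp := (@poincare_cst R n d).
Local Notation n0 := (ambient_gt0 n2).

Lemma powR_dim (r : R) : 0 < r -> r ^+ n = r * (r `^ p * r `^ d).
Proof.
move=> r0; rewrite -powRD; last by rewrite (gt_eqF r0) implybT.
have -> : p + d = n.-1%:R.
  by rewrite subrK; case: (n) n2 => // k _; rewrite -natr1 addrK.
by rewrite powR_mulrn ?(ltW r0)// -exprS prednK// n0.
Qed.

Definition local_poincare_at (u m : V -> R) := forall z (r : R), Gamma z -> 0 < r ->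
  L1 (fun x => indb z r x * u x) /\
  (nnint (fun x => indb z r x * (u x - avg u z r) ^+ 2)%R <=
   (Cp * (r ^+ 2 * r `^ p))%:E * nnint (fun x => indb z (2 * r) x * m x)%R)%E.

(** One-sided, as it is applied to nonnegative functions. *)
Definition vanishing (f : V -> R) x := forall e, 0 < e -> exists2 rho : R, 0 < rho &
  forall r, 0 < r -> r < rho -> avg f x r <= e.

Section oscillation.
Variables (u m : V -> R).
Hypotheses (bu : borel_fun u) (bm : borel_fun m) (m0 : forall x, 0 <= m x)
  (mfin : (nnint m < +oo)%E) (LP : local_poincare_at u m).

Definition energy z (r : R) : R := fine (nnint (fun x => indb z r x * m x)%R).

#[local] Hint Resolve indb_ge0 : core.

Lemma energyE z r : nnint (fun x => indb z r x * m x) = (energy z r)%:E.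
Proof.
have bi := @borel_indb R n z r.
rewrite fineK// ge0_fin_numE; last by apply: nnint_ge0 => x; exact: mulr_ge0.
apply: le_lt_trans mfin; apply: le_nnint => //; first by borel.
  by move=> x; exact: mulr_ge0.
by move=> x; rewrite ler_piMl// indb_le1.
Qed.

Lemma energy_ge0 z r : 0 <= energy z r.
Proof. by rewrite -lee_fin -energyE; apply: nnint_ge0 => x; exact: mulr_ge0. Qed.

Definition osc_cst : R := Cp / kappa.

Lemma osc_cst_ge0 : 0 <= osc_cst.
Proof. by rewrite divr_ge0 ?(ltW kappa_gt0)// ltW// poincare_cst_gt0. Qed.

(** Jensen's inequality and the Poincare inequality; dividing [r ^+ 2 * r]^ p[by the volume leaves]r
    / r [^ d]. *)
Lemma oscillation z (r : R) : Gamma z -> 0 < r ->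
  avg (fun y => `|u y - avg u z r|) z r ^+ 2 <= osc_cst * (r / r `^ d) * energy z (2 * r).
Proof.
move=> Gz r0; have [Lu H] := LP Gz r0.
have bf : borel_fun (fun y => `|u y - avg u z r|) by borel.
have := @avg_sqr_le _ _ kappa_gt0 (fun y => `|u y - avg u z r|) z r
  (Cp * (r ^+ 2 * r `^ p) * energy z (2 * r)) r0 (L1_indb_abs _ bu Lu) bf.
rewrite EFinM -energyE.
under [X in (nnint X <= _)%E -> _]eq_fun do rewrite real_normK ?num_real//.
move=> /(_ H) /le_trans; apply; rewrite (powR_dim r0) le_eqVlt; apply/orP; left; apply/eqP.
by rewrite /osc_cst; field; rewrite ?gt_eqF ?powR_gt0.
Qed.

Lemma oscillation_sub z (r r' : R) : Gamma z -> 0 < r' -> r' <= r -> r <= 16 * r' ->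
  `|avg u z r' - avg u z r| <= 16 ^+ n * avg (fun y => `|u y - avg u z r|) z r.
Proof.
move=> Gz r'0 r'r rr'; have r0 : 0 < r by exact: lt_le_trans r'r.
have bf : borel_fun (fun y => `|u y - avg u z r|) by borel.
apply: (le_trans (avg_sub_cst kappa_gt0 _ r'0 bu (LP Gz r'0).1)).
apply: (avg_subball kappa_gt0 r'0 r0 rr') => //; last by apply: L1_indb_abs => //; exact: (LP Gz r0).1.
exact: le_ball.
Qed.

Lemma avg_triangle z (r c l : R) : Gamma z -> 0 < r ->
  avg (fun y => `|u y - l|) z r <= avg (fun y => `|u y - c|) z r + `|c - l|.
Proof.
move=> Gz r0; have Lu := (LP Gz r0).1.
have La := L1_indb_abs c bu Lu.
have Lc : L1 (fun y => indb z r y * `|c - l|).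
  by apply: (L1_indbM (M := `|c - l|)) => [|y]; [exact: borel_cst|rewrite normr_id].
rewrite -(avg_cst kappa_gt0 `|c - l| z r0) /avg -mulrDl -rintD//.
rewrite ler_pM2r ?invr_gt0 ?mulr_gt0 ?exprn_gt0//; apply: le_rint; [exact: L1_indb_abs|exact: L1D|].
move=> y; rewrite -mulrDr; apply: ler_wpM2l => //.
by rewrite -{1}(subrK c (u y)) -addrA ler_normD.
Qed.

(* The oscillation of [u] at scale [t] is controlled by the left-hand side to the power 1/2, so that at
   a good point the dyadic averages form a Cauchy sequence. *)
Definition good x := exists2 rho : R, 0 < rho & forall t, 0 < t -> t < rho ->
  t / t `^ d * energy x (2 * t) <= Num.sqrt t.

Lemma bad_null : hausdorff_outer d (Gamma `&` [set x | ~ good x]) = 0%E.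
Proof.
apply/eqP; rewrite eq_le outer_measure_ge0 andbT; apply/lee_addgt0Pr => e e0; rewrite add0e.
pose mm := fine (nnint m).
have mE : nnint m = mm%:E by rewrite fineK// ge0_fin_numE// nnint_ge0.
have mm0 : 0 <= mm by rewrite -lee_fin -mE nnint_ge0.
pose K : R := C0 * n%:R `^ d * 5 `^ d * 2 `^ d * (mm + 1).
have K0 : 0 < K.
  have c0 : 0 < C0 := lt_le_trans ltr01 C01.
  have nn : 0 < (n%:R : R) by rewrite ltr0n n0.
  have m1 : 0 < mm + 1 by rewrite ltr_wpDl.
  by rewrite /K !mulr_gt0 ?powR_gt0.
pose rho := (e / K) ^+ 2; have rho0 : 0 < rho by rewrite exprn_gt0// divr_gt0.
set S := _ `&` _.
have /choice[t tP] x : exists t, S x -> [/\ 0 < t, t < rho & Num.sqrt t < t / t `^ d * energy x (2 * t)].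
  have [Sx|nSx] := pselect (S x); last by exists 0 => /nSx.
  apply: contrapT => H; apply: Sx.2; exists rho => // t t0 tr.
  by rewrite leNgt; apply/negP => lt; apply: H; exists t => _; split.
have sK : 0 <= 2 `^ d * Num.sqrt rho by rewrite mulr_ge0 ?powR_ge0 ?sqrtr_ge0.
have CC : 0 <= C0 * n%:R `^ d by rewrite mulr_ge0 ?powR_ge0// (le_trans ler01).
have := @hausdorff_vitali R n d (C0 * n%:R `^ d) S (fun x => 2 * t x) (2 * rho) (2 `^ d * Num.sqrt rho) m
  _ sK CC d0 _ bm m0 _.
move=> H; apply: (le_trans (H _ _ _)) => {H}.
- by move=> x /tP[t0 tr _]; rewrite mulr_gt0//= ler_wpM2l// ltW.
- move=> x r [Gx _] r0; apply: le_trans (regular_ball_le n2 reg Gx r0).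
  by apply: le_outer_measure => y [[Gy _] xy]; split.
- move=> x Sx; have [t0 tr tE] := tP x Sx.
  rewrite energyE -EFinM lee_fin powRM// ?(ltW t0)// -mulrA; apply: ler_wpM2l; first exact: powR_ge0.
  have s0 : 0 < Num.sqrt (t x) by rewrite sqrtr_gt0.
  have td : 0 < t x `^ d by exact: powR_gt0.
  have E0 := energy_ge0 x (2 * t x).
  apply: (@le_trans _ _ (Num.sqrt (t x) * energy x (2 * t x))); last first.
    by apply: ler_wpM2r => //; rewrite ler_sqrt// ltW.
  move: tE; rewrite -{2}(sqr_sqrtr (ltW t0)) expr2 mulrAC -mulrA -mulrA.
  rewrite -[X in X < _]mulr1 ltr_pM2l// => /ltW; rewrite mulrA ler_pdivlMr// mul1r.
  done.
rewrite mE -EFinM lee_fin sqrtr_sqr ger0_norm ?divr_ge0 ?(ltW e0) ?(ltW K0)//.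
rewrite (_ : _ * mm = (e / K) * (C0 * n%:R `^ d * 5 `^ d * 2 `^ d * mm)); last by ring.
rewrite mulrAC ler_pdivrMr// ler_wpM2l ?(ltW e0)// /K ler_wpM2l ?lerDl//.
by rewrite !mulr_ge0 ?powR_ge0// (le_trans ler01).
Qed.

(** Along a geometric sequence of radii the means are Cauchy, because consecutive ones differ by at
    most a multiple of the oscillation. A radius between two terms is compared with the larger one,
    at the cost of [16 ^+ n]. *)
Lemma good_limit x : Gamma x -> good x -> exists l, vanishing (fun y => `|u y - l|) x.
Proof.
move=> Gx [rho rho0 rhoP].
pose T := rho / 2; have T0 : 0 < T by rewrite divr_gt0.
(* With ratio 16 the oscillation, of order the fourth root of [t k] at a good point, decays like
   [2 ^- k]. *)
pose t k := T / 16 ^+ k.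
have t0 k : 0 < t k by rewrite divr_gt0// exprn_gt0.
have tT k : t k < rho.
  apply: (@le_lt_trans _ _ T); last by rewrite /T; lra.
  by rewrite ler_pdivrMr ?exprn_gt0// ler_peMr ?(ltW T0)// exprn_ege1// ler1n.
have tS k : t k = 16 * t k.+1 by rewrite /t exprS; field; rewrite expf_neq0.
pose a k := avg u x (t k); pose o k := avg (fun y => `|u y - a k|) x (t k).
have o0 k : 0 <= o k by apply: avg_ge0 => //; exact: ltW.
pose D := Num.sqrt (osc_cst * Num.sqrt T).
have D0 : 0 <= D by exact: sqrtr_ge0.
have oD k : o k <= D / 2 ^+ k.
  have e2 : (0 : R) <= D / 2 ^+ k by rewrite divr_ge0// exprn_ge0.
  rewrite -(@ler_pXn2r _ 2)// ?nnegrE//.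
  apply: (le_trans (oscillation Gx (t0 k))); rewrite -mulrA.
  apply: (@le_trans _ _ (osc_cst * Num.sqrt (t k))).
    by apply: ler_wpM2l (rhoP _ (t0 k) (tT k)); exact: osc_cst_ge0.
  have -> : Num.sqrt (t k) = Num.sqrt T / 4 ^+ k.
    have -> : t k = (Num.sqrt T / 4 ^+ k) ^+ 2.
      rewrite expr_div_n sqr_sqrtr ?(ltW T0)// -exprM mulnC exprM /t.
      by congr (_ / _ ^+ _); ring.
    by rewrite sqrtr_sqr ger0_norm// divr_ge0 ?sqrtr_ge0// exprn_ge0.
  rewrite expr_div_n sqr_sqrtr; last by rewrite mulr_ge0 ?osc_cst_ge0 ?sqrtr_ge0.
  rewrite -exprM mulnC exprM (_ : 2 ^+ 2 = 4 :> R) ?mulrA//; ring.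
have n16 : (0 : R) <= 16 ^+ n by rewrite exprn_ge0.
have [|k|l lP] := @geometric_limit R a (16 ^+ n * D); first by rewrite mulr_ge0.
  apply: (@le_trans _ _ (16 ^+ n * o k)).
    apply: oscillation_sub => //; first by rewrite [leRHS]tS; have := t0 k.+1; lra.
    by rewrite -tS.
  by rewrite -mulrA ler_wpM2l.
exists l => e e0.
pose D' := 16 ^+ n * (D + 2 * (16 ^+ n * D)).
have D'0 : 0 <= D' by rewrite mulr_ge0// addr_ge0// !mulr_ge0.
have bl : borel_fun (fun y => `|u y - l|) by borel.
have small k : avg (fun y => `|u y - l|) x (t k) <= (D + 2 * (16 ^+ n * D)) / 2 ^+ k.
  apply: (le_trans (avg_triangle (a k) l Gx (t0 k))); rewrite mulrDl; apply: lerD => //.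
  exact: oD.
have [K KP] : exists K, D' / 2 ^+ K <= e.
  have /cvgrPdist_le /(_ e e0) [K _ KP] : (fun k => D' * (2^-1) ^+ k) @ \oo --> (D' * 0 : R).
    apply: cvgM; first exact: cvg_cst.
    by apply: cvg_expr; rewrite ger0_norm// invf_lt1// ltr1n.
  exists K; have := KP K (leqnn K); rewrite mulr0 sub0r normrN ger0_norm ?exprVn//.
  by rewrite mulr_ge0// invr_ge0 exprn_ge0.
exists (t K) => // r r0 rK.
have [k [Kk rk kr]] : exists k, [/\ (K <= k)%N, r <= t k & t k.+1 <= r].
  have ex : exists k, t k <= r.
    have /cvgrPdist_le /(_ r r0) [j _ jP] : (fun k => T * (16^-1) ^+ k) @ \oo --> (T * 0 : R).
      apply: cvgM; first exact: cvg_cst.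
      by apply: cvg_expr; rewrite ger0_norm// invf_lt1// ltr1n.
    exists j; have := jP j (leqnn j); rewrite mulr0 sub0r normrN ger0_norm ?exprVn//.
    by rewrite mulr_ge0 ?(ltW T0)// invr_ge0 exprn_ge0.
  have tmono i j : (i <= j)%N -> t j <= t i.
    move=> ij; rewrite ler_pM2l// lef_pV2 ?posrE ?exprn_gt0//; apply: ler_weXn2l => //; exact: ler1n.
  case: (ex_minnP ex) => -[|k] kr kmin.
    by have := lt_le_trans rK (tmono 0%N K (leq0n K)); rewrite ltNge kr.
  exists k; split => //.
    by rewrite -ltnS ltnNge; apply/negP => /tmono /le_trans /(_ kr); rewrite leNgt rK.
  by rewrite leNgt; apply/negP => /ltW /kmin; rewrite ltnn.
apply: le_trans KP; apply: (@le_trans _ _ (16 ^+ n * avg (fun y => `|u y - l|) x (t k))).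
  apply: (avg_subball kappa_gt0 r0 (t0 k)) => //.
  - by rewrite tS ler_wpM2l.
  - exact: le_ball.
  - by apply: L1_indb_abs => //; exact: (LP Gx (t0 k)).1.
rewrite /D' -mulrA; apply: ler_wpM2l => //; apply: (le_trans (small k)).
apply: ler_wpM2l; first by rewrite addr_ge0// !mulr_ge0.
by rewrite lef_pV2 ?posrE ?exprn_gt0//; apply: ler_weXn2l => //; exact: ler1n.
Qed.

(** At a good point the trace is the limit [l] in the mean, so [G l = 0], and the Lipschitz bound on
    [G] transfers the convergence from [u] to [G (u y)]. *)
Lemma good_vanishing x (G : R -> R) (L M : R) : Gamma x -> good x -> trace u x <= M ->
  borel_fun (fun y => G (u y)) ->
  0 <= L -> (forall s t, `|G s - G t| <= L * `|s - t|) -> (forall t, t <= M -> G t = 0) ->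
  vanishing (fun y => G (u y)) x.
Proof.
move=> Gx gx TM bG L0 GL G0; have [l lP] := good_limit Gx gx.
have Lu (r : R) : 0 < r -> L1 (fun y => indb x r y * u y) by move=> r0; exact: (LP Gx r0).1.
move: TM; rewrite (trace_avg kappa_gt0 n0 bu Lu lP) => lM e e0.
have L1' : 0 < L + 1 by rewrite ltr_wpDl.
have [rho rho0 rhoP] := lP (e / (L + 1)) (divr_gt0 e0 L1').
exists rho => // r r0 rr; have := rhoP r r0 rr.
have La := L1_indb_abs l bu (Lu r r0).
have GU y : `|G (u y)| <= L * `|u y - l| by rewrite -[X in `|X|]subr0 -(G0 l lM).
have bi := @borel_indb R n x r.
rewrite ler_pdivlMr// => H; apply: le_trans H.
apply: (@le_trans _ _ (L * avg (fun y => `|u y - l|) x r)); last first.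
  by rewrite mulrC; apply: ler_wpM2l; [apply: avg_ge0 => //; exact: ltW|rewrite lerDl].
rewrite /avg mulrA ler_pM2r ?invr_gt0 ?mulr_gt0 ?exprn_gt0// -rintZ//.
apply: le_rint; [|exact: L1Z|].
  apply: (@L1_le _ _ _ (fun y => L * (indb x r y * `|u y - l|))); [by borel|exact: L1Z|].
  by move=> y; rewrite normrM [leRHS]ger0_norm ?mulr_ge0// mulrCA ger0_norm// ler_wpM2l.
move=> y; rewrite mulrCA; apply: ler_wpM2l => //; exact: le_trans (ler_norm _) (GU y).
Qed.

End oscillation.
End traces.

(** * Hardy inequality for functions with vanishing trace *)

Section trace_poincare.
Context {R : realType} {n : nat}.
Local Notation V := 'rV[R]_n.
Local Notation kappa := (@leb_unit_ball R n).
Implicit Types (x y z : V).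
Variables (d C0 : R) (Gamma : set V).
Hypotheses (n2 : (2 <= n)%N) (d0 : 0 < d) (dn : d < n%:R - 1) (C01 : 1 <= C0)
  (Gneq0 : Gamma !=set0) (clG : closed Gamma) (reg : ahlfors_regular d C0 Gamma)
  (kappa_gt0 : 0 < kappa).
Variables (v m : V -> R).
Hypotheses (bv : borel_fun v) (v0 : forall x, 0 <= v x)
  (bm : borel_fun m) (m0 : forall x, 0 <= m x) (mfin : (nnint m < +oo)%E)
  (LP : local_poincare_at d Gamma v m)
  (van : hausdorff_outer d (Gamma `&` [set x | ~ vanishing v x]) = 0%E).

Local Notation p := (n%:R - 1 - d : R).
Local Notation Cp := (@poincare_cst R n d).
Local Notation Q := (@osc_cst R n d).
Local Notation n0 := (ambient_gt0 n2).
Local Notation p0 := (codim_gt0 dn).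
Local Notation E := (energy m).
Local Notation w := (weight Gamma d).

#[local] Hint Resolve indb_ge0 : core.

Lemma energyS z z' (r r' : R) : ball z r `<=` ball z' r' -> E z r <= E z' r'.
Proof.
move=> sub; rewrite -lee_fin -!energyE//; have b1 := @borel_indb R n z r; have b2 := @borel_indb R n z' r'.
apply: le_nnint => [|||x]; [by borel|by borel|by move=> x; exact: mulr_ge0|].
by have [[-> /sub xr]|[-> _]] := indbP z r x; [rewrite indb_in|rewrite mul0r mulr_ge0].
Qed.

(** The two factors [16 ^+ n] come from squaring [oscillation_sub], and 32 from [16 * 16 ^+ k * t k]
    with [16 ^+ k * t k = 2 * r]. *)
Definition density_cst : R := 32 * 16 ^+ n * 16 ^+ n * Q.

Lemma density_cst_ge0 : 0 <= density_cst.
Proof. by have Q0 := osc_cst_ge0 d n2 kappa_gt0; rewrite /density_cst; nonneg. Qed.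

(* If all consecutive dyadic averages were close, telescoping would bound [avg v x (2 * r)] by half
   of itself, since the averages tend to 0. *)
Lemma vanishing_density x (r lam : R) : Gamma x -> vanishing v x -> 0 < r -> 0 < lam ->
  lam <= avg v x (2 * r) ->
  exists t, [/\ 0 < t, t <= 2 * r & t `^ d <= density_cst * r / lam ^+ 2 * E x (2 * t)].
Proof.
move=> Gx vx r0 lam0 lamv; pose t k := 2 * r / 16 ^+ k.
have T0 : 0 < 2 * r by rewrite mulr_gt0.
have t0 k : 0 < t k by rewrite divr_gt0 ?exprn_gt0.
have tT k : t k <= 2 * r by rewrite ler_pdivrMr ?exprn_gt0// ler_peMr ?(ltW T0)// exprn_ege1// ler1n.
have tS k : t k = 16 * t k.+1 by rewrite /t exprS; field; rewrite expf_neq0.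
pose a k := avg v x (t k).
have [k kP] : exists k, lam / 2 ^+ k.+2 <= `|a k.+1 - a k|.
  apply: contrapT => H.
  have step k : `|a k.+1 - a k| < lam / 2 ^+ k.+2.
    by rewrite ltNge; apply/negP => Hk; apply: H; exists k.
  (* The bounds [lam / 2 ^+ k.+2] on the increments add up to [lam / 2], so the means would stay
     above [lam / 2], against [vx]. *)
  have low k : lam / 2 + lam / 2 ^+ k.+1 <= a k.
    elim: k => [|k IH]; first by rewrite expr1 -splitr /a /t expr0 divr1.
    have := step k; rewrite ltr_norml => /andP[h _].
    have -> : lam / 2 ^+ k.+2 = lam / 2 ^+ k.+1 - lam / 2 ^+ k.+2.
      by rewrite !exprS; field; rewrite expf_neq0.
    by lra.
  have [rho rho0 rhoP] := vx (lam / 4) (divr_gt0 lam0 (ltr0n _ 4)).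
  have [k kr] : exists k, t k < rho.
    have /cvgrPdist_lt /(_ rho rho0) [j _ jP] : (fun k => 2 * r * (16^-1) ^+ k) @ \oo --> (2 * r * 0 : R).
      apply: cvgM; first exact: cvg_cst.
      by apply: cvg_expr; rewrite ger0_norm// invf_lt1// ltr1n.
    exists j; have := jP j (leqnn j); rewrite mulr0 sub0r normrN ger0_norm ?exprVn//.
    by rewrite mulr_ge0 ?(ltW T0)// invr_ge0 exprn_ge0.
  have := rhoP (t k) (t0 k) kr; have := low k; rewrite -/(a k).
  have : 0 < lam / 2 ^+ k.+1 by rewrite divr_gt0// exprn_gt0.
  by lra.
exists (t k); split => //.
set o := avg (fun y => `|v y - a k|) x (t k).
have o0 : 0 <= o by apply: avg_ge0 => //; exact: ltW.
have osc : o ^+ 2 <= Q * (t k / t k `^ d) * E x (2 * t k) by exact: (oscillation n2 kappa_gt0 bv bm m0 mfin LP Gx (t0 k)).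
have sub : `|a k.+1 - a k| <= 16 ^+ n * o.
  apply: (oscillation_sub kappa_gt0 bv LP Gx (t0 k.+1)); first by rewrite [leRHS]tS; have := t0 k.+1; lra.
  by rewrite -tS.
have l0 : 0 <= lam / 2 ^+ k.+2 by rewrite divr_ge0 ?exprn_ge0// ltW.
have n16 : (0 : R) <= 16 ^+ n by rewrite exprn_ge0.
have : (lam / 2 ^+ k.+2) ^+ 2 <= (16 ^+ n * o) ^+ 2.
  by rewrite ler_sqr ?nnegrE//; [exact: le_trans kP sub|exact: mulr_ge0].
rewrite [leRHS]exprMn => H.
have {}H := le_trans H (ler_wpM2l (sqr_ge0 _) osc).
have td : 0 < t k `^ d by exact: powR_gt0.
have E0 := energy_ge0 bm m0 mfin x (2 * t k).
(* The loss [4 ^+ k] from the square of the threshold is absorbed by the decay of [t k], whatever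
   the scale found. *)
have e4 : (4 : R) ^+ k <= 16 ^+ k by apply: lerXn2r; rewrite ?nnegrE// ler_nat.
have l2 : 0 < lam ^+ 2 by rewrite exprn_gt0.
have X0 : 0 <= (16 ^+ n) ^+ 2 * Q * E x (2 * t k).
  by have Q0 := osc_cst_ge0 d n2 kappa_gt0; nonneg.
have H2 : lam ^+ 2 * t k `^ d <= 16 * 4 ^+ k * t k * ((16 ^+ n) ^+ 2 * Q * E x (2 * t k)).
  have c0 : 0 <= 16 * 4 ^+ k * t k `^ d by rewrite !mulr_ge0 ?exprn_ge0// ltW.
  have := ler_wpM2l c0 H.
  rewrite (_ : _ * (lam / _) ^+ 2 = lam ^+ 2 * t k `^ d); last first.
    rewrite expr_div_n -exprM mulnC exprM (_ : 2 ^+ 2 = 4 :> R); last by ring.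
    by rewrite !exprS; field; rewrite expf_neq0.
  move=> /le_trans; apply; rewrite le_eqVlt; apply/orP; left; apply/eqP; field.
  by rewrite gt_eqF.
rewrite [leRHS]mulrAC ler_pdivlMr// mulrC; apply: (le_trans H2).
apply: (@le_trans _ _ (16 * 16 ^+ k * t k * ((16 ^+ n) ^+ 2 * Q * E x (2 * t k)))).
  by rewrite ler_wpM2r// ler_wpM2r ?(ltW (t0 k))// ler_wpM2l.
rewrite le_eqVlt; apply/orP; left; apply/eqP; rewrite /t /density_cst.
by field; rewrite expf_neq0.
Qed.

Definition trace_cst : R :=
  4 ^+ n * (C0 * (C0 * n%:R `^ d * 5 `^ d * 2 `^ d * density_cst)).

Lemma trace_cst_ge0 : 0 <= trace_cst.
Proof.
have c0 : 0 <= C0 := le_trans ler01 C01.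
by have D0 := density_cst_ge0; rewrite /trace_cst; nonneg.
Qed.

Lemma trace_poincare z (r : R) : Gamma z -> 0 < r ->
  avg v z r ^+ 2 <= trace_cst * (r / r `^ d) * E z (5 * r).
Proof.
move=> Gz r0; have E5 := energy_ge0 bm m0 mfin z (5 * r).
have rd : 0 < r `^ d by exact: powR_gt0.
have cC : 0 < C0 := lt_le_trans ltr01 C01.
have a0 : 0 <= avg v z r by apply: avg_ge0 => //; exact: ltW.
have [a0'|az] := ltP 0 (avg v z r); last first.
  have -> : avg v z r = 0 by apply/eqP; rewrite eq_le az a0.
  by rewrite expr0n/= mulr_ge0// mulr_ge0 ?trace_cst_ge0// divr_ge0 ?ltW.
(* For [x] in the ball of centre [z], the ball of radius [2 * r] about [x] contains it and is
   [2 ^+ n] times as large, so the mean of [v] over it is at least [lam]. *)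
pose lam := avg v z r / 2 ^+ n; have lam0 : 0 < lam by rewrite divr_gt0// exprn_gt0.
pose S := [set x | Gamma x /\ ball z r x /\ vanishing v x].
have /choice[t tP] x : exists t, S x ->
    [/\ 0 < t, t <= 2 * r & t `^ d <= density_cst * r / lam ^+ 2 * E x (2 * t)].
  have [[Gx [xr vx]]|nS] := pselect (S x); last by exists 0 => /nS.
  have [|t tP] := @vanishing_density x r lam Gx vx r0 lam0 _; last by exists t.
    rewrite /lam ler_pdivrMr ?exprn_gt0// mulrC; apply: (avg_subball kappa_gt0 r0 _ _) => //.
    - by rewrite mulr_gt0.
    - move=> y /rV_ball_norm zy; apply/rV_ball_norm; move: xr => /rV_ball_norm xr.
      by rewrite -(subrKA z) (le_lt_trans (ler_normD _ _))// distrC mulr_natl mulr2n ltrD.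
    - by apply: (LP Gx _).1; rewrite mulr_gt0.
pose A := 2 `^ d * (density_cst * r / lam ^+ 2).
have A0 : 0 <= A.
  by rewrite mulr_ge0 ?powR_ge0// divr_ge0 ?sqr_ge0// mulr_ge0 ?density_cst_ge0// ltW.
have CC : 0 <= C0 * n%:R `^ d by rewrite mulr_ge0 ?powR_ge0// ltW.
have b5 := @borel_indb R n z (5 * r).
have bf : borel_fun (fun y => indb z (5 * r) y * m y) by borel.
have f0 y : 0 <= indb z (5 * r) y * m y by exact: mulr_ge0.
(* The balls of radius [2 * t x], at most [4 * r], are centred within [r] of [z]; hence the radius
   [5 * r]. *)
have HS : (hausdorff_outer d S <= (C0 * n%:R `^ d * 5 `^ d * A * E z (5 * r))%:E)%E.
  rewrite [X in (_ <= X)%E]EFinM -energyE//.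
  apply: (@hausdorff_vitali R n d (C0 * n%:R `^ d) S (fun x => 2 * t x) (4 * r) A) => //.
  - by move=> x /tP[tx0 tx2 _]; rewrite mulr_gt0//=; lra.
  - move=> x s [Gx _] s0; apply: le_trans (regular_ball_le n2 reg Gx s0).
    by apply: le_outer_measure => y [[Gy _] xy]; split.
  - move=> x Sx; have [tx0 tx2 td] := tP x Sx; have [Gx [xr _]] := Sx.
    have -> : (fun y => indb x (2 * t x) y * (indb z (5 * r) y * m y)) = (fun y => indb x (2 * t x) y * m y).
      apply/funext => y; have [[-> xy]|[-> _]] := indbP x (2 * t x) y; last by rewrite !mul0r.
      rewrite indb_in ?mul1r//; move: xr xy => /rV_ball_norm xr /rV_ball_norm xy; apply/rV_ball_norm.
      by rewrite -(subrKA x) (le_lt_trans (ler_normD _ _))//; lra.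
    rewrite energyE// -EFinM lee_fin powRM// ?(ltW tx0)// /A -[leRHS]mulrA; apply: ler_wpM2l => //.
have : (hausdorff_outer d (Gamma `&` ball z r) <= hausdorff_outer d S)%E.
  apply: (@le_trans _ _ (hausdorff_outer d (S `|` (Gamma `&` [set x | ~ vanishing v x])))).
    apply: le_outer_measure => x [Gx xr]; have [vx|nvx] := pselect (vanishing v x).
      by left.
    by right.
  by apply: (le_trans (outer_measureU2 (hausdorff_outer d) _ _)); rewrite [X in (_ + X <= _)%E]van adde0.
move=> /(le_trans (regular_ball_ge reg Gz r0)) /le_trans /(_ HS); rewrite lee_fin.
rewrite mulrC ler_pdivrMr// => H.
have l2 : 0 < lam ^+ 2 by rewrite exprn_gt0.
have H2 := ler_wpM2r (ltW l2) H.
have -> : avg v z r ^+ 2 = 4 ^+ n * lam ^+ 2.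
  have -> : (4 : R) ^+ n = (2 ^+ n) ^+ 2.
    by rewrite -exprM mulnC exprM (_ : 2 ^+ 2 = 4 :> R)//; ring.
  by rewrite /lam; field; rewrite expf_neq0.
rewrite (_ : trace_cst * _ * _ = 4 ^+ n * ((C0 * n%:R `^ d * 5 `^ d * A * E z (5 * r)) * C0 * lam ^+ 2) / r `^ d).
  by rewrite ler_pdivlMr// -[leLHS]mulrA; apply: ler_wpM2l; [exact: exprn_ge0|rewrite mulrC].
by rewrite /trace_cst /A; field; rewrite !gt_eqF.
Qed.

Definition ball_cst : R := 2 * Cp + 2 * (kappa * trace_cst).

Lemma ball_cst_ge0 : 0 <= ball_cst.
Proof.
have c1 := poincare_cst_gt0 d n2; have c2 := trace_cst_ge0.
by rewrite /ball_cst; nonneg.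
Qed.

Lemma sqr_ball_le z (r : R) : Gamma z -> 0 < r ->
  (nnint (fun x => indb z r x * v x ^+ 2)%R <= (ball_cst * (r ^+ 2 * r `^ p) * E z (5 * r))%:E)%E.
Proof.
move=> Gz r0; set c := avg v z r; have bi := @borel_indb R n z r.
have rd : 0 < r `^ d by exact: powR_gt0.
apply: (@le_trans _ _ (nnint (fun x => 2 * (indb z r x * (v x - c) ^+ 2) + 2 * c ^+ 2 * indb z r x)%R)).
  apply: le_nnint => [|||x]; [by borel|by borel|by move=> x; nonneg|].
  have [[-> xr]|[-> _]] := indbP z r x; last by rewrite !(mul0r,mulr0) addr0.
  by rewrite !mul1r mulr1; have := sqrD_le (v x - c) c; rewrite subrK.
rewrite nnintD; [|by borel|by borel|by move=> x; nonneg|by move=> x; nonneg].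
rewrite (@nnintZ _ _ 2); [|by []|by borel|by move=> x; nonneg].
rewrite (@nnintZ _ _ (2 * c ^+ 2)); [|by nonneg|by borel|by []].
rewrite nnint_indb//.
have E25 : E z (2 * r) <= E z (5 * r) by apply: energyS; apply: le_ball; lra.
have K0 : 0 <= Cp * (r ^+ 2 * r `^ p).
  by have c1 := poincare_cst_gt0 d n2; nonneg.
apply: (@le_trans _ _ (2%:E * (Cp * (r ^+ 2 * r `^ p) * E z (5 * r))%:E +
  (2 * (trace_cst * (r / r `^ d) * E z (5 * r)))%:E * (kappa * r ^+ n)%:E)%E); last first.
  rewrite -!EFinM -EFinD lee_fin le_eqVlt; apply/orP; left; apply/eqP; rewrite (powR_dim d n2 r0) /ball_cst.
  by field; rewrite gt_eqF.
apply: leeD.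
  apply: lee_wpmul2l => //; apply: (le_trans (LP Gz r0).2); rewrite energyE// -EFinM lee_fin.
  exact: ler_wpM2l.
apply: lee_wpmul2r; first by rewrite lee_fin mulr_ge0 ?exprn_ge0 ?ltW.
by rewrite lee_fin; apply: ler_wpM2l => //; exact: trace_poincare.
Qed.

Definition nbh (r : R) : set V := [set x | exists2 z, Gamma z & ball z r x].

Lemma open_nbh r : open (nbh r).
Proof.
rewrite (_ : nbh r = \bigcup_(z in Gamma) ball z r).
  by apply: bigcup_open => z _; exact: ball_open.
by apply/seteqP; split => x [z Gz xz]; exists z.
Qed.

Lemma borel_nbh r : borel_fun (\1_(nbh r)).
Proof. by apply: borel_indic; apply: measurable_open_borel; exact: open_nbh. Qed.

Definition layer_cst : R := ball_cst * 9 * 3 `^ p * 17 ^+ n.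

(** Instead of a covering with bounded overlap, the centre [y] of a ball of radius [r] is averaged
    over the whole space, and Tonelli's theorem is used once to introduce these balls and once to
    remove them. *)
Lemma layer (r : R) : 0 < r ->
  (nnint (fun x => \1_(nbh r) x * v x ^+ 2)%R <= (layer_cst * (r ^+ 2 * r `^ p))%:E * nnint m)%E.
Proof.
move=> r0; pose b := kappa * r ^+ n; have b0 : 0 < b by rewrite mulr_gt0// exprn_gt0.
have b1 : 0 <= b^-1 by rewrite invr_ge0 ltW.
have bN := borel_nbh r.
pose f x := \1_(nbh r) x * v x ^+ 2.
have bf : borel_fun f by rewrite /f; borel.
have f0 x : 0 <= f x by rewrite /f mulr_ge0 ?sqr_ge0// indicE.
have swap (s : R) x y : indb 0 s (x - y) = indb y s x.
  have [[-> /rV_ball_norm xs]|[-> ys]] := indbP y s x.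
    by rewrite indb_in//; apply/rV_ball_norm; rewrite sub0r normrN distrC.
  by rewrite indb_out// => /rV_ball_norm H; apply: ys; apply/rV_ball_norm; rewrite distrC -[X in `|X|]opprK normrN -[X in `|X|]sub0r.
have swap' (s : R) x y : indb 0 s (x - y) = indb x s y.
  have [[-> /rV_ball_norm xs]|[-> ys]] := indbP x s y.
    by rewrite indb_in//; apply/rV_ball_norm; rewrite sub0r normrN.
  by rewrite indb_out// => /rV_ball_norm H; apply: ys; apply/rV_ball_norm; rewrite -[X in `|X|]opprK normrN -[X in `|X|]sub0r.
(* If the ball about [y] meets the layer, some [z] of Gamma is within [2 * r] of [y]. [sqr_ball_le]
   is applied on the ball of radius [3 * r] about [z], and its energy ball, of radius [15 * r], lies
   within [17 * r] of [y]. *)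
pose s := 17 * r; have s0 : 0 < s by rewrite mulr_gt0.
pose K := b^-1 * (ball_cst * ((3 * r) ^+ 2 * (3 * r) `^ p)).
have B0 := ball_cst_ge0.
have K0 : 0 <= K by rewrite /K; nonneg.
have b2 : borel_fun2 (fun x y => b^-1 * (indb 0 r (x - y) * f x)).
  apply: borel2M; first exact: borel2_cst.
  by apply: borel2M; [exact: borel2_sub (borel_indb _ _)|exact: borel2_fst].
have b3 : borel_fun2 (fun y x => K * (indb 0 s (y - x) * m x)).
  apply: borel2M; first exact: borel2_cst.
  by apply: borel2M; [exact: borel2_sub (borel_indb _ _)|exact: borel2_snd].
have bE : borel_fun (fun y => E y s).
  have b4 : borel_fun2 (fun y x => indb 0 s (y - x) * m x).
    by apply: borel2M; [exact: borel2_sub (borel_indb _ _)|exact: borel2_snd].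
  have := borel_fine_nnint b4 (fun y x => mulr_ge0 (indb_ge0 0 s (y - x)) (m0 x)).
  congr borel_fun; apply/funext => y; rewrite /energy; congr (fine (nnint _)); apply/funext => x.
  by rewrite swap'.
apply: (@le_trans _ _ (nnint (fun y => K * E y s))).
  apply: (nnint_tonelli_le b2) => //.
  - by move=> x y; rewrite mulr_ge0// mulr_ge0.
  - by borel.
  - move=> x; rewrite (_ : (fun y => _) = (fun y => (b^-1 * f x) * indb x r y)); last first.
      by apply/funext => y; rewrite swap' mulrCA mulrC mulrA.
    rewrite nnintZ; [|by rewrite mulr_ge0|exact: borel_indb|by []].
    by rewrite nnint_indb// -EFinM lee_fin -/b mulrAC mulVf ?mul1r// gt_eqF.
  - move=> y; have E0 := energy_ge0 bm m0 mfin y s.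
    have [[z [Gz yz]]|H] := pselect (exists z, Gamma z /\ ball y (2 * r) z); last first.
      rewrite [X in (X <= _)%E](_ : _ = 0)%E; first by rewrite lee_fin mulr_ge0.
      apply: integral0_eq => x _; rewrite swap /f.
      have [[-> xr]|[-> _]] := indbP y r x; last by rewrite mul0r mulr0.
      rewrite indicE memNset ?mul0r ?mulr0// => -[z Gz zx]; apply: H; exists z; split => //.
      apply/rV_ball_norm; move: xr zx => /rV_ball_norm xr /rV_ball_norm zx.
      by rewrite -(subrKA x) (le_lt_trans (ler_normD _ _))// [X in _ + X]distrC; lra.
    move: yz => /rV_ball_norm yz.
    have r3 : 0 < 3 * r by rewrite mulr_gt0.
    rewrite [X in (X <= _)%E](_ : _ = nnint (fun x => b^-1 * (indb y r x * f x))); last first.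
      by congr nnint; apply/funext => x; rewrite swap.
    have biy := @borel_indb R n y r; have biz := @borel_indb R n z (3 * r).
    rewrite nnintZ; [|by []|by borel|by move=> x; exact: mulr_ge0].
    rewrite /K -mulrA EFinM; apply: lee_wpmul2l => //.
    apply: (@le_trans _ _ (nnint (fun x => indb z (3 * r) x * v x ^+ 2))).
      apply: le_nnint => [|||x]; [by borel|by borel|by move=> x; exact: mulr_ge0|].
      have [[-> /rV_ball_norm xr]|[-> _]] := indbP y r x; last by rewrite mul0r; nonneg.
      rewrite indb_in ?mul1r; last first.
        by apply/rV_ball_norm; rewrite -(subrKA y) (le_lt_trans (ler_normD _ _))// distrC; lra.
      by rewrite /f ler_piMl ?sqr_ge0// indicE lern1 leq_b1.
    apply: (le_trans (sqr_ball_le Gz r3)); rewrite lee_fin; apply: ler_wpM2l.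
      by nonneg.
    apply: energyS => x /rV_ball_norm xz; apply/rV_ball_norm.
    by rewrite -(subrKA z) (le_lt_trans (ler_normD _ _))// /s; lra.
apply: (@le_trans _ _ (nnint (fun x => K * (kappa * s ^+ n) * m x))).
  have KS : 0 <= K * (kappa * s ^+ n).
    by rewrite mulr_ge0// mulr_ge0 ?exprn_ge0 ?(ltW kappa_gt0) ?(ltW s0).
  apply: (nnint_tonelli_le b3) => //.
  - by move=> y x; rewrite mulr_ge0// mulr_ge0.
  - by borel.
  - by borel.
  - by move=> y; rewrite mulr_ge0// energy_ge0.
  - move=> y; have biy := @borel_indb R n y s.
    rewrite [X in (_ <= X)%E](_ : _ = nnint (fun x => K * (indb y s x * m x))); last first.
      by congr nnint; apply/funext => x; rewrite swap'.
    rewrite nnintZ; [|by []|by borel|by move=> x; exact: mulr_ge0].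
    by rewrite energyE// -EFinM.
  - move=> x; rewrite [X in (X <= _)%E](_ : _ = nnint (fun y => (K * m x) * indb x s y)); last first.
      by congr nnint; apply/funext => y; rewrite swap; ring.
    rewrite nnintZ; [|by rewrite mulr_ge0|exact: borel_indb|by []].
    by rewrite nnint_indb// -EFinM lee_fin mulrAC.
rewrite nnintZ//; last first.
  by rewrite mulr_ge0// mulr_ge0 ?exprn_ge0 ?(ltW kappa_gt0) ?(ltW s0).
rewrite le_eqVlt; apply/orP; left; apply/eqP; congr (_%:E * _)%E.
rewrite /K /b /layer_cst /s exprMn powRM// ?(ltW r0)// [(17 * r) ^+ n]exprMn.
by field; rewrite !gt_eqF ?exprn_gt0.
Qed.

End trace_poincare.

(** * The energy estimate *)

Section flux.
Context {R : realType} {n : nat}.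
Local Notation V := 'rV[R]_n.
Local Notation kappa := (@leb_unit_ball R n).
Implicit Types (x y z : V) (u : V -> R) (g F : 'I_n -> V -> R) (K Omega : set V).

Lemma pos_lower_bound k (f : 'I_k -> R) : (forall i, 0 < f i) -> exists2 e : R, 0 < e & forall i, e <= f i.
Proof.
elim: k f => [f _|k IH f f0]; first by exists 1 => // -[].
have [e e0 eP] := IH (fun i => f (lift ord0 i)) (fun i => f0 _).
exists (Num.min e (f ord0)); first by rewrite lt_min e0 f0.
move=> i; have [->|] := eqVneq i ord0; first by rewrite ge_min lexx orbT.
by move=> /eqP i0; case: (unliftP ord0 i) => [j ->|//]; rewrite ge_min eP.
Qed.

Lemma L1_mul_sqr (f h : V -> R) : borel_fun f -> borel_fun h -> (nnint (fun x => f x ^+ 2)%R < +oo)%E ->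
  (nnint (fun x => h x ^+ 2)%R < +oo)%E -> L1 (fun x => f x * h x).
Proof.
move=> bf bh f2 h2.
have Lf : L1 (fun x => f x ^+ 2) by apply: L1_ge0 => //; [borel|move=> x; exact: sqr_ge0].
have Lh : L1 (fun x => h x ^+ 2) by apply: L1_ge0 => //; [borel|move=> x; exact: sqr_ge0].
apply: (@L1_le _ _ _ (fun x => f x ^+ 2 + h x ^+ 2)); [by borel|exact: L1D|].
move=> x; rewrite [leRHS]ger0_norm ?addr_ge0 ?sqr_ge0// normrM.
have := sqr_ge0 (`|f x| - `|h x|); rewrite sqrrB !real_normK ?num_real//.
have : 0 <= `|f x| * `|h x| by exact: mulr_ge0.
by lra.
Qed.

Lemma L1_sqr_support (f : V -> R) (r : R) : borel_fun f -> (nnint (fun x => f x ^+ 2)%R < +oo)%E ->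
  (forall x, ~ ball (0 : V) r x -> f x = 0) -> L1 f.
Proof.
move=> bf f2 f0; have bi := @borel_indb R n 0 r.
rewrite (_ : f = fun x => f x * indb 0 r x); last first.
  apply/funext => x; have [[-> _]|[-> nx]] := indbP 0 r x; first by rewrite mulr1.
  by rewrite f0// mul0r.
apply: L1_mul_sqr => //; apply: (@le_lt_trans _ _ (nnint (indb 0 r))).
  apply: le_nnint => [|||x]; [by borel|by borel|by move=> x; exact: sqr_ge0|].
  by rewrite expr2 ler_piMl ?indb_ge0// indb_le1.
have [_] := L1_indb (0 : V) r; congr (_ < _)%E; congr nnint; apply/funext => x.
by rewrite ger0_norm// indb_ge0.
Qed.

Lemma nnint_sqrM_bounded (f h : V -> R) (M : R) : borel_fun f -> borel_fun h -> (nnint (fun x => f x ^+ 2)%R < +oo)%E ->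
  (forall x, `|h x| <= M) -> (nnint (fun x => (f x * h x) ^+ 2)%R < +oo)%E.
Proof.
move=> bf bh f2 hM; apply: (@le_lt_trans _ _ (nnint (fun x => M ^+ 2 * f x ^+ 2)%R)).
  apply: le_nnint => [|||x]; [by borel|by borel|by move=> x; exact: sqr_ge0|].
  rewrite exprMn mulrC ler_wpM2r ?sqr_ge0// -real_normK ?num_real// ler_sqr ?nnegrE//.
  exact: le_trans (normr_ge0 _) (hM x).
rewrite nnintZ; [|exact: sqr_ge0|by borel|by move=> x; exact: sqr_ge0].
by rewrite lte_mul_pinfty// lee_fin sqr_ge0.
Qed.

Lemma L1_sum (I : Type) (l : seq I) (f : I -> V -> R) : (forall i, L1 (f i)) -> L1 (fun x => \sum_(i <- l) f i x).
Proof.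
move=> Lf; elim: l => [|i l IH]; last by under eq_fun do rewrite big_cons; exact: L1D.
under eq_fun do rewrite big_nil; have := L1Z 0 (L1_indb (0 : V) 1); congr L1.
by apply/funext => x; rewrite mul0r.
Qed.

Lemma rint_sum (I : Type) (l : seq I) (f : I -> V -> R) : (forall i, L1 (f i)) ->
  rint (fun x => \sum_(i <- l) f i x) = \sum_(i <- l) rint (f i).
Proof.
move=> Lf; elim: l => [|i l IH].
  rewrite big_nil (_ : (fun _ => _) = (fun x => 0 * indb (0 : V) 1 x)).
    by rewrite rintZ ?mul0r//; exact: L1_indb.
  by apply/funext => x; rewrite big_nil mul0r.
by under eq_fun do rewrite big_cons; rewrite rintD ?IH ?big_cons//; exact: L1_sum.
Qed.

Definition L2loc Omega g := forall i K, compact K -> K `<=` Omega ->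
  (nnint (fun x => (\1_K x * g i x) ^+ 2)%R < +oo)%E.

(** The weak equation accepts only smooth test functions, so it is tested with [psi * G(Ue)] for
    mollifications [Ue] of [u]. Since the flux and the gradient are only locally square integrable,
    the product of [F] with the mollified gradient converges by [mollify_L2]; the factors [G(Ue)]
    and [dG(Ue)] are handled by [mollify_weighted]. *)
Lemma flux_comp Omega u g F (G dG : R -> R) psi : 0 < kappa -> open Omega -> bounded_derivatives G dG ->
  locL1 Omega u -> (forall i, locL1 Omega (g i)) -> L2loc Omega g -> wgrad Omega u g ->
  (forall i, borel_fun (F i)) -> L2loc Omega F ->
  (forall phi, test_function Omega phi -> rint (fun x => \sum_i F i x * partial i phi x) = 0) ->
  test_function Omega psi ->
  [/\ L1 (fun x => \sum_i F i x * partial i psi x * G (u x)),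
      L1 (fun x => \sum_i F i x * psi x * g i x * dG (u x)) &
      rint (fun x => \sum_i F i x * psi x * g i x * dG (u x)) =
      - rint (fun x => \sum_i F i x * partial i psi x * G (u x))].
Proof.
move=> kappa_gt0 oO [sG sdG Gd [M MP]] [bu uloc] gloc g2 wg bF F2 weak tpsi.
have [K [cK KO psi0]] := test_support tpsi.
have [s [K' [s0 cK' K'O KK']]] := compact_thicken oO cK KO.
have [r r0 Kr] := compact_ball cK.
pose U x := \1_K' x * u x; pose H i x := \1_K' x * g i x.
have Ui : L1 U by exact: uloc.
have Hi i : L1 (H i) by apply: (proj2 (gloc i)).
have H2 i : (nnint (fun x => H i x ^+ 2)%R < +oo)%E by exact: g2.
have [C Cgt0 mol] := mollifier_exists kappa_gt0.
have M0 : 0 <= M by have [+ _ _] := MP 0 0; exact: le_trans.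
have [B B0 BP] := test_bounded tpsi.
have spsi := test_smooth tpsi.
have bpsi := smooth_borel spsi.
have bdpsi i := smooth_borel (smooth_partial i spsi).
have bG (v : V -> R) : borel_fun v -> borel_fun (fun x => G (v x)) := borel_smooth1 sG.
have bdG (v : V -> R) : borel_fun v -> borel_fun (fun x => dG (v x)) := borel_smooth1 sdG.
have GM t : `|G t| <= M by have [] := MP 0 t.
have dGM t : `|dG t| <= M by have [] := MP 0 t.
have dpsi0 i x : ~ K x -> partial i psi x = 0.
  by apply: test_partial_eq0 => //; apply: compact_closed => //; exact: norm_hausdorff.
have K'x x : K x -> K' x by move=> Kx; apply: (KK' x x) => //; rewrite subrr normr0 ltW.
have KU x : K x -> U x = u x by move=> Kx; rewrite /U indicE mem_set ?mul1r//; exact: K'x.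
have KH i x : K x -> H i x = g i x by move=> Kx; rewrite /H indicE mem_set ?mul1r//; exact: K'x.
have bK := @borel_indic R n K (compact_borel cK).
pose FK i x := \1_K x * F i x.
have bFK i : borel_fun (FK i) by have := bF i; rewrite /FK => ?; borel.
have FK2 i : (nnint (fun x => FK i x ^+ 2)%R < +oo)%E by exact: F2.
have Kind x : (\1_K x = 1 :> R /\ K x) \/ (\1_K x = 0 :> R /\ ~ K x).
  have [Kx|nKx] := pselect (K x); [left|right]; rewrite indicE; first by rewrite mem_set.
  by rewrite memNset.
pose P i x := FK i x * partial i psi x; pose S i x := FK i x * psi x.
have bP i : borel_fun (P i) by have := bFK i; have := bdpsi i; rewrite /P => ? ?; borel.
have bS i : borel_fun (S i) by have := bFK i; rewrite /S => ?; borel.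
have P0 i x : ~ ball (0 : V) r x -> P i x = 0.
  by move=> nx; rewrite /P dpsi0 ?mulr0// => /Kr.
have S0 i x : ~ ball (0 : V) r x -> S i x = 0.
  by move=> nx; rewrite /S psi0 ?mulr0// => /Kr.
have S2 i : (nnint (fun x => S i x ^+ 2)%R < +oo)%E by exact: nnint_sqrM_bounded BP.
have LP i : L1 (P i).
  have [B' B'0 BP'] := test_bounded (test_partial i tpsi).
  apply: (L1_sqr_support (bP i) _ (P0 i)); exact: nnint_sqrM_bounded BP'.
have LS i : L1 (S i) by exact: L1_sqr_support (S0 i).
have LSH i : L1 (fun x => S i x * H i x) by apply: L1_mul_sqr => //; exact: (proj1 (Hi i)).
have SH0 i x : ~ ball (0 : V) r x -> S i x * H i x = 0 by move=> /S0->; rewrite mul0r.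
have bU := proj1 Ui.
have bH i : borel_fun (H i) := proj1 (Hi i).
have LPG i v : borel_fun v -> L1 (fun x => P i x * G (v x)).
  by move=> bv; apply: (L1M_bounded (M := M) (LP i)) => //; exact: bG.
have LSHG i v : borel_fun v -> L1 (fun x => S i x * H i x * dG (v x)).
  by move=> bv; apply: (L1M_bounded (M := M) (LSH i)) => //; exact: bdG.
have EP : (fun x => \sum_i F i x * partial i psi x * G (u x)) = (fun x => \sum_i P i x * G (U x)).
  apply/funext => x; apply: eq_bigr => i _; rewrite /P /FK.
  by have [[-> Kx]|[-> nKx]] := Kind x; [rewrite KU// mul1r|rewrite dpsi0// !mulr0 !mul0r].
have ES : (fun x => \sum_i F i x * psi x * g i x * dG (u x)) = (fun x => \sum_i S i x * H i x * dG (U x)).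
  apply/funext => x; apply: eq_bigr => i _; rewrite /S /FK.
  by have [[-> Kx]|[-> nKx]] := Kind x; [rewrite KU// KH// mul1r|rewrite psi0// !mulr0 !mul0r].
have A1 := L1_sum (index_enum _) (fun i => LPG i U bU).
have A2 := L1_sum (index_enum _) (fun i => LSHG i U bU).
rewrite EP ES; split => //.
rewrite (rint_sum _ (fun i => LPG i U bU)) (rint_sum _ (fun i => LSHG i U bU)).
apply/eqP; rewrite -subr_eq0 opprK -big_split/=; apply/eqP.
apply: (@eq0_small _ _ (n%:R * 3)) => t t0 _.
have Gl := bounded_derivatives_lipschitz Gd dGM.
have M20 : 0 <= M + M by rewrite addr_ge0.
have M1 : 0 < M + 1 by rewrite ltr_wpDl.
have /choice[e1 E1] i : exists e1 : R, 0 < e1 /\ forall eps rho, 0 < eps -> eps <= e1 -> mollifier C eps rho ->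
    forall D : V -> R, borel_fun D -> (forall x, `|D x| <= M + M) ->
    (forall x, `|D x| <= (M + M) * `|conv U rho x - U x|) -> (nnint (fun x => `|P i x| * `|D x|)%R <= t%:E)%E.
  by have [e ? ?] := mollify_weighted C (LP i) (P0 i) Ui M20 r0 t0; exists e.
have /choice[e2 E2] i : exists e1 : R, 0 < e1 /\ forall eps rho, 0 < eps -> eps <= e1 -> mollifier C eps rho ->
    forall D : V -> R, borel_fun D -> (forall x, `|D x| <= M + M) ->
    (forall x, `|D x| <= (M + M) * `|conv U rho x - U x|) -> (nnint (fun x => `|S i x * H i x| * `|D x|)%R <= t%:E)%E.
  by have [e ? ?] := mollify_weighted C (LSH i) (SH0 i) Ui M20 r0 t0; exists e.
have /choice[e3 E3] i : exists e1 : R, 0 < e1 /\ forall eps rho, 0 < eps -> eps <= e1 -> mollifier C eps rho ->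
    (nnint (fun x => `|S i x| * `|conv (H i) rho x - H i x|)%R <= (t / (M + 1))%:E)%E.
  by have [e ? ?] := mollify_L2 C (bS i) (S2 i) (S0 i) (Hi i) (H2 i) r0 (divr_gt0 t0 M1); exists e.
(* Each coordinate comes with its own admissible scale; one [eps] must be below them all. *)
have [f1 f10 f1P] := pos_lower_bound (fun i => (E1 i).1).
have [f2 f20 f2P] := pos_lower_bound (fun i => (E2 i).1).
have [f3 f30 f3P] := pos_lower_bound (fun i => (E3 i).1).
pose eps := Num.min s (Num.min f1 (Num.min f2 f3)).
have eps0 : 0 < eps by rewrite !lt_min s0 f10 f20.
have [rho m] := mol eps eps0.
have es : eps <= s by rewrite ge_min lexx.
have ee1 i : eps <= e1 i by apply: le_trans (f1P i); rewrite /eps !ge_min lexx ?orbT.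
have ee2 i : eps <= e2 i by apply: le_trans (f2P i); rewrite /eps !ge_min lexx ?orbT.
have ee3 i : eps <= e3 i by apply: le_trans (f3P i); rewrite /eps !ge_min lexx ?orbT.
have trho := mol_test m.
pose Ue := conv U rho; pose He i := conv (H i) rho.
have sUe : smooth Ue by exact: conv_smooth.
have bUe := smooth_borel sUe.
have bHe i : borel_fun (He i) by exact: (borel_conv m (Hi i)).
have parU i x : K x -> partial i Ue x = He i x.
  move=> Kx; apply: (wgrad_conv i m wg K'O) => // y xy; apply: (KK' x) => //; exact: le_trans es.
have LSHe i : L1 (fun x => S i x * He i x * dG (Ue x)).
  have [M' [f0 _ _]] := conv_partial2_bounded (Hi i) trho.
  apply: (L1M_bounded (M := M)) => //; last exact: bdG.
  exact: (L1M_bounded (M := M') (LS i)).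
have tphi : test_function Omega (fun x => psi x * G (Ue x)).
  by apply: test_functionM; [assumption|exact: smooth_comp].
have := weak _ tphi.
rewrite (_ : (fun x => \sum_i F i x * partial i (fun y => psi y * G (Ue y)) x) =
    (fun x => \sum_i (P i x * G (Ue x) + S i x * He i x * dG (Ue x)))); last first.
  apply/funext => x; apply: eq_bigr => i _.
  rewrite partialM//; last exact: smooth_comp.
  rewrite (partial_comp i x Gd sUe) /P /S /FK; have [[-> Kx]|[-> nKx]] := Kind x.
    by rewrite parU//; ring.
  by rewrite dpsi0// psi0//; ring.
rewrite (rint_sum _ (fun i => L1D (LPG i Ue bUe) (LSHe i))).
move=> int0; rewrite -[X in `|X|]subr0 -[X in `|_ - X|]int0 -sumrB.
apply: (le_trans (ler_norm_sum _ _ _)).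
rewrite -mulrA (_ : n%:R * _ = \sum_(i < n) 3 * t); last by rewrite sumr_const card_ord mulr_natl.
apply: ler_sum => i _; rewrite rintD//; last exact: LPG.
have bPi := bP i; have bSi := bS i; have bHi := bH i; have bHei := bHe i.
have bA := bG _ bU; have bB := bG _ bUe; have bC := bdG _ bU; have bD := bdG _ bUe.
have D1 x : `|G (U x) - G (Ue x)| <= M + M.
  by apply: (le_trans (ler_normB _ _)); exact: lerD.
have D2 x : `|G (U x) - G (Ue x)| <= (M + M) * `|Ue x - U x|.
  by apply: (le_trans (Gl _ _)); rewrite distrC ler_wpM2r// lerDl.
have D3 x : `|dG (U x) - dG (Ue x)| <= M + M.
  by apply: (le_trans (ler_normB _ _)); exact: lerD.
have D4 x : `|dG (U x) - dG (Ue x)| <= (M + M) * `|Ue x - U x|.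
  have [_ _] := MP (U x) (Ue x); move=> /le_trans; apply.
  by rewrite distrC ler_wpM2r// lerDl.
have Q1 : `|rint (fun x => P i x * G (U x)) - rint (fun x => P i x * G (Ue x))| <= t.
  rewrite -rintB; [|exact: LPG|exact: LPG].
  apply: rint_small; first by apply: L1B; exact: LPG.
  rewrite (_ : (fun x => `|_|) = (fun x => `|P i x| * `|G (U x) - G (Ue x)|)); last first.
    by apply/funext => x; rewrite -mulrBr normrM.
  by apply: ((E1 i).2 eps rho) => //; borel.
have Q2 : `|rint (fun x => S i x * H i x * dG (U x)) - rint (fun x => S i x * He i x * dG (Ue x))| <= 2 * t.
  rewrite -rintB//; last exact: LSHG.
  apply: rint_small; first by apply: L1B => //; exact: LSHG.
  apply: (@le_trans _ _ (nnint (fun x => `|S i x * H i x| * `|dG (U x) - dG (Ue x)| +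
     M * (`|S i x| * `|He i x - H i x|))%R)).
    apply: le_nnint => [|||x]; [by borel|by borel|by []|].
    rewrite (_ : _ - _ = S i x * H i x * (dG (U x) - dG (Ue x)) + S i x * (H i x - He i x) * dG (Ue x)); last by ring.
    apply: (le_trans (ler_normD _ _)); rewrite normrM lerD2l !normrM mulrC [X in _ * (_ * X)]distrC.
    by apply: ler_wpM2r => //; exact: mulr_ge0.
  rewrite nnintD; [|by borel|by borel|by move=> x; rewrite mulr_ge0|by move=> x; rewrite !mulr_ge0].
  rewrite (@nnintZ _ _ M); [|by []|by borel|by move=> x; rewrite mulr_ge0].
  apply: (@le_trans _ _ (t%:E + M%:E * (t / (M + 1))%:E)%E).
    apply: leeD; first by apply: ((E2 i).2 eps rho) => //; borel.
    by apply: lee_wpmul2l => //; exact: ((E3 i).2 eps rho).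
  rewrite -EFinM -EFinD lee_fin [leRHS]mulr_natl mulr2n lerD2l mulrCA ler_piMr ?(ltW t0)//.
  by rewrite ler_pdivrMr// mul1r lerDl.
rewrite [X in _ - X]addrC opprD addrACA; apply: (le_trans (ler_normD _ _)).
by apply: (le_trans (lerD Q2 Q1)); lra.
Qed.

End flux.

(** * Cutoffs and weighted annuli *)

Section energy.
Context {R : realType} {n : nat}.
Local Notation V := 'rV[R]_n.
Local Notation kappa := (@leb_unit_ball R n).
Implicit Types (x y z : V).
Variables (d C0 : R) (Gamma : set V).
Hypotheses (n2 : (2 <= n)%N) (d0 : 0 < d) (dn : d < n%:R - 1) (C01 : 1 <= C0)
  (Gneq0 : Gamma !=set0) (clG : closed Gamma) (reg : ahlfors_regular d C0 Gamma)
  (kappa_gt0 : 0 < kappa).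

Local Notation p := (n%:R - 1 - d : R).
Local Notation nbh := (nbh Gamma).
Local Notation w := (weight Gamma d).
Local Notation n0 := (ambient_gt0 n2).

#[local] Hint Resolve indb_ge0 : core.

Lemma ind_ge0 (A : set V) x : (0 : R) <= \1_A x. Proof. by rewrite indicE. Qed.
#[local] Hint Resolve ind_ge0 : core.

Lemma nbh_shift (r s : R) x y : nbh r x -> `|x - y| < s -> nbh (r + s) y.
Proof.
move=> [z Gz /rV_ball_norm xz] xy; exists z => //; apply/rV_ball_norm.
by rewrite -(subrKA x) (le_lt_trans (ler_normD _ _))// ltrD.
Qed.

Lemma nbh_le (r s : R) : r <= s -> nbh r `<=` nbh s.
Proof. by move=> rs x [z Gz xz]; exists z => //; exact: le_ball xz. Qed.

Lemma Gamma_nbh (r : R) x : 0 < r -> Gamma x -> nbh r x.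
Proof. by move=> r0 Gx; exists x => //; exact: ballxx. Qed.

Lemma nbh_small x : ~ Gamma x -> exists2 r : R, 0 < r & ~ nbh r x.
Proof.
move=> nG; have oG : open (~` Gamma) by exact: closed_openC.
have /nbhs_ballP[e /= e0 eP] : nbhs x (~` Gamma) by exact: open_nbhs_nbhs.
by exists e => // -[z Gz zx]; apply: (eP z) => //; exact: ball_sym.
Qed.

(** The product of a cutoff at scale [eta] around Gamma and one at scale [r] around infinity. Both
    gradient terms live off the neighbourhood of radius [2 * eta], where the weight is bounded. *)
Lemma energy_cutoff : exists2 C : R, 0 < C & forall eta r : R, 0 < eta -> eta <= r ->
  exists phi : V -> R, [/\ test_function (~` Gamma) phi, forall x, 0 <= phi x <= 1,
    forall x, `|x| < 2 * r -> ~ nbh (4 * eta) x -> phi x = 1 &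
    forall i x, `|partial i phi x| <= C / eta * (\1_(nbh (4 * eta)) x * \1_(~` nbh (2 * eta)) x) +
      C / r * (\1_[set x | 2 * r <= `|x|] x * (indb 0 (4 * r) x * \1_(~` nbh (2 * eta)) x))].
Proof.
have [C Cgt0 cut] := @cutoff_exists R n kappa_gt0.
exists C => // eta r eta0 er; have r0 : 0 < r by exact: lt_le_trans er.
have cn s : closed (~` nbh s) by apply: open_closedC; exact: open_nbh.
(* The ball of radius [8 * r] only makes the set bounded: the outer edge of [phi1] lies where [phi2]
   already vanishes. *)
have [|||phi1 [t1 p1 one1 supp1 grad1]] := cut (ball 0 (8 * r) `&` ~` nbh (3 * eta)) (8 * r) eta.
- apply: measurableI; first by apply: measurable_open_borel; exact: ball_open.
  by apply: measurable_closed_borel; exact: cn.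
- by move=> x [].
- by [].
have [|||phi2 [t2 p2 one2 supp2 grad2]] := cut (ball 0 (3 * r)) (3 * r) r.
- by apply: measurable_open_borel; exact: ball_open.
- by [].
- by [].
have n0x (s : R) x : ball (0 : V) s x <-> `|x| < s.
  by split=> [/rV_ball_norm|H]; [|apply/rV_ball_norm]; rewrite sub0r normrN.
have phi1_0 x : nbh (2 * eta) x -> phi1 x = 0.
  move=> Nx; apply: contrapT => /eqP /supp1[y [_ nNy] xy]; apply: nNy.
  by apply: nbh_le (nbh_shift Nx xy); lra.
have phi2_0 x : 4 * r <= `|x| -> phi2 x = 0.
  move=> x4; apply: contrapT => /eqP /supp2[y /n0x y3 xy].
  have := ler_normD (x - y) y; rewrite subrK; lra.
have phi1_1 x : `|x| < 4 * r -> ~ nbh (4 * eta) x -> phi1 x = 1.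
  move=> x4 nN; apply: one1 => y xy; split.
    by apply/n0x; have := ler_normB x (x - y); rewrite subKr; lra.
  move=> Ny; apply: nN; apply: nbh_le (nbh_shift Ny _); last by rewrite distrC; exact: xy.
  by lra.
have phi2_1 x : `|x| < 2 * r -> phi2 x = 1.
  move=> x2; apply: one2 => y xy; apply/n0x.
  by have := ler_normB x (x - y); rewrite subKr; lra.
(* Where a function with values between 0 and 1 equals 0 or 1 it has an extremum, so its gradient
   vanishes; this localizes the gradients exactly. *)
have ext i phi x : test_function setT phi -> (forall x, 0 <= phi x <= 1) -> phi x = 0 \/ phi x = 1 ->
    partial i phi x = 0.
  move=> tphi p01 H; have [M _ MP] := test_bounded (test_partial i (test_partial i tphi)).
  apply: (partial_extremum (test_smooth tphi) MP).
  by case: H => ->; [left|right] => y; have /andP[] := p01 y.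
have s1 := test_smooth t1; have s2 := test_smooth t2.
have cl4 : closed [set y : V | `|0 - y| <= 4 * r].
  by apply: compact_closed; [exact: norm_hausdorff|exact: (@compact_closed_ball R n 0 (4 * r))].
exists (fun x => phi1 x * phi2 x); split.
- apply: (@test_functionP _ _ _ ([set y : V | `|0 - y| <= 4 * r] `&` ~` nbh (2 * eta))).
  + exact: smoothM.
  + apply: (@subclosed_compact _ _ [set y : V | `|0 - y| <= 4 * r]).
    * by apply: closedI.
    * exact: (@compact_closed_ball R n 0 (4 * r)).
    * by move=> x [].
  + by move=> x [_ nN] Gx; apply: nN; apply: Gamma_nbh => //; rewrite mulr_gt0.
  + move=> x nx; have [Nx|nN] := pselect (nbh (2 * eta) x); first by rewrite phi1_0// mul0r.
    rewrite phi2_0 ?mulr0//; rewrite leNgt; apply/negP => x4; apply: nx; split => //=.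
    by rewrite sub0r normrN ltW.
- move=> x; have /andP[a b] := p1 x; have /andP[c e] := p2 x.
  by rewrite mulr_ge0//= (le_trans _ e)// ler_piMl.
- move=> x x2 nN; rewrite phi2_1// phi1_1 ?mulr1//.
  by apply: lt_le_trans x2 _; rewrite ler_wpM2r ?ler_nat// ltW.
- move=> i x; rewrite partialM//; have /andP[a b] := p1 x; have /andP[c e] := p2 x.
  have k1 : 0 <= C / eta by rewrite divr_ge0 ?ltW.
  have k2 : 0 <= C / r by rewrite divr_ge0 ?ltW.
  have [Nx|nN] := pselect (nbh (2 * eta) x).
    rewrite phi1_0// mul0r (ext i phi1)//; last by left; exact: phi1_0.
    rewrite mulr0 addr0 normr0 addr_ge0// mulr_ge0// mulr_ge0// mulr_ge0//.
  rewrite [\1_(~` nbh (2 * eta)) x]indicE mem_set// !mulr1.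
  have [x4|x4] := leP (4 * r) `|x|.
    rewrite phi2_0// mul0r (ext i phi2)//; last by left; exact: phi2_0.
    by rewrite mulr0 addr0 normr0 addr_ge0// mulr_ge0// mulr_ge0.
  rewrite indb_in ?mulr1; last by apply/n0x.
  apply: (le_trans (ler_normD _ _)); rewrite addrC !normrM (ger0_norm a) (ger0_norm c); apply: lerD.
    have [N4|nN4] := pselect (nbh (4 * eta) x).
      rewrite indicE mem_set// mulr1; apply: le_trans (grad1 i x); exact: ler_piMl.
    by rewrite (ext i phi1 x t1 p1 (or_intror (phi1_1 x x4 nN4))) normr0 mulr0 mulr_ge0.
  have [x2|x2] := leP (2 * r) `|x|.
    rewrite [\1_[set _ | _] x]indicE mem_set// mulr1; apply: le_trans (grad2 i x); exact: ler_piMl.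
  by rewrite (ext i phi2 x t2 p2 (or_intror (phi2_1 x x2))) normr0 mulr0 mulr_ge0.
Qed.

Lemma young_sqr (a b y : R) : 0 <= a -> 0 <= b -> y ^+ 2 <= a * b -> y <= a + b.
Proof.
move=> a0 b0 H; rewrite leNgt; apply/negP => ly.
have : (a + b) ^+ 2 < y ^+ 2 by rewrite ltr_pXn2r// ?nnegrE ?addr_ge0// ltW// (le_lt_trans _ ly)// addr_ge0.
have := sqr_ge0 a; have := sqr_ge0 b; have := mulr_ge0 a0 b0; rewrite sqrrD; lra.
Qed.

Section annulus.
Variables (v m : V -> R).
Hypotheses (bv : borel_fun v) (v0 : forall x, 0 <= v x)
  (bm : borel_fun m) (m0 : forall x, 0 <= m x) (mfin : (nnint m < +oo)%E)
  (LP : local_poincare_at d Gamma v m)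
  (van : hausdorff_outer d (Gamma `&` [set x | ~ vanishing v x]) = 0%E).

Definition annulus_cst : R := @layer_cst R n d C0 * 4 * 2 `^ p.

Lemma annulus_cst_ge0 : 0 <= annulus_cst.
Proof.
have b0 := ball_cst_ge0 d n2 C01 kappa_gt0.
by rewrite /annulus_cst /layer_cst; nonneg.
Qed.

Definition shell (r s : R) x : R := \1_(nbh s) x * \1_(~` nbh r) x.

Lemma shell_ge0 r s x : 0 <= shell r s x. Proof. exact: mulr_ge0. Qed.

Lemma borel_shell r s : borel_fun (shell r s).
Proof.
apply: borelM; first exact: borel_nbh.
by apply: borel_indic; apply: measurable_closed_borel; apply: open_closedC; exact: open_nbh.
Qed.

(** Off the neighbourhood of radius [r] the weight is at most [(r]^
    p)^-1[, which cancels the factor]r [^ p] of [layer]. *)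
Lemma layer_weighted (r : R) : 0 < r ->
  (nnint (fun x => shell r (2 * r) x * (v x ^+ 2 * w x))%R <= (annulus_cst * r ^+ 2)%:E * nnint m)%E.
Proof.
move=> r0; have r20 : 0 < 2 * r by rewrite mulr_gt0.
have bN := @borel_nbh R n Gamma (2 * r); have bw := @borel_weight R n d Gamma Gneq0.
have bs := borel_shell r (2 * r).
have rp : 0 < r `^ p by exact: powR_gt0.
apply: (@le_trans _ _ (nnint (fun x => (r `^ p)^-1 * (\1_(nbh (2 * r)) x * v x ^+ 2))%R)).
  apply: le_nnint => [|||x]; [by borel|by borel| |].
    by move=> x; rewrite mulr_ge0 ?shell_ge0// mulr_ge0 ?sqr_ge0// powR_ge0.
  rewrite [leLHS](_ : _ = \1_(nbh (2 * r)) x * (\1_(~` nbh r) x * (v x ^+ 2 * w x))); last first.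
    by rewrite /shell; ring.
  rewrite [leRHS]mulrCA; apply: ler_wpM2l => //.
  rewrite indicE; have [nN|N] := pselect ((~` nbh r) x); last first.
    by rewrite memNset// mul0r mulr_ge0 ?sqr_ge0// invr_ge0 ltW.
  rewrite mem_set// mul1r mulrC; apply: ler_wpM2r; first exact: sqr_ge0.
  rewrite -[leRHS]mul1r ler_pdivlMr// mulrC; apply: (weight_le dn Gneq0 r0).
  by move=> z Gz zx; apply: nN; exists z.
rewrite nnintZ; [|by rewrite invr_ge0 ltW|by borel|by move=> x; rewrite mulr_ge0 ?sqr_ge0].
have L := layer n2 d0 C01 reg kappa_gt0 bv v0 bm m0 mfin LP van r20.
apply: (le_trans (lee_wpmul2l _ L)); first by rewrite lee_fin invr_ge0 ltW.
rewrite muleA -EFinM le_eqVlt; apply/orP; left; apply/eqP; congr (_%:E * _)%E.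
by rewrite powRM ?(ltW r0)// /annulus_cst; field; rewrite gt_eqF.
Qed.

(** A sum over dyadic shells; as the bound is quadratic in the radius, the last shell dominates and
    the constant does not depend on [k]. *)
Lemma annulus_weighted (r : R) k : 0 < r ->
  (nnint (fun x => shell r (2 ^+ k * r) x * (v x ^+ 2 * w x))%R <=
   (annulus_cst * (2 ^+ k * r) ^+ 2)%:E * nnint m)%E.
Proof.
move=> r0; have bw := @borel_weight R n d Gamma Gneq0.
have vw x : 0 <= v x ^+ 2 * w x by rewrite mulr_ge0 ?sqr_ge0// powR_ge0.
have A0 := annulus_cst_ge0.
elim: k => [|k IH].
  rewrite expr0 mul1r [X in (X <= _)%E](_ : _ = 0)%E; first by rewrite mule_ge0 ?nnint_ge0// lee_fin; nonneg.
  apply: integral0_eq => x _; rewrite /shell !indicE in_setC.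
  by case: (_ \in _); rewrite /= ?mulr0 ?mul0r.
have bs1 := borel_shell r (2 ^+ k * r); have bs2 := borel_shell (2 ^+ k * r) (2 * (2 ^+ k * r)).
have bs3 := borel_shell r (2 ^+ k.+1 * r).
have rk : 0 < 2 ^+ k * r by rewrite mulr_gt0// exprn_gt0.
apply: (@le_trans _ _ (nnint (fun x => shell r (2 ^+ k * r) x * (v x ^+ 2 * w x) +
   shell (2 ^+ k * r) (2 * (2 ^+ k * r)) x * (v x ^+ 2 * w x))%R)).
  apply: le_nnint => [|||x]; [by borel|by borel|by move=> x; rewrite mulr_ge0 ?shell_ge0|].
  rewrite -mulrDl; apply: ler_wpM2r => //; rewrite /shell exprS -mulrA !indicE !in_setC.
  by do 3 case: (_ \in _); rewrite /= ?(mulr0,mul0r,mulr1,addr0,add0r,lexx,ler01)// ?lerDl ?ler01.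
rewrite nnintD; [|by borel|by borel|by move=> x; rewrite mulr_ge0 ?shell_ge0|by move=> x; rewrite mulr_ge0 ?shell_ge0].
apply: (le_trans (leeD IH (layer_weighted rk))).
rewrite -ge0_muleDl; [|by rewrite lee_fin; nonneg|by rewrite lee_fin; nonneg].
apply: lee_wpmul2r; first exact: nnint_ge0.
rewrite -EFinD lee_fin -mulrDr; apply: ler_wpM2l => //.
have -> : 2 ^+ k.+1 * r = 2 * (2 ^+ k * r) by rewrite (exprS 2 k) mulrA.
by move: (2 ^+ k * r) => a; have := sqr_ge0 a; lra.
Qed.

End annulus.
End energy.

(** * One-sided maximum principle for Borel data *)

Section maximum_principle.
Context {R : realType} {n : nat}.
Local Notation V := 'rV[R]_n.
Local Notation kappa := (@leb_unit_ball R n).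
Implicit Types (x y z : V).
Variables (d C0 C1 M : R) (Gamma : set V) (u : V -> R) (g F : 'I_n -> V -> R).
Hypotheses (n2 : (2 <= n)%N) (d0 : 0 < d) (dn : d < n%:R - 1) (C01 : 1 <= C0)
  (Gneq0 : Gamma !=set0) (clG : closed Gamma) (reg : ahlfors_regular d C0 Gamma)
  (kappa_gt0 : 0 < kappa) (C11 : 1 <= C1).

Local Notation p := (n%:R - 1 - d : R).
Local Notation nbh := (nbh Gamma).
Local Notation w := (weight Gamma d).
Local Notation m := (fun x => w x * \sum_i g i x ^+ 2).

(** [F] stands for the flux [A g] and the matrix is forgotten: [F_le] is its upper bound, component
    by component, and [m_le] its coercivity. *)
Hypotheses (uloc : locL1 (~` Gamma) u) (bg : forall i, borel_fun (g i)) (bF : forall i, borel_fun (F i))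
  (gG : forall i x, Gamma x -> g i x = 0)
  (mfin : (nnint m < +oo)%E) (wg : wgrad (~` Gamma) u g)
  (F_le : forall i x, F i x ^+ 2 <= C1 ^+ 2 * (w x * m x))
  (m_le : forall x, m x <= C1 * \sum_i F i x * g i x)
  (weak : forall phi, test_function (~` Gamma) phi -> rint (fun x => \sum_i F i x * partial i phi x) = 0)
  (Tu : hausdorff_outer d (Gamma `&` [set x | ~ trace u x <= M]) = 0%E).

#[local] Hint Resolve indb_ge0 : core.

#[local] Hint Resolve ind_ge0 : core.

Lemma m_ge0 x : 0 <= m x.
Proof. by rewrite mulr_ge0 ?weight_ge0// sumr_ge0// => i _; exact: sqr_ge0. Qed.

Lemma borel_m : borel_fun m.
Proof.
have bw := @borel_weight R n d Gamma Gneq0.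
by apply: borelM => //; apply: borel_sum => i; have bgi := bg i; borel.
Qed.

Lemma energy_bound_m : energy_bound d Gamma g m.
Proof.
split => //; [exact: borel_m|exact: m_ge0|].
move=> z r x Gz zx; have S0 : 0 <= \sum_i g i x ^+ 2 by apply: sumr_ge0 => i _; exact: sqr_ge0.
(* On Gamma the distance is 0 and [powR] gives the weight its default value 0, so the bound there
   rests on the convention [gG]. *)
have [Gx|nG] := pselect (Gamma x).
  by rewrite big1 ?mulr0// => i _; rewrite gG// expr0n.
by rewrite mulrA ler_peMl//; exact: weight_ge Gz zx nG.
Qed.

Lemma ball_inside K : compact K -> K `<=` ~` Gamma -> exists r z b, [/\ 0 < r, Gamma z, K `<=` ball z b &
  forall x, K x -> forall z, Gamma z -> ~ ball z r x].
Proof.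
move=> cK KG; have oG : open (~` Gamma) by exact: closed_openC.
have [s [K' [s0 _ K'G KK']]] := compact_thicken oG cK KG.
have [b b0 Kb] := compact_ball cK; have [z Gz] := Gneq0.
exists s, z, (`|z| + b); split => //.
  move=> x /Kb /rV_ball_norm; rewrite sub0r normrN => xb; apply/rV_ball_norm.
  by rewrite (le_lt_trans (ler_normB _ _))// ltrD2l.
move=> x Kx y Gy /rV_ball_norm yx; apply: (K'G y) => //.
by apply: (KK' x) => //; rewrite distrC ltW.
Qed.

Lemma g_L2loc : L2loc (~` Gamma) g.
Proof.
move=> i K cK KG; have [r [z [b [r0 Gz Kb _]]]] := ball_inside cK KG.
have bK := @borel_indic R n K (compact_borel cK); have bgi := bg i.
have [_ bm m0 _ eb] := energy_bound_m.
apply: (@le_lt_trans _ _ (nnint (fun x => (n%:R * b) `^ p * m x)%R)).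
  apply: le_nnint => [|||x]; [by borel|by apply: borelM => //; exact: borel_cst|by move=> x; exact: sqr_ge0|].
  have Q0 : 0 <= (n%:R * b) `^ p * m x by rewrite mulr_ge0 ?powR_ge0.
  rewrite indicE; have [Kx|nKx] := pselect (K x); last by rewrite memNset// mul0r expr0n.
  rewrite mem_set// mul1r; apply: le_trans (eb z b x Gz (Kb x Kx)).
  by rewrite (bigD1 i)//= lerDl sumr_ge0// => j _; exact: sqr_ge0.
rewrite nnintZ ?powR_ge0//.
by rewrite lte_mul_pinfty// lee_fin powR_ge0.
Qed.

Lemma F_L2loc : L2loc (~` Gamma) F.
Proof.
move=> i K cK KG; have [r [z [b [r0 Gz Kb Kr]]]] := ball_inside cK KG.
have bK := @borel_indic R n K (compact_borel cK); have bFi := bF i.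
have [_ bm m0 _ eb] := energy_bound_m.
have rp : 0 < r `^ p by exact: powR_gt0.
have Q0 : 0 <= C1 ^+ 2 / r `^ p by rewrite divr_ge0 ?sqr_ge0// ltW.
apply: (@le_lt_trans _ _ (nnint (fun x => (C1 ^+ 2 / r `^ p) * m x)%R)).
  apply: le_nnint => [|||x]; [by borel|by apply: borelM => //; exact: borel_cst|by move=> x; exact: sqr_ge0|].
  have Q1 : 0 <= C1 ^+ 2 / r `^ p * m x by rewrite mulr_ge0.
  rewrite indicE; have [Kx|nKx] := pselect (K x); last by rewrite memNset// mul0r expr0n.
  rewrite mem_set// mul1r; apply: (le_trans (F_le i x)); rewrite -[leRHS]mulrA.
  apply: ler_wpM2l; first exact: sqr_ge0.
  apply: ler_wpM2r => //; rewrite -[leRHS]mul1r ler_pdivlMr// mulrC.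
  by apply: (weight_le dn Gneq0 r0) => z' Gz'; exact: Kr.
rewrite nnintZ//.
by rewrite lte_mul_pinfty// lee_fin.
Qed.

Lemma g_locL1 i : locL1 (~` Gamma) (g i).
Proof.
split => // K cK KG; have [b b0 Kb] := compact_ball cK.
have bK := @borel_indic R n K (compact_borel cK); have bgi := bg i.
apply: (@L1_sqr_support _ _ _ b); [by borel|exact: g_L2loc|].
by move=> x nx; rewrite indicE memNset ?mul0r// => /Kb.
Qed.

Section test.
Variables (G dG : R -> R) (L : R).
Hypotheses (bd : bounded_derivatives G dG) (G0 : forall t, 0 <= G t) (GL : forall t, G t <= L)
  (dG0 : forall t, 0 <= dG t) (dGL : forall t, dG t <= L).
Let v x := G (u x).
Let mv x := dG (u x) ^+ 2 * m x.

Hypotheses (van : hausdorff_outer d (Gamma `&` [set x | ~ vanishing v x]) = 0%E).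

Local Lemma bv : borel_fun v.
Proof. by have [s _ _ _] := bd; exact: borel_smooth1 s (proj1 uloc). Qed.

Local Lemma bdGu : borel_fun (fun x => dG (u x)).
Proof. by have [_ s _ _] := bd; exact: borel_smooth1 s (proj1 uloc). Qed.

Local Lemma L0 : 0 <= L. Proof. exact: le_trans (dG0 0) (dGL 0). Qed.

Lemma comp_energy_bound : energy_bound d Gamma (fun i x => dG (u x) * g i x) mv.
Proof.
have [_ bm m0 _ eb] := energy_bound_m; have b := bdGu.
have bmv : borel_fun mv by apply: borelM => //; borel.
have mv0 x : 0 <= mv x by rewrite mulr_ge0 ?sqr_ge0.
split => //.
- by move=> i; have bgi := bg i; borel.
- apply: (@le_lt_trans _ _ (nnint (fun x => L ^+ 2 * m x)%R)).
    apply: le_nnint => [|||x] //; first by apply: borelM => //; exact: borel_cst.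
    by apply: ler_wpM2r => //; rewrite ler_sqr ?nnegrE// L0.
  by rewrite nnintZ ?sqr_ge0// lte_mul_pinfty// lee_fin sqr_ge0.
- move=> z r x Gz zx; under eq_bigr do rewrite exprMn.
  rewrite -mulr_sumr mulrCA; apply: ler_wpM2l; first exact: sqr_ge0.
  exact: (eb z r x Gz zx).
Qed.

Lemma comp_poincare : local_poincare_at d Gamma v mv.
Proof.
move=> z r Gz r0; have vM x : `|v x| <= L by rewrite ger0_norm; [exact: GL|exact: G0].
split; first exact: L1_indbM bv vM.
have oG : open (~` Gamma) by exact: closed_openC.
apply: (local_poincare_bounded n2 d0 dn Gneq0 clG reg kappa_gt0 Gz r0 bv vM comp_energy_bound).
exact: (wgrad_comp kappa_gt0 oG bd uloc g_locL1 wg).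
Qed.

(* The test function [phi * G(u)], read through ellipticity. *)
Lemma energy_test phi : test_function (~` Gamma) phi -> (forall x, 0 <= phi x) ->
  (nnint (fun x => dG (u x) * m x * phi x)%R <=
   C1%:E * \sum_i nnint (fun x => `|F i x| * `|partial i phi x| * v x)%R)%E.
Proof.
move=> tphi phi0; have oG : open (~` Gamma) by exact: closed_openC.
have [A1 A2 A3] := flux_comp kappa_gt0 oG bd uloc g_locL1 g_L2loc wg bF F_L2loc weak tphi.
have C1_0 : 0 <= C1 := le_trans ler01 C11.
have [_ bm m0 _ _] := energy_bound_m; have bdg := bdGu; have bphi := smooth_borel (test_smooth tphi).
have bV := bv.
pose T x := \sum_i F i x * phi x * g i x * dG (u x).
rewrite -/T in A2 A3.
have key x : dG (u x) * m x * phi x <= C1 * T x.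
  have -> : T x = (\sum_i F i x * g i x) * (phi x * dG (u x)).
    by rewrite mulr_suml; apply: eq_bigr => i _; ring.
  rewrite [leRHS]mulrA; apply: (@le_trans _ _ (m x * (phi x * dG (u x)))).
    move: (w x) (\sum_i g i x ^+ 2) => a b.
    by rewrite le_eqVlt; apply/orP; left; apply/eqP; ring.
  by apply: ler_wpM2r (m_le x); exact: mulr_ge0.
have lk x : 0 <= dG (u x) * m x * phi x := mulr_ge0 (mulr_ge0 (dG0 _) (m0 x)) (phi0 x).
have T0 x : 0 <= T x.
  have : 0 <= C1 * T x := le_trans (lk x) (key x).
  by rewrite pmulr_rge0// (lt_le_trans ltr01).
apply: (@le_trans _ _ (nnint (fun x => C1 * T x)%R)).
  have bT := proj1 A2.
  by apply: le_nnint => //; [borel|borel].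
rewrite nnintZ//; last exact: (proj1 A2).
apply: lee_wpmul2l; first by rewrite lee_fin.
rewrite -rint_nnint// A3; apply: (@le_trans _ _ (`|rint (fun x => \sum_i F i x * partial i phi x * G (u x))|%:E)).
  by rewrite lee_fin -normrN ler_norm.
apply: (le_trans (rint_norm_le A1)).
have bd_ i := smooth_borel (smooth_partial i (test_smooth tphi)).
rewrite -(@nnint_sum _ _ _ _ (fun i x => `|F i x| * `|partial i phi x| * v x)); last 2 first.
- by move=> i; have b1 := bF i; have b2 := bd_ i; borel.
- by move=> j x; rewrite mulr_ge0 ?(G0 (u x))// mulr_ge0.
apply: le_nnint => [|||x].
- by apply: borel_norm; exact: (proj1 A1).
- by apply: borel_sum => i; have b1 := bF i; have b2 := bd_ i; borel.
- by [].
apply: (le_trans (ler_norm_sum _ _ _)); apply: ler_sum => i _.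
by rewrite !normrM (ger0_norm (G0 _)).
Qed.

Let mmv := fine (nnint mv).

Local Lemma bmv : borel_fun mv. Proof. by have [] := comp_energy_bound. Qed.
Local Lemma mv_ge0 x : 0 <= mv x. Proof. by have [] := comp_energy_bound. Qed.
Local Lemma mv_fin : (nnint mv < +oo)%E. Proof. by have [] := comp_energy_bound. Qed.

Local Lemma mmvE : nnint mv = mmv%:E.
Proof. by rewrite fineK// ge0_fin_numE ?mv_fin// nnint_ge0// => x; exact: mv_ge0. Qed.

Local Lemma mmv_ge0 : 0 <= mmv.
Proof. by rewrite -lee_fin -mmvE nnint_ge0// => x; exact: mv_ge0. Qed.

(** Young's inequality with parameter [lam] splits [|F| |grad phi| v] into [lam * m] on the support
    of the gradient, which is small near Gamma and near infinity, and a multiple of [v ^+ 2 * w]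
    divided by [lam], bounded uniformly in [eta] and [r] by [annulus_weighted]. The relation between
    [J], [eta] and [r] makes the shell from [2 * eta] to [8 * r] dyadic. *)
Lemma energy_step : exists2 S : R, 0 <= S & forall (eta r lam e : R) J z, 0 < eta -> eta <= r -> 0 < lam ->
  Gamma z -> `|z| <= r -> 2 ^+ J * (2 * eta) = 8 * r ->
  (nnint (fun x => \1_(nbh (4 * eta)) x * m x)%R <= e%:E)%E ->
  (nnint (fun x => \1_[set x : V | (2 * r <= `|x|)%R] x * m x)%R <= e%:E)%E ->
  exists phi : V -> R, [/\ borel_fun phi, forall x, 0 <= phi x,
    forall x, `|x| < 2 * r -> ~ nbh (4 * eta) x -> phi x = 1 &
    (nnint (fun x => dG (u x) * m x * phi x)%R <= (C1 * (n%:R * (2 * lam * e + S / lam)))%:E)%E].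
Proof.
have [C Cgt0 cut] := @energy_cutoff R n Gamma kappa_gt0.
pose E := @annulus_cst R n d C0.
have E0 : 0 <= E by exact: annulus_cst_ge0.
have M0 := mmv_ge0.
(* 80 is 16 + 64: the squares of [4 * eta] and [8 * r], the outer radii of the two shells, relative
   to [eta] and [r]. *)
exists (80 * (C1 * C) ^+ 2 * E * mmv); first by nonneg.
move=> eta r lam e J z eta0 er lam0 Gz zr JE e1 e2.
have r0 : 0 < r by exact: lt_le_trans er.
have [phi [tphi phi01 phi1 gphi]] := cut eta r eta0 er.
have phi0 x : 0 <= phi x by have /andP[] := phi01 x.
exists phi; split => //; first exact: smooth_borel (test_smooth tphi).
apply: (le_trans (energy_test tphi phi0)); rewrite EFinM; apply: lee_wpmul2l.
  by rewrite lee_fin (le_trans ler01).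
set B := 2 * lam * e + _.
rewrite (_ : (n%:R * B)%:E = \sum_(i < n) B%:E)%E; last first.
  by rewrite sumEFin sumr_const card_ord mulr_natl.
apply: lee_sum => i _.
have [_ bm m0 _ _] := energy_bound_m; have bV := bv; have bFi := bF i.
have bw := @borel_weight R n d Gamma Gneq0.
have bdi := smooth_borel (smooth_partial i (test_smooth tphi)).
pose sh1 := shell Gamma (2 * eta) (4 * eta); pose sh2 := shell Gamma (2 * eta) (8 * r).
pose n4 : V -> R := \1_(nbh (4 * eta)); pose far : V -> R := \1_[set x : V | 2 * r <= `|x|].
have bs1 : borel_fun sh1 by exact: borel_shell.
have bs2 : borel_fun sh2 by exact: borel_shell.
have bn4 : borel_fun n4 by exact: borel_nbh.
have bfar : borel_fun far.
  apply: borel_indic; apply: measurable_ge_borel; apply: borel_continuous => x.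
  by apply: (@norm_continuous R V).
have sh10 x : 0 <= sh1 x by exact: shell_ge0.
have sh20 x : 0 <= sh2 x by exact: shell_ge0.
have vw x : 0 <= v x ^+ 2 * w x by rewrite mulr_ge0 ?sqr_ge0 ?weight_ge0.
pose k1 := (C1 * (C / eta)) ^+ 2 / lam; pose k2 := (C1 * (C / r)) ^+ 2 / lam.
have k10 : 0 <= k1 by rewrite divr_ge0 ?sqr_ge0// ltW.
have k20 : 0 <= k2 by rewrite divr_ge0 ?sqr_ge0// ltW.
have young (c : R) x : `|F i x| * c * v x <= lam * m x + (C1 * c) ^+ 2 / lam * (v x ^+ 2 * w x).
  apply: young_sqr; first by rewrite mulr_ge0// ltW.
    by rewrite mulr_ge0// divr_ge0 ?sqr_ge0// ltW.
  rewrite !exprMn real_normK ?num_real//.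
  have := F_le i x => /(ler_wpM2r (mulr_ge0 (sqr_ge0 c) (sqr_ge0 (v x)))).
  move=> H; rewrite -mulrA; apply: (le_trans H).
  by rewrite le_eqVlt; apply/orP; left; apply/eqP; field; rewrite gt_eqF.
have q1 x : 0 <= n4 x * m x by exact: mulr_ge0.
have q2 x : 0 <= sh1 x * (v x ^+ 2 * w x) by exact: mulr_ge0.
have q3 x : 0 <= far x * m x by exact: mulr_ge0.
have q4 x : 0 <= sh2 x * (v x ^+ 2 * w x) by exact: mulr_ge0.
have a1 x : 0 <= lam * (n4 x * m x) := mulr_ge0 (ltW lam0) (q1 x).
have a2 x : 0 <= k1 * (sh1 x * (v x ^+ 2 * w x)) := mulr_ge0 k10 (q2 x).
have a3 x : 0 <= lam * (far x * m x) := mulr_ge0 (ltW lam0) (q3 x).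
have a4 x : 0 <= k2 * (sh2 x * (v x ^+ 2 * w x)) := mulr_ge0 k20 (q4 x).
have h1 x := addr_ge0 (a1 x) (a2 x).
have h2 x := addr_ge0 (a3 x) (a4 x).
have lm x : 0 <= lam * m x := mulr_ge0 (ltW lam0) (m0 x).
have k1v x : 0 <= k1 * (v x ^+ 2 * w x) := mulr_ge0 k10 (vw x).
have k2v x : 0 <= k2 * (v x ^+ 2 * w x) := mulr_ge0 k20 (vw x).
apply: (@le_trans _ _ (nnint (fun x => (lam * (n4 x * m x) + k1 * (sh1 x * (v x ^+ 2 * w x))) +
   (lam * (far x * m x) + k2 * (sh2 x * (v x ^+ 2 * w x))))%R)).
  apply: le_nnint => [||x|x].
  - by borel.
  - by borel.
  - by rewrite mulr_ge0 ?(G0 (u x))// mulr_ge0.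
  have vx0 : 0 <= v x by exact: G0.
  apply: (@le_trans _ _ (sh1 x * (`|F i x| * (C / eta) * v x) +
      far x * (indb 0 (4 * r) x * \1_(~` nbh (2 * eta)) x) * (`|F i x| * (C / r) * v x))).
    rewrite [leRHS](_ : _ = `|F i x| * (C / eta * sh1 x + C / r * (far x *
       (indb 0 (4 * r) x * \1_(~` nbh (2 * eta)) x))) * v x); last by ring.
    by apply: ler_wpM2r => //; apply: ler_wpM2l => //; exact: gphi.
  apply: lerD.
    rewrite /sh1 /shell -/(n4 x).
    have [->|->] : n4 x = 0 \/ n4 x = 1 by rewrite /n4 indicE; case: (_ \in _); [right|left].
      by rewrite !(mul0r, mulr0, addr0).
    rewrite !mul1r; have [->|->] : (\1_(~` nbh (2 * eta)) x : R) = 0 \/ (\1_(~` nbh (2 * eta)) x : R) = 1.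
        by rewrite indicE; case: (_ \in _); [right|left].
      by rewrite !(mul0r, mulr0, addr0); exact: lm.
    by rewrite !mul1r; exact: young.
  have [->|->] : far x = 0 \/ far x = 1 by rewrite /far indicE; case: (_ \in _); [right|left].
    by rewrite !(mul0r, mulr0, add0r); exact: a4.
  have [[-> x4]|[-> _]] := indbP 0 (4 * r) x; last first.
    by rewrite !(mul0r, mulr0, mul1r); exact: addr_ge0 (lm x) (a4 x).
  (* The point [z] of Gamma is within [r] of the origin, so the ball of radius [4 * r] is within
     [5 * r] of Gamma. *)
  have n8 : nbh (8 * r) x.
    exists z => //; apply/rV_ball_norm; move: x4 => /rV_ball_norm; rewrite sub0r normrN => x4.
    by have := ler_normB z x; lra.
  rewrite !mul1r /sh2 /shell (_ : \1_(nbh (8 * r)) x = 1) ?mul1r; last by rewrite indicE mem_set.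
  have [->|->] : (\1_(~` nbh (2 * eta)) x : R) = 0 \/ (\1_(~` nbh (2 * eta)) x : R) = 1.
      by rewrite indicE; case: (_ \in _); [right|left].
    by rewrite !(mul0r, mulr0, addr0); exact: lm.
  by rewrite !mul1r; exact: young.
have AW k : (nnint (fun x => shell Gamma (2 * eta) (2 ^+ k * (2 * eta)) x * (v x ^+ 2 * w x))%R <=
    (E * (2 ^+ k * (2 * eta)) ^+ 2 * mmv)%:E)%E.
  rewrite EFinM -mmvE.
  have e20 : 0 < 2 * eta by rewrite mulr_gt0.
  exact: (annulus_weighted n2 d0 dn C01 Gneq0 reg kappa_gt0 bV (fun x => G0 (u x)) bmv mv_ge0 mv_fin comp_poincare van k e20).
have W1 : (nnint (fun x => sh1 x * (v x ^+ 2 * w x))%R <= (E * (16 * eta ^+ 2) * mmv)%:E)%E.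
  have := AW 1%N; rewrite expr1 (_ : 2 * (2 * eta) = 4 * eta) ?exprMn; last by ring.
  by rewrite (_ : 4 ^+ 2 = 16 :> R)//; ring.
have W2 : (nnint (fun x => sh2 x * (v x ^+ 2 * w x))%R <= (E * (64 * r ^+ 2) * mmv)%:E)%E.
  have := AW J; rewrite JE exprMn.
  by rewrite (_ : 8 ^+ 2 = 64 :> R)//; ring.
rewrite nnintD; [|by borel|by borel|by []|by []].
rewrite nnintD; [|by borel|by borel|by []|by []].
rewrite nnintD; [|by borel|by borel|by []|by []].
rewrite (@nnintZ _ _ lam); [|exact: ltW|by borel|by []].
rewrite (@nnintZ _ _ lam); [|exact: ltW|by borel|by []].
rewrite (@nnintZ _ _ k1); [|by []|by borel|by []].
rewrite (@nnintZ _ _ k2); [|by []|by borel|by []].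
apply: (@le_trans _ _ ((lam%:E * e%:E + k1%:E * (E * (16 * eta ^+ 2) * mmv)%:E) +
   (lam%:E * e%:E + k2%:E * (E * (64 * r ^+ 2) * mmv)%:E))%E).
  by apply: leeD; apply: leeD; apply: lee_wpmul2l => //; rewrite lee_fin// ltW.
rewrite -!EFinM -!EFinD lee_fin le_eqVlt; apply/orP; left; apply/eqP.
by rewrite /B /k1 /k2; field; rewrite !gt_eqF.
Qed.

(** The cutoffs of [energy_step] tend to 1 off Gamma while [m] vanishes on Gamma, so Fatou's lemma
    removes them from a bound that is arbitrarily small. *)
Lemma energy_zero : nnint (fun x => dG (u x) * m x)%R = 0%E.
Proof.
have [_ bm m0 _ _] := energy_bound_m; have bdg := bdGu.
have q0 x : 0 <= dG (u x) * m x by exact: mulr_ge0.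
apply/eqP; rewrite eq_le nnint_ge0// andbT; apply/lee_addgt0Pr => e e0; rewrite add0e.
have [S S0 SP] := energy_step; have [z Gz] := Gneq0.
have nn : 0 < (n%:R : R) by rewrite ltr0n (ambient_gt0 n2).
have C1_0 : 0 < C1 := lt_le_trans ltr01 C11.
pose e1 := e / (C1 * n%:R * 2); have e10 : 0 < e1 by rewrite divr_gt0// !mulr_gt0.
(* Chosen first, to make [S / lam] at most [e1]; then [e2] below makes [2 * lam * e2] equal to [e1],
   and the domains are chosen last. *)
pose lam := S / e1 + 1; have lam0 : 0 < lam by rewrite ltr_wpDl// divr_ge0// ltW.
have Sl : S / lam <= e1.
  rewrite ler_pdivrMr// /lam mulrDr mulr1 mulrCA mulfV ?mulr1 ?gt_eqF//.
  by rewrite lerDl ltW.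
pose e2 := e1 / (2 * lam); have e20 : 0 < e2 by rewrite divr_gt0// mulr_gt0.
have [j jz] : exists j : nat, `|z| + 1 <= 2 ^+ j.
  exists (Num.trunc (`|z| + 1)).+1; apply: (le_trans (ltW (truncnS_gt _))).
  by rewrite -natrX ler_nat ltnW// ltn_expl.
(* Powers of 2, so that [8 * r k] is [2 * eta k] times the power [2 * k + j + 2] of 2; [j] puts [z]
   within [r k] of the origin. *)
pose eta (k : nat) : R := 2^-1 ^+ k; pose r (k : nat) : R := 2 ^+ (k + j).
have eta0 k : 0 < eta k by rewrite exprn_gt0.
have eta1 k : eta k <= 1 by rewrite /eta exprn_ile1// invf_le1// ler1n.
have r1 k : `|z| + 1 <= r k.
  by apply: (le_trans jz); apply: ler_weXn2l; [exact: ler1n|exact: leq_addl].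
have rk k : k%:R <= r k.
  rewrite /r -natrX ler_nat; apply: (leq_trans (ltnW (ltn_expl k (isT : (1 < 2)%N)))).
  by rewrite leq_exp2l// leq_addr.
have L1m : L1 m by exact: L1_ge0.
have Nnbh x : Gamma x \/ exists N, forall k, (N <= k)%N -> ~ nbh (4 * eta k) x.
  have [Gx|nG] := pselect (Gamma x); [by left|right].
  have [s s0 ns] := nbh_small clG nG.
  have /cvgrPdist_lt /(_ s s0) [N _ NP] : (fun k => 4 * eta k) @ \oo --> (4 * 0 : R).
    apply: cvgM; first exact: cvg_cst.
    by apply: cvg_expr; rewrite ger0_norm// invf_lt1// ltr1n.
  exists N => k /NP; rewrite mulr0 sub0r normrN ger0_norm ?mulr_ge0 ?(ltW (eta0 k))// => H Nx.
  by apply: ns; apply: nbh_le Nx; exact: ltW.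
have Nfar x : exists N, forall k, (N <= k)%N -> `|x| < 2 * r k.
  exists (Num.trunc `|x|).+1 => k Nk; apply: (lt_le_trans (truncnS_gt _)).
  apply: (@le_trans _ _ (r k)); first by apply: le_trans (rk k); rewrite ler_nat.
  by rewrite ler_peMl ?ler1n// (le_trans _ (r1 k))// addr_ge0.
have [|||N1 N1P] := @nnint_dominated _ _ (fun k x => \1_(nbh (4 * eta k)) x * m x) m _ _ L1m _ _ e20.
- by move=> k; have bN := @borel_nbh R n Gamma (4 * eta k); borel.
- by move=> k x; rewrite mulr_ge0//= ler_piMl// indicE lern1 leq_b1.
- apply: aeT => x; apply/cvgrPdist_le => t t0; have [Gx|[N NP]] := Nnbh x.
    exists 0%N => // k _; rewrite big1 ?mulr0 ?subrr ?normr0 ?(ltW t0)//.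
    by move=> i _; rewrite gG// expr0n.
  exists N => // k /NP nx; rewrite indicE memNset// mul0r subrr normr0; exact: ltW.
have bfar k : borel_fun (\1_[set x : V | 2 * r k <= `|x|]).
  apply: borel_indic; apply: measurable_ge_borel; apply: borel_continuous => x.
  by apply: (@norm_continuous R V).
have [|||N2 N2P] := @nnint_dominated _ _ (fun k x => \1_[set x : V | 2 * r k <= `|x|] x * m x) m _ _ L1m _ _ e20.
- by move=> k; have bN := bfar k; borel.
- by move=> k x; rewrite mulr_ge0//= ler_piMl// indicE lern1 leq_b1.
- apply: aeT => x; apply/cvgrPdist_le => t t0; have [N NP] := Nfar x.
  exists N => // k /NP nx; rewrite indicE memNset ?mul0r ?subrr ?normr0 ?(ltW t0)//=.
  by apply/negP; rewrite -ltNge.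
pose N := maxn N1 N2.
have /choice[phi phiP] k : exists phi : V -> R, [/\ borel_fun phi, forall x, 0 <= phi x,
    forall x, `|x| < 2 * r (N + k)%N -> ~ nbh (4 * eta (N + k)%N) x -> phi x = 1 &
    (nnint (fun x => dG (u x) * m x * phi x)%R <= e%:E)%E].
  set K := (N + k)%N.
  have [|||||phi [b1 b2 b3 b4]] := SP (eta K) (r K) lam e2 (2 * K + j + 2)%N z (eta0 K) _ lam0 Gz.
  - by apply: (le_trans (eta1 K)); apply: le_trans (r1 K); rewrite lerDr.
  - by apply: le_trans (r1 K); rewrite lerDl.
  - have -> : (2 : R) ^+ (2 * K + j + 2) = 2 ^+ K * 2 ^+ K * 2 ^+ j * 4.
      by rewrite exprD exprD mul2n -addnn exprD; congr (_ * _); ring.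
    by rewrite /eta /r exprVn exprD; field; rewrite expf_neq0.
  - by apply: N1P; apply: leq_trans (leq_addr _ _); exact: leq_maxl.
  - by apply: N2P; apply: leq_trans (leq_addr _ _); exact: leq_maxr.
  exists phi; split => //; apply: (le_trans b4); rewrite lee_fin.
  have : 2 * lam * e2 + S / lam <= 2 * e1.
    rewrite /e2 [2 * lam * _](_ : _ = e1); last by field; rewrite gt_eqF.
    by rewrite mulr_natl mulr2n lerD2l.
  move=> H; rewrite mulrA; apply: (@le_trans _ _ (C1 * n%:R * (2 * e1))).
    by apply: ler_wpM2l => //; rewrite mulr_ge0 ?ltW.
  by rewrite /e1 le_eqVlt; apply/orP; left; apply/eqP; field; rewrite !gt_eqF.
apply: (@nnint_fatou _ _ (fun k x => dG (u x) * m x * phi k x)) => //.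
- by move=> k; have [bk _ _ _] := phiP k; borel.
- by borel.
- by move=> k x; have [_ pk _ _] := phiP k; rewrite mulr_ge0.
- move=> x; have [Gx|[Na NaP]] := Nnbh x.
    have -> : m x = 0 by rewrite big1 ?mulr0// => i _; rewrite gG// expr0n.
    by rewrite mulr0; under eq_fun do rewrite mul0r; exact: cvg_cst.
  have [Nb NbP] := Nfar x; apply/cvgrPdist_le => t t0; exists (maxn Na Nb) => // k /= kN.
  have [_ _ pk _] := phiP k; rewrite pk ?mulr1 ?subrr ?normr0 ?(ltW t0)//.
    by apply: NbP; apply: leq_trans (leq_addl _ _); apply: leq_trans kN; exact: leq_maxr.
  by apply: NaP; apply: leq_trans (leq_addl _ _); apply: leq_trans kN; exact: leq_maxl.
- by move=> k; have [_ _ _] := phiP k.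
Qed.

End test.

Lemma one_sided_maximum : ae (fun x => u x <= M).
Proof.
have oG : open (~` Gamma) by exact: closed_openC.
have [_ bm m0 _ _] := energy_bound_m.
have [dG [bd dG0]] := @pexp_bounded_derivatives R M.
pose G t := pexp (t - M).
have [sG sdG Gd [L LP]] := bd.
have G0 t : 0 <= G t by exact: pexp_ge0.
have GL t : G t <= L by have [+ _ _] := LP 0 t; apply: le_trans; exact: ler_norm.
have dGL t : dG t <= L by have [_ + _] := LP 0 t; apply: le_trans; exact: ler_norm.
have L0 : 0 <= L by exact: le_trans (dGL 0).
pose v x := G (u x).
have bV : borel_fun v by exact: borel_smooth1 sG (proj1 uloc).
have LPu : local_poincare_at d Gamma u m.
  move=> z r Gz r0; exact: (local_poincare n2 d0 dn Gneq0 clG reg kappa_gt0 Gz r0 uloc g_locL1 energy_bound_m wg).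
have van : hausdorff_outer d (Gamma `&` [set x | ~ vanishing v x]) = 0%E.
  apply/eqP; rewrite eq_le outer_measure_ge0 andbT.
  apply: (@le_trans _ _ (hausdorff_outer d ((Gamma `&` [set x | ~ good d m x]) `|` (Gamma `&` [set x | ~ trace u x <= M])))).
    apply: le_outer_measure => x [Gx nv]; have [gx|ngx] := pselect (good d m x); last by left.
    right; split => // TM; apply: nv.
    apply: (good_vanishing n2 kappa_gt0 (proj1 uloc) bm m0 mfin LPu Gx gx TM bV L0).
      by apply: bounded_derivatives_lipschitz => // t; have [] := LP 0 t.
    by move=> t tM; rewrite /G pexp_le0// subr_le0.
  apply: (le_trans (outer_measureU2 (hausdorff_outer d) _ _)).
  by rewrite [X in (_ + X <= _)%E]Tu adde0 [X in (X <= _)%E](bad_null n2 d0 C01 reg bm m0 mfin).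
have E0 := energy_zero bd G0 GL dG0 dGL van.
pose mv x := dG (u x) ^+ 2 * m x.
have [_ bmv mv0 mvfin _] := comp_energy_bound bd dG0 dGL.
(* Since [dG] is at most [L], the energy of [G(u)] is at most [L] times the integral that
   [energy_zero] annihilates. *)
have mvz : nnint mv = 0%E.
  have bdg := bdGu bd.
  apply/eqP; rewrite eq_le nnint_ge0// andbT -[X in (_ <= X)%E](mule0 L%:E) -E0 -nnintZ//; last 2 first.
  - by borel.
  - by move=> x; exact: mulr_ge0.
  apply: le_nnint => //; first by borel.
  move=> x; rewrite /mv expr2 -mulrA; apply: ler_wpM2r; first exact: mulr_ge0.
  exact: dGL.
(* With zero energy, [layer] makes [v] vanish on every neighbourhood of Gamma, and those of positive
   integer radius exhaust the space. *)
have vz r : 0 < r -> ae (fun x => \1_(nbh r) x * v x ^+ 2 = 0).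
  move=> r0; have bN := @borel_nbh R n Gamma r.
  apply: nnint_eq0; [by borel|by move=> x; rewrite mulr_ge0 ?sqr_ge0|].
  apply/eqP; rewrite eq_le nnint_ge0 ?andbT; last by move=> x; rewrite mulr_ge0 ?sqr_ge0.
  apply: (le_trans (layer n2 d0 C01 reg kappa_gt0 bV (fun x => G0 (u x)) bmv mv0 mvfin (comp_poincare bd G0 GL dG0 dGL) van r0)).
  by rewrite mvz mule0.
have := ae_forall (fun k => vz k.+1%:R (ltr0Sn R k)); apply: aeS => x H.
have [z Gz] := Gneq0; have := H (Num.trunc `|z - x|).
rewrite indicE mem_set; last first.
  by exists z => //; apply/rV_ball_norm; exact: truncnS_gt.
rewrite mul1r => /eqP; rewrite sqrf_eq0 => /eqP vx0.
by rewrite leNgt; apply/negP => Mx; move: vx0 => /eqP; rewrite gt_eqF// /v /G pexp_gt0// subr_gt0.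
Qed.

End maximum_principle.

(** * Borel representatives *)

Section borel_representatives.
Context {R : realType} {n : nat}.
Local Notation V := 'rV[R]_n.
Local Notation leb := (lebesgue_vec R n).
Local Notation outer := (lebesgue_outer R n).
Implicit Types (A B D E N : set V) (f : V -> R).

Definition borel_null N := measurable (N : set borelV) /\ leb N = 0%E.

Lemma outer_box_volume S : (outer S <= box_volume S)%E.
Proof.
apply: (@box_volume_ind R n (fun S v => (outer S <= v)%E)) => [|{}S _|a b ab0].
- by rewrite outer_measure0.
- by rewrite leey.
- by rewrite -box_volumeE//; exact: leb_box_le.
Qed.

Lemma borel_box_volume (S : set V) : (box_volume S < +oo)%E -> measurable (S : set borelV).
Proof.
apply: (@box_volume_ind R n (fun S v => (v < +oo)%E -> measurable (S : set borelV)))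
  => [_|{}S _|a b _ _]; [exact: measurable0|by rewrite ltxx|].
rewrite (_ : box a b = \bigcap_(i in [set: 'I_n]) ((fun x : borelV => (x : V) 0 i) @^-1` `[a 0 i, b 0 i])).
  apply: fin_bigcap_measurable => // i _; rewrite -[X in measurable X]setTI.
  by apply: measurable_coord => //; exact: measurable_itv.
apply/seteqP; split => x /= h i; first by move=> _ /=; rewrite in_itv/= h.
by have := h i I; rewrite /= in_itv.
Qed.

(** The sets of a covering with finite sum of volumes are closed boxes or empty, hence Borel;
    intersect the unions of coverings that are optimal up to [k.+1%:R^-1]. If the outer measure is
    infinite the whole space will do. *)
Lemma borel_hull E : exists B, [/\ measurable (B : set borelV), E `<=` B & outer B = outer E].
Proof.
have [Eoo|Efin] := eqVneq (outer E) +oo%E.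
  exists setT; split; [exact: (@measurableT _ borelV)|by []|].
  apply/eqP; rewrite Eoo eq_le leey/= -Eoo.
  exact: le_outer_measure.
have Efn : outer E \is a fin_num by rewrite ge0_fin_numE ?outer_measure_ge0// ltey.
have cov k : exists B, [/\ measurable (B : set borelV), E `<=` B & (outer B <= outer E + (k.+1%:R^-1)%:E)%E].
  have k0 : 0 < (k.+1%:R^-1 : R) by rewrite invr_gt0.
  have [_ [F EF <-] Fk] := lb_ereal_inf_adherent k0 Efn.
  have F0 j : (0 <= box_volume (F j))%E by exact: box_volume_ge0.
  exists (\bigcup_j F j); split => //.
    apply: (@bigcup_measurable _ borelV) => j _; apply: borel_box_volume.
    apply: le_lt_trans (lt_trans Fk _).
      have := @nneseries_lim_ge R (fun j => box_volume (F j)) xpredT 0%N j.+1 (fun j _ _ => F0 j).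
      by apply: le_trans; rewrite big_nat_recr//= leeDr// sume_ge0.
    by rewrite -[ereal_inf _]fineK// -EFinD ltry.
  apply: (le_trans (outer_measure_sigma_subadditive outer F)); apply: le_trans (ltW Fk).
  by apply: lee_nneseries => j _ //; exact: outer_box_volume.
have /choice[B BP] := cov.
exists (\bigcap_k B k); split.
- by apply: (@bigcap_measurable _ borelV) => // k _; have [] := BP k.
- by move=> x Ex k _; have [_ + _] := BP k; exact.
apply/eqP; rewrite eq_le; apply/andP; split; last first.
  by apply: le_outer_measure => x Ex k _; have [_ + _] := BP k; exact.
apply/lee_addgt0Pr => e e0.
have [k ke] : exists k : nat, k.+1%:R^-1 < e.
  exists (Num.trunc e^-1); rewrite invf_plt ?posrE//; exact: truncnS_gt.
apply: (@le_trans _ _ (outer (B k))); first by apply: le_outer_measure => x; exact.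
have [_ _] := BP k; move=> /le_trans; apply.
by rewrite leeD2l// lee_fin ltW.
Qed.

Lemma borel_nullU N N' : borel_null N -> borel_null N' -> borel_null (N `|` N').
Proof.
move=> [mN N0] [mN' N'0]; split; first exact: (@measurableU _ borelV).
apply/eqP; rewrite eq_le measure_ge0 andbT.
by apply: (le_trans (outer_measureU2 outer N N')); rewrite [X in (X + _ <= _)%E]N0 [X in (_ + X <= _)%E]N'0 adde0.
Qed.

Lemma borel_null_bigcup (T : countType) (N : T -> set V) : (forall k, borel_null (N k)) -> borel_null (\bigcup_k N k).
Proof.
move=> N0; split.
  by apply: (@countable_bigcupT_measurable _ borelV) => [|k]; [exact: countableP|have [] := N0 k].
pose Nk (k : nat) := if @unpickle T k is Some q then N q else set0.
have Nk0 k : outer (Nk k) = 0%E.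
  by rewrite /Nk; case: unpickle => [q|]; [have [] := N0 q|exact: outer_measure0].
apply/eqP; rewrite eq_le measure_ge0 andbT; apply: (@le_trans _ _ (outer (\bigcup_k Nk k))).
  by apply: le_outer_measure => x [q _ Nx]; exists (pickle q) => //; rewrite /Nk pickleK.
apply: (le_trans (outer_measure_sigma_subadditive outer Nk)).
by rewrite eseries0// => k _ _; exact: Nk0.
Qed.

Lemma null_hull E : leb E = 0%E -> exists2 N, borel_null N & E `<=` N.
Proof. by move=> E0; have [N [mN EN N0]] := borel_hull E; exists N => //; split => //; rewrite -E0. Qed.

(** The part of [E] in a ball has finite measure, so it differs from its Borel hull by a null set,
    itself contained in a Borel null set. Off the union of these, [E] is the union of the hulls. *)
Lemma borel_mod_null E : measurable (E : set lebV) ->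
  exists2 N, borel_null N & measurable (E `\` N : set borelV).
Proof.
move=> mE; pose Ek (k : nat) := E `&` ball 0 k.+1%:R.
have mb (k : nat) : measurable (ball (0 : V) k.+1%:R : set lebV) by apply: measurable_open; exact: ball_open.
have mEk k : measurable (Ek k : set lebV) by exact: (@measurableI _ lebV).
have step k : exists BN : set V * set V, [/\ measurable (BN.1 : set borelV), borel_null BN.2,
    Ek k `<=` BN.1 & BN.1 `\` Ek k `<=` BN.2].
  have [B [mB EB BE]] := borel_hull (Ek k).
  have [|N N0 BN] := @null_hull (B `\` Ek k); last by exists (B, N).
  have mB' : measurable (B : set lebV) by exact: borel_cara.
  rewrite measureD//; last first.
    rewrite [X in (X < _)%E]BE; apply: le_lt_trans (leb_ball_lty 0 k.+1%:R).
    by apply: le_outer_measure => x [].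
  rewrite setIidr// [X in (X - _)%E]BE subee// ge0_fin_numE ?outer_measure_ge0//.
  apply: le_lt_trans (leb_ball_lty 0 k.+1%:R).
  by apply: le_outer_measure => x [].
have /choice[BN BNP] := step.
exists (\bigcup_k (BN k).2); first by apply: borel_null_bigcup => k; have [] := BNP k.
rewrite (_ : _ `\` _ = \bigcup_k ((BN k).1 `\` \bigcup_k (BN k).2)).
  apply: (@bigcup_measurable _ borelV) => k _; apply: (@measurableD _ borelV); first by have [] := BNP k.
  by apply: (@bigcup_measurable _ borelV) => j _; have [_ []] := BNP j.
apply/seteqP; split => [x [Ex nx]|x [k _ [Bx nx]]].
  have : [set: V] x by [].
  rewrite -bigcup_ball => -[k _ kx]; exists k => //; split => //.
  by have [_ _ + _] := BNP k; apply; split.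
split => //; have [Ekx|nEk] := pselect (Ek k x); first by have [] := Ekx.
by exfalso; apply: nx; exists k => //; have [_ _ _] := BNP k; apply.
Qed.

Lemma leb_null_measurable A : leb A = 0%E -> measurable (A : set lebV).
Proof. by move=> A0; apply: measure_is_complete_caratheodory; have [N [mN N0] AN] := null_hull A0; exists N; split => //; exact: borel_cara. Qed.

Lemma measurable_modify D f : measurable (D : set lebV) -> leb (~` D) = 0%E ->
  measurable_fun (D : set lebV) (f : lebV -> R) -> measurable_fun setT (f : lebV -> R).
Proof.
move=> mD D0 mf; rewrite -(setUv D); apply/measurable_funU => //; first exact: measurableC.
split => // _ B mB; apply: leb_null_measurable; apply/eqP; rewrite eq_le measure_ge0 andbT -D0.
by apply: le_outer_measure => x [].
Qed.

(** The sublevel sets at rational thresholds are Borel off one common null set. Allowing any larger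
    Borel null set [N'] lets several functions share the same one. *)
Lemma borel_rep f : measurable_fun setT (f : lebV -> R) ->
  exists2 N, borel_null N & forall N', borel_null N' -> N `<=` N' -> borel_fun (fun x => \1_(~` N') x * f x).
Proof.
move=> mf; pose E (q : rat) := [set x | f x < ratr q].
have mE q : measurable (E q : set lebV).
  rewrite -[X in measurable X]setTI; rewrite (_ : E q = f @^-1` `]-oo, ratr q[).
    by apply: mf => //; exact: measurable_itv.
  by apply/seteqP; split => x /=; rewrite in_itv.
have /choice[N NP] : forall q, exists N, borel_null N /\ measurable (E q `\` N : set borelV).
  by move=> q; have [N] := borel_mod_null (mE q); exists N.
exists (\bigcup_q N q); first by apply: borel_null_bigcup => q; have [] := NP q.
move=> N' [mN' _] NN'; have mC := @measurableC _ borelV _ mN'.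
rewrite (_ : (fun x => _) = ((f : borelV -> R) \_ (~` N' : set borelV))); last first.
  by apply/funext => x; rewrite patchE indicE; case: ifPn => _; rewrite ?mul1r ?mul0r.
apply/(measurable_restrictT (f : borelV -> R) mC).
apply: (measurability _ (RGenInftyO.measurableE R)).
move=> _ [_ [t ->] <-].
rewrite (_ : _ `&` _ = \bigcup_(q : rat) (if ratr q < t then (E q `\` N q) `&` ~` N' else set0)).
  apply: (@countable_bigcupT_measurable _ borelV) => [|q]; first exact: countableP.
  case: ifP => _; last exact: (@measurable0 _ borelV).
  by apply: (@measurableI _ borelV) => //; have [] := NP q.
apply/seteqP; split => [x [nx]|x [q _]]; last first.
  case: ifP => // qt [[Ex _] nx].
  by split => //; rewrite /= in_itv/=; exact: lt_trans qt.
rewrite /= in_itv/= => xt.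
have [q] := rat_in_itvoo xt; rewrite in_itv/= => /andP[xq qt].
exists q => //; rewrite qt; split => //; split => // Nx; apply: nx; apply: NN'.
by exists q.
Qed.

End borel_representatives.

(** * Passing to Borel data off a null set *)

Section reduction.
Context {R : realType} {n : nat}.
Local Notation V := 'rV[R]_n.
Local Notation leb := (lebesgue_vec R n).
Local Notation kappa := (@leb_unit_ball R n).
Implicit Types (x y z : V) (N D : set V) (f : V -> R).
Variable (Gamma : set V).
Hypotheses (clG : closed Gamma) (G0 : leb Gamma = 0%E).
Local Notation Omega := (~` Gamma).

(** A compact exhaustion of [Omega], through which local integrability gives measurability on
    [Omega] and equality of gradients on compact sets gives equality almost everywhere. *)
Definition inner_part (k : nat) : set V := [set x | `|x| <= k%:R] `&` ~` nbh Gamma k.+1%:R^-1.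

Lemma inner_part_compact k : compact (inner_part k).
Proof.
apply: bounded_closed_compact.
  exists k%:R; split; first exact: num_real.
  by move=> M kM x [xk _]; exact: le_trans (ltW kM).
apply: closedI; last by apply: open_closedC; exact: open_nbh.
apply: (@closed_comp _ _ (fun x : V => `|x|) [set r | r <= k%:R]); last exact: closed_le.
by move=> x _; exact: (@norm_continuous R V).
Qed.

Lemma inner_part_sub k : inner_part k `<=` Omega.
Proof. by move=> x [_ nx] Gx; apply: nx; exists x => //; exact: ballxx. Qed.

Lemma bigcup_inner_part : \bigcup_k inner_part k = Omega.
Proof.
apply/seteqP; split => [x [k _]|x nG]; first exact: inner_part_sub.
have [r r0 nr] := nbh_small clG nG.
pose k := maxn (Num.trunc `|x|).+1 (Num.trunc r^-1).
exists k => //; split => /=.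
  by apply: (le_trans (ltW (truncnS_gt _))); rewrite ler_nat leq_maxl.
move=> nx; apply: nr; apply: nbh_le nx.
rewrite invf_ple ?posrE//; apply: (le_trans (ltW (truncnS_gt _))).
by rewrite ler_nat ltnS leq_maxr.
Qed.

Lemma measurable_complG : measurable (Omega : set lebV).
Proof. by apply: measurable_open; exact: closed_openC. Qed.

Lemma measurable_offG f : measurable_fun (Omega : set lebV) (f : lebV -> R) -> measurable_fun setT (f : lebV -> R).
Proof. by apply: measurable_modify; [exact: measurable_complG|rewrite setCK]. Qed.

Lemma loc_integrable_measurable f : loc_integrable Omega f -> measurable_fun setT (f : lebV -> R).
Proof.
move=> fi; apply: measurable_offG; rewrite -bigcup_inner_part.
have mK k : measurable (inner_part k : set lebV) by apply: borel_cara; apply: compact_borel; exact: inner_part_compact.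
apply/(measurable_fun_bigcup (f : lebV -> R) mK) => k.
have cK : compact (inner_part k) by exact: inner_part_compact.
have /integrableP[/measurable_EFinP mf _] := fi _ cK (@inner_part_sub k).
exact: mf.
Qed.

Section representative.
Variable N : set V.
Hypothesis (N0 : borel_null N).
(** Once [N] contains Gamma these representatives vanish on Gamma, so that integrals over [Omega]
    become integrals over the whole space. *)
Definition offnull f x : R := \1_(~` N) x * f x.

Lemma integral_offnull D f : measurable (D : set lebV) -> measurable_fun setT (f : lebV -> R) ->
  borel_fun (offnull f) -> (\int[leb]_(x in D) (f x)%:E = \int[leb]_(x in D) (offnull f x)%:E)%E.
Proof.
move=> mD mf bf; apply: ae_eq_integral.
- exact: mD.
- by apply/measurable_EFinP; exact: measurable_funTS mf.
- by apply/measurable_EFinP; exact: measurable_funTS (borel_fun_leb bf).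
exists N; split; [exact: borel_cara (proj1 N0)|exact: (proj2 N0)|].
move=> x /= H; apply: contrapT => nN; apply: H => _.
by rewrite /offnull indicE mem_set// mul1r.
Qed.

(** The trace is defined by integrals over Lebesgue measurable balls, so it is unchanged at every
    point, including the points of Gamma where the representative was set to 0. *)
Lemma trace_offnull f : measurable_fun setT (f : lebV -> R) -> borel_fun (offnull f) -> trace (offnull f) = trace f.
Proof.
move=> mf bf; apply/funext => x; rewrite /trace; 
have -> // : ball_average (offnull f) x = ball_average f x; apply/funext => r; rewrite /ball_average /Rintegral; congr (_ * fine _).
rewrite [RHS]integral_offnull//; apply: measurable_open; exact: open_eball.
Qed.

Hypothesis GN : Gamma `<=` N.

Lemma offnullG f x : Gamma x -> offnull f x = 0.
Proof. by move=> /GN Nx; rewrite /offnull indicE memNset ?mul0r//; exact. Qed.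

Lemma Rintegral_offnull f : measurable_fun setT (f : lebV -> R) -> borel_fun (offnull f) ->
  \int[leb]_(x in Omega) f x = rint (offnull f).
Proof.
move=> mf bf; rewrite /rint /Rintegral integral_offnull//; last exact: measurable_complG.
congr fine; rewrite [LHS]integral_mkcond; apply: eq_integral => x _.
rewrite patchE; case: ifPn => //; rewrite notin_setE => nx.
by rewrite offnullG//; exact: contrapT.
Qed.

Lemma offnull_norm f x : `|offnull f x| <= `|f x|.
Proof. by rewrite /offnull normrM ler_piMl// indicE; case: (_ \in _); rewrite ?normr1 ?normr0. Qed.

Lemma locL1_offnull f : loc_integrable Omega f -> borel_fun (offnull f) -> locL1 Omega (offnull f).
Proof.
move=> fi bf; split => // K cK KO; have bK := @borel_indic R n K (compact_borel cK).
split; first by borel.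
have /integrableP[mf] := fi K cK KO; apply: le_lt_trans.
have mK : measurable (K : set lebV) by exact: borel_cara (compact_borel cK).
rewrite /nnint [leRHS]integral_mkcond; apply: ge0_le_integral.
- exact: measurableT.
- by [].
- by apply/measurable_EFinP/borel_fun_leb; borel.
- apply/(measurable_restrictT _ mK).
  have /measurable_EFinP mf' := mf; apply/measurable_EFinP.
  exact: measurableT_comp (@normr_measurable R setT) mf'.
move=> x _; rewrite patchE indicE; case: ifP => xK /=; last by rewrite mul0r normr0.
by rewrite mul1r lee_fin offnull_norm.
Qed.

Lemma wgrad_offnull u (g : V -> V) : weak_gradient Omega u g ->
  measurable_fun setT (u : lebV -> R) -> (forall i, measurable_fun setT ((fun x => g x 0 i) : lebV -> R)) ->
  borel_fun (offnull u) -> (forall i, borel_fun (offnull (fun x => g x 0 i))) ->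
  wgrad Omega (offnull u) (fun i => offnull (fun x => g x 0 i)).
Proof.
move=> [_ wg] mu mg bu bg phi tphi i.
have bphi := smooth_borel (test_smooth tphi); have bd := smooth_borel (smooth_partial i (test_smooth tphi)).
rewrite (_ : (fun x => _ * partial i phi x) = offnull (fun x => u x * partial i phi x)); last first.
  by apply/funext => x; rewrite /offnull mulrA.
rewrite [in RHS](_ : (fun x => _ * phi x) = offnull (fun x => g x 0 i * phi x)); last first.
  by apply/funext => x; rewrite /offnull mulrA.
rewrite -!Rintegral_offnull; first exact: wg.
- exact: measurable_funM (mg i) (borel_fun_leb bphi).
- rewrite (_ : offnull _ = fun x => offnull (fun x => g x 0 i) x * phi x); first exact: borelM.
  by apply/funext => x; rewrite /offnull mulrA.
- exact: measurable_funM mu (borel_fun_leb bd).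
- rewrite (_ : offnull _ = fun x => offnull u x * partial i phi x); first exact: borelM.
  by apply/funext => x; rewrite /offnull mulrA.
Qed.

End representative.

Lemma borel_rep_fin (I : finType) (f : I -> V -> R) : (forall i, measurable_fun setT (f i : lebV -> R)) ->
  exists2 N, borel_null N & forall N', borel_null N' -> N `<=` N' -> forall i, borel_fun (offnull N' (f i)).
Proof.
move=> mf; have /choice[N NP] : forall i, exists N, borel_null N /\
    forall N', borel_null N' -> N `<=` N' -> borel_fun (offnull N' (f i)).
  by move=> i; have [N] := borel_rep (mf i); exists N.
exists (\bigcup_i N i); first by apply: borel_null_bigcup => i; have [] := NP i.
move=> N' N'0 NN' i; have [_] := NP i; apply => // x Nx; apply: NN'; by exists i.
Qed.

End reduction.

(** * The maximum principle *)

Section borel_solutions.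
Context {R : realType} {n : nat}.
Local Notation V := 'rV[R]_n.
Local Notation kappa := (@leb_unit_ball R n).
Implicit Types (x y z : V) (u : V -> R) (g F : 'I_n -> V -> R).
Variables (d C0 C1 : R) (Gamma : set V).
Hypotheses (n2 : (2 <= n)%N) (d0 : 0 < d) (dn : d < n%:R - 1) (C01 : 1 <= C0)
  (Gneq0 : Gamma !=set0) (clG : closed Gamma) (reg : ahlfors_regular d C0 Gamma)
  (kappa_gt0 : 0 < kappa) (C11 : 1 <= C1).
Local Notation w := (weight Gamma d).

Definition borel_solution u g F :=
  [/\ locL1 (~` Gamma) u, wgrad (~` Gamma) u g, forall i, borel_fun (g i), forall i, borel_fun (F i) &
      forall i x, Gamma x -> g i x = 0] /\
  [/\ (nnint (fun x => w x * \sum_i g i x ^+ 2)%R < +oo)%E,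
      forall i x, F i x ^+ 2 <= C1 ^+ 2 * (w x * (w x * \sum_i g i x ^+ 2)),
      forall x, w x * \sum_i g i x ^+ 2 <= C1 * \sum_i F i x * g i x &
      forall phi, test_function (~` Gamma) phi -> rint (fun x => \sum_i F i x * partial i phi x) = 0].

Lemma L1N (f : V -> R) : L1 f -> L1 (fun x => - f x).
Proof.
move=> [bf ff]; split; first exact: borelN.
by under eq_fun do rewrite normrN.
Qed.

(** Integrability is not assumed: when one of the two parts has an infinite integral, [fine] returns
    0 on both sides. *)
Lemma rintN (f : V -> R) : rint (fun x => - f x) = - rint f.
Proof.
rewrite /rint /Rintegral [in LHS]integralE [in RHS]integralE.
have -> : (fun x => (- f x)%:E) = (\- (EFin \o f))%E by [].
rewrite funeposN funenegN.
by case: integral => [a| |]; case: integral => [b| |]; rewrite ?oppr0//= opprB.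
Qed.

Lemma borel_solution_poincare u g F : borel_solution u g F ->
  local_poincare_at d Gamma u (fun x => w x * \sum_i g i x ^+ 2).
Proof.
move=> [[uloc wg bg bF gG] [mfin F_le m_le weak]] z r Gz r0.
have gl i := g_locL1 dn Gneq0 clG bg gG mfin i.
have eb := energy_bound_m dn Gneq0 clG bg gG mfin.
exact: (local_poincare n2 d0 dn Gneq0 clG reg kappa_gt0 Gz r0 uloc gl eb wg).
Qed.

Lemma borel_solutionN u g F : borel_solution u g F ->
  borel_solution (fun x => - u x) (fun i x => - g i x) (fun i x => - F i x).
Proof.
move=> [[[bu Lu] wg bg bF gG] [mfin F_le m_le weak]].
have E x : \sum_i (- g i x) ^+ 2 = \sum_i g i x ^+ 2 by apply: eq_bigr => i _; rewrite sqrrN.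
split; split.
- split; first exact: borelN.
  by move=> K cK KG; under eq_fun do rewrite mulrN; exact: L1N (Lu K cK KG).
- move=> phi tphi i; under eq_fun do rewrite mulNr.
  by rewrite rintN (wg phi tphi i); under [in RHS]eq_fun do rewrite mulNr; rewrite rintN.
- by move=> i; exact: borelN.
- by move=> i; exact: borelN.
- by move=> i x /gG ->; rewrite oppr0.
- by under eq_fun do rewrite E.
- by move=> i x; rewrite E sqrrN; exact: F_le.
- by move=> x; rewrite E [X in C1 * X](eq_bigr (fun i => F i x * g i x)) => [|i _]; rewrite ?mulrNN.
- move=> phi tphi; rewrite (_ : (fun x => _) = fun x => - \sum_i F i x * partial i phi x).
    by rewrite rintN weak// oppr0.
  by apply/funext => x; rewrite -sumrN; apply: eq_bigr => i _; rewrite mulNr.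
Qed.

Lemma borel_solution_max u g F M : borel_solution u g F ->
  hausdorff_outer d (Gamma `&` [set x | ~ trace u x <= M]) = 0%E -> ae (fun x => u x <= M).
Proof.
move=> [[uloc wg bg bF gG] [mfin F_le m_le weak]] Tu.
exact: (one_sided_maximum n2 d0 dn C01 Gneq0 clG reg kappa_gt0 C11 uloc bg bF gG mfin wg F_le m_le weak Tu).
Qed.

(** At a [good] point both limits exist and [trace_avg] identifies them; the other points, where
    [trace] may be a default value, are discarded by [bad_null]. *)
Lemma borel_solution_traceN u g F : borel_solution u g F ->
  hausdorff_outer d (Gamma `&` [set x | trace (fun x => - u x) x <> - trace u x]) = 0%E.
Proof.
move=> S; have LP := borel_solution_poincare S; have SN := borel_solutionN S.
have LPN := borel_solution_poincare SN.
move: S SN => [[[bu Lu] wg bg bF gG] [mfin F_le m_le weak]] _.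
have [_ bm m0 _ _] := energy_bound_m dn Gneq0 clG bg gG mfin.
apply/eqP; rewrite eq_le outer_measure_ge0 andbT -(bad_null n2 d0 C01 reg bm m0 mfin).
apply: le_outer_measure => x [Gx Tx]; split => // gx; apply: Tx.
have n0 : (0 < n)%N by exact: ltnW.
have [l lP] := good_limit n2 kappa_gt0 bu bm m0 mfin LP Gx gx.
rewrite (trace_avg kappa_gt0 n0 bu (fun r r0 => proj1 (LP x r Gx r0)) lP).
apply: (trace_avg kappa_gt0 n0 (borelN bu) (fun r r0 => proj1 (LPN x r Gx r0))).
by move=> e e0; have [rho r0 H] := lP e e0; exists rho => // r; under [X in avg X]eq_fun do rewrite -opprD normrN; exact: H.
Qed.

Lemma borel_solution_min u g F M : borel_solution u g F ->
  hausdorff_outer d (Gamma `&` [set x | ~ M <= trace u x]) = 0%E -> ae (fun x => M <= u x).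
Proof.
move=> S Tu; have SN := borel_solutionN S; have TN := borel_solution_traceN S.
have : ae (fun x => - u x <= - M).
  apply: (borel_solution_max SN); apply/eqP; rewrite eq_le outer_measure_ge0 andbT.
  rewrite -[leRHS]adde0 -{1}Tu -TN; apply: le_trans (outer_measureU2 (hausdorff_outer d) _ _).
  apply: le_outer_measure => x [Gx Tx].
  have [E|nE] := pselect (trace (fun x => - u x) x = - trace u x); last by right.
  by left; split => // MT; apply: Tx; rewrite /= E lerN2.
by apply: aeS => x; rewrite lerN2.
Qed.

End borel_solutions.

(** * Borel data of a weak solution *)

Section solution_representative.
Context {R : realType} {n : nat}.
Local Notation V := 'rV[R]_n.
Local Notation leb := (lebesgue_vec R n).
Local Notation kappa := (@leb_unit_ball R n).
Implicit Types (x y z : V).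
Variables (d C0 C1 : R) (Gamma : set V) (A : V -> 'M[R]_n) (u : V -> R).
Hypotheses (n2 : (2 <= n)%N) (d0 : 0 < d) (dn : d < n%:R - 1) (C01 : 1 <= C0)
  (Gneq0 : Gamma !=set0) (clG : closed Gamma) (reg : ahlfors_regular d C0 Gamma)
  (C11 : 1 <= C1) (ellA : elliptic Gamma d C1 A) (uW : in_W Gamma d u)
  (sol : weak_solution Gamma A u).
Local Notation w := (weight Gamma d).

Let leb_Gamma : leb Gamma = 0%E := regular_null n2 d0 dn Gneq0 clG reg.

Lemma mx_applyE (M : 'M[R]_n) (xi : V) i : mx_apply M xi 0 i = \sum_j M i j * xi 0 j.
Proof. by rewrite mxE; apply: eq_bigr => j _; rewrite mxE mulrC. Qed.

Lemma dotv_delta (v : V) i : dotv v (delta_mx 0 i) = v 0 i.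
Proof.
rewrite /dotv (bigD1 i)//= mxE !eqxx mulr1 big1 ?addr0// => j ji.
by rewrite mxE (negPf ji) andbF mulr0.
Qed.

Lemma enorm_delta i : enorm (delta_mx 0 i : V) = 1.
Proof. by rewrite /enorm dotv_delta mxE !eqxx sqrtr1. Qed.

(** The upper bound on [A] is used with [zeta] the [i]-th unit vector. *)
Lemma flux_le x (xi : V) i : ~ Gamma x ->
  (mx_apply (A x) xi 0 i) ^+ 2 <= C1 ^+ 2 * (w x * (w x * \sum_j xi 0 j ^+ 2)).
Proof.
move=> nG; have [_ /(_ x xi (delta_mx 0 i) nG) + _] := ellA.
rewrite dotv_delta enorm_delta mulr1 => H.
have C1_0 : 0 <= C1 by exact: le_trans ler01 C11.
have : `|mx_apply (A x) xi 0 i| ^+ 2 <= (C1 * w x * enorm xi) ^+ 2.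
  by rewrite ler_sqr ?nnegrE// !mulr_ge0// ?weight_ge0 ?enorm_ge0.
rewrite real_normK ?num_real// !exprMn enorm_sqr => /le_trans; apply.
rewrite le_eqVlt; apply/orP; left; apply/eqP; rewrite -!mulrA; congr (_ * _).
Qed.

Lemma energy_flux_le x (xi : V) : ~ Gamma x ->
  w x * \sum_i xi 0 i ^+ 2 <= C1 * \sum_i mx_apply (A x) xi 0 i * xi 0 i.
Proof.
move=> nG; have [_ _ /(_ x xi nG)] := ellA.
rewrite -mulrA ler_pdivrMl ?(lt_le_trans ltr01)// enorm_sqr; apply: le_trans.
rewrite le_eqVlt; apply/orP; left; apply/eqP; congr (_ * _).
Qed.

Lemma offnull_cases (N : set V) x : (N x /\ forall f, offnull N f x = 0) \/ (~ N x /\ forall f, offnull N f x = f x).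
Proof.
have [Nx|nN] := pselect (N x); [left|right]; split => // f; rewrite /offnull indicE.
  by rewrite memNset ?mul0r//; exact.
by rewrite mem_set// mul1r.
Qed.

(** [in_W] and [weak_solution] each bring their own weak gradient, [g1] with finite energy and [g2]
    satisfying the equation. The data are built from [g2], and its energy is finite because the two
    agree almost everywhere. *)
Lemma borel_solution_exists : 0 < kappa -> exists N g F,
  [/\ borel_null N, measurable_fun setT (u : lebV -> R) & borel_solution d C1 Gamma (offnull N u) g F].
Proof.
move=> kappa_gt0; have [ul [g1 wg1 fin1]] := uW; have [g2 wg2 weak] := sol.
have bw := @borel_weight R n d Gamma Gneq0.
have mu := loc_integrable_measurable clG leb_Gamma ul.
have mg1 i := loc_integrable_measurable clG leb_Gamma (proj1 wg1 i).
have mg2 i := loc_integrable_measurable clG leb_Gamma (proj1 wg2 i).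
have mA i j : measurable_fun setT ((fun x => A x i j) : lebV -> R).
  by apply: (measurable_offG clG leb_Gamma); have [+ _ _] := ellA; apply.
have [Nu Nu0 NuP] := borel_rep mu.
have [N1 N10 N1P] := borel_rep_fin mg1.
have [N2 N20 N2P] := borel_rep_fin mg2.
have [NA NA0 NAP] := @borel_rep_fin R n ('I_n * 'I_n)%type (fun ij x => A x ij.1 ij.2) (fun ij => mA ij.1 ij.2).
have G0 : borel_null Gamma by split => //; exact: measurable_closed_borel.
(* One null set for [u], both gradients and all entries of [A], so that all algebraic relations hold
   exactly off [N] and trivially on it. *)
pose N := Gamma `|` Nu `|` N1 `|` N2 `|` NA.
have N0 : borel_null N by do 4 (apply: borel_nullU => //).
have GN : Gamma `<=` N by move=> x Gx; do 4 left.
have bu : borel_fun (offnull N u) by apply: NuP => // x Nx; do 3 left; right.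
have bg1 i : borel_fun (offnull N (fun x => g1 x 0 i)).
  by apply: N1P => // x Nx; do 2 left; right.
have bg2 i : borel_fun (offnull N (fun x => g2 x 0 i)).
  by apply: N2P => // x Nx; left; right.
have bA i j : borel_fun (offnull N (fun x => A x i j)).
  by apply: (NAP N N0 _ (i, j)) => x Nx; right.
pose flux i x := mx_apply (A x) (g2 x) 0 i.
have bflux i : borel_fun (offnull N (flux i)).
  rewrite (_ : offnull N (flux i) = fun x => \sum_j offnull N (fun x => A x i j) x * offnull N (fun x => g2 x 0 j) x).
    by apply: borel_sum => j; exact: borelM.
  apply/funext => x; have [[_ E]|[_ E]] := offnull_cases N x.
    by rewrite E big1// => j _; rewrite E mul0r.
  by rewrite E /flux mx_applyE; apply: eq_bigr => j _; rewrite !E.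
have mflux i : measurable_fun setT (flux i : lebV -> R).
  rewrite (_ : flux i = fun x => \sum_j A x i j * g2 x 0 j); last by apply/funext => x; exact: mx_applyE.
  by apply: measurable_sum => j; exact: measurable_funM.
exists N, (fun i => offnull N (fun x => g2 x 0 i)), (fun i => offnull N (flux i)); split => //.
have l2 := wgrad_offnull clG N0 GN wg2 mu mg2 bu bg2.
have l1 := wgrad_offnull clG N0 GN wg1 mu mg1 bu bg1.
have ll1 i := locL1_offnull (proj1 wg1 i) (bg1 i).
have ll2 i := locL1_offnull (proj1 wg2 i) (bg2 i).
have lu := locL1_offnull ul bu.
split; split => //.
- by move=> i x; exact: offnullG.
- have S0 (g : V -> V) x : 0 <= \sum_i offnull N (fun x => g x 0 i) x ^+ 2.
    by apply: sumr_ge0 => i _; exact: sqr_ge0.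
  have oG : open (~` Gamma) by exact: closed_openC.
  (* [wgrad_unique] concerns one compact set and one coordinate; countability of the exhaustion and
     of the coordinates makes the exceptional set common. *)
  have unique : ae (fun x => forall i, offnull N (fun x => g2 x 0 i) x = offnull N (fun x => g1 x 0 i) x).
    have step i k : ae (fun x => inner_part Gamma k x ->
        offnull N (fun x => g2 x 0 i) x = offnull N (fun x => g1 x 0 i) x).
      have cK : compact (inner_part Gamma k) by exact: inner_part_compact.
      exact: (wgrad_unique i kappa_gt0 oG (proj2 lu) ll2 ll1 l2 l1 cK (@inner_part_sub _ _ _ k)).
    have : ae (fun x => forall (k : nat) (i : 'I_n), i = k :> nat -> forall j, inner_part Gamma j x ->
        offnull N (fun x => g2 x 0 i) x = offnull N (fun x => g1 x 0 i) x).
      apply: ae_forall => k; have [kn|nk] := ltnP k n; last first.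
        by apply: aeT => x i ik; move: (ltn_ord i); rewrite ik ltnNge nk.
      have := ae_forall (step (Ordinal kn)); apply: aeS => x H i ik j.
      have -> : i = Ordinal kn by exact: val_inj.
      exact: H.
    apply: aeS => x H i; have [Gx|nG] := pselect (Gamma x); first by rewrite !(offnullG GN).
    have : (\bigcup_k inner_part Gamma k) x by rewrite bigcup_inner_part.
    by move=> [j _ Ij]; exact: (H i i erefl j Ij).
  rewrite (@nnint_eq_ae _ _ _ (fun x => w x * \sum_i offnull N (fun x => g1 x 0 i) x ^+ 2)); first last.
  + by apply: aeS unique => x H; congr (_ * _); apply: eq_bigr => i _; rewrite H.
  + by move=> x; rewrite mulr_ge0 ?weight_ge0.
  + by move=> x; rewrite mulr_ge0 ?weight_ge0.
  + by apply: borelM => //; apply: borel_sum => i; exact: borelX.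
  + by apply: borelM => //; apply: borel_sum => i; exact: borelX.
  apply: le_lt_trans fin1; rewrite /nnint [leRHS]integral_mkcond.
  have mO := measurable_complG clG.
  apply: ge0_le_integral.
  + exact: measurableT.
  + by move=> x _; rewrite lee_fin mulr_ge0 ?weight_ge0.
  + apply/measurable_EFinP/borel_fun_leb; apply: borelM => //; apply: borel_sum => i; exact: borelX.
  + apply/(measurable_restrictT _ mO); apply/measurable_EFinP; apply: measurable_funTS.
    apply: measurable_funM; last exact: borel_fun_leb.
    rewrite (_ : (fun x => _) = fun x => \sum_i g1 x 0 i * g1 x 0 i); last by apply/funext => x; exact: enorm_sqr.
    by apply: measurable_sum => i; exact: measurable_funM.
  move=> x _; rewrite patchE; case: ifPn; rewrite ?notin_setE ?in_setE => xO; last first.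
    have Gx : Gamma x by exact: contrapT.
    by rewrite big1 ?mulr0// => i _; rewrite (offnullG GN)// expr0n.
  rewrite lee_fin mulrC; apply: ler_wpM2r; first exact: weight_ge0.
  rewrite enorm_sqr; apply: ler_sum => i _; rewrite -[leRHS]real_normK ?num_real//.
  by rewrite -[leLHS]real_normK ?num_real// ler_sqr ?nnegrE//; exact: offnull_norm.
- move=> i x; have [[Nx E]|[nN E]] := offnull_cases N x.
    rewrite E expr0n/=; apply: mulr_ge0; first exact: sqr_ge0.
    apply: mulr_ge0; first exact: weight_ge0.
    apply: mulr_ge0; first exact: weight_ge0.
    by apply: sumr_ge0 => j _; exact: sqr_ge0.
  rewrite E; under eq_bigr do rewrite E.
  by apply: flux_le => Gx; exact/nN/GN.
- move=> x; have [[Nx E]|[nN E]] := offnull_cases N x.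
    by rewrite big1 ?mulr0 ?big1 ?mulr0// => i _; rewrite E ?mul0r ?expr0n.
  under eq_bigr do rewrite E; under [X in _ <= _ * X]eq_bigr do rewrite !E.
  by apply: energy_flux_le => Gx; exact/nN/GN.
- move=> phi tphi; have bd i := smooth_borel (smooth_partial i (test_smooth tphi)).
  have E : offnull N (fun x => dotv (mx_apply (A x) (g2 x)) (grad phi x)) =
      fun x => \sum_i offnull N (flux i) x * partial i phi x.
    apply/funext => x; have [[_ H]|[_ H]] := offnull_cases N x.
      by rewrite H big1// => i _; rewrite H mul0r.
    by rewrite H /dotv; apply: eq_bigr => i _; rewrite H; congr (_ * _); rewrite mxE.
  rewrite -E -(Rintegral_offnull clG N0 GN); first exact: weak.
    rewrite /dotv; apply: measurable_sum => i; apply: measurable_funM; first exact: mflux.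
    rewrite (_ : (fun x => grad phi x 0 i) = partial i phi); last by apply/funext => x; rewrite mxE.
    exact: borel_fun_leb.
  by rewrite E; apply: borel_sum => i; exact: borelM.
Qed.

End solution_representative.

(** * From bounds almost everywhere to essential bounds *)

Section maximum_on_solutions.
Context {R : realType} {n : nat}.
Local Notation V := 'rV[R]_n.
Local Notation leb := (lebesgue_vec R n).
Local Notation kappa := (@leb_unit_ball R n).
Implicit Types (x y z : V).
Variables (d C0 C1 : R) (Gamma : set V) (A : V -> 'M[R]_n) (u : V -> R).
Hypotheses (n2 : (2 <= n)%N) (d0 : 0 < d) (dn : d < n%:R - 1) (C01 : 1 <= C0)
  (Gneq0 : Gamma !=set0) (clG : closed Gamma) (reg : ahlfors_regular d C0 Gamma)
  (C11 : 1 <= C1) (ellA : elliptic Gamma d C1 A) (uW : in_W Gamma d u)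
  (sol : weak_solution Gamma A u).
Local Notation Hd := (hausdorff_measure d).
Local Notation Omega := (~` Gamma).

Lemma leb_offnull (N : set V) (P : R -> Prop) : borel_null N -> ae (fun x => P (offnull N u x)) ->
  leb (Omega `&` [set x | ~ P (u x)]) = 0%E.
Proof.
move=> [mN N0] aP; apply/eqP; rewrite eq_le measure_ge0 andbT.
apply: (@le_trans _ _ (lebesgue_outer R n (N `|` ~` [set x | P (offnull N u x)]))).
  apply: le_outer_measure => x [_ nP]; have [Nx|nN] := pselect (N x); [by left|right].
  by move=> /=; rewrite /offnull indicE mem_set// mul1r.
apply: (le_trans (outer_measureU2 (lebesgue_outer R n) _ _)).
by rewrite [X in (X + _ <= _)%E]N0 [X in (_ + X <= _)%E]aP adde0.
Qed.

Lemma solution_max M : hausdorff_outer d (Gamma `&` [set x | ~ trace u x <= M]) = 0%E ->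
  leb (Omega `&` [set x | ~ u x <= M]) = 0%E.
Proof.
(* If the unit ball had measure 0 then so would every set, and the claim would be trivial;
   mollifiers are available otherwise. *)
move=> Tu; have [k0|k0] := eqVneq kappa 0; first exact: leb0_unit_ball.
have kappa_gt0 : 0 < kappa by rewrite lt_neqAle eq_sym k0 leb_unit_ball_ge0.
have [N [g [F [N0 mu S]]]] := borel_solution_exists n2 d0 dn Gneq0 clG reg C11 ellA uW sol kappa_gt0.
apply: (leb_offnull (P := fun t => t <= M) N0); have [[[bu _] _ _ _ _] _] := S.
by apply: (borel_solution_max n2 d0 dn C01 Gneq0 clG reg kappa_gt0 C11 S); rewrite trace_offnull.
Qed.

Lemma solution_min M : hausdorff_outer d (Gamma `&` [set x | ~ M <= trace u x]) = 0%E ->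
  leb (Omega `&` [set x | ~ M <= u x]) = 0%E.
Proof.
move=> Tu; have [k0|k0] := eqVneq kappa 0; first exact: leb0_unit_ball.
have kappa_gt0 : 0 < kappa by rewrite lt_neqAle eq_sym k0 leb_unit_ball_ge0.
have [N [g [F [N0 mu S]]]] := borel_solution_exists n2 d0 dn Gneq0 clG reg C11 ellA uW sol kappa_gt0.
apply: (leb_offnull (P := fun t => M <= t) N0); have [[[bu _] _ _ _ _] _] := S.
by apply: (borel_solution_min n2 d0 dn C01 Gneq0 clG reg kappa_gt0 C11 S); rewrite trace_offnull.
Qed.

(** Rules out that an essential supremum over Gamma is [-oo], the case in which there is no real
    bound [M] to feed to [solution_max]. *)
Lemma hausdorff_pos : hausdorff_outer d Gamma <> 0%E.
Proof.
move=> G0; have [x Gx] := Gneq0; have := regular_ball_ge reg Gx ltr01.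
apply/negP; rewrite -ltNge; apply: (@le_lt_trans _ _ (hausdorff_outer d Gamma)).
  by apply: le_outer_measure => y [].
by rewrite G0 lte_fin mulr_gt0 ?invr_gt0 ?powR_gt0// (lt_le_trans ltr01).
Qed.

Lemma hausdorff_ae (P : V -> Prop) : {ae (Hd : measure (caratheodory_type (hausdorff_outer d)) R), forall x, P x} ->
  hausdorff_outer d (Gamma `&` [set x | ~ P x]) = 0%E.
Proof.
move=> [B [mB B0 PB]]; apply/eqP; rewrite eq_le outer_measure_ge0 andbT -B0.
by apply: le_outer_measure => x [_ nP]; exact: PB.
Qed.

Lemma leb_ae_patch (f : V -> \bar R) (y : \bar R) : leb (Omega `&` [set x | ~ (f x <= y)%E]) = 0%E ->
  (ess_sup_on leb Omega f <= y)%E.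
Proof.
move=> f0; apply/ess_supP; exists (Omega `&` [set x | ~ (f x <= y)%E]).
split => //; first exact: leb_null_measurable.
move=> x /= H; rewrite /patch in H; split; first by move=> Gx; apply: H; rewrite memNset ?leNye//; exact.
by move=> fy; apply: H; case: ifP => _ //; exact: leNye.
Qed.

Lemma ess_sup_trace (f : V -> \bar R) :
  hausdorff_outer d (Gamma `&` [set x | ~ (f x <= ess_sup_on Hd Gamma f)%E]) = 0%E.
Proof.
have := ess_sup_ge Hd (patch (cst -oo%E) Gamma f) => /hausdorff_ae H.
apply/eqP; rewrite eq_le outer_measure_ge0 andbT -H.
by apply: le_outer_measure => x [Gx nf]; split => //; rewrite /= /patch mem_set.
Qed.

Lemma hausdorff_sub (P Q : V -> Prop) : (forall x, P x -> Q x) ->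
  hausdorff_outer d (Gamma `&` [set x | ~ P x]) = 0%E -> hausdorff_outer d (Gamma `&` [set x | ~ Q x]) = 0%E.
Proof.
move=> PQ P0; apply/eqP; rewrite eq_le outer_measure_ge0 andbT -P0.
by apply: le_outer_measure => x [Gx nQ]; split => // Px; exact/nQ/PQ.
Qed.

Lemma ess_sup_solution :
  (ess_sup_on leb Omega (EFin \o u) <= ess_sup_on Hd Gamma (EFin \o trace u))%E.
Proof.
have := ess_sup_trace (EFin \o trace u); case: (ess_sup_on Hd _ _) => [M| |] H.
- by apply: leb_ae_patch; exact: solution_max.
- by rewrite leey.
- exfalso; apply: hausdorff_pos; rewrite -[RHS]H; congr hausdorff_outer.
  by apply/seteqP; split => x // [].
Qed.

Lemma ess_inf_solution :
  (ess_inf_on Hd Gamma (EFin \o trace u) <= ess_inf_on leb Omega (EFin \o u))%E.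
Proof.
rewrite /ess_inf_on !ess_infEN leeN2.
have pE D (f : V -> R) : (\- (patch (cst +oo) D (EFin \o f)) = patch (cst -oo) D (EFin \o (fun x => (- f x)%R)))%E.
  by apply/funext => x; rewrite /= /patch; case: ifP.
rewrite !pE -/(ess_sup_on leb _ _) -/(ess_sup_on Hd _ _).
have := ess_sup_trace (EFin \o (fun x => - trace u x)); case: (ess_sup_on Hd _ _) => [M| |] H.
- apply: leb_ae_patch; have := @solution_min (- M).
  have E (f : V -> R) : [set x | ~ ((- f x)%:E <= M%:E)%E] = [set x | ~ - M <= f x].
    by apply/seteqP; split => x /=; rewrite lee_fin lerNl.
  by rewrite /= -!E; apply.
- by rewrite leey.
- exfalso; apply: hausdorff_pos; rewrite -[RHS]H; congr hausdorff_outer.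
  by apply/seteqP; split => x // [].
Qed.

Lemma ess_sup_norm_solution :
  (ess_sup_on leb Omega (fun z => `|u z|%:E) <= ess_sup_on Hd Gamma (fun x => `|trace u x|%:E))%E.
Proof.
have := ess_sup_trace (fun x => `|trace u x|%:E); case: (ess_sup_on Hd _ _) => [M| |] H.
- apply: leb_ae_patch.
  have H1 : leb (Omega `&` [set x | ~ u x <= M]) = 0%E.
    by apply: solution_max; apply: hausdorff_sub H => x; rewrite lee_fin ler_norml => /andP[].
  have H2 : leb (Omega `&` [set x | ~ - M <= u x]) = 0%E.
    by apply: solution_min; apply: hausdorff_sub H => x; rewrite lee_fin ler_norml => /andP[].
  apply/eqP; rewrite eq_le measure_ge0 andbT.
  apply: (@le_trans _ _ (lebesgue_outer R n ((Omega `&` [set x | ~ u x <= M]) `|` (Omega `&` [set x | ~ - M <= u x])))).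
    apply: le_outer_measure => x [Ox nu].
    have [uM|nM] := pselect (u x <= M); [right|by left].
    by split => // Mu; apply: nu; rewrite /= lee_fin ler_norml Mu uM.
  apply: (le_trans (outer_measureU2 (lebesgue_outer R n) _ _)).
  by rewrite [X in (X + _ <= _)%E]H1 [X in (_ + X <= _)%E]H2 adde0.
- by rewrite leey.
- exfalso; apply: hausdorff_pos; rewrite -[RHS]H; congr hausdorff_outer.
  by apply/seteqP; split => x // [].
Qed.

End maximum_on_solutions.

Theorem lemma9p3 (R : realType) (n : nat) (d : R) (Gamma : set 'rV[R]_n)
    (C0 C1 : R) (A : 'rV[R]_n -> 'M[R]_n) (u : 'rV[R]_n -> R)
    (n_ge2 : (2 <= n)%N) (d_gt0 : 0 < d) (d_lt : d < n%:R - 1)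
    (Gamma_neq0 : Gamma !=set0) (Gamma_closed : closed Gamma)
    (C0_ge1 : 1 <= C0) (Gamma_regular : ahlfors_regular d C0 Gamma)
    (C1_ge1 : 1 <= C1) (A_elliptic : elliptic Gamma d C1 A)
    (uW : in_W Gamma d u) (u_solution : weak_solution Gamma A u) :
  let leb := lebesgue_vec R n in
  let Hd := hausdorff_measure d in
  let Omega := ~` Gamma in
  let Tu := trace u in
  [/\ (ess_sup_on leb Omega (fun z => (u z)%:E) <=
         ess_sup_on Hd Gamma (fun x => (Tu x)%:E))%E,
      (ess_inf_on Hd Gamma (fun x => (Tu x)%:E) <=
         ess_inf_on leb Omega (fun z => (u z)%:E))%E &
      (ess_sup_on Hd Gamma (fun x => `|Tu x|%:E) < +oo)%E ->
      (ess_sup_on leb Omega (fun z => `|u z|%:E) <=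
         ess_sup_on Hd Gamma (fun x => `|Tu x|%:E))%E].
Proof.
move=> leb Hd Omega Tu; split=> [||_].
- exact: (ess_sup_solution n_ge2 d_gt0 d_lt C0_ge1 Gamma_neq0 Gamma_closed Gamma_regular
    C1_ge1 A_elliptic uW u_solution).
- exact: (ess_inf_solution n_ge2 d_gt0 d_lt C0_ge1 Gamma_neq0 Gamma_closed Gamma_regular
    C1_ge1 A_elliptic uW u_solution).
- exact: (ess_sup_norm_solution n_ge2 d_gt0 d_lt C0_ge1 Gamma_neq0 Gamma_closed Gamma_regular
    C1_ge1 A_elliptic uW u_solution).
Qed.
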